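(* Let $\alpha>1$, $m_0\in\mathcal P_\alpha(\mathbb R^d)$ and $R\ge R(\alpha,[m_0]_\alpha)$. Assume that there exist constants $c_3>0$ and $c_4\in\mathbb R$ such that for all $(x,p,m)\in\mathbb R^d\times\mathbb R^d\times\mathcal P_\alpha(\mathbb R^d)$ $$\langle D_xH(x,p,m),p\rangle\ge c_3|p|^2-c_4 .$$ Then there exists at least one Mean Field Games equilibrium $\eta\in\mathcal P_{m_0}(\Gamma_T,R)$ for $m_0$ such that the associated family of measures $\{m^\eta_t\}_{t\in[0,T]}$, $m^\eta_t=e_t\sharp\eta$, belongs to $\mathrm{Lip}(\mathcal P_\alpha)$.
   Context: Data: $T>0$; real matrices $A$ ($d\times d$) and $B$ ($d\times k$). $\mathcal P_p(\mathbb R^d)$ is the set of Borel probability measures on $\mathbb R^d$ with finite $p$-th moment and $d_1$ is the Kantorovich–Rubinstein (1-Wasserstein) distance. $L:\mathbb R^d\times\mathbb R^k\times\mathcal P_1(\mathbb R^d)\to\mathbb R$ and $G:\mathbb R^d\times\mathcal P_1(\mathbb R^d)\to\mathbb R$ satisfy the standing assumptions: (1) for each $m$, $(x,u)\mapsto L(x,u,m)$ is $C^2$, and $m\mapsto L(x,u,m)$ is $d_1$-Lipschitz with a constant independent of $(x,u)$; (2) $G$ is bounded and uniformly continuous on $\mathbb R^d\times\mathcal P_1(\mathbb R^d)$, and for each $m$, $x\mapsto G(x,m)$ is in $C^1_b(\mathbb R^d)$ (bounded with bounded uniformly continuous first derivatives); (3) there are constants $C_0>0$, $C_1,C_2\ge0$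 such that for all $(x,u,m)$: $\frac{1}{C_0}\mathrm{Id}\le D^2_{uu}L(x,u,m)\le C_0\mathrm{Id}$, $\|D^2_{xu}L(x,u,m)\|\le C_1(1+|u|)$, and $|L(x,0,m)|+|D_xL(x,0,m)|+|D_uL(x,0,m)|\le C_2$. The Hamiltonian is $H(x,p,m)=\sup_{u\in\mathbb R^k}\{-\langle p,Ax+Bu\rangle-L(x,u,m)\}$. For $x\in\mathbb R^d$ and $u\in L^1(0,T;\mathbb R^k)$, $\gamma(\cdot;x,u)$ is the solution of $\dot\gamma=A\gamma+Bu$ on $[0,T]$, $\gamma(0)=x$. $\Gamma_T$ is the set of all such curves, with the uniform norm, and $e_t(\gamma)=\gamma(t)$. Let $[m_0]_\alpha=\int|x|^\alpha\,m_0(dx)$. For $R\ge[m_0]_\alpha$, $$\mathcal P_{m_0}(\Gamma_T,R)=\Big\{\eta\in\mathcal P(\Gamma_T):\int_{\Gamma_T}\|\dot\gamma\|_{2}^\alpha\,\eta(d\gamma)\le R,\ e_0\sharp\eta=m_0\Big\},$$ where $\|\cdot\|_2$ is the $L^2(0,T)$ norm. For $\eta$ in this set, let $J_\eta(x,u)=\int_0^TL(\gamma(t;x,u),u(t),e_t\sharp\eta)\,dt+G(\gamma(T;x,u),e_T\sharp\eta)$, and let $\Gamma^*_\eta(x)$ be the set of curves $\gamma(\cdot;x,u^* )$ where $u^*$ minimizes $J_\eta(x,\cdot)$ over $L^2(0,T;\mathbb R^k)$. A Mean Field Games equilibrium for $m_0$ is an $\eta\in\mathcal P_{m_0}(\Gamma_T,R)$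 with $\operatorname{supp}(\eta)\subset\bigcup_{x\in\mathbb R^d}\Gamma^*_\eta(x)$. $R(\alpha,[m_0]_\alpha)\ge[m_0]_\alpha$ denotes a positive constant such that, for every $R\ge R(\alpha,[m_0]_\alpha)$, the set $\mathcal P_{m_0}(\Gamma_T,R)$ is non-empty and for every $\eta$ in it there is $\nu\in\mathcal P_{m_0}(\Gamma_T,R)$ whose disintegration $\nu(d\gamma)=\int\nu_x(d\gamma)m_0(dx)$ with respect to $e_0$ satisfies $\operatorname{supp}(\nu_x)\subset\Gamma^*_\eta(x)$ for $m_0$-a.e. $x$ (such a constant exists). $\mathrm{Lip}(\mathcal P_\alpha)$ is the set of curves $t\in[0,T]\mapsto m_t\in\mathcal P_\alpha(\mathbb R^d)$ with $\sup_{t\ne s}\frac{d_1(m_t,m_s)}{|t-s|}<\infty$. *)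

(* Defs.v *)
From HB Require Import structures.
From mathcomp Require Import all_boot all_order all_algebra.
From mathcomp Require Import all_classical all_reals all_analysis.

Set Implicit Arguments.
Unset Strict Implicit.
Unset Printing Implicit Defensive.

Import Order.TTheory GRing.Theory Num.Theory.
Import numFieldNormedType.Exports.

Local Open Scope classical_set_scope.
Local Open Scope ring_scope.

(* Matrices carry the sup norm in the library; it only provides the topology
   here, and every quantitative statement uses the Euclidean norm [enorm]. *)
Section Euclidean.
Context {R : realType}.

Definition edot n (x y : 'cV[R]_n) : R := \sum_i x i 0 * y i 0.

Definition enorm n (x : 'cV[R]_n) : R := Num.sqrt (edot x x).

Definition opnorm m n (M : 'M[R]_(m, n)) : R :=
  sup [set enorm (M *m v) | v in [set v | enorm v <= 1]].

Definition loewner_le n (M N : 'M[R]_n) : Prop :=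
  forall v, edot v (M *m v) <= edot v (N *m v).

End Euclidean.

Section Derivatives.
Context {R : realType}.

Definition is_C1 (V : normedModType R) (f : V -> R) : Prop :=
  (forall z, differentiable f z) /\ (forall v, continuous ('D_v f)).

Definition is_C2 (V : normedModType R) (f : V -> R) : Prop :=
  is_C1 f /\ (forall v, is_C1 ('D_v f)).

Definition basis n (i : 'I_n) : 'cV[R]_n := delta_mx i 0.

Definition grad n (f : 'cV[R]_n -> R) (x : 'cV[R]_n) : 'cV[R]_n :=
  \col_i 'D_(basis i) f x.

Definition hessian n (f : 'cV[R]_n -> R) (x : 'cV[R]_n) : 'M[R]_n :=
  \matrix_(i, j) 'D_(basis i) ('D_(basis j) f) x.

Definition mixed_hessian n p (f : 'cV[R]_n -> 'cV[R]_p -> R)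
    (x : 'cV[R]_n) (u : 'cV[R]_p) : 'M[R]_(n, p) :=
  \matrix_(i, j) 'D_(basis i) (fun y => 'D_(basis j) (f y) u) x.

Definition is_C1b n (f : 'cV[R]_n -> R) : Prop :=
  [/\ is_C1 f,
      exists M, forall x, `|f x| <= M,
      exists M, forall x, enorm (grad f x) <= M
    & forall e, 0 < e -> exists2 del, 0 < del &
        forall x y, enorm (x - y) < del -> enorm (grad f x - grad f y) < e].

End Derivatives.

HB.instance Definition _ (R : realType) (m n : nat) :=
  Measurable.copy 'M[R]_(m, n) (g_sigma_algebraType (@open 'M[R]_(m, n))).

Section Wasserstein.
Context {R : realType} {n : nat}.
Local Notation V := 'cV[R]_n.
Local Notation Prob := (probability V R).
Local Open Scope ereal_scope.

Definition moment (p : R) (m : Prob) : \bar R := \int[m]_x (enorm x `^ p)%:E.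

Definition finite_moment (p : R) (m : Prob) : Prop := moment p m < +oo.

Definition coupling (m m' : Prob) (pi : probability (V * V)%type R) : Prop :=
  forall E : set V, measurable E ->
    pi (E `*` setT) = m E /\ pi (setT `*` E) = m' E.

Definition d1 (m m' : Prob) : \bar R :=
  ereal_inf [set \int[pi]_z (enorm (z.1 - z.2)%R)%:E | pi in coupling m m'].

End Wasserstein.

Section StandingAssumptions.
Context {R : realType} {d k : nat}.
Local Notation X := 'cV[R]_d.
Local Notation U := 'cV[R]_k.
Local Notation Prob := (probability X R).
Local Notation P1 := (finite_moment 1).

(* [L] and [G] are functions on P_1(R^d), encoded as functions on all Borel
   probability measures whose values outside P_1(R^d) are never constrained. *)
Record running_cost_assumptions (L : X -> U -> Prob -> R) : Prop := {
  L_C2 : forall m, P1 m -> is_C2 (fun z : X * U => L z.1 z.2 m);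
  L_Lipschitz : exists2 K : R, 0 <= K & forall x u m m', P1 m -> P1 m' ->
    (`|L x u m - L x u m'|%:E <= K%:E * d1 m m')%E;
  L_growth : exists C0 C1 C2 : R, [/\ 0 < C0, 0 <= C1, 0 <= C2 &
    forall x u m, P1 m ->
      [/\ loewner_le (C0^-1)%:M (hessian (fun v => L x v m) u),
          loewner_le (hessian (fun v => L x v m) u) C0%:M,
          opnorm (mixed_hessian (fun y v => L y v m) x u)
            <= C1 * (1 + enorm u)
        & `|L x 0 m| + enorm (grad (fun y => L y 0 m) x)
            + enorm (grad (fun v => L x v m) 0) <= C2]] }.

Record terminal_cost_assumptions (G : X -> Prob -> R) : Prop := {
  G_bounded : exists M : R, forall x m, P1 m -> `|G x m| <= M;
  G_unif_continuous : forall e : R, 0 < e -> exists2 del : R, 0 < del &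
    forall x y m m', P1 m -> P1 m' ->
      enorm (x - y) < del -> (d1 m m' < del%:E)%E -> `|G x m - G y m'| < e;
  G_C1b : forall m, P1 m -> is_C1b (fun x => G x m) }.

(* Finite under [running_cost_assumptions] for [m] in P_1, as [L x u m] then
   grows quadratically in [u]. *)
Definition hamiltonian (A : 'M[R]_d) (B : 'M[R]_(d, k))
    (L : X -> U -> Prob -> R) (x p : X) (m : Prob) : R :=
  sup (range (fun u : U => - edot p (A *m x + B *m u) - L x u m)).

End StandingAssumptions.

Definition support (R : realType) (S : topologicalType) (mu : set S -> \bar R) :
    set S :=
  [set x | forall O : set S, open O -> O x -> (0 < mu O)%E].

Section Trajectories.
Context {R : realType} {d k : nat}.
Variables (A : 'M[R]_d) (B : 'M[R]_(d, k)) (T : R).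
Local Notation X := 'cV[R]_d.
Local Notation U := 'cV[R]_k.
Local Notation mu := (@lebesgue_measure R).

(* u in L^p(0,T; R^k); a control is a function on R of which only the
   restriction to [0,T] matters. *)
Definition control_Lp (p : R) (u : R -> U) : Prop :=
  measurable_fun `[0, T] u /\
  (\int[mu]_(t in `[0%R, T]) (enorm (u t) `^ p)%:E < +oo)%E.

(* Caratheodory solutions on [0,T]. A curve on [0,T] is represented by its
   extension to R which is constant on ]-oo,0] and on [T,+oo[, so that its
   uniform norm over R is its uniform norm over [0,T]. *)
Definition solution (x : X) (u : R -> U) (g : R -> X) : Prop :=
  [/\ {within `[0, T], continuous g},
      forall t, t \in `[0, T] ->
        g t = x + \col_i \int[mu]_(s in `[0, t]) (A *m g s + B *m u s) i 0
    & forall t, g t = g (Num.min T (Num.max 0 t))].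

Definition trajectories : set {uniform R -> X} :=
  [set g | exists x u, control_Lp 1 u /\ solution x u g].

Definition Gamma : Type := set_type trajectories.

HB.instance Definition _ := Topological.copy Gamma (set_type trajectories).

Lemma zero_trajectory : (fun=> 0 : X) \in trajectories.
Proof.
rewrite inE; exists 0, (fun=> 0); split; first split.
- exact: measurable_cst.
- have enorm0 : enorm (0 : U) = 0.
    by rewrite /enorm /edot big1 ?sqrtr0// => i _; rewrite mxE mul0r.
  by rewrite enorm0 powR0 ?oner_eq0// integral0.
- split=> // [|t _].
    by apply: continuous_subspaceT => t; exact: cvg_cst.
  apply/esym/colP => i; rewrite !mxE add0r /Rintegral.
  rewrite (eq_integral (fun=> 0%E)) ?integral0// => s _ /=.
  by rewrite !big1 ?addr0// => j _; rewrite mxE mulr0.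
Qed.

HB.instance Definition _ :=
  isPointed.Build Gamma (exist _ (fun=> 0 : X) zero_trajectory).

HB.instance Definition _ :=
  Measurable.copy Gamma (g_sigma_algebraType (@open Gamma)).

Definition ev (t : R) (g : Gamma) : X := (\val g : R -> X) t.

Lemma continuous_ev (t : R) : continuous (ev t).
Proof.
have ct : continuous (fun f : {uniform R -> X} => f t).
  move=> f O /nbhsP [E entE EO]; apply/uniform_nbhs.
  by exists E; split=> // h /(_ t I) Eh; apply: EO; rewrite /xsection/= inE.
apply/continuousP => O oO.
exists ((fun f : {uniform R -> X} => f t) @^-1` O) => //.
by have /continuousP := ct; apply.
Qed.

Lemma measurable_ev (t : R) : measurable_fun setT (ev t).
Proof.
apply: (@measurability _ _ _ _ setT _ (@open X)) => // _ [W oW <-].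
rewrite setTI; apply: sub_sigma_algebra.
by have /continuousP := @continuous_ev t; apply.
Qed.

HB.instance Definition _ (t : R) :=
  isMeasurableFun.Build _ _ _ _ (ev t) (measurable_ev t).

(* Trajectories are absolutely continuous, hence derivable almost everywhere. *)
Definition velocity_norm2 (g : Gamma) : \bar R :=
  ((\int[mu]_(t in `[0%R, T]) (enorm (derive1 (ev ^~ g) t) ^+ 2)%:E)
    `^ 2^-1)%E.

(* The linear equation has exactly one solution, so [get] returns it. *)
Definition traj (x : X) (u : R -> U) : Gamma :=
  get [set g : Gamma | solution x u (fun t => ev t g)].

Definition marginal (eta : probability Gamma R) (t : R) : probability X R :=
  distribution eta (ev t).

Definition PGamma (alpha : R) (m0 : probability X R) (r : R) :
    set (probability Gamma R) :=
  [set eta : probability Gamma R |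
    (\int[eta]_g (velocity_norm2 g `^ alpha) <= r%:E)%E /\
    (forall E, measurable E -> marginal eta 0 E = m0 E)].

Section Game.
Variables (L : X -> U -> probability X R -> R) (G : X -> probability X R -> R).

Definition cost (eta : probability Gamma R) (x : X) (u : R -> U) : R :=
  \int[mu]_(t in `[0, T]) L (ev t (traj x u)) (u t) (marginal eta t)
  + G (ev T (traj x u)) (marginal eta T).

Definition optimal_curves (eta : probability Gamma R) (x : X) : set Gamma :=
  [set g | exists u, [/\ control_Lp 2 u,
      forall v, control_Lp 2 v -> cost eta x u <= cost eta x v
    & g = traj x u]].

Definition disintegration (m0 : probability X R) (nu : probability Gamma R)
    (kappa : R.-pker X ~> Gamma) : Prop :=
  (forall E, measurable E -> nu E = (\int[m0]_x kappa x E)%E) /\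
  {ae m0, forall x, kappa x (ev 0 @^-1` [set x]) = 1%E}.

(* r0 may serve as the constant R(alpha, [m0]_alpha). *)
Definition admissible_bound (alpha : R) (m0 : probability X R) (r0 : R) :
    Prop :=
  [/\ 0 < r0, (moment alpha m0 <= r0%:E)%E &
    forall r, r0 <= r ->
      PGamma alpha m0 r !=set0 /\
      forall eta, PGamma alpha m0 r eta ->
        exists2 nu, PGamma alpha m0 r nu &
        exists2 kappa : R.-pker X ~> Gamma, disintegration m0 nu kappa &
          {ae m0, forall x, support (kappa x) `<=` optimal_curves eta x}].

Definition MFG_equilibrium (alpha : R) (m0 : probability X R) (r : R)
    (eta : probability Gamma R) : Prop :=
  PGamma alpha m0 r eta /\
  support eta `<=` \bigcup_(x in [set: X]) optimal_curves eta x.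

End Game.

Definition Lip_curve (alpha : R) (m : R -> probability X R) : Prop :=
  (forall t, t \in `[0, T] -> finite_moment alpha (m t)) /\
  (ereal_sup [set d1 (m st.1) (m st.2) * (`|st.1 - st.2|^-1)%:E |
     st in [set st : R * R |
       [/\ st.1 \in `[0%R, T], st.2 \in `[0%R, T] & st.1 != st.2]]] < +oo)%E.

End Trajectories.

(* Main.v *)
(** Write [S eta] for the set of curves that are optimal against [eta]. It is
    closed jointly in [eta] and the curve: along a limit the running costs
    converge uniformly, and they are convex in the control, so weak limits of
    controls suffice. Brouwer's theorem, in the approximate form given by
    Scarf's combinatorial lemma and applied to convex combinations of best
    responses to a finite net of [PGamma], produces for each finite family of
    events and each tolerance an [eta] whose charged open sets all meet [S eta']
    for some [eta'] close to [eta] on the family. These [eta] have a limit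
    along an ultrafilter because the sublevel sets of the kinetic energy are
    compact, and by the closed graph the limit is supported in its own [S eta].

    For the regularity, an optimal control is stationary, [D_u L = - B^T p] with
    [p' = - A^T p - D_x L] and [p T = D_x G]. The right-hand side of the
    equation for [p] is [D_x H], so the hypothesis gives
    [(|p|^2)' = 2 <D_x H, p> >= - 2 c4]; integrating backwards bounds [p],
    strong convexity of [L] then bounds the control, and optimal curves are
    Lipschitz with a constant that is affine in [|g 0|]. *)

Require Import Defs.
From HB Require Import structures.
From mathcomp Require Import all_boot all_order all_algebra.

Set Implicit Arguments.
Unset Strict Implicit.
Unset Printing Implicit Defensive.

(** * Approximate fixed points *)

(** The obstacle is the space of measures on curves. Optimality of a response is expressed by asking
    that every charged open set meet the optimal curves, a form that passes to mixtures and, through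
    the closed graph, to limits. Limits are taken event by event along an ultrafilter; they give
    only a finitely additive set function [h], which compactness turns into a measure [eta] with
    [eta O <= h O] on open sets. That inequality carries lower semicontinuous bounds to the limit
    and, once the curves are cut into disjoint open cells with a nearly null remainder, gives the
    convergence of the marginals uniformly in time. Two features of the curve space shape the
    estimates. The velocity is an almost everywhere derivative, so the kinetic energy is recovered
    from the energies of piecewise affine interpolations, which depend continuously on finitely many
    values of the curve. And the range of [B] may be a proper subspace, so a limit of trajectories
    has to be shown to be driven by a control again. *)

Section Dominance.
Variables (S I : finType) (rho : I -> S -> nat).
Hypothesis rho_inj : forall i, injective (rho i).

(** Ranks are preferences of the agents [I], larger being better: no [x] lies strictly above the
    worst element of [D] for all agents at once. In particular each element of [D] is the worst one
    for some agent. *)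
Definition dominant (D : {set S}) :=
  [forall x, exists i, forall y in D, rho i x <= rho i y].

Lemma dominantP (D : {set S}) :
  reflect (forall x, exists i, forall y, y \in D -> rho i x <= rho i y)
    (dominant D).
Proof.
apply: (iffP forallP) => H x.
  by have /existsP[i /forall_inP Hi] := H x; exists i.
by have [i Hi] := H x; apply/existsP; exists i; apply/forall_inP.
Qed.

Lemma dominant_sub (D E : {set S}) : D \subset E -> dominant E -> dominant D.
Proof.
move=> /subsetP DE /dominantP H; apply/dominantP => x.
by have [i Hi] := H x; exists i => y /DE /Hi.
Qed.

Lemma min_selector (q : {set S}) : q != set0 ->
  exists m : I -> S, forall i, m i \in q /\
    forall z, z \in q -> rho i (m i) <= rho i z.
Proof.
case/set0Pn => y0 qy0; exists (fun i => [arg min_(y < y0 in q) rho i y]) => i.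
by case: arg_minnP.
Qed.

(* A door of a room loses one vertex, so exactly two agents [a], [b] share
   their worst vertex; the room is completed by replacing either of them. *)
Lemma card_door_rooms (q : {set S}) : q != set0 -> #|I| = #|q|.+1 ->
  dominant q ->
  (forall e, exists x, forall l, l != e -> exists2 y, y \in q & rho l y < rho l x) ->
  #|[set x | (x \notin q) && dominant (x |: q)]| = 2.
Proof.
move=> q0 cI domq Mne.
have [m mP] := min_selector q0.
have mq i : m i \in q by case: (mP i).
have mle i z : z \in q -> rho i (m i) <= rho i z by case: (mP i) => _; apply.
have msurj y : y \in q -> exists i, m i = y.
  move=> yq; have /dominantP/(_ y)[i Hi] := domq; exists i; apply: (@rho_inj i).
  by apply/eqP; rewrite eqn_leq mle// Hi.
(* [m] maps the agents onto [q], and there is one more agent than there are vertices. *)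
have [a [b [ab mab]]] : exists a b, a != b /\ m a = m b.
  have : ~~ injectiveb m.
    apply/negP => /injectiveP inj_m; have := card_imset predT inj_m.
    suff -> : [set m x | x in predT] = q.
      by rewrite cI => /eqP; rewrite ltn_eqF.
    apply/setP => y; apply/imsetP/idP => [[i _ ->]//|yq].
    by have [i <-] := msurj y yq; exists i.
  by move=> /injectivePn[a [b ab mab]]; exists a, b.
have imq e : (e == a) || (e == b) ->
    forall y, y \in q -> exists2 i, i != e & m i = y.
  move=> he y yq; have [i iy] := msurj y yq.
  case: (eqVneq i e) => [ie|]; last by exists i.
  case/orP : he => /eqP he; move: iy; rewrite ie he => iy.
    by exists b; rewrite ?[b == a]eq_sym// -mab.
  by exists a; rewrite ?mab.
have imqN e : (forall y, y \in q -> exists2 i, i != e & m i = y) ->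
    (e == a) || (e == b).
  move=> H; apply/contraT; rewrite negb_or => /andP[ea eb].
  have imE : [set m i | i in [set~ e]] = q.
    apply/setP => y; apply/imsetP/idP => [[i _ ->]//|/H[i ie <-]].
    by exists i; rewrite // !inE.
  have : #|[set m i | i in [set~ e]]| = #|[set~ e]|.
    by rewrite imE cardsC1 cI.
  move=> /eqP/imset_injP inj.
  suff E : a = b by rewrite E eqxx in ab.
  by apply: inj => //; rewrite !inE eq_sym.
(* The vertices in [M e] beat the worst vertex of [q] for every agent but [e]. Adding the one that
   [e] prefers among them hands it to [e] as worst vertex and leaves the other agents as they
   were. *)
pose M e x := [forall l, (l != e) ==> (rho l (m l) < rho l x)].
have Mn0 e : exists x, M e x.
  have [x Hx] := Mne e; exists x; apply/forallP => l; apply/implyP => le.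
  by have [y yq] := Hx l le; apply: leq_ltn_trans; exact: mle.
pose xe e := [arg max_(x > xchoose (Mn0 e) | M e x) rho e x].
have xeM e : M e (xe e).
  by rewrite /xe; case: arg_maxnP => //; exact: (xchooseP (Mn0 e)).
have xemax e z : M e z -> rho e z <= rho e (xe e).
  rewrite /xe; case: arg_maxnP => [|x _ H Hz]; first exact: (xchooseP (Mn0 e)).
  exact: H.
have MP e x l : M e x -> l != e -> rho l (m l) < rho l x.
  by move=> /forallP/(_ l)/implyP.
have xe_notin e : (e == a) || (e == b) -> xe e \notin q.
  move=> he; apply/negP => xq; have [i ie ix] := imq _ he _ xq.
  by have := MP _ _ _ (xeM e) ie; rewrite ix ltnn.
have Mdom e x : (e == a) || (e == b) -> M e x -> rho e x <= rho e (m e).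
  move=> he Mx; have /dominantP/(_ x)[i Hi] := domq.
  case: (eqVneq i e) => [<-|ie]; first exact: Hi.
  by have := MP _ _ _ Mx ie; rewrite ltnNge Hi.
have xe_dom e : (e == a) || (e == b) -> dominant (xe e |: q).
  move=> he; apply/dominantP => z; have /dominantP/(_ z)[i Hi] := domq.
  case: (boolP (M e z)) => Mz.
    exists e => y; rewrite in_setU1 => /orP[/eqP->|yq]; first exact: xemax.
    by apply: leq_trans (mle _ _ yq); exact: Mdom.
  move: Mz; rewrite negb_forall => /existsP[l]; rewrite negb_imply -leqNgt.
  move=> /andP[le zl]; exists l => y; rewrite in_setU1 => /orP[/eqP->|yq].
    by apply: leq_trans zl _; apply: ltnW; exact: MP (xeM e) le.
  exact: leq_trans zl (mle _ _ yq).
(* Conversely, [x] is then the worst vertex of some agent [e], and of no other: if it were also the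
   worst for [l], the agents other than [l] would still reach every vertex of [x |: q], and they are
   too few. *)
have ext x : x \notin q -> dominant (x |: q) ->
    exists2 e, (e == a) || (e == b) & x = xe e.
  move=> xq dx; have [e He] := dominantP _ dx x.
  have Hl l : l != e -> rho l (m l) < rho l x.
    move=> le; rewrite ltnNge; apply/negP => xl.
    have Hsurj y : y \in x |: q ->
        exists2 i, i != l & forall z, z \in x |: q -> rho i y <= rho i z.
      rewrite in_setU1 => /orP[/eqP->|yq].
        by exists e => //; rewrite eq_sym.
      have [i Hi] := dominantP _ dx y; exists i => //.
      apply/eqP => il; subst i.
      have : rho l y <= rho l x by apply: Hi; rewrite setU11.
      have := leq_trans xl (mle l y yq); move=> h1 h2.
      have /rho_inj xy : rho l x = rho l y by apply/eqP; rewrite eqn_leq h1 h2.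
      by rewrite xy yq in xq.
    have xq0 : x |: q != set0 by apply/set0Pn; exists x; rewrite setU11.
    have [m' mP'] := min_selector xq0.
    have : #|x |: q| <= #|[set~ l]|.
      apply: leq_trans (leq_imset_card m' _); apply: subset_leq_card.
      apply/subsetP => y yx; apply/imsetP.
      have [i il Hi] := Hsurj y yx; exists i; first by rewrite !inE.
      apply: (@rho_inj i); apply/eqP; rewrite eqn_leq.
      by have [mi1 mi2] := mP' i; rewrite Hi ?mi2.
    by rewrite cardsU1 xq cardsC1 cI/= ltnn.
  have he : (e == a) || (e == b).
    apply: imqN => y yq; have [i Hi] := dominantP _ dx y; exists i.
      apply/eqP => ie; subst i.
      have h1 : rho e y <= rho e x by apply: Hi; rewrite setU11.
      have h2 : rho e x <= rho e y by apply: He; rewrite in_setU1 yq orbT.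
      have /rho_inj xy : rho e x = rho e y by apply/eqP; rewrite eqn_leq h1 h2.
      by rewrite xy yq in xq.
    apply: (@rho_inj i); apply/eqP; rewrite eqn_leq mle//=.
    by apply: Hi; rewrite in_setU1 mq orbT.
  exists e => //.
  have Mx : M e x by apply/forallP => l; apply/implyP/Hl.
  apply: (@rho_inj e); apply/eqP; rewrite eqn_leq xemax//=.
  have [i Hi] := dominantP _ dx (xe e); case: (eqVneq i e) => [ie|ie].
    by subst i; apply: Hi; rewrite setU11.
  have := MP _ _ _ (xeM e) ie; rewrite ltnNge => /negP[]; apply: Hi.
  by rewrite in_setU1 mq orbT.
have -> : [set x | (x \notin q) && dominant (x |: q)] = [set xe a; xe b].
  apply/setP => x; rewrite !inE; apply/andP/orP => [[xq /(ext _ xq)[e]]|].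
    by move=> /orP[]/eqP-> ->; [left|right].
  by case=> /eqP ->; rewrite xe_notin ?xe_dom ?eqxx ?orbT.
rewrite cards2; suff -> : xe a != xe b by [].
apply/eqP => E; have h1 := MP _ _ _ (xeM b) ab.
have h2 : rho a (xe a) <= rho a (m a) by apply: Mdom; rewrite ?eqxx.
by rewrite E leqNgt h1 in h2.
Qed.

Variables (col : S -> I) (i0 : I).

Definition good_door (q : {set S}) := [set col x | x in q] == [set~ i0].

(** A room with all colours loses only its vertex of colour [i0]. In any other room with a good
    door, exactly one colour is repeated, and either of its two vertices may be dropped, which makes
    two good doors. *)
Lemma odd_good_doors (D : {set S}) : #|D| = #|I| ->
  odd #|[set x in D | good_door (D :\ x)]| = ([set col x | x in D] == setT).
Proof.
move=> cD; case: eqP => [colD|colD].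
  have injD : {in D &, injective col}.
    by apply/imset_injP; rewrite colD cardsT cD.
  have [x xD xi0] : exists2 x, x \in D & i0 = col x.
    by apply/imsetP; rewrite colD inE.
  suff -> : [set x in D | good_door (D :\ x)] = [set x] by rewrite cards1.
  apply/setP => y; rewrite !inE; apply/andP/eqP => [[yD /eqP good]|->].
    apply: (injD) => //; rewrite -xi0; apply/eqP/contraT => yi0.
    have : col y \in [set~ i0] by rewrite !inE.
    rewrite -good => /imsetP[z]; rewrite !inE => /andP[zy zD] /(injD _ _ yD zD) E.
    by rewrite E eqxx in zy.
  split=> //; apply/eqP/setP => i; rewrite !inE; apply/imsetP/idP.
    move=> [z]; rewrite !inE => /andP[zx zD] ->; rewrite xi0.
    by apply: contraNneq zx => /(injD _ _ zD xD) ->.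
  move=> ii0; have : i \in [set col x | x in D] by rewrite colD inE.
  move=> /imsetP[z zD iz]; exists z => //; rewrite !inE zD andbT.
  by apply: contraNneq ii0 => zx; rewrite iz zx xi0.
case: (set_0Vmem [set x in D | good_door (D :\ x)]) => [->|[x]].
  by rewrite cards0.
rewrite !inE => /andP[xD /eqP gx].
have inj z : z \in D -> good_door (D :\ z) -> {in D :\ z &, injective col}.
  move=> zD /eqP gz; apply/imset_injP; rewrite gz cardsC1.
  by have := cardsD1 z D; rewrite zD cD => ->.
have cxi0 : col x != i0.
  apply/eqP => xi0; apply: colD; apply/setP => i; rewrite inE.
  case: (eqVneq i i0) => [->|ii0]; first by rewrite -xi0 imset_f.
  have : i \in [set~ i0] by rewrite !inE.
  rewrite -gx => /imsetP[z]; rewrite !inE => /andP[_ zD] ->.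
  by rewrite imset_f.
have : col x \in [set~ i0] by rewrite !inE.
rewrite -gx => /imsetP[y yDx cxy].
have [yx yD] : y != x /\ y \in D by move: yDx; rewrite !inE => /andP[].
suff -> : [set x in D | good_door (D :\ x)] = [set x; y].
  by rewrite cards2 eq_sym yx.
apply/setP => z; rewrite !inE; apply/andP/orP => [[zD gz]|].
  case: (eqVneq z x) => [_|zx]; first by left.
  case: (eqVneq z y) => [_|zy]; first by right.
  have E : x = y by apply: (inj z) => //; rewrite !inE ?xD ?yD eq_sym ?zx ?zy.
  by rewrite E eqxx in yx.
case=> /eqP {z}->; first by rewrite /good_door gx.
split=> //; rewrite /good_door -gx; apply/eqP/setP => i.
apply/imsetP/imsetP => -[z]; rewrite !inE => /andP[zy zD] ->.
  case: (eqVneq z x) => [->|zx]; first by exists y; rewrite // !inE yx.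
  by exists z; rewrite // !inE zx.
case: (eqVneq z y) => [->|zx']; first by exists x; rewrite // !inE eq_sym yx.
by exists z; rewrite // !inE zx'.
Qed.

(** Both sides count the pairs made of a dominant room and one of its good doors. A subset of a
    dominant set is dominant, so the doors need no further condition on the left. *)
Lemma double_count_doors :
  \sum_(D : {set S} | (#|D| == #|I|) && dominant D) #|[set x in D | good_door (D :\ x)]| =
  \sum_(q : {set S} | [&& #|q|.+1 == #|I|, dominant q & good_door q])
     #|[set x | (x \notin q) && dominant (x |: q)]|.
Proof.
under eq_bigr do rewrite -sum1dep_card.
under [RHS]eq_bigr do rewrite -sum1dep_card.
rewrite (exchange_big_dep predT)//= [RHS](exchange_big_dep predT)//=.
apply: eq_bigr => x _.
rewrite (reindex_onto (fun q => x |: q) (fun D => D :\ x)); last first.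
  by move=> D /andP[_ /andP[xD _]]; rewrite setD1K.
apply: eq_bigl => q; case: (boolP (x \in q)) => xq.
  rewrite !(andbF, andbT)/= andbC; apply/negbTE; rewrite negb_and.
  by apply/orP; left; apply/eqP => /setP/(_ x); rewrite !inE eqxx xq.
have E : (x |: q) :\ x = q.
  apply/setP => y; rewrite !inE; case: (eqVneq y x) => // ->.
  by rewrite (negbTE xq).
rewrite E eqxx andbT cardsU1 xq setU11/=.
case: (#|q|.+1 == #|I|) => //=; case: (boolP (good_door q)) => _; last first.
  by rewrite !andbF.
rewrite !andbT; case: (boolP (dominant (x |: q))) => //= dx; last by rewrite andbF.
by rewrite (dominant_sub _ dx)// subsetU1.
Qed.

End Dominance.

(** * Scarf's lemma *)

Section Scarf.
Variables (T : finType) (n : nat) (r : 'I_n.+1 -> T -> nat).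
Hypothesis r_inj : forall i, injective (r i).
Variables (c : T -> 'I_n.+1) (t0 : T).

(* [inr i] is the slack vertex of agent [i]: worst for [i], and better than
   every vertex of [T] for the other agents. *)
Definition slack_rank (i : 'I_n.+1) (x : T + 'I_n.+1) : nat :=
  match x with
  | inl t => (r i t).+1
  | inr j => if j == i then 0 else (\max_t r i t).+2 + j
  end.

Definition slack_col (x : T + 'I_n.+1) : 'I_n.+1 :=
  match x with inl t => c t | inr j => j end.

Lemma slack_rank_top i t j : j != i -> slack_rank i (inl t) < slack_rank i (inr j).
Proof.
move=> /negbTE /= ->; apply: leq_trans (leq_addr _ _).
by rewrite !ltnS; exact: (@leq_bigmax _ (r i) t).
Qed.

Lemma slack_rank_inj i : injective (slack_rank i).
Proof.
have H t j : slack_rank i (inl t) <> slack_rank i (inr j).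
  case: (eqVneq j i) => [->|/(slack_rank_top t)]; first by rewrite /= eqxx.
  by move=> /[swap] ->; rewrite ltnn.
move=> [x|x] [y|y] => [[/r_inj->]//|/H//|/esym/H//|] /=.
case: eqP => [->|_]; case: eqP => [->|_] //.
by move=> /eqP; rewrite eqn_add2l => /eqP/val_inj ->.
Qed.

Let i0 : 'I_n.+1 := ord0.

(** The door of all slack vertices but that of [i0] plays the part of the boundary: only the
    favourite vertex of [i0] completes it. Any other good door contains some [inl t], which every
    [inr e] beats for all agents but [e], so [card_door_rooms] applies. *)
Lemma card_slack_door (q : {set T + 'I_n.+1}) :
  #|q|.+1 == #|'I_n.+1| -> dominant slack_rank q -> good_door slack_col i0 q ->
  odd #|[set x | (x \notin q) && dominant slack_rank (x |: q)]| =
  (q == [set inr j | j in [set~ i0]]).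
Proof.
move=> /eqP cq domq goodq; case: eqP => [qE|qN].
  have qin j : (inr j \in q) = (j != i0).
    rewrite qE; apply/imsetP/idP => [[j' + [->]]|j0]; first by rewrite !inE.
    by exists j => //; rewrite !inE.
  have qinl t : (inl t \in q) = false by rewrite qE; apply/negP => /imsetP[].
  pose tm := [arg max_(t > t0) r i0 t].
  have tmP t : r i0 t <= r i0 tm by rewrite /tm; case: arg_maxnP => // ? _; apply.
  suff -> : [set x | (x \notin q) && dominant slack_rank (x |: q)] = [set inl tm].
    by rewrite cards1.
  apply/setP => x; rewrite !inE; apply/andP/eqP => [[xq /dominantP dx]|->].
    have [i Hi] := dx (inl tm).
    case: (eqVneq i i0) => [ii0|ii0]; last first.
      by have := Hi (inr i); rewrite in_setU1 qin ii0 orbT /= eqxx => /(_ isT).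
    case: x xq dx Hi => [t _ _|j]; last first.
      rewrite qin negbK => /eqP -> _ /(_ (inr i0)).
      by rewrite setU11 ii0/= => /(_ isT).
    move=> /(_ (inl t)); rewrite setU11 ii0 => /(_ isT) Ht.
    have {}Ht : r i0 tm <= r i0 t by [].
    by congr inl; apply: (@r_inj i0); apply/eqP; rewrite eqn_leq tmP Ht.
  split; first by rewrite qinl.
  apply/dominantP => -[t|j].
    exists i0 => y; rewrite in_setU1 => /orP[/eqP->|]; first by rewrite /= ltnS.
    case: y => [s|j]; first by rewrite qinl.
    by rewrite qin => j0; apply: ltnW; exact: slack_rank_top.
  by exists j => y _; rewrite /= eqxx.
(* Slack vertices have their own index as colour, so a good door made only of them is the boundary
   door. *)
have [t tq] : exists t, inl t \in q.
  apply/existsP/contraT; rewrite negb_exists => /forallP qinl; exfalso.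
  apply: qN; have := eqP goodq => colq.
  apply/eqP; rewrite eqEcard; apply/andP; split; last first.
    by rewrite card_imset ?cardsC1; [rewrite -cq|move=> ? ? []].
  apply/subsetP => -[t|j] yq; first by rewrite (negbTE (qinl t)) in yq.
  apply/imsetP; exists j => //; rewrite -colq; apply/imsetP.
  by exists (inr j).
rewrite card_door_rooms//; first exact: slack_rank_inj.
  by apply/set0Pn; exists (inl t).
move=> e; exists (inr e) => l le; exists (inl t) => //.
by apply: slack_rank_top; rewrite eq_sym.
Qed.

(** Parity: if no dominant room had all colours, the number of pairs of a room and a good door would
    be even when counted by rooms, and odd when counted by doors because of the single boundary
    door. *)
Theorem scarf : exists (D : {set T}) (C : {set 'I_n.+1}),
  [/\ C != set0, [set c x | x in D] = C &
     forall x, exists2 i, i \in C & forall y, y \in D -> r i x <= r i y].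
Proof.
have [D /andP[/andP[/eqP cD domD] /eqP colD]] :
    exists D : {set T + 'I_n.+1}, ((#|D| == #|'I_n.+1|) && dominant slack_rank D) &&
      ([set slack_col x | x in D] == setT).
  apply/existsP/contraT; rewrite negb_exists => /forallP H; exfalso.
  have := double_count_doors slack_rank slack_col i0.
  move=> /(congr1 odd); rewrite !(big_morph odd oddD (erefl _)).
  rewrite big1; last first.
    move=> D /andP[/eqP cD domD]; rewrite odd_good_doors//.
    by have := H D; rewrite cD domD eqxx/= => /negbTE.
  pose q0 : {set T + 'I_n.+1} := [set inr j | j in [set~ i0]].
  have cq0 : #|q0|.+1 == #|'I_n.+1|.
    by rewrite card_imset ?cardsC1 ?card_ord//; move=> ? ? [].
  have gq0 : good_door slack_col i0 q0.
    apply/eqP/setP => i; apply/imsetP/idP => [[x /imsetP[j + -> ->]]//|ii0].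
    by exists (inr i) => //; apply/imsetP; exists i.
  have dq0 : dominant slack_rank q0.
    apply/dominantP => -[t|j]; last by exists j => y _; rewrite /= eqxx.
    exists i0 => y /imsetP[j]; rewrite !inE => j0 ->; apply: ltnW.
    exact: slack_rank_top.
  rewrite (bigD1 q0)/=; last by rewrite cq0 dq0 gq0.
  rewrite card_slack_door// eqxx big1// => q /andP[/and3P[h1 h2 h3] qq0].
  by rewrite card_slack_door//; exact/negbTE.
(* When the slack vertices are discarded, an agent that witnesses dominance against a vertex of [T]
   cannot have its own slack vertex in [D]; its colour therefore comes from a vertex of [T]. *)
have slackC j : (inr j \in D) -> forall t, ~ (forall y, y \in D ->
    slack_rank j (inl t) <= slack_rank j y).
  by move=> jD t /(_ _ jD); rewrite /= eqxx.
exists [set t | inl t \in D], [set c x | x in [set t | inl t \in D]].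
have HC x : exists2 i, i \in [set c x | x in [set t | inl t \in D]] &
    forall y, y \in [set t | inl t \in D] -> r i x <= r i y.
  have /dominantP/(_ (inl x))[i Hi] := domD; exists i; last first.
    by move=> y; rewrite inE => /Hi.
  have : i \in [set slack_col x | x in D] by rewrite colD inE.
  case/imsetP => -[t tD ->|j jD ij]; first by apply/imsetP; exists t; rewrite ?inE.
  by case: (slackC i _ x Hi); rewrite ij.
split=> //; apply/set0Pn.
by have [i iC _] := HC t0; exists i.
Qed.

End Scarf.

From mathcomp Require Import all_classical all_reals all_analysis.
From mathcomp Require Import measurable_realfun ring lra zify.
From mathcomp Require finmap.

Import Order.TTheory GRing.Theory Num.Theory.
Import numFieldNormedType.Exports.

Local Open Scope classical_set_scope.
Local Open Scope ring_scope.

Lemma leq_trans_excess (N n u v w k : nat) :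
  (N < w + n.+1 -> k <= v -> u + w <= k + N -> u <= v + n)%N.
Proof. lia. Qed.

(** * Approximate zeros of tangent fields on the simplex *)

Section ApproximateBrouwer.
Variables (n : nat).

Section Grid.
Variable N : nat.

(** The points of the simplex whose coordinates are multiples of [1 / N], scaled by [N]. *)
Definition grid := {t : {ffun 'I_n.+1 -> 'I_N.+1} | (\sum_i t i == N :> nat)%N}.

(** Agent [i] compares the [i]-th coordinates; ties are broken by the enumeration of the grid, since
    Scarf's lemma needs injective rankings. *)
Definition grid_rank (i : 'I_n.+1) (t : grid) : nat :=
  (val t i * #|{: grid}| + enum_rank t)%N.

Lemma grid_rank_le i (s t : grid) :
  (grid_rank i s <= grid_rank i t)%N -> (val s i <= val t i)%N.
Proof.
rewrite /grid_rank => h; rewrite leqNgt; apply/negP => ts.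
have /leq_ltn_trans/(_ (ltn_ord (enum_rank t))) := leqnn (enum_rank t).
rewrite -(ltn_add2l (val t i * #|{: grid}|)) -mulSnr => /(leq_ltn_trans h).
by rewrite ltnNge => /negP[]; apply: leq_trans (leq_addr _ _); rewrite leq_mul2r ts orbT.
Qed.

Lemma grid_rank_inj i : injective (grid_rank i).
Proof.
move=> s t E; have E1 : val s i = val t i :> nat.
  by apply/eqP; rewrite eqn_leq !(@grid_rank_le i)// E.
by move: E; rewrite /grid_rank E1 => /addnI/val_inj/enum_rank_inj.
Qed.

Lemma grid_sum (t : grid) : (\sum_i val t i = N :> nat)%N.
Proof. by apply/eqP; exact: (valP t). Qed.

(** Let [m i] be the least [i]-th coordinate over [D]. Dominance forbids a grid point above all the
    [m i] with [i] in [C], so these minima nearly exhaust the total [N]; at most [n] units remain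
    for everything else. *)
Lemma grid_close (D : {set grid}) (C : {set 'I_n.+1}) (y0 : grid) :
  C != finset.set0 -> y0 \in D ->
  (forall x : grid, exists2 i, i \in C &
     forall y, y \in D -> (grid_rank i x <= grid_rank i y)%N) ->
  (forall y i, y \in D -> (val y i <= val y0 i + n)%N) /\
  (forall i, i \notin C -> (val y0 i <= n)%N).
Proof.
move=> /set0Pn[i1 i1C] y0D dom.
pose m (i : 'I_n.+1) : nat := val [arg min_(y < y0 in D) (val y i : nat)] i.
have mle i y : y \in D -> (m i <= val y i)%N.
  by move=> yD; rewrite /m; case: arg_minnP => // x _; apply.
have mex i : exists2 y, y \in D & val y i = m i :> nat.
  by rewrite /m; case: arg_minnP => // x xD _; exists x.
have big : (N < \sum_(i in C) (m i).+1)%N.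
  rewrite ltnNge; apply/negP => le.
  pose s := (\sum_(i in C) (m i).+1)%N.
  (* One unit above each minimum over [C], with the surplus placed at [i1] to reach the total
     [N]. *)
  pose x0 i : nat := if i \in C then ((m i).+1 + (if i == i1 then N - s else 0))%N else 0%N.
  have x0sum : (\sum_i x0 i = N)%N.
    rewrite /x0 -big_mkcond/= big_split/= -/s [X in (_ + X)%N](bigD1 i1)//= eqxx.
    by rewrite big1 ?addn0 ?subnKC// => i /andP[_ /negbTE ->].
  have x0N i : (x0 i < N.+1)%N by rewrite ltnS -[leqRHS]x0sum (bigD1 i)//= leq_addr.
  have xP : (\sum_i [ffun i => Ordinal (x0N i)] i == N :> nat)%N.
    by under eq_bigr do rewrite ffunE; rewrite x0sum.
  have [i iC Hi] := dom (Sub [ffun i => Ordinal (x0N i)] xP).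
  have [y yD ym] := mex i.
  have := grid_rank_le (Hi y yD); rewrite SubK ffunE/= ym /x0 iC; lia.
have cC : (\sum_(i in C) (m i).+1 = \sum_(i in C) m i + #|C|)%N.
  by rewrite -sum1_card -big_split/=; apply: eq_bigr => i _; rewrite addn1.
have cn : (#|C| <= n.+1)%N by rewrite -[leqRHS]card_ord max_card.
have big' : (N < \sum_(i in C) m i + n.+1)%N.
  by apply: leq_trans big _; rewrite cC leq_add2l.
have dec (y : grid) : y \in D -> forall i, i \in C ->
    (val y i + \sum_(j in C) m j <= m i + N)%N.
  move=> yD i iC; have := grid_sum y; rewrite (bigID (mem C))/= (bigD1 i iC)/=.
  rewrite [(\sum_(j in C) m j)%N](bigD1 i iC)/=.
  have : (\sum_(j in C | j != i) m j <= \sum_(j in C | j != i) val y j)%N.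
    by apply: leq_sum => j _; exact: mle.
  move: (\sum_(i0 in C | _) _)%N => a; move: (\sum_(i0 in C | _) _)%N => b.
  by move: (\sum_(i0 | _) _)%N (m i) (nat_of_ord _) => c u v; lia.
have decN (y : grid) : y \in D -> forall i, i \notin C -> (val y i <= n)%N.
  move=> yD i iC; have := grid_sum y; rewrite (bigID (mem C))/=.
  rewrite [X in (_ + X)%N](bigD1 i iC)/=.
  have : (\sum_(j in C) m j <= \sum_(j in C) val y j)%N.
    by apply: leq_sum => j _; exact: mle.
  move: big' (val y i : nat) => +; move: (\sum_(i0 in C) _)%N => a.
  move: (\sum_(i0 in C) _)%N => b; move: (\sum_(i0 | _) _)%N => c.
  by lia.
split=> [y i yD|]; last exact: decN.
case: (boolP (i \in C)) => iC; last by rewrite (leq_trans (decN _ yD _ iC))// leq_addl.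
exact: leq_trans_excess big' (mle i _ y0D) (dec _ yD _ iC).
Qed.

End Grid.

Variables (R : realType).

Definition simplex (l : 'I_n.+1 -> R) : Prop :=
  (forall i, 0 <= l i) /\ \sum_i l i = 1.

(* The label of a grid point is some [j] with [g j >= 0]; a colour that is
   missing from a dominant set has a small coordinate there. *)
Theorem approx_brouwer (g : 'I_n.+1 -> ('I_n.+1 -> R) -> R) (K : R) :
  0 <= K ->
  (forall j l l', simplex l -> simplex l' ->
     `|g j l - g j l'| <= K * \sum_i `|l i - l' i|) ->
  (forall l, simplex l -> \sum_j g j l = 0) ->
  (forall j l, simplex l -> - (K * l j) <= g j l) ->
  forall e, 0 < e -> exists2 l, simplex l & forall j, - e <= g j l.
Proof.
move=> K0 gLip gsum gbd e e0.
(* With [N > q], points of a dominant set differ by at most [n / N] in each coordinate, hence each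
   [g j] varies by at most [e] on it; a coordinate of size [n / N] also gives [K * l j <= e]. *)
pose q := (K * (n.+1 * n.+1)%:R / e)%R.
have q0 : 0 <= q by rewrite divr_ge0// ?mulr_ge0// ltW.
pose N := (Num.trunc q).+1.
have qN : q < N%:R by rewrite /N; exact: truncnS_gt.
have N0 : 0 < N%:R :> R by rewrite ltr0n.
pose lam (t : grid N) i : R := (val t i)%:R / N%:R.
have lamS t : simplex (lam t).
  split=> [i|]; first by rewrite divr_ge0.
  by rewrite -mulr_suml -natr_sum grid_sum divff// gt_eqF.
have lab t : exists j, 0 <= g j (lam t).
  apply/not_existsP => H; have := gsum _ (lamS t); apply/eqP; rewrite lt_eqF//.
  rewrite (bigD1 ord0)//= -[ltRHS]addr0 ltr_leD//; first by rewrite ltNge; exact/negP/H.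
  by apply: sumr_le0 => j _; rewrite leNgt; apply/negP => /ltW/H.
have /choice[c cP] := lab.
pose t0 := [ffun i : 'I_n.+1 => if i == ord0 then ord_max else ord0 : 'I_N.+1].
have t0P : (\sum_i t0 i == N :> nat)%N.
  rewrite (bigD1 ord0)//= ffunE eqxx/= big1 ?addn0// => i /negbTE i0.
  by rewrite ffunE i0.
have [D [C [C0 cDC dom]]] :=
  scarf (@grid_rank_inj N) c (Sub t0 t0P).
have [i1 i1C] := set0Pn _ C0.
have [y0 y0D _] : exists2 y, y \in D & i1 = c y by apply/imsetP; rewrite cDC.
have [close small] := grid_close C0 y0D dom.
have dist y : y \in D -> K * \sum_i `|lam y i - lam y0 i| <= e.
  move=> yD; have y0d i : `|lam y i - lam y0 i| <= n%:R / N%:R.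
    rewrite /lam -mulrBl normrM [ `|N%:R^-1|]ger0_norm ?invr_ge0// ler_pM2r ?invr_gt0//.
    have := close _ i yD; have [c2 _] := grid_close C0 yD dom; have := c2 _ i y0D.
    rewrite -!(ler_nat R) !natrD ler_norml; lra.
  have : \sum_(i < n.+1) `|lam y i - lam y0 i| <= (n.+1 * n)%:R / N%:R.
    apply: (@le_trans _ _ (\sum_(i < n.+1) n%:R / N%:R)); first exact: ler_sum.
    by rewrite sumr_const card_ord -[_ *+ n.+1]mulr_natl natrM mulrA.
  move=> /(ler_wpM2l K0)/le_trans; apply.
  rewrite mulrA ler_pdivrMr// [leRHS]mulrC -ler_pdivrMr//.
  apply: le_trans (ltW qN); rewrite /q ler_pM2r ?invr_gt0//.
  by rewrite ler_wpM2l// ler_nat leq_mul2l leqnSn orbT.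
exists (lam y0) => // j.
case: (boolP (j \in C)) => jC; last first.
  apply: le_trans (gbd _ _ (lamS _)); rewrite lerN2.
  rewrite /lam mulrA ler_pdivrMr// [leRHS]mulrC -ler_pdivrMr//.
  apply: le_trans (ltW qN); rewrite /q ler_pM2r ?invr_gt0//.
  rewrite ler_wpM2l// ler_nat; apply: leq_trans (small _ jC) _; lia.
have [y yD jy] : exists2 y, y \in D & j = c y by apply/imsetP; rewrite cDC.
have := gLip j _ _ (lamS y) (lamS y0); have := dist _ yD; have := cP y.
by rewrite -jy ler_norml; lra.
Qed.

End ApproximateBrouwer.

(** * Euclidean vectors and square-integrable functions *)

Section Vectors.
Context {R : realType}.
Implicit Types n m : nat.

Lemma edotC n (x y : 'cV[R]_n) : edot x y = edot y x.
Proof. by apply: eq_bigr => i _; rewrite mulrC. Qed.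

Lemma edotDl n (x y z : 'cV[R]_n) : edot (x + y) z = edot x z + edot y z.
Proof. by rewrite /edot -big_split/=; apply: eq_bigr => i _; rewrite mxE mulrDl. Qed.

Lemma edotZl n a (x z : 'cV[R]_n) : edot (a *: x) z = a * edot x z.
Proof. by rewrite /edot mulr_sumr; apply: eq_bigr => i _; rewrite mxE mulrA. Qed.

Lemma edotNl n (x z : 'cV[R]_n) : edot (- x) z = - edot x z.
Proof. by rewrite -scaleN1r edotZl mulN1r. Qed.

Lemma edotBl n (x y z : 'cV[R]_n) : edot (x - y) z = edot x z - edot y z.
Proof. by rewrite edotDl edotNl. Qed.

Lemma edotDr n (x y z : 'cV[R]_n) : edot z (x + y) = edot z x + edot z y.
Proof. by rewrite edotC edotDl ![edot z _]edotC. Qed.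

Lemma edotZr n a (x z : 'cV[R]_n) : edot z (a *: x) = a * edot z x.
Proof. by rewrite edotC edotZl [edot z _]edotC. Qed.

Lemma edotNr n (x z : 'cV[R]_n) : edot z (- x) = - edot z x.
Proof. by rewrite edotC edotNl [edot z _]edotC. Qed.

Lemma edotBr n (x y z : 'cV[R]_n) : edot z (x - y) = edot z x - edot z y.
Proof. by rewrite edotDr edotNr. Qed.

Lemma edot0l n (z : 'cV[R]_n) : edot 0 z = 0.
Proof. by rewrite -(scale0r 0) edotZl mul0r. Qed.

Lemma edot0r n (z : 'cV[R]_n) : edot z 0 = 0.
Proof. by rewrite edotC edot0l. Qed.

Lemma edot_ge0 n (x : 'cV[R]_n) : 0 <= edot x x.
Proof. by apply: sumr_ge0 => i _; rewrite -expr2 sqr_ge0. Qed.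

Lemma enorm_ge0 n (x : 'cV[R]_n) : 0 <= enorm x.
Proof. exact: sqrtr_ge0. Qed.

Lemma sqr_enorm n (x : 'cV[R]_n) : enorm x ^+ 2 = edot x x.
Proof. by rewrite sqr_sqrtr// edot_ge0. Qed.

Lemma sqr_enormE n (x : 'cV[R]_n) : enorm x ^+ 2 = \sum_i x i 0 ^+ 2.
Proof. by rewrite sqr_enorm; apply: eq_bigr => i _; rewrite expr2. Qed.

Lemma enorm0 n : enorm (0 : 'cV[R]_n) = 0.
Proof. by rewrite /enorm edot0l sqrtr0. Qed.

Lemma enormZ n a (x : 'cV[R]_n) : enorm (a *: x) = `|a| * enorm x.
Proof.
by rewrite /enorm edotZl edotZr mulrA -expr2 sqrtrM ?sqr_ge0// sqrtr_sqr.
Qed.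

Lemma enormN n (x : 'cV[R]_n) : enorm (- x) = enorm x.
Proof. by rewrite -scaleN1r enormZ normrN1 mul1r. Qed.

Lemma coord_enorm n (x : 'cV[R]_n) i : `|x i 0| <= enorm x.
Proof.
rewrite -(ler_pXn2r (ltn0Sn 1)) ?nnegrE ?enorm_ge0//.
rewrite real_normK ?num_real// sqr_enormE (bigD1 i)//= lerDl.
by apply: sumr_ge0 => j _; exact: sqr_ge0.
Qed.

Lemma enorm_eq0 n (x : 'cV[R]_n) : enorm x = 0 -> x = 0.
Proof.
move=> x0; apply/colP => i; rewrite mxE; apply/eqP; rewrite -normr_eq0.
by rewrite eq_le normr_ge0 -x0 coord_enorm.
Qed.

(** Cauchy-Schwarz, from the square of [|y|^2 x - <x, y> y]. *)
Lemma normr_edot n (x y : 'cV[R]_n) : `|edot x y| <= enorm x * enorm y.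
Proof.
have [/enorm_eq0 ->|y0] := eqVneq (enorm y) 0.
  by rewrite edot0r enorm0 normr0 mulr0.
have ey : 0 < enorm y by rewrite lt_neqAle eq_sym y0 enorm_ge0.
rewrite -(ler_pXn2r (ltn0Sn 1)) ?nnegrE ?mulr_ge0 ?enorm_ge0//.
rewrite real_normK ?num_real// exprMn.
have := edot_ge0 (enorm y ^+ 2 *: x - edot x y *: y).
rewrite edotBl !edotBr !edotZl !edotZr [edot y x]edotC -!sqr_enorm.
set a := enorm x; set b := enorm y; set c := edot x y.
have -> : b ^+ 2 * (b ^+ 2 * a ^+ 2) - b ^+ 2 * (c * c) - (c * (b ^+ 2 * c) - c * (c * b ^+ 2))
  = b ^+ 2 * (a ^+ 2 * b ^+ 2 - c ^+ 2) by ring.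
by rewrite pmulr_rge0 ?exprn_gt0// subr_ge0.
Qed.

Lemma edot_le n (x y : 'cV[R]_n) : edot x y <= enorm x * enorm y.
Proof. exact: le_trans (ler_norm _) (normr_edot _ _). Qed.

Lemma ler_enormD n (x y : 'cV[R]_n) : enorm (x + y) <= enorm x + enorm y.
Proof.
rewrite -(ler_pXn2r (ltn0Sn 1)) ?nnegrE ?addr_ge0 ?enorm_ge0//.
rewrite sqr_enorm edotDl !edotDr sqrrD -!sqr_enorm [edot y x]edotC.
have := edot_le x y; lra.
Qed.

Lemma ler_enormB n (x y : 'cV[R]_n) : enorm (x - y) <= enorm x + enorm y.
Proof. by rewrite -(enormN y); exact: ler_enormD. Qed.

Lemma enorm_distC n (x y : 'cV[R]_n) : enorm (x - y) = enorm (y - x).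
Proof. by rewrite -enormN opprB. Qed.

Lemma ler_enorm_distD n (z x y : 'cV[R]_n) :
  enorm (x - y) <= enorm (x - z) + enorm (z - y).
Proof. by have := ler_enormD (x - z) (z - y); rewrite addrA subrK. Qed.

Lemma enorm_le_sum n (x : 'cV[R]_n) : enorm x <= \sum_i `|x i 0|.
Proof.
have xE : x = \sum_i x i 0 *: (delta_mx i 0 : 'cV[R]_n).
  apply/colP => j; rewrite summxE (bigD1 j)//= big1 ?addr0.
    by rewrite !mxE !eqxx mulr1.
  by move=> i /negbTE ij; rewrite !mxE eq_sym ij mulr0.
rewrite {1}xE; elim/big_rec2 : _ => [|i a b _ h]; first by rewrite enorm0.
apply: le_trans (ler_enormD _ _) (lerD _ h); rewrite enormZ ler_piMr//.
rewrite -(ler_pXn2r (ltn0Sn 1)) ?nnegrE ?enorm_ge0// sqr_enormE expr1n.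
rewrite (bigD1 i)//= big1 ?addr0; first by rewrite mxE !eqxx expr1n.
by move=> j /negbTE ji; rewrite mxE ji expr0n.
Qed.

(** A crude substitute for the operator norm where any constant will do; it also bounds the set
    whose supremum is [opnorm]. *)
Definition mx_sum m n (M : 'M[R]_(m, n)) : R := \sum_i \sum_j `|M i j|.

Lemma mx_sum_ge0 m n (M : 'M[R]_(m, n)) : 0 <= mx_sum M.
Proof. by apply: sumr_ge0 => i _; apply: sumr_ge0. Qed.

Lemma enorm_mulmx m n (M : 'M[R]_(m, n)) (v : 'cV[R]_n) :
  enorm (M *m v) <= mx_sum M * enorm v.
Proof.
apply: le_trans (enorm_le_sum _) _; rewrite /mx_sum mulr_suml; apply: ler_sum => i _.
rewrite mxE mulr_suml; apply: le_trans (ler_norm_sum _ _ _) _.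
by apply: ler_sum => j _; rewrite normrM ler_wpM2l// coord_enorm.
Qed.

Lemma enorm_opnorm m n (M : 'M[R]_(m, n)) (v : 'cV[R]_n) :
  enorm (M *m v) <= opnorm M * enorm v.
Proof.
have [/enorm_eq0 ->|v0] := eqVneq (enorm v) 0.
  by rewrite mulmx0 !enorm0 mulr0.
have ev : 0 < enorm v by rewrite lt_neqAle eq_sym v0 enorm_ge0.
rewrite -ler_pdivrMr// mulrC -[X in X * _](@ger0_norm _ (enorm v)^-1) ?invr_ge0 ?enorm_ge0//.
rewrite -enormZ scalemxAr; apply: ub_le_sup.
  exists (mx_sum M) => _ [w /= w1 <-]; apply: le_trans (enorm_mulmx _ _) _.
  by rewrite ler_piMr// mx_sum_ge0.
exists ((enorm v)^-1 *: v) => //=.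
by rewrite enormZ ger0_norm ?invr_ge0 ?enorm_ge0// mulVf.
Qed.

Lemma edot_mulmx m n (M : 'M[R]_(m, n)) x y : edot x (M *m y) = edot (M^T *m x) y.
Proof.
rewrite /edot; under eq_bigr do rewrite mxE mulr_sumr.
rewrite exchange_big/=; apply: eq_bigr => j _; rewrite mxE mulr_suml.
by apply: eq_bigr => i _; rewrite mxE; ring.
Qed.

Lemma enorm_lt_ball n (x y : 'cV[R]_n) e : enorm (x - y) < e -> ball x e y.
Proof.
move=> h; split; first by apply: le_lt_trans h; exact: enorm_ge0.
move=> i j; rewrite (ord1 j); apply: le_lt_trans h.
by have := coord_enorm (x - y) i; rewrite !mxE.
Qed.

Lemma ball_enorm n (x y : 'cV[R]_n) e : ball x e y -> enorm (x - y) <= n%:R * e.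
Proof.
move=> [_ h]; apply: le_trans (enorm_le_sum _) _.
rewrite -[n in n%:R]card_ord -sum1_card natr_sum mulr_suml; apply: ler_sum => i _.
by rewrite mul1r !mxE; exact/ltW/h.
Qed.

Lemma nbhs_enormP n (x : 'cV[R]_n) (P : set 'cV[R]_n) :
  nbhs x P <-> exists2 e, 0 < e & forall y, enorm (x - y) < e -> P y.
Proof.
split=> [/nbhs_ballP[e /= e0 eP]|[e e0 eP]].
  by exists e => // y /enorm_lt_ball; exact: eP.
apply/nbhs_ballP; exists (e / n.+1%:R); first by rewrite /= divr_gt0.
move=> y /ball_enorm h; apply: eP; apply: le_lt_trans h _.
rewrite mulrA ltr_pdivrMr// mulrC ltr_pM2l// ltr_nat//.
Qed.

Lemma continuous_enorm n : continuous (@enorm R n).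
Proof.
move=> x P /nbhs_ballP[e e0 eP]; apply/nbhs_enormP; exists e => // y xy.
apply: eP; apply: le_lt_trans xy; rewrite /= ler_norml; apply/andP; split.
  by have := ler_enormD (y - x) x; rewrite subrK -[enorm (y - x)]enormN opprB; lra.
by have := ler_enormD (x - y) y; rewrite subrK; lra.
Qed.

Lemma continuous_enormP n m (f : 'cV[R]_n -> 'cV[R]_m) x :
  {for x, continuous f} <-> forall e, 0 < e -> exists2 d, 0 < d &
    forall y, enorm (x - y) < d -> enorm (f x - f y) < e.
Proof.
split=> [cf e e0|H P /nbhs_enormP[e e0 eP]].
  have /cf/nbhs_enormP[d d0 dP] : nbhs (f x) [set z | enorm (f x - z) < e].
    by apply/nbhs_enormP; exists e.
  by exists d.
have [d d0 dP] := H e e0; apply/nbhs_enormP; exists d => // y /dP; exact: eP.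
Qed.

Lemma continuous_measurable_cV n (f : 'cV[R]_n -> R) :
  continuous f -> measurable_fun setT f.
Proof.
move=> cf; apply: (measurability _ (measurable_realfun.RGenOpens.measurableE R)).
move=> _ [_ [a [b ->] <-]]; rewrite setTI; apply: sub_sigma_algebra.
by move/continuousP : cf; apply; exact: interval_open.
Qed.

Lemma measurable_coord n (i : 'I_n) :
  measurable_fun setT (fun x : 'cV[R]_n => x i 0).
Proof. exact: (@continuous_measurable_cV n _ (@coord_continuous R n 1 i 0)). Qed.

Lemma measurable_enorm n : measurable_fun setT (@enorm R n).
Proof. exact: (@continuous_measurable_cV n _ (@continuous_enorm n)). Qed.

Section MeasurableVector.
Context d (T : measurableType d).

(** The Borel sets are generated by the open sets, and an open set is a countable union of cubes
    with rational centres, each cut out by finitely many conditions on coordinates. *)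
Lemma measurable_fun_cVP n (D : set T) (f : T -> 'cV[R]_n) : measurable D ->
  measurable_fun D f <-> forall i, measurable_fun D (fun t => f t i 0).
Proof.
move=> mD; split=> [mf i|mf].
  exact: (measurableT_comp (measurable_coord i)).
apply: (@measurability _ _ _ _ _ _ (@open 'cV[R]_n)) => // _ [W oO <-].
pose B (q : 'cV[rat]_n * nat) : set 'cV[R]_n :=
  [set x | forall i, `|x i 0 - ratr (q.1 i 0)| < q.2.+1%:R^-1].
have -> : W = \bigcup_(q in [set q | B q `<=` W]) B q.
  apply/seteqP; split=> [x Wx|x [q qO]]; last exact: qO.
  have /nbhs_ballP[e /= e0 eO] : nbhs x W by exact: open_nbhs_nbhs.
  have [N Ne] : exists N : nat, N.+1%:R^-1 < e / 2.
    exists (Num.trunc (e / 2)^-1); rewrite invf_plt ?posrE ?divr_gt0//.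
    exact: truncnS_gt.
  have /choice[q qP] : forall i : 'I_n, exists q : rat, `|x i 0 - ratr q| < N.+1%:R^-1.
    move=> i; have lt : x i 0 - N.+1%:R^-1 < x i 0 + N.+1%:R^-1.
      by rewrite ltrBlDr -addrA ltrDl addr_gt0// invr_gt0.
    have [q] := rat_in_itvoo lt; rewrite in_itv/= => /andP[h1 h2].
    by exists q; rewrite distrC ltr_distl h1 h2.
  exists (\col_i q i, N) => [y /= yB|i]; last by rewrite /= mxE; exact: qP.
  apply: eO; split=> // i j; rewrite (ord1 j) /ball /=.
  have /= := yB i; rewrite mxE => h.
  apply: le_lt_trans (ler_distD (ratr (q i)) _ _) _; rewrite [ `|_ - y i 0|]distrC.
  apply: lt_trans (ltrD (qP i) h) _; rewrite [ltRHS](splitr e); exact: ltrD.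
rewrite preimage_bigcup setI_bigcupr bigcup_mkcond.
apply: countable_bigcupT_measurable => // -[q N]; case: ifP => // _.
(* The index [None] contributes [D] itself, which keeps the finite intersection correct for
   [n = 0]. *)
suff -> : D `&` f @^-1` B (q, N) =
    \bigcap_(i in [set: option 'I_n]) (if i is Some i then
      D `&` (fun t => `|f t i 0 - ratr (q i 0)|) @^-1` `]-oo, N.+1%:R^-1[ else D).
  apply: fin_bigcap_measurable => // -[i|//] _.
  have mi : measurable_fun D (fun t => `|f t i 0 - ratr (q i 0)|).
    by apply: measurableT_comp => //; exact: measurable_funB (mf i) _.
  by apply: mi.
apply/seteqP; split=> t.
  by move=> [Dt tB] [i|] _ //=; split=> //; rewrite in_itv/=; exact: tB.
move=> H; split; first exact: (H None).
by move=> i; have [_] := H (Some i) I; rewrite /= in_itv.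
Qed.

End MeasurableVector.

End Vectors.

(** * Real-valued integrable and square-integrable functions *)

Section RealIntegrable.
Context d (T : measurableType d) (R : realType).
Variables (mu : {measure set T -> \bar R}) (D : set T).
Hypothesis mD : measurable D.
Implicit Types f g h : T -> R.

Definition ibl f : Prop := mu.-integrable D (EFin \o f).

Lemma ibl_mfun f : ibl f -> measurable_fun D f.
Proof. by move=> /measurable_int/measurable_EFinP. Qed.

Lemma eq_ibl f g : (forall x, D x -> f x = g x) -> ibl f -> ibl g.
Proof.
by move=> fg; apply: eq_integrable => // x; rewrite inE => Dx /=; rewrite fg.
Qed.

Lemma iblD f g : ibl f -> ibl g -> ibl (fun x => f x + g x).
Proof. by move=> If Ig; have := integrableD mD If Ig. Qed.

Lemma iblN f : ibl f -> ibl (fun x => - f x).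
Proof. by move=> If; have := integrableN If. Qed.

Lemma iblB f g : ibl f -> ibl g -> ibl (fun x => f x - g x).
Proof. by move=> If Ig; have := iblD If (iblN Ig). Qed.

Lemma iblZ c f : ibl f -> ibl (fun x => c * f x).
Proof. by move=> If; have := integrableZl mD c If. Qed.

Lemma iblZr c f : ibl f -> ibl (fun x => f x * c).
Proof. by move=> /(iblZ c); apply: eq_ibl => x _; rewrite mulrC. Qed.

Lemma ibl_le f g : measurable_fun D f -> (forall x, D x -> `|f x| <= g x) ->
  ibl g -> ibl f.
Proof.
move=> mf fg; apply: le_integrable => //; first exact/measurable_EFinP.
by move=> x Dx /=; rewrite lee_fin (le_trans (fg x Dx))// ler_norm.
Qed.

Lemma ibl_norm f : ibl f -> ibl (fun x => `|f x|).
Proof. by move=> If; have := integrable_norm If. Qed.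

Lemma ibl_sum (I : Type) (s : seq I) (P : pred I) (h : I -> T -> R) :
  (forall i, P i -> ibl (h i)) -> ibl (fun x => \sum_(i <- s | P i) h i x).
Proof.
move=> Ih; have := @integrable_sum _ _ _ mu D mD I s P (fun i x => (h i x)%:E) Ih.
by apply: eq_integrable => // x _ /=; rewrite sumEFin.
Qed.

Lemma ibl_cst c : (mu D < +oo)%E -> ibl (cst c).
Proof.
move=> muD; apply/integrableP; split; first exact/measurable_EFinP.
rewrite (_ : (fun x => _) = cst `|c|%:E)// integral_cst// lte_mul_pinfty//.
Qed.

Lemma Rint_sum (I : Type) (s : seq I) (P : pred I) (h : I -> T -> R) :
  (forall i, P i -> ibl (h i)) ->
  \int[mu]_(x in D) (\sum_(i <- s | P i) h i x) =
  \sum_(i <- s | P i) \int[mu]_(x in D) h i x.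
Proof.
move=> Ih; elim: s => [|i s IHs].
  under eq_Rintegral do rewrite big_nil; rewrite big_nil.
  by rewrite Rintegral_cst// mul0r.
under eq_Rintegral do rewrite big_cons; rewrite big_cons.
case: ifP => Pi; last by rewrite IHs.
by rewrite RintegralD ?IHs//; [exact: Ih|exact: ibl_sum].
Qed.

Lemma Rint_le f g : ibl f -> ibl g -> (forall x, D x -> f x <= g x) ->
  \int[mu]_(x in D) f x <= \int[mu]_(x in D) g x.
Proof. exact: le_Rintegral. Qed.

Lemma integralE_fin f : ibl f ->
  (\int[mu]_(x in D) (f x)%:E)%E = (\int[mu]_(x in D) f x)%:E.
Proof. by move=> If; rewrite /Rintegral fineK// integrable_fin_num. Qed.

Lemma ge0_ibl f : measurable_fun D f -> (forall x, D x -> 0 <= f x) ->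
  (\int[mu]_(x in D) (f x)%:E < +oo)%E -> ibl f.
Proof.
move=> mf f0 If; apply/integrableP; split; first exact/measurable_EFinP.
apply: le_lt_trans If; apply: ge0_le_integral => //.
- by do 2 apply: measurableT_comp => //.
- by apply/measurable_EFinP.
- by move=> x Dx /=; rewrite ger0_norm// f0.
Qed.

Lemma ibl_ltey f : ibl f -> (\int[mu]_(x in D) (f x)%:E < +oo)%E.
Proof. by move=> If; rewrite integralE_fin// ltry. Qed.

Lemma Rdct (f_ : nat -> T -> R) f g :
  (forall n, measurable_fun D (f_ n)) -> measurable_fun D f ->
  {ae mu, forall x, D x -> f_ n x @[n --> \oo] --> f x} ->
  ibl g -> {ae mu, forall x n, D x -> `|f_ n x| <= g x} ->
  ibl f /\ \int[mu]_(x in D) f_ n x @[n --> \oo] --> \int[mu]_(x in D) f x.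
Proof.
move=> mf_ mf cvf Ig fg.
have [] := @dominated_convergence _ _ _ mu D mD (fun n x => (f_ n x)%:E)
  (fun x => (f x)%:E) (fun x => (g x)%:E).
- by move=> n; exact/measurable_EFinP.
- exact/measurable_EFinP.
- apply: filterS cvf => x /[apply] H; exact: cvg_EFin (nearW _ _) H.
- exact: Ig.
- by apply: filterS fg => x H n /H; rewrite lee_fin.
move=> If _ cv; split=> //.
rewrite -[X in _ --> X]fineK in cv; last exact: integrable_fin_num.
exact: fine_cvg cv.
Qed.

Definition sqi f : Prop := measurable_fun D f /\ ibl (fun x => f x ^+ 2).

Lemma sqiM f g : sqi f -> sqi g -> ibl (fun x => f x * g x).
Proof.
move=> [mf If] [mg Ig]; apply: ibl_le (iblD If Ig); first exact: measurable_funM.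
move=> x _; rewrite ler_norml; apply/andP; split.
  by have := sqr_ge0 (f x + g x); have := sqr_ge0 (f x - g x); nra.
by have := sqr_ge0 (f x + g x); have := sqr_ge0 (f x - g x); nra.
Qed.

Lemma sqiD f g : sqi f -> sqi g -> sqi (fun x => f x + g x).
Proof.
move=> Sf Sg; split; first by apply: measurable_funD; [case: Sf|case: Sg].
have := iblD (iblD (proj2 Sf) (proj2 Sg)) (iblZ 2 (sqiM Sf Sg)).
by apply: eq_ibl => x _; ring.
Qed.

Lemma sqiZ c f : sqi f -> sqi (fun x => c * f x).
Proof.
move=> [mf If]; split; first exact: measurable_funM.
by apply: eq_ibl (iblZ (c ^+ 2) If) => x _; ring.
Qed.

Lemma sqiN f : sqi f -> sqi (fun x => - f x).
Proof.
move=> [mf If]; split; first exact: measurable_funN.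
by apply: eq_ibl If => x _; ring.
Qed.

Lemma sqiB f g : sqi f -> sqi g -> sqi (fun x => f x - g x).
Proof. by move=> Sf /sqiN Sg; exact: sqiD. Qed.

Lemma eq_sqi f g : (forall x, D x -> f x = g x) -> sqi f -> sqi g.
Proof.
move=> fg [mf If]; split; last by apply: eq_ibl If => x Dx; rewrite fg.
by apply: eq_measurable_fun mf => x; rewrite inE => /fg.
Qed.

Lemma sqi_le f g : measurable_fun D f -> (forall x, D x -> `|f x| <= g x) ->
  sqi g -> sqi f.
Proof.
move=> mf fg [_ Ig]; split=> //; apply: ibl_le Ig; first exact: measurable_funX.
move=> x Dx; rewrite normrX ler_pXn2r ?nnegrE//; first exact: fg.
exact: le_trans (fg x Dx).
Qed.

Lemma sqi_cst c : (mu D < +oo)%E -> sqi (cst c).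
Proof. by move=> muD; split=> //; exact: (ibl_cst (c ^+ 2)). Qed.

Lemma sqi_ibl f : (mu D < +oo)%E -> sqi f -> ibl f.
Proof.
by move=> muD Sf; apply: eq_ibl (sqiM Sf (sqi_cst 1 muD)) => x _; rewrite mulr1.
Qed.

Lemma sqi_norm f : sqi f -> sqi (fun x => `|f x|).
Proof.
move=> [mf If]; split; first exact: measurableT_comp.
by apply: eq_ibl If => x _; rewrite real_normK// num_real.
Qed.

Lemma sqi_sum (I : Type) (s : seq I) (P : pred I) (h : I -> T -> R) :
  (forall i, P i -> sqi (h i)) -> sqi (fun x => \sum_(i <- s | P i) h i x).
Proof.
move=> Ih; elim: s => [|i s IHs].
  under eq_fun do rewrite big_nil; split=> //.
  have -> : (fun=> 0 ^+ 2) = cst 0 :> (T -> R) by apply/funext => x; rewrite expr0n.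
  exact: integrable0.
case Pi : (P i); under eq_fun do rewrite big_cons Pi; last exact: IHs.
by apply: sqiD => //; exact: Ih.
Qed.

(** The variance inequality: the integral of [(f - c) ^+ 2] is nonnegative, and [c] is taken to be
    the mean of [f]. *)
Lemma sqr_Rint_le f : (mu D < +oo)%E -> sqi f ->
  (\int[mu]_(x in D) f x) ^+ 2 <= fine (mu D) * \int[mu]_(x in D) (f x ^+ 2).
Proof.
move=> muD Sf; have If := sqi_ibl muD Sf.
set m := fine (mu D); set a := \int[mu]_(x in D) f x.
have m0 : 0 <= m by rewrite fine_ge0.
have key c : 0 <= \int[mu]_(x in D) (f x ^+ 2) - 2 * c * a + c ^+ 2 * m.
  have -> : \int[mu]_(x in D) (f x ^+ 2) - 2 * c * a + c ^+ 2 * m =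
      \int[mu]_(x in D) ((f x - c) ^+ 2).
    rewrite -(RintegralZl (2 * c) mD If)// -RintegralB//; [|exact: (proj2 Sf)|exact: iblZ].
    rewrite /m -Rintegral_cst// -RintegralD//; last 2 first.
    - exact: (iblB (proj2 Sf) (iblZ _ If)).
    - exact: ibl_cst.
    by apply: eq_Rintegral => x _; ring.
  by apply: Rintegral_ge0 => x _; exact: sqr_ge0.
have [m00|m00] := eqVneq m 0.
  (* On a null set the quadratic in [c] degenerates to an affine function, equal to [-1] at this [c]
     unless [a = 0]. *)
  rewrite m00 mul0r; have := key ((\int[mu]_(x in D) (f x ^+ 2) + 1) / (2 * a)).
  have [->|a0] := eqVneq a 0; first by rewrite expr0n.
  rewrite m00 mulr0 addr0.
  have -> : 2 * ((\int[mu]_(x in D) (f x ^+ 2) + 1) / (2 * a)) * a =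
    \int[mu]_(x in D) (f x ^+ 2) + 1 by field.
  lra.
have {m00}mp : 0 < m by rewrite lt_neqAle eq_sym m00.
have := key (a / m).
have -> : \int[mu]_(x in D) (f x ^+ 2) - 2 * (a / m) * a + (a / m) ^+ 2 * m =
  \int[mu]_(x in D) (f x ^+ 2) - a ^+ 2 / m by field; rewrite gt_eqF.
by rewrite subr_ge0 ler_pdivrMr// mulrC.
Qed.

End RealIntegrable.

(** * Kinetic energy on meshes *)

Section IntervalIntegrals.
Context {R : realType}.
Local Notation mu := (@lebesgue_measure R).
Implicit Types f g : R -> R.

Lemma ae_imp (P Q : R -> Prop) : (forall x, P x -> Q x) ->
  {ae mu, forall x, P x} -> {ae mu, forall x, Q x}.
Proof.
by move=> PQ; apply: filterS => //; exact: (ae_filter_ringOfSetsType mu).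
Qed.

Lemma ae_conj (P Q : R -> Prop) : {ae mu, forall x, P x} ->
  {ae mu, forall x, Q x} -> {ae mu, forall x, P x /\ Q x}.
Proof. by apply: filterS2 => //; exact: (ae_filter_ringOfSetsType mu). Qed.

Lemma mu_itv (a b : R) : a <= b -> mu `[a, b] = (b - a)%:E.
Proof.
rewrite le_eqVlt => /predU1P[<-|ab]; first by rewrite lebesgue_measure_itv/= ltxx subrr.
by rewrite lebesgue_measure_itv/= lte_fin ab.
Qed.

Lemma mu_itv_lty (a b : R) : (mu `[a, b] < +oo)%E.
Proof. by rewrite lebesgue_measure_itv/=; case: ifP => _; rewrite ?ltry// -EFinD ltry. Qed.

Lemma sqi_ibl_itv (a b : R) f : sqi mu `[a, b] f -> ibl mu `[a, b] f.
Proof. by apply: sqi_ibl => //; exact: mu_itv_lty. Qed.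

Lemma ibl_cst_itv (a b c : R) : ibl mu `[a, b] (cst c).
Proof. by apply: ibl_cst => //; exact: mu_itv_lty. Qed.

Lemma sqi_cst_itv (a b c : R) : sqi mu `[a, b] (cst c).
Proof. by apply: sqi_cst => //; exact: mu_itv_lty. Qed.

Lemma sub_itvcc (a b c e : R) : c <= a -> b <= e -> `[a, b] `<=` `[c, e].
Proof.
move=> ca be x /=; rewrite !in_itv/= => /andP[ax xb].
by rewrite (le_trans ca ax) (le_trans xb be).
Qed.

Lemma ibl_itv (a b c e : R) f : c <= a -> b <= e ->
  ibl mu `[c, e] f -> ibl mu `[a, b] f.
Proof. by move=> ca be; apply: integrableS => //; exact: sub_itvcc. Qed.

Lemma sqi_itv (a b c e : R) f : c <= a -> b <= e ->
  sqi mu `[c, e] f -> sqi mu `[a, b] f.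
Proof.
move=> ca be [mf If]; split; last exact: ibl_itv If.
by apply: measurable_funS mf => //; exact: sub_itvcc.
Qed.

Lemma Rint_cat (a b c : R) f : a <= b -> b <= c -> ibl mu `[a, c] f ->
  \int[mu]_(x in `[a, c]) f x =
  \int[mu]_(x in `[a, b]) f x + \int[mu]_(x in `[b, c]) f x.
Proof.
move=> ab bc If; rewrite addrC; apply/eqP; rewrite -subr_eq; apply/eqP.
rewrite (@Rintegral_itvB _ f (BLeft a) (BRight c) b)//.
by rewrite Rintegral_itv_obnd_cbnd//; apply: integrableS If => // x /=; rewrite !in_itv/= => /andP[/ltW bx ->]; rewrite (le_trans ab bx).
Qed.

Lemma Rint_le_itv (a b c e : R) f : c <= a -> a <= b -> b <= e -> ibl mu `[c, e] f ->
  (forall x, x \in `[c, e] -> 0 <= f x) ->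
  \int[mu]_(x in `[a, b]) f x <= \int[mu]_(x in `[c, e]) f x.
Proof.
move=> ca ab be If f0; rewrite (@Rint_cat c a e)//; last exact: le_trans be.
rewrite (@Rint_cat a b e)//; last exact: ibl_itv If.
rewrite addrCA lerDl addr_ge0//.
  apply: Rintegral_ge0 => x xca; apply: f0; apply: sub_itvcc xca => //.
  exact: le_trans be.
apply: Rintegral_ge0 => x xca; apply: f0; apply: sub_itvcc xca => //.
exact: le_trans ab.
Qed.

Lemma sqr_Rint_itv (a b : R) f : a <= b -> sqi mu `[a, b] f ->
  (\int[mu]_(x in `[a, b]) f x) ^+ 2 <= (b - a) * \int[mu]_(x in `[a, b]) (f x ^+ 2).
Proof.
move=> ab Sf; rewrite (_ : b - a = fine (mu `[a, b])); last by rewrite mu_itv.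
exact: sqr_Rint_le (mu_itv_lty _ _) Sf.
Qed.

Variable T : R.
Hypothesis T0 : 0 < T.
Local Notation D := (`[0, T]%classic).

(** Lebesgue differentiation for [f] extended by zero to the line; near an interior point [g] is [c]
    plus the primitive of the extension. *)
Lemma ftc_ae f (g : R -> R) (c : R) : ibl mu D f ->
  (forall t, t \in `[0, T] -> g t = c + \int[mu]_(s in `[0, t]) f s) ->
  {ae mu, forall t, t \in `]0, T[ -> derivable g t 1 /\ derive1 g t = f t}.
Proof.
move=> If gE; pose f0 := f \_ D.
have If0 : mu.-integrable setT (EFin \o f0).
  have [+ _] := @integrable_restrict _ _ _ mu D (measurable_itv _) setT measurableT (EFin \o f).
  by rewrite setTI restrict_EFin; apply.
have locf0 : locally_integrable setT f0.
  split; [exact: (ibl_mfun If0)|exact: openT|].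
  move=> K _ cK; have /integrableP[mf] := If0; apply: le_lt_trans.
  apply: ge0_subset_integral => //.
    exact: compact_measurable.
  by apply/measurable_EFinP; apply: measurableT_comp => //; exact: (ibl_mfun If0).
have Iy y : mu.-integrable `[0, y] (EFin \o f0) by apply: integrableS If0.
have := @FTC1 R f0 (BLeft 0) Iy locf0.
apply: ae_imp => t H; rewrite in_itv/= => /andP[t0 tT].
have {H}[] : derivable (fun x : R => \int[mu]_(s in `[0, x]) f0 s) t 1 /\
    derive1 (fun x : R => \int[mu]_(s in `[0, x]) f0 s) t = f0 t.
  by apply: H; first [exact: t0|exact: ltW|by rewrite ltBSide/= ltW].
set F := (fun x : R => _) => dF F't.
have gF : {near t, c \o* cst 1 \+ F =1 g}.
  near=> s; rewrite gE; last first.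
    rewrite in_itv/=; apply/andP; split; apply/ltW.
      by near: s; exact: lt_nbhsr.
    by near: s; exact: lt_nbhsl.
  rewrite /= mul1r /F; congr (_ + _); apply: eq_Rintegral => x.
  rewrite inE/= in_itv/= => /andP[x0 xs]; rewrite /f0 patchE mem_set//= in_itv/= x0.
  by apply: le_trans xs _; apply/ltW; near: s; exact: lt_nbhsl.
have dcF : is_derive t (1 : R) (c \o* cst 1 \+ F) (f t).
  have -> : f t = 0 + f0 t.
    by rewrite add0r /f0 patchE mem_set//= in_itv/= !ltW.
  have -> : c \o* cst 1 \+ F = cst c + F by apply/funext => x /=; rewrite mul1r.
  by apply: is_deriveD; split; rewrite // -F't derive1E.
have : is_derive t (1 : R) g (f t).
  by apply: near_eq_is_derive dcF; rewrite ?oner_eq0//; exact: filterS gF.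
by case=> dg gf; split=> //; rewrite derive1E.
Unshelve. all: by end_near. Qed.

Lemma ae_itvoo (P : R -> Prop) : {ae mu, forall t, t \in `]0, T[ -> P t} ->
  {ae mu, forall t, D t -> P t}.
Proof.
have H x : {ae mu, forall t, t <> x}.
  by exists [set x]; split=> //; [exact: lebesgue_measure_set1|move=> t /=/contrapT].
move=> HP; apply: ae_imp (ae_conj (ae_conj (H 0) (H T)) HP) => t [[t0 tT]].
rewrite /= !in_itv/= => PT /andP[t0' tT'].
by apply: PT; rewrite !lt_neqAle t0' tT' !andbT; apply/andP; split; apply/eqP => // /esym.
Qed.

Lemma ibl_prim_eq0 f : ibl mu D f ->
  (forall t, t \in `[0, T] -> \int[mu]_(s in `[0, t]) f s = 0) ->
  {ae mu, forall t, D t -> f t = 0}.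
Proof.
move=> If F0; apply: ae_itvoo.
have : forall t, t \in `[0, T] -> cst 0 t = 0 + \int[mu]_(s in `[0, t]) f s.
  by move=> t tT; rewrite F0// addr0.
by move=> /(ftc_ae If); apply: ae_imp => t H /H[_ <-]; rewrite derive1_cst.
Qed.

End IntervalIntegrals.

Section StepFunctions.
Context {R : realType}.
Local Notation mu := (@lebesgue_measure R).
Implicit Types f g U : R -> R.
Lemma fine_mu_itvco (a b : R) : a <= b -> fine (mu `[a, b[) = b - a.
Proof.
rewrite le_eqVlt => /predU1P[<-|ab]; first by rewrite lebesgue_measure_itv/= ltxx subrr.
by rewrite lebesgue_measure_itv/= lte_fin ab.
Qed.

Variable T : R.
Hypothesis T0 : 0 < T.
Local Notation D := (`[0, T]%classic).

Definition mesh (N : nat) : R := T / N%:R.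
Definition node (N j : nat) : R := j%:R * mesh N.
(** The half-open pieces tile [[0, T[], and the value at [T] is 0. *)
Definition step (N : nat) (a : nat -> R) (s : R) : R :=
  \sum_(j < N) a j * \1_(`[node N j, node N j.+1[) s.
Definition diff U (N j : nat) : R := U (node N j.+1) - U (node N j).
(** The derivative of the piecewise affine interpolation of [U] at the nodes; [energy] is the
    integral of its square, an expression in finitely many values of [U]. *)
Definition slope U (N : nat) : R -> R := step N (fun j => diff U N j / mesh N).
Definition energy U (N : nat) : R := \sum_(j < N) diff U N j ^+ 2 / mesh N.

Section FixedMesh.
Variable N : nat.
Hypothesis N0 : (0 < N)%N.

Lemma mesh_gt0 : 0 < mesh N.
Proof. by rewrite divr_gt0// ltr0n. Qed.

Lemma node_le i j : (i <= j)%N -> node N i <= node N j.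
Proof. by move=> ij; rewrite ler_wpM2r ?ler_nat// ltW// mesh_gt0. Qed.

Lemma node0 : node N 0 = 0. Proof. by rewrite /node mul0r. Qed.

Lemma nodeN : node N N = T.
Proof. by rewrite /node /mesh mulrC divfK// pnatr_eq0 -lt0n. Qed.

Lemma node_ge0 j : 0 <= node N j.
Proof. by rewrite -node0 node_le. Qed.

Lemma node_leT j : (j <= N)%N -> node N j <= T.
Proof. by move=> jN; rewrite -nodeN node_le. Qed.

Lemma nodeSB j : node N j.+1 - node N j = mesh N.
Proof. by rewrite /node -mulrBl -natrB// subSnn mul1r. Qed.

Lemma node_in j : (j <= N)%N -> node N j \in `[0, T].
Proof. by move=> jN; rewrite in_itv/= node_ge0 node_leT. Qed.

Lemma stepE a j s : (j < N)%N -> s \in `[node N j, node N j.+1[ -> step N a s = a j.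
Proof.
move=> jN; rewrite in_itv/= => /andP[js sj].
rewrite /step (bigD1 (Ordinal jN))//= big1 ?addr0.
  by rewrite indicE mem_set ?mulr1//= in_itv/= js.
move=> i ij; rewrite indicE memNset ?mulr0//= in_itv/= => /andP[si is'].
case: (ltngtP i j) => ji.
- by have := node_le ji; rewrite leNgt (le_lt_trans js is').
- by have := node_le ji; rewrite leNgt (le_lt_trans si sj).
- by move: ij; rewrite -val_eqE/= ji eqxx.
Qed.

Lemma sqi_step a : sqi mu D (step N a).
Proof.
apply: sqi_sum => // i _; apply: sqiZ => //; apply: sqi_le (sqi_cst _ 1 (mu_itv_lty _ _)) => //.
by move=> x _; rewrite ger0_norm// indicE; case: (_ \in _).
Qed.

Lemma ibl_step a : ibl mu D (step N a).
Proof. apply: sqi_ibl (sqi_step a) => //; exact: mu_itv_lty. Qed.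

Lemma Rint_step_mul a g : ibl mu D g ->
  \int[mu]_(s in D) (step N a s * g s) =
  \sum_(j < N) a j * \int[mu]_(s in `[node N j, node N j.+1]) g s.
Proof.
move=> Ig.
have sub (j : 'I_N) : `[node N j, node N j.+1[ `<=` D.
  move=> x; rewrite /= !in_itv/= => /andP[h1 /ltW h2].
  by rewrite (le_trans (node_ge0 _) h1) (le_trans h2)// node_leT.
have E (j : 'I_N) s : \1_(`[node N j, node N j.+1[) s * g s =
    (g \_ `[node N j, node N j.+1[) s.
  by rewrite indicE patchE; case: ifP => _; rewrite ?mul1r ?mul0r.
have Ij (j : 'I_N) : ibl mu D (fun s => \1_(`[node N j, node N j.+1[) s * g s).
  apply: ibl_le (ibl_norm Ig) => //.
    by apply: measurable_funM => //; exact: ibl_mfun Ig.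
  move=> x _; rewrite normrM ler_piMl// ger0_norm// indicE; case: (_ \in _) => //.
under eq_Rintegral.
  move=> s _; rewrite /step mulr_suml; under eq_bigr do rewrite -mulrA; over.
rewrite Rint_sum//; last by move=> j _; exact: iblZ.
apply: eq_bigr => j _; rewrite RintegralZl//; last exact: Ij.
congr (_ * _); under eq_Rintegral do rewrite E.
rewrite -Rintegral_mkcondr (setIidr (@sub j)) Rintegral_itv_bndo_bndc//.
by apply: integrableS Ig => //; exact: sub.
Qed.

Lemma Rint_step_piece a j t : (j < N)%N -> node N j <= t <= node N j.+1 ->
  \int[mu]_(s in `[node N j, t]) step N a s = a j * (t - node N j).
Proof.
move=> jN /andP[h1 h2].
have Is : ibl mu `[node N j, t] (step N a).
  apply: ibl_itv (ibl_step a); [exact: node_ge0|exact: le_trans h2 (node_leT _)].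
rewrite -Rintegral_itv_bndo_bndc; last first.
  by apply: integrableS Is => // x; rewrite /= !in_itv/= => /andP[-> /ltW].
rewrite (@eq_Rintegral _ _ _ mu _ (cst (a j))); last first.
  move=> s; rewrite inE/= in_itv/= => /andP[h3 h4]; apply: stepE => //.
  by rewrite in_itv/= h3 (lt_le_trans h4).
rewrite Rintegral_cst//; congr (_ * _); exact: fine_mu_itvco.
Qed.

Lemma Rint_step_sqr a :
  \int[mu]_(s in D) (step N a s ^+ 2) = \sum_(j < N) a j ^+ 2 * mesh N.
Proof.
under eq_Rintegral do rewrite expr2.
rewrite Rint_step_mul; last exact: ibl_step.
apply: eq_bigr => j _; rewrite Rint_step_piece// ?node_le ?leqnSn ?lexx//.
by rewrite nodeSB mulrA expr2.
Qed.

Lemma sqr_slope U : \int[mu]_(s in D) (slope U N s ^+ 2) = energy U N.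
Proof.
rewrite Rint_step_sqr; apply: eq_bigr => j _; field.
by rewrite gt_eqF// mesh_gt0.
Qed.

(** Pythagoras: [slope U N] is the orthogonal projection of [f] on the step functions of the
    mesh. *)
Lemma dist_slope f U : sqi mu D f ->
  (forall j, (j < N)%N ->
     \int[mu]_(s in `[node N j, node N j.+1]) f s = diff U N j) ->
  \int[mu]_(s in D) ((f s - slope U N s) ^+ 2) =
  \int[mu]_(s in D) (f s ^+ 2) - energy U N.
Proof.
move=> Sf fU; have Ss := sqi_step (fun j => diff U N j / mesh N).
have If := sqi_ibl_itv Sf.
have Isf : ibl mu D (fun s => slope U N s * f s) by apply: sqiM.
have E1 : \int[mu]_(s in D) (slope U N s * f s) = energy U N.
  rewrite Rint_step_mul//; apply: eq_bigr => j _; rewrite fU//; field.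
  by rewrite gt_eqF// mesh_gt0.
transitivity (\int[mu]_(s in D) (f s ^+ 2 - 2 * (slope U N s * f s) + slope U N s ^+ 2)).
  by apply: eq_Rintegral => s _; ring.
rewrite RintegralD//; [|by apply: iblB; [|exact: (proj2 Sf)|exact: iblZ]|exact: (proj2 Ss)].
rewrite RintegralB//; [|exact: (proj2 Sf)|exact: iblZ].
by rewrite RintegralZl// E1 sqr_slope; ring.
Qed.

Lemma slope_prim U i : (i <= N)%N ->
  \int[mu]_(s in `[0, node N i]) slope U N s = U (node N i) - U 0.
Proof.
elim: i => [_|i IHi iN]; first by rewrite node0 set_itv1 Rintegral_set1 subrr.
rewrite (@Rint_cat _ _ (node N i)) ?node_ge0 ?node_le//; last first.
  by apply: ibl_itv (ibl_step _) => //; exact: node_leT.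
rewrite IHi; last exact: ltnW.
rewrite Rint_step_piece// ?node_le ?leqnSn ?lexx// nodeSB divfK ?gt_eqF ?mesh_gt0//.
by rewrite /diff; ring.
Qed.

(** The primitive of the slope interpolates [U - U 0] exactly at the nodes; between two nodes both
    move by at most the square root of [c * mesh N]. *)
Lemma slope_prim_near U c t : 0 <= c ->
  (forall s t, s \in `[0, T] -> t \in `[0, T] -> (U t - U s) ^+ 2 <= c * `|t - s|) ->
  t \in `[0, T] ->
  `|\int[mu]_(s in `[0, t]) slope U N s - (U t - U 0)| <= 2 * Num.sqrt (c * mesh N).
Proof.
move=> c0 Umod tT; have := tT; rewrite in_itv/= => /andP[t0 tT'].
have h0 := mesh_gt0.
have [j jN /andP[jt tj]] : exists2 j, (j < N)%N & node N j <= t <= node N j.+1.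
  have [tN|tN] := eqVneq t T.
    exists N.-1; first by rewrite prednK.
    by rewrite prednK// nodeN tN lexx andbT node_leT// leq_pred.
  have q0 : 0 <= t / mesh N by rewrite divr_ge0// ltW.
  have /andP[h1 h2] := truncn_itv q0.
  exists (Num.trunc (t / mesh N)); last first.
    apply/andP; split; rewrite /node; first by rewrite -ler_pdivlMr.
    by rewrite -ler_pdivrMr// ltW.
  rewrite -(ltr_nat R); apply: le_lt_trans h1 _.
  rewrite ltr_pdivrMr// -[ltRHS]/(node N N) nodeN lt_neqAle tN//.
have dist s : node N j <= s <= node N j.+1 -> `|U s - U (node N j)| <= Num.sqrt (c * mesh N).
  move=> /andP[h1 h2]; rewrite -sqrtr_sqr ler_sqrt; last by rewrite mulr_ge0// ltW.
  have jT : node N j \in `[0, T] by exact/node_in/ltnW.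
  apply: le_trans (Umod (node N j) s jT _) _.
  - by rewrite in_itv/= (le_trans (node_ge0 _) h1) (le_trans h2)// node_leT.
  - by rewrite ler_wpM2l// ger0_norm ?subr_ge0// -(nodeSB j) lerD2r.
rewrite (@Rint_cat _ _ (node N j)) ?node_ge0//; last exact: ibl_itv (ibl_step _).
rewrite slope_prim ?(ltnW jN)// Rint_step_piece// ?jt//.
set v := _ / _ * _.
have -> : U (node N j) - U 0 + v - (U t - U 0) = v - (U t - U (node N j)) by ring.
apply: le_trans (ler_normB _ _) _; rewrite mulr_natl mulr2n lerD//; last by apply: dist; rewrite jt.
have := dist (node N j.+1); rewrite lexx andbT node_le ?leqnSn// => /(_ isT).
apply: le_trans; rewrite /v -mulrA normrM ler_piMr// ger0_norm.
  by rewrite mulrC ler_pdivrMr// mul1r -(nodeSB j) lerD2r.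
by rewrite mulr_ge0 ?invr_ge0 ?subr_ge0// ltW.
Qed.

End FixedMesh.

Lemma node_refine N K j : (0 < N)%N -> (0 < K)%N -> node N j = node (N * K) (j * K).
Proof.
move=> N0 K0; rewrite /node /mesh !natrM; field.
by rewrite !pnatr_eq0 -!lt0n N0 K0.
Qed.

Lemma slope_refine U N K j : (0 < N)%N -> (0 < K)%N -> (j < N)%N ->
  \int[mu]_(s in `[node N j, node N j.+1]) slope U (N * K) s = diff U N j.
Proof.
move=> N0 K0 jN; have NK0 : (0 < N * K)%N by rewrite muln_gt0 N0.
have := @Rint_cat _ 0 (node N j) (node N j.+1) (slope U (N * K)).
rewrite node_ge0// node_le// => /(_ isT isT) H.
have {}H := H (ibl_itv (lexx 0) (node_leT N0 jN) (ibl_step _ _)).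
move/eqP: H; rewrite addrC -subr_eq eq_sym => /eqP ->.
rewrite !(node_refine _ N0 K0) !slope_prim ?leq_mul2r ?jN ?(ltnW jN) ?orbT//.
by rewrite /diff -!node_refine//; ring.
Qed.

(** The coarse slope is the projection of the fine one, so [dist_slope] applies with the fine slope
    in the place of [f]. *)
Lemma energy_refine U N K : (0 < N)%N -> (0 < K)%N ->
  \int[mu]_(s in D) ((slope U (N * K) s - slope U N s) ^+ 2) =
  energy U (N * K) - energy U N.
Proof.
move=> N0 K0; have NK0 : (0 < N * K)%N by rewrite muln_gt0 N0.
rewrite (dist_slope N0) ?sqr_slope//; first exact: sqi_step.
by move=> j jN; exact: slope_refine.
Qed.

Lemma energy_le_refine U N K : (0 < N)%N -> (0 < K)%N -> energy U N <= energy U (N * K).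
Proof.
move=> N0 K0; rewrite -subr_ge0 -energy_refine//.
by apply: Rintegral_ge0 => x _; exact: sqr_ge0.
Qed.

Lemma energy_le_sqr f U N : (0 < N)%N -> sqi mu D f ->
  (forall t, t \in `[0, T] -> \int[mu]_(s in `[0, t]) f s = U t - U 0) ->
  (forall j, (j < N)%N ->
     \int[mu]_(s in `[node N j, node N j.+1]) f s = diff U N j) /\
  energy U N <= \int[mu]_(s in D) (f s ^+ 2).
Proof.
move=> N0 Sf fU; have If := sqi_ibl_itv Sf.
have H j : (j < N)%N ->
     \int[mu]_(s in `[node N j, node N j.+1]) f s = diff U N j.
  move=> jN; have := @Rint_cat _ 0 (node N j) (node N j.+1) f.
  rewrite node_ge0// node_le// => /(_ isT isT (ibl_itv (lexx 0) (node_leT N0 jN) If)).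
  rewrite !fU ?node_in ?(ltnW jN)// /diff => h.
  by apply: (addrI (U (node N j) - U 0)); rewrite -h; ring.
split=> //; rewrite -subr_ge0 -dist_slope//.
by apply: Rintegral_ge0 => x _; exact: sqr_ge0.
Qed.

End StepFunctions.

(** * Bounded energies characterize primitives of square-integrable functions *)

Section EnergyPrimitive.
Context {R : realType}.
Local Notation mu := (@lebesgue_measure R).
Implicit Types f g U : R -> R.
Variable T : R.
Hypothesis T0 : 0 < T.
Local Notation D := (`[0, T]%classic).

Let pow2_gt0 n : (0 < 2 ^ n)%N. Proof. by rewrite expn_gt0. Qed.

(** On nested meshes L^2 distances of slopes are differences of energies, so a bound on the monotone
    energies makes the slopes Cauchy. *)
Lemma energy_pow2_dist U m n :
  \int[mu]_(s in D) ((slope T U (2 ^ m) s - slope T U (2 ^ n) s) ^+ 2) =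
  `|energy T U (2 ^ m) - energy T U (2 ^ n)|.
Proof.
wlog nm : m n / (n <= m)%N => [W|].
  have /orP[/W//|/W H] := leq_total n m.
  rewrite distrC -H; apply: eq_Rintegral => s _; ring.
rewrite -(subnKC nm) expnD energy_refine// ger0_norm// subr_ge0.
exact: energy_le_refine.
Qed.

Lemma energy_pow2_nd U : nondecreasing_seq (fun n => energy T U (2 ^ n)).
Proof.
by move=> n m nm; rewrite -(subnKC nm) expnD energy_le_refine.
Qed.

Lemma fast_subsequence U c : (forall n, energy T U (2 ^ n) <= c) ->
  exists phi : nat -> nat, forall k, (k <= phi k)%N /\
    forall j, `|energy T U (2 ^ phi j) - energy T U (2 ^ phi k)| <=
              (2^-1) ^+ k + (2^-1) ^+ j.
Proof.
move=> bd; pose q n := energy T U (2 ^ n); pose l := sup (range q).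
have ub : has_ubound (range q) by exists c => _ [n _ <-]; exact: bd.
have ql n : q n <= l by apply: ub_le_sup => //; exists n.
have H k : exists n, (k <= n)%N /\ l - (2^-1) ^+ k < q n.
  have e0 : 0 < (2^-1 : R) ^+ k by rewrite exprn_gt0// invr_gt0.
  have [_ [n _ <-] hn] := @sup_adherent _ (range q) _ e0 (conj (ex_intro _ (q 0%N) (ex_intro2 _ _ 0%N I erefl)) ub).
  exists (maxn k n); rewrite leq_maxl; split=> //; apply: lt_le_trans hn _.
  by apply: (@energy_pow2_nd U n (maxn k n)); exact: leq_maxr.
have [phi phiP] := choice H; exists phi => k; split; first by case: (phiP k).
move=> j; have [_ h1] := phiP k; have [_ h2] := phiP j.
have := ql (phi k); have := ql (phi j); rewrite /q in h1 h2 *.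
have : 0 <= (2^-1 : R) ^+ k by rewrite exprn_ge0// invr_ge0.
have : 0 <= (2^-1 : R) ^+ j by rewrite exprn_ge0// invr_ge0.
by rewrite ler_norml; lra.
Qed.

(** Along a fast subsequence the increments of the slopes are summable in L^1, so the slopes
    converge almost everywhere under an integrable bound. Fatou's lemma gives the bound [c], and
    dominated convergence identifies the primitive through [slope_prim_near]. *)
Theorem energy_prim U (c K : R) : 0 <= c -> 0 <= K ->
  (forall s t, s \in `[0, T] -> t \in `[0, T] -> (U t - U s) ^+ 2 <= K * `|t - s|) ->
  (forall n, energy T U (2 ^ n) <= c) ->
  exists w, [/\ sqi mu D w, \int[mu]_(s in D) (w s ^+ 2) <= c &
    forall t, t \in `[0, T] -> \int[mu]_(s in `[0, t]) w s = U t - U 0].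
Proof.
move=> c0 K0 Umod bd.
have [phi phiP] := fast_subsequence bd.
(* Energies control squared distances, so doubling the index makes the distances themselves decay
   like [2^-k]. *)
pose psi k := phi (k.*2); pose w_ k := slope T U (2 ^ psi k).
have Sw k : sqi mu D (w_ k) by exact: sqi_step.
have mw k : measurable_fun D (w_ k) by case: (Sw k).
pose dw k s := `|w_ k.+1 s - w_ k s|.
have Sdw k : sqi mu D (dw k) by apply: sqi_norm => //; exact: sqiB.
have Idw k : ibl mu D (dw k) by exact: sqi_ibl_itv.
have dw_le k : \int[mu]_(s in D) dw k s <= Num.sqrt (T * 2) * (2^-1) ^+ k.
  have h0 : 0 <= (2^-1 : R) ^+ k by rewrite exprn_ge0// invr_ge0.
  rewrite -[X in _ * X]ger0_norm// -sqrtr_sqr -sqrtrM ?mulr_ge0 ?(ltW T0)//.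
  rewrite -[leLHS]ger0_norm; last by apply: Rintegral_ge0 => s _; exact: normr_ge0.
  rewrite -sqrtr_sqr ler_sqrt; last by rewrite mulr_ge0 ?sqr_ge0// mulr_ge0// ltW.
  apply: le_trans (sqr_Rint_itv (ltW T0) (Sdw k)) _; rewrite subr0 -mulrA ler_wpM2l ?(ltW T0)//.
  have -> : \int[mu]_(s in D) (dw k s ^+ 2) =
      \int[mu]_(s in D) ((w_ k.+1 s - w_ k s) ^+ 2).
    by apply: eq_Rintegral => s _; rewrite /dw real_normK// num_real.
  rewrite energy_pow2_dist; have [_ /(_ (k.+1).*2)] := phiP (k.*2).
  move=> /le_trans; apply.
  have E : (2^-1 : R) ^+ k.*2 = (2^-1) ^+ k ^+ 2 by rewrite -muln2 exprM.
  have -> : (2^-1 : R) ^+ (k.+1).*2 = 4^-1 * (2^-1) ^+ k ^+ 2.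
    by rewrite doubleS -E !exprS; field.
  by rewrite E; have := sqr_ge0 ((2^-1 : R) ^+ k); lra.
pose S s := (\sum_(k <oo) (dw k s)%:E)%E.
have mdw k : measurable_fun D (fun s => (dw k s)%:E).
  by apply/measurable_EFinP; exact: ibl_mfun (Idw k).
have dw0 k s : (0 <= (dw k s)%:E)%E by rewrite lee_fin normr_ge0.
have S0 s : (0 <= S s)%E by apply: nneseries_ge0 => *; exact: dw0.
have mS : measurable_fun D S.
  by apply: ge0_emeasurable_sum.
have IS : (\int[mu]_(s in D) S s < +oo)%E.
  rewrite integral_nneseries//.
  apply: (@le_lt_trans _ _ (Num.sqrt (T * 2) * 2)%:E); last by rewrite ltry.
  apply: lime_le.
    by apply: is_cvg_nneseries => n _ _; apply: integral_ge0 => s _; exact: dw0.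
  apply: nearW => n; rewrite big_mkord.
  rewrite (eq_bigr (fun k : 'I_n => (\int[mu]_(s in D) dw k s)%:E)); last first.
    by move=> k _; rewrite integralE_fin.
  rewrite sumEFin lee_fin.
  apply: (@le_trans _ _ (\sum_(k < n) Num.sqrt (T * 2) * (2^-1) ^+ k)).
    by apply: ler_sum => k _; exact: dw_le.
  rewrite -mulr_sumr ler_wpM2l ?sqrtr_ge0//.
  have -> : \sum_(k < n) (2^-1 : R) ^+ k = 2 * (1 - (2^-1) ^+ n).
    elim: n => [|n IHn]; first by rewrite big_ord0 expr0 subrr mulr0.
    by rewrite big_ord_recr/= IHn exprS; field.
  have : 0 <= (2^-1 : R) ^+ n by rewrite exprn_ge0// invr_ge0.
  lra.
have IS' : mu.-integrable D S.
  apply/integrableP; split=> //; under eq_integral do rewrite gee0_abs//.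
  exact: IS.
have fS : {ae mu, forall s, D s -> S s \is a fin_num}.
  by apply: integrable_ae IS'.
have part s n : D s -> S s \is a fin_num -> \sum_(k < n) dw k s <= fine (S s).
  move=> Ds Ss; rewrite -lee_fin fineK// -sumEFin -(big_mkord xpredT (fun k => (dw k s)%:E)).
  by apply: nneseries_lim_ge => k _ _; exact: dw0.
have cvw s : D s -> S s \is a fin_num -> cvgn (fun k => w_ k s).
  move=> Ds Ss; pose u := telescope (fun k => w_ k s).
  have ns : cvgn (series (fun k => `|u k|)).
    apply: nondecreasing_is_cvgn.
      apply/nondecreasing_seqP => n; rewrite !seriesEord/= big_ord_recr/=.
      by rewrite lerDl normr_ge0.
    by exists (fine (S s)) => _ [n _ <-]; rewrite seriesEord/=; exact: part.
  have : cvgn (series u) by exact: normed_cvg ns.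
  rewrite telescopeK => cu.
  have -> : (fun k => w_ k s) = (fun k => w_ k s - w_ 0%N s) + cst (w_ 0%N s).
    by apply/funext => n; rewrite /GRing.add/= subrK.
  by apply: is_cvgD => //; exact: is_cvg_cst.
(* The limit superior is measurable on all of [D] and equals the limit almost everywhere. *)
pose w s := fine (limn_esup (fun k => (w_ k s)%:E)).
have wcv s : D s -> S s \is a fin_num -> w_ k s @[k --> \oo] --> w s.
  move=> Ds Ss; have cv := cvw s Ds Ss.
  have ecv : (w_ k s)%:E @[k --> \oo] --> (limn (fun k => w_ k s))%:E.
    by apply: cvg_EFin => //; exact: nearW.
  have [_ E] := cvg_limn_einf_sup ecv.
  by rewrite /w E.
have mwlim : measurable_fun D w.
  apply: measurableT_comp => //; apply: measurable_fun_limn_esup => k.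
  exact/measurable_EFinP.
have wbd s k : D s -> S s \is a fin_num -> `|w_ k s| <= `|w_ 0%N s| + fine (S s).
  move=> Ds Ss; have := part s k Ds Ss.
  have : `|w_ k s - w_ 0%N s| <= \sum_(j < k) dw j s.
    elim: k => [|k IHk]; first by rewrite subrr normr0 big_ord0.
    rewrite big_ord_recr/=; apply: le_trans (ler_distD (w_ k s) _ _) _.
    by rewrite addrC lerD.
  have := ler_normD (w_ k s - w_ 0%N s) (w_ 0%N s); rewrite subrK; lra.
have Ibd : ibl mu D (fun s => `|w_ 0%N s| + fine (S s)).
  apply: iblD => //; first by apply: ibl_norm; exact: sqi_ibl_itv.
  apply: le_integrable IS' => //.
    by apply/measurable_EFinP; exact: measurableT_comp.
  move=> s _ /=; rewrite ger0_norm ?fine_ge0// gee0_abs//.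
  by case: (S s) (S0 s) => [x| |] //= _; rewrite leey.
have [Iw _] : ibl mu D w /\ \int[mu]_(x in D) w_ k x @[k --> \oo] --> \int[mu]_(x in D) w x.
  apply: Rdct Ibd _ => //.
    by apply: ae_imp fS => s H Ds; exact/wcv/H.
  by apply: ae_imp fS => s H k Ds; exact/wbd/H.
have Ew2 : (\int[mu]_(s in D) (w s ^+ 2)%:E <= c%:E)%E.
  pose F k s := (w_ k s ^+ 2)%:E.
  have mF k : measurable_fun D (F k) by apply/measurable_EFinP; exact: measurable_funX.
  have F0 k s : D s -> (0 <= F k s)%E by rewrite lee_fin sqr_ge0.
  have : (\int[mu]_(x in D) limn_einf (F^~ x) <= limn_einf (fun n => \int[mu]_(x in D) F n x))%E.
    by apply: fatou.
  rewrite (_ : (\int[mu]_(x in D) _)%E = (\int[mu]_(s in D) (w s ^+ 2)%:E)%E); last first.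
    apply: ae_eq_integral => //.
    - rewrite (_ : (fun x => limn_einf (F^~ x)) = (fun x => - limn_esup (fun k => - F k x)%E)%E).
        apply: measurableT_comp => //; apply: measurable_fun_limn_esup => k.
        by apply: (measurableT_comp (f := -%E)) => //; exact: mF.
      apply/funext => x; rewrite -limn_einfN; congr limn_einf.
      by apply/funext => k; rewrite /F/= opprK.
    - by apply/measurable_EFinP; exact: measurable_funX.
    apply: ae_imp fS => s H Ds; have cv := wcv s Ds (H Ds).
    have ecv : F k s @[k --> \oo] --> (w s ^+ 2)%:E.
      apply: cvg_EFin; first exact: nearW.
      have -> : fine \o F ^~ s = (fun k => w_ k s * w_ k s).
        by apply/funext => k; rewrite /= expr2.
      by rewrite expr2; exact: (cvgM cv cv).
    by have [-> _] := cvg_limn_einf_sup ecv.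
  move=> /le_trans; apply; rewrite limn_einf_lim; apply: lime_le.
    exact: is_cvg_einfs.
  apply: nearW => n; apply: ereal_inf_le; exists (\int[mu]_(x in D) F n x)%E.
    by exists n => //=.
  have -> : (\int[mu]_(x in D) F n x)%E = (\int[mu]_(x in D) (w_ n x ^+ 2))%:E.
    by rewrite integralE_fin//; case: (Sw n).
  by rewrite sqr_slope// lee_fin.
have Sqw : sqi mu D w.
  split=> //; apply: ge0_ibl => //.
  - exact: measurable_funX.
  - by move=> x _; exact: sqr_ge0.
  - by apply: le_lt_trans Ew2 _; rewrite ltry.
exists w; split=> //; first by rewrite -lee_fin -integralE_fin//; case: Sqw.
move=> t tT; have := tT; rewrite in_itv/= => /andP[t0 tT'].
have sub : `[0, t] `<=` D by exact: sub_itvcc.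
have [_ cv] : ibl mu `[0, t] w /\
    \int[mu]_(x in `[0, t]) w_ k x @[k --> \oo] --> \int[mu]_(x in `[0, t]) w x.
  apply: Rdct (ibl_itv _ _ Ibd) _ => //.
  - by move=> n; apply: measurable_funS (mw n).
  - exact: measurable_funS mwlim.
  - by apply: ae_imp fS => s H /sub Ds; exact/wcv/H.
  - by apply: ae_imp fS => s H k /sub Ds; exact/wbd/H.
apply: (cvg_unique _ cv) => //.
apply/cvgrPdist_le => e e0.
(* Once the number of pieces exceeds [q], the error [2 * sqrt (K * mesh)] is at most [e]. *)
pose q := K * T * 4 / e ^+ 2.
have q0 : 0 <= q by rewrite divr_ge0 ?sqr_ge0// mulr_ge0// mulr_ge0// ltW.
near=> k.
rewrite distrC; apply: le_trans (slope_prim_near T0 (pow2_gt0 _) K0 Umod tT) _.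
have N0 : 0 < (2 ^ psi k)%:R :> R by rewrite ltr0n.
have qk : q <= (2 ^ psi k)%:R.
  have kpsi : (k <= 2 ^ psi k)%N.
    apply: (leq_trans _ (ltnW (ltn_expl _ (ltnSn 1)))).
    have [h _] := phiP k.*2; apply: leq_trans h; rewrite -addnn; exact: leq_addr.
  apply: (@le_trans _ _ k%:R); last by rewrite ler_nat.
  near: k; exact: nbhs_infty_ger.
have e2 : 0 <= e / 2 by rewrite divr_ge0// ltW.
rewrite mulrC -ler_pdivlMr// -[leRHS]ger0_norm// -sqrtr_sqr ler_sqrt ?sqr_ge0//.
have {}qk : K * T * 4 <= (2 ^ psi k)%:R * e ^+ 2.
  by rewrite -ler_pdivrMr// exprn_gt0.
rewrite (_ : K * mesh T _ = K * T / (2 ^ psi k)%:R); last by rewrite /mesh mulrA.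
rewrite ler_pdivrMr//.
have -> : (e / 2) ^+ 2 * (2 ^ psi k)%:R = (2 ^ psi k)%:R * e ^+ 2 / 4 :> R by field.
by rewrite ler_pdivlMr.
Unshelve. all: by end_near. Qed.

Lemma prim_mod f : sqi mu D f -> forall s t, s \in `[0, T] -> t \in `[0, T] ->
  (\int[mu]_(x in `[0, t]) f x - \int[mu]_(x in `[0, s]) f x) ^+ 2 <=
  `|t - s| * \int[mu]_(x in D) (f x ^+ 2).
Proof.
move=> Sf s t; wlog st : s t / s <= t => [W sT tT|].
  have /orP[/W|/W] := le_total s t; first exact.
  by move=> /(_ tT sT); rewrite distrC -[X in _ -> X <= _]sqrrN opprB.
rewrite !in_itv/= => /andP[s0 sT] /andP[t0 tT].
have If := sqi_ibl_itv Sf.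
rewrite (@Rint_cat _ 0 s t)//; last exact: ibl_itv If.
rewrite addrC addKr ger0_norm ?subr_ge0//.
apply: le_trans (sqr_Rint_itv st (sqi_itv s0 tT Sf)) _.
rewrite ler_wpM2l ?subr_ge0//; apply: Rint_le_itv => //; first by case: Sf.
by move=> x _; exact: sqr_ge0.
Qed.

Lemma sqi_uniq f g : ibl mu D f -> ibl mu D g ->
  (forall t, t \in `[0, T] -> \int[mu]_(s in `[0, t]) f s = \int[mu]_(s in `[0, t]) g s) ->
  {ae mu, forall t, D t -> f t = g t}.
Proof.
move=> If Ig fg; have H : {ae mu, forall t, D t -> f t - g t = 0}.
  apply: ibl_prim_eq0 => //; first exact: iblB.
  move=> t tT; have := tT; rewrite in_itv/= => /andP[t0 tT'].
  rewrite RintegralB//; [by rewrite fg// subrr|exact: ibl_itv If|exact: ibl_itv Ig].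
by apply: ae_imp H => t h Dt; apply/eqP; rewrite -subr_eq0 h.
Qed.

(* The averages of [f] over dyadic intervals form a martingale converging to
   [f] in L^2. *)
Theorem energy_sup f U e : sqi mu D f -> 0 < e ->
  (forall t, t \in `[0, T] -> \int[mu]_(s in `[0, t]) f s = U t - U 0) ->
  exists n, \int[mu]_(s in D) (f s ^+ 2) - e < energy T U (2 ^ n).
Proof.
move=> Sf e0 fU; apply/not_existsP => H.
have If2 : ibl mu D (fun s => f s ^+ 2) by case: Sf.
have i0 : 0 <= \int[mu]_(s in D) (f s ^+ 2) by apply: Rintegral_ge0 => s _; exact: sqr_ge0.
have bd n : energy T U (2 ^ n) <= \int[mu]_(s in D) (f s ^+ 2) - e.
  by rewrite leNgt; apply/negP/H.
have c0 : 0 <= \int[mu]_(s in D) (f s ^+ 2) - e.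
  apply: le_trans (bd 0%N); apply: sumr_ge0 => j _.
  by rewrite divr_ge0 ?sqr_ge0// ltW// mesh_gt0.
(* If all energies stayed below the integral by [e], this [w] would have the primitive of [f], hence
   equal [f] almost everywhere, and yet a strictly smaller norm. *)
have [|w [Sw wc wU]] := energy_prim c0 i0 _ bd.
  move=> s t sT tT; have := prim_mod Sf sT tT; rewrite !fU// mulrC.
  by have -> : U t - U 0 - (U s - U 0) = U t - U s by ring.
have fw : {ae mu, forall t, D t -> f t = w t}.
  apply: sqi_uniq; [exact: sqi_ibl_itv|exact: sqi_ibl_itv|].
  by move=> t tT; rewrite fU// wU.
have : \int[mu]_(s in D) (f s ^+ 2) = \int[mu]_(s in D) (w s ^+ 2).
  congr fine; apply: ae_eq_integral => //.
  - by apply/measurable_EFinP; exact: ibl_mfun If2.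
  - by apply/measurable_EFinP; case: Sw => _ /ibl_mfun.
  by apply: ae_imp fw => s h Ds; rewrite h.
by move: wc; lra.
Qed.

End EnergyPrimitive.

(** * Linear equations *)

Lemma coordB {R : realType} n (x y : 'cV[R]_n) i : (x - y) i 0 = x i 0 - y i 0.
Proof. by rewrite !mxE. Qed.

Lemma coordD {R : realType} n (x y : 'cV[R]_n) i : (x + y) i 0 = x i 0 + y i 0.
Proof. by rewrite !mxE. Qed.

Section VectorIntegral.
Context {R : realType} {n : nat}.
Local Notation mu := (@lebesgue_measure R).
Local Notation V := 'cV[R]_n.
Implicit Types (f g : R -> V) (E : set (measurableTypeR R)).

Definition vibl E f : Prop := forall i, ibl mu E (fun s => f s i 0).
Definition vint E f : V := \col_i \int[mu]_(s in E) f s i 0.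

Lemma vibl_mfun E f : measurable E -> vibl E f -> measurable_fun E f.
Proof.
by move=> mE If; apply/(measurable_fun_cVP _ mE) => i; exact: ibl_mfun (If i).
Qed.

Lemma viblD E f g : measurable E -> vibl E f -> vibl E g -> vibl E (fun s => f s + g s).
Proof.
by move=> mE If Ig i; apply: (eq_ibl mE _ (iblD mE (If i) (Ig i))) => s _; rewrite mxE.
Qed.

Lemma viblN E f : measurable E -> vibl E f -> vibl E (fun s => - f s).
Proof.
by move=> mE If i; apply: (eq_ibl mE _ (iblN (If i))) => s _; rewrite mxE.
Qed.

Lemma viblB E f g : measurable E -> vibl E f -> vibl E g -> vibl E (fun s => f s - g s).
Proof. by move=> mE If /(viblN mE); exact: viblD. Qed.

Lemma vintD E f g : measurable E -> vibl E f -> vibl E g ->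
  vint E (fun s => f s + g s) = vint E f + vint E g.
Proof.
move=> mE If Ig; apply/colP => i; rewrite !mxE -RintegralD//; [|exact: If|exact: Ig].
by apply: eq_Rintegral => s _; rewrite mxE.
Qed.

Lemma vintB E f g : measurable E -> vibl E f -> vibl E g ->
  vint E (fun s => f s - g s) = vint E f - vint E g.
Proof.
move=> mE If Ig; apply/colP => i; rewrite !mxE -RintegralB//; [|exact: If|exact: Ig].
by apply: eq_Rintegral => s _; rewrite !mxE.
Qed.

Lemma eq_vint E f g : (forall s, E s -> f s = g s) -> vint E f = vint E g.
Proof.
by move=> fg; apply/colP => i; rewrite !mxE; apply: eq_Rintegral => s; rewrite inE => /fg ->.
Qed.

Lemma eq_vibl E f g : measurable E -> (forall s, E s -> f s = g s) -> vibl E f -> vibl E g.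
Proof. by move=> mE fg If i; apply: (eq_ibl mE _ (If i)) => s /fg ->. Qed.

Lemma vibl_enorm E f : measurable E -> vibl E f -> ibl mu E (fun s => enorm (f s)).
Proof.
move=> mE If; apply: (@ibl_le _ _ _ _ _ mE _ (fun s => \sum_i `|f s i 0|)).
- by apply: (measurableT_comp (@measurable_enorm R n)); exact: vibl_mfun.
- by move=> s _; rewrite ger0_norm ?enorm_ge0// enorm_le_sum.
- by apply: ibl_sum => // i _; apply: ibl_norm; exact: If.
Qed.

Lemma vibl_le E f (g : R -> R) : measurable E -> measurable_fun E f ->
  (forall s, E s -> enorm (f s) <= g s) -> ibl mu E g -> vibl E f.
Proof.
move=> mE mf fg Ig i; apply: (@ibl_le _ _ _ _ _ mE _ g) => //.
  by have /measurable_fun_cVP := mf; apply.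
by move=> s Es; apply: le_trans (coord_enorm _ _) (fg s Es).
Qed.

Lemma edot_vint E f x : measurable E -> vibl E f ->
  edot x (vint E f) = \int[mu]_(s in E) edot x (f s).
Proof.
move=> mE If; rewrite /edot Rint_sum//; last by move=> i _; apply: iblZ => //; exact: If.
by apply: eq_bigr => i _; rewrite mxE RintegralZl//; exact: If.
Qed.

Lemma ibl_edot E f x : measurable E -> vibl E f -> ibl mu E (fun s => edot x (f s)).
Proof. by move=> mE If; apply: ibl_sum => // i _; apply: iblZ => //; exact: If. Qed.

(** Pairing the integral with itself and applying Cauchy-Schwarz under the integral sign gives the
    bound multiplied by [enorm (vint E f)], which is then cancelled. *)
Lemma enorm_vint E f : measurable E -> vibl E f ->
  enorm (vint E f) <= \int[mu]_(s in E) enorm (f s).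
Proof.
move=> mE If; have [->|v0] := eqVneq (enorm (vint E f)) 0.
  by apply: Rintegral_ge0 => s _; exact: enorm_ge0.
have v1 : 0 < enorm (vint E f) by rewrite lt_neqAle eq_sym v0 enorm_ge0.
rewrite -(ler_pM2l v1) -expr2 sqr_enorm edot_vint// -RintegralZl//; last exact: vibl_enorm.
apply: Rint_le => //; first exact: ibl_edot.
  by apply: iblZ => //; exact: vibl_enorm.
by move=> s _; exact: edot_le.
Qed.

Lemma vibl_sub E F f : measurable E -> measurable F -> E `<=` F -> vibl F f -> vibl E f.
Proof. by move=> mE mF EF If i; apply: integrableS (If i). Qed.

End VectorIntegral.

Section LinearMap.
Context {R : realType} {m n : nat}.
Local Notation mu := (@lebesgue_measure R).
Variable A : 'M[R]_(m, n).
Implicit Types (f : R -> 'cV[R]_n) (E : set (measurableTypeR R)).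

Lemma vibl_mulmx E f : measurable E -> vibl E f -> vibl E (fun s => A *m f s).
Proof.
move=> mE If i; apply: (@eq_ibl _ _ _ _ _ mE (fun s => \sum_j A i j * f s j 0)).
  by move=> s _; rewrite mxE.
by apply: ibl_sum => // j _; apply: iblZ => //; exact: If.
Qed.

Lemma vint_mulmx E f : measurable E -> vibl E f ->
  vint E (fun s => A *m f s) = A *m vint E f.
Proof.
move=> mE If; apply/colP => i; rewrite !mxE.
under eq_Rintegral do rewrite mxE.
rewrite Rint_sum//; last by move=> j _; apply: iblZ => //; exact: If.
by apply: eq_bigr => j _; rewrite mxE RintegralZl//; exact: If.
Qed.

End LinearMap.

Section ContinuousOnInterval.
Context {R : realType}.
Local Notation mu := (@lebesgue_measure R).
Variable T : R.
Hypothesis T0 : 0 < T.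
Local Notation D := (`[0, T]%classic).

Lemma within_ibl (f : R -> R) : {within D, continuous f} -> ibl mu D f.
Proof. by move=> cf; apply: continuous_compact_integrable => //; exact: segment_compact. Qed.

Lemma within_bounded (f : R -> R) : {within D, continuous f} ->
  exists2 M, 0 <= M & forall t, D t -> `|f t| <= M.
Proof.
move=> cf; have /compact_bounded[M [_ HM]] := continuous_compact cf (@segment_compact R 0 T).
exists (`|M| + 1) => [|t Dt]; first by rewrite addr_ge0.
by apply: HM; [rewrite ltr_pwDr// ler_norm|exists t].
Qed.

Lemma within_prim (f : R -> R) : ibl mu D f ->
  {within D, continuous (fun t => \int[mu]_(s in `[0, t]) f s)}.
Proof. by apply: parameterized_integral_continuous; exact: ltW. Qed.

Lemma within_prim_back (f : R -> R) : ibl mu D f ->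
  {within D, continuous (fun t => \int[mu]_(s in `[t, T]) f s)}.
Proof.
move=> If.
have c1 : {within D, continuous (cst (\int[mu]_(s in D) f s) \- (fun t => \int[mu]_(s in `[0, t]) f s))}.
  apply: within_continuousB; last exact: within_prim.
  by apply: continuous_subspaceT => t; exact: cvg_cst.
apply: (subspace_eq_continuous _ c1) => t; rewrite inE/= in_itv/= => /andP[t0 tT].
by rewrite /from_subspace/= (@Rint_cat _ 0 t T)// addrC addKr.
Qed.

End ContinuousOnInterval.

(** The sequences [a n - 2 K 2^-n] and [a n + 2 K 2^-n] are monotone and enclose a common point,
    which yields the limit together with its rate. *)
Lemma halving_limit {R : realType} (a : nat -> R) (K : R) : 0 <= K ->
  (forall n, `|a n.+1 - a n| <= K * 2^-1 ^+ n) ->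
  exists l, forall n, `|l - a n| <= 2 * K * 2^-1 ^+ n.
Proof.
move=> K0 Ha; pose b n := a n - 2 * K * 2^-1 ^+ n; pose c n := a n + 2 * K * 2^-1 ^+ n.
have p0 n : 0 <= (2^-1 : R) ^+ n by rewrite exprn_ge0// invr_ge0.
have bS n : b n <= b n.+1.
  have := Ha n; rewrite ler_norml => /andP[h _]; rewrite -subr_ge0.
  have -> : b n.+1 - b n = a n.+1 - a n + K * 2^-1 ^+ n by rewrite /b exprS; field.
  by rewrite -lerBlDr sub0r.
have cS n : c n.+1 <= c n.
  have := Ha n; rewrite ler_norml => /andP[_ h]; rewrite -subr_ge0.
  have -> : c n - c n.+1 = K * 2^-1 ^+ n - (a n.+1 - a n) by rewrite /c exprS; field.
  by rewrite subr_ge0.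
have bnd : nondecreasing_seq b by exact/nondecreasing_seqP.
have cni : nonincreasing_seq c by exact/nonincreasing_seqP.
have bc n m : b n <= c m.
  apply: le_trans (bnd _ _ (leq_maxl n m)) (le_trans _ (cni _ _ (leq_maxr n m))).
  have h := mulr_ge0 (mulr_ge0 (ler0n R 2) K0) (p0 (maxn n m)).
  by rewrite /b /c lerBlDr -addrA lerDl addr_ge0.
have ub : has_ubound (range b) by exists (c 0%N) => _ [n _ <-]; exact: bc.
exists (sup (range b)) => n; rewrite ler_distl; apply/andP; split.
  by apply: ub_le_sup => //; exists n.
by apply: ge_sup; [exists (b 0%N), 0%N|move=> _ [m _ <-]; exact: bc].
Qed.

(** * Linear integral equations by a weighted contraction *)

Section Picard.
Context {R : realType} {n : nat}.
Local Notation mu := (@lebesgue_measure R).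
Local Notation V := 'cV[R]_n.
Variables (T : R) (A : 'M[R]_n) (I : R -> set (measurableTypeR R)) (W : R -> R).
Local Notation D := (`[0, T]%classic).
Hypothesis mI : forall t, D t -> measurable (I t).
Hypothesis ID : forall t, D t -> I t `<=` D.
Hypothesis IP : forall f : R -> R, ibl mu D f ->
  {within D, continuous (fun t => \int[mu]_(s in I t) f s)}.
Hypothesis W1 : forall t, D t -> 1 <= W t.
Hypothesis IW : ibl mu D W.
Hypothesis WM : exists M, forall t, D t -> W t <= M.
Hypothesis WI : forall t, D t -> mx_sum A * \int[mu]_(s in I t) W s <= W t / 2.

Let viblI (f : R -> V) t : D t -> vibl D f -> vibl (I t) f.
Proof. by move=> Dt; apply: vibl_sub => //; [exact: mI|exact: ID]. Qed.

(** The integral operator contracts by one half in the norm [sup |f| / W]; this is what the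
    hypothesis [WI] on the weight encodes. *)
Lemma weighted_step (f : R -> V) C t : 0 <= C -> D t -> vibl D f ->
  (forall s, D s -> enorm (f s) <= C * W s) ->
  enorm (vint (I t) (fun s => A *m f s)) <= C / 2 * W t.
Proof.
move=> C0 Dt If fC; have mIt := mI Dt; have IDt := ID Dt.
have IfI := viblI Dt If.
apply: le_trans (enorm_vint mIt (vibl_mulmx A mIt IfI)) _.
have IWI : ibl mu (I t) W by apply: integrableS IW.
apply: (@le_trans _ _ (\int[mu]_(s in I t) ((mx_sum A * C) * W s))).
  apply: Rint_le => //; first by apply: vibl_enorm => //; exact: vibl_mulmx.
    exact: iblZ.
  move=> s Is; apply: le_trans (enorm_mulmx _ _) _.
  by rewrite -mulrA ler_wpM2l ?mx_sum_ge0// fC//; exact: IDt.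
rewrite RintegralZl//; set J := \int[mu]_(s in _) _.
have -> : mx_sum A * C * J = C * (mx_sum A * J) by ring.
have -> : C / 2 * W t = C * (W t / 2) by ring.
by rewrite ler_wpM2l//; exact: WI.
Qed.

(** The weight makes the Picard iteration converge on the whole interval at once, in the manner of
    Bielecki. The abstract domain [I t] covers both the forward equation on [[0, t]] and the
    backward one on [[t, T]]. *)
Theorem picard (F : R -> V) : (forall i, {within D, continuous (fun t => F t i 0)}) ->
  exists y : R -> V, (forall i, {within D, continuous (fun t => y t i 0)}) /\
    forall t, D t -> y t = F t + vint (I t) (fun s => A *m y s).
Proof.
move=> cF; pose P (y : R -> V) t := F t + vint (I t) (fun s => A *m y s).
pose y_ k := iter k P F.
have mD : measurable (D : set (measurableTypeR R)) by exact: measurable_itv.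
have cP y : vibl D y -> forall i, {within D, continuous (fun t => P y t i 0)}.
  move=> Iy i; have -> : (fun t => P y t i 0) =
      (fun t => F t i 0) \+ (fun t => \int[mu]_(s in I t) (A *m y s) i 0).
    by apply/funext => t; rewrite /P coordD [vint _ _ _ _]mxE.
  by apply: within_continuousD; [exact: cF|apply: IP; exact: vibl_mulmx].
have Iy k : vibl D (y_ k).
  elim: k => [|k IHk] i; apply: within_ibl; first exact: cF.
  exact: cP.
have [C C0 HC] : exists2 C, 0 <= C & forall t, D t -> enorm (y_ 1%N t - y_ 0%N t) <= C.
  have B k i : exists2 M, 0 <= M & forall t, D t -> `|y_ k t i 0| <= M.
    by apply: within_bounded; case: k => [|k]; [exact: cF|exact: cP].
  have /choice[M1 HM1] : forall i, exists M, 0 <= M /\ forall t, D t -> `|y_ 1%N t i 0| <= M.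
    by move=> i; have [M] := B 1%N i; exists M.
  have /choice[M0 HM0] : forall i, exists M, 0 <= M /\ forall t, D t -> `|y_ 0%N t i 0| <= M.
    by move=> i; have [M] := B 0%N i; exists M.
  exists (\sum_i (M1 i + M0 i)).
    by apply: sumr_ge0 => i _; have [? _] := HM1 i; have [? _] := HM0 i; exact: addr_ge0.
  move=> t Dt; apply: le_trans (enorm_le_sum _) _; apply: ler_sum => i _; rewrite coordB.
  apply: le_trans (ler_normB _ _) _; have [_ h1] := HM1 i; have [_ h0] := HM0 i.
  by apply: lerD; [exact: h1|exact: h0].
have step k t : D t -> enorm (y_ k.+1 t - y_ k t) <= C * 2^-1 ^+ k * W t.
  elim: k t => [|k IHk] t Dt.
    by rewrite expr0 mulr1; apply: le_trans (HC t Dt) _; rewrite ler_peMr// W1.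
  have -> : y_ k.+2 t - y_ k.+1 t = vint (I t) (fun s => A *m (y_ k.+1 s - y_ k s)).
    rewrite {1}/y_ iterS -/(y_ k.+1) [y_ k.+1 t]/y_ iterS -/(y_ k) /P opprD addrACA subrr add0r.
    rewrite -vintB//; [|exact: mI|by apply: vibl_mulmx; [exact: mI|exact: viblI]..].
    by apply: eq_vint => s _; rewrite mulmxBr.
  rewrite exprS mulrCA mulrC [2^-1 * _]mulrC.
  have := @weighted_step (fun s => y_ k.+1 s - y_ k s) (C * 2^-1 ^+ k) t.
  rewrite [W t * _]mulrC; apply => //; last exact: viblB.
  by rewrite mulr_ge0// exprn_ge0// invr_ge0.
have [M HM] := WM.
have KM0 t : D t -> 0 <= C * M.
  by move=> Dt; rewrite mulr_ge0//; apply: le_trans (HM t Dt); apply: le_trans (W1 Dt).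
have lim t i : exists l, D t -> forall k, `|l - y_ k t i 0| <= 2 * (C * M) * 2^-1 ^+ k.
  have [Dt|nDt] := pselect (D t); last by exists 0.
  have [|l Hl] := @halving_limit R (fun k => y_ k t i 0) (C * M) (KM0 t Dt); last by exists l.
  move=> k; have := coord_enorm (y_ k.+1 t - y_ k t) i; rewrite coordB => /le_trans; apply.
  apply: le_trans (step k t Dt) _; rewrite mulrAC ler_wpM2r ?exprn_ge0 ?invr_ge0//.
  by rewrite ler_wpM2l// HM.
have /choice[l Hl] : forall ti : R * 'I_n, exists l, D ti.1 -> forall k,
    `|l - y_ k ti.1 ti.2 0| <= 2 * (C * M) * 2^-1 ^+ k by case=> t i; exact: lim.
pose y t : V := \col_i l (t, i).
have yl t i k : D t -> `|y t i 0 - y_ k t i 0| <= 2 * (C * M) * 2^-1 ^+ k.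
  by move=> Dt; rewrite mxE; exact: (Hl (t, i) Dt).
have pow_cvg (K : R) : K * 2^-1 ^+ k @[k --> \oo] --> 0.
  rewrite -(mulr0 K); apply: cvgM; first exact: cvg_cst.
  by apply: cvg_expr; rewrite ger0_norm ?invr_ge0// invf_lt1// ltr1n.
have my i : measurable_fun D (fun t => y t i 0).
  apply: (@measurable_fun_cvg _ _ _ _ (fun k t => y_ k t i 0)).
    by move=> k; exact: ibl_mfun (Iy k i).
  move=> t Dt; apply/cvgrPdist_le => e e0.
  have /cvgrPdist_le/(_ _ e0) := pow_cvg (2 * (C * M)); apply: filterS => k.
  rewrite sub0r normrN => /(le_trans (ler_norm _)); apply: le_trans; exact: yl.
have Ity : vibl D y.
  move=> i; apply: (@ibl_le _ _ _ _ _ mD _ (fun t => `|y_ 0%N t i 0| + 2 * (C * M))).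
  - exact: my.
  - move=> t Dt; have := yl t i 0%N Dt; rewrite expr0 mulr1.
    have := ler_normD (y t i 0 - y_ 0%N t i 0) (y_ 0%N t i 0); rewrite subrK; lra.
  - by apply: iblD => //; [apply: ibl_norm; exact: Iy|exact: ibl_cst_itv].
(* Both sides are within a multiple of [2^-k] of the iterates of ranks [k] and [k.+1], for every
   [k]. *)
have yE t : D t -> y t = P y t.
  move=> Dt; apply/colP => i; apply/eqP; rewrite -subr_eq0 -normr_le0.
  pose K := 2 * (C * M) + mx_sum A * (n%:R * (2 * (C * M))) * fine (mu (I t)).
  have bd k : `|y t i 0 - P y t i 0| <= K * 2^-1 ^+ k.
    have -> : y t i 0 - P y t i 0 = (y t i 0 - y_ k.+1 t i 0) +
        vint (I t) (fun s => A *m (y_ k s - y s)) i 0.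
      have -> : vint (I t) (fun s => A *m (y_ k s - y s)) =
          vint (I t) (fun s => A *m y_ k s) - vint (I t) (fun s => A *m y s).
        rewrite -vintB//; [|exact: mI|by apply: vibl_mulmx; [exact: mI|exact: viblI]..].
        by apply: eq_vint => s _; rewrite mulmxBr.
      rewrite [y_ k.+1 t]/y_ iterS -/(y_ k) /P.
      rewrite coordB !coordD; ring.
    apply: le_trans (ler_normD _ _) _; rewrite /K mulrDl lerD//.
      apply: le_trans (yl _ _ _ Dt) _; rewrite exprS mulrCA ler_piMl ?invf_le1 ?ler1n//.
      by rewrite mulr_ge0 ?exprn_ge0 ?invr_ge0// mulr_ge0// (KM0 t).
    apply: le_trans (coord_enorm _ _) _.
    apply: le_trans (enorm_vint (mI Dt) _) _.
      by apply: vibl_mulmx; [exact: mI|apply: viblB; [exact: mI|exact: viblI..]].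
    have muI : (mu (I t) < +oo)%E.
      apply: le_lt_trans (mu_itv_lty 0 T); apply: le_measure; rewrite ?inE//; [exact: mI|exact: ID].
    rewrite -mulrAC -Rintegral_cst; last exact: mI.
    apply: Rint_le; [exact: mI|..|].
    - apply: vibl_enorm; first exact: mI.
      by apply: vibl_mulmx; [exact: mI|apply: viblB; [exact: mI|exact: viblI..]].
    - by apply: ibl_cst => //; exact: mI.
    - move=> s Is; apply: le_trans (enorm_mulmx _ _) _; rewrite -mulrA ler_wpM2l ?mx_sum_ge0//.
      apply: le_trans (enorm_le_sum _) _.
      apply: (@le_trans _ _ (\sum_(i < n) 2 * (C * M) * 2^-1 ^+ k)).
        apply: ler_sum => j _; have := yl s j k (ID Dt Is).
        by rewrite distrC coordB.
      by rewrite sumr_const card_ord -[_ *+ n]mulr_natl mulrA.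
  exact: (ler_cvg_to (cvg_cst _) (pow_cvg K) (nearW _ bd)).
exists y; split=> // i.
apply: (subspace_eq_continuous _ (cP y Ity i)) => t; rewrite inE => Dt.
by rewrite /from_subspace/= yE.
Qed.

End Picard.

Section Exponential.
Context {R : realType}.
Local Notation mu := (@lebesgue_measure R).

Lemma continuous_expRM (c : R) : continuous (fun s => expR (c * s)).
Proof.
move=> s; apply: continuous_comp; last exact: continuous_expR.
by apply: cvgM; [exact: cvg_cst|exact: cvg_id].
Qed.

Lemma ibl_expRM (c p q : R) : ibl mu `[p, q] (fun s => expR (c * s)).
Proof.
apply: continuous_compact_integrable; first exact: segment_compact.
by apply: continuous_subspaceT; exact: continuous_expRM.
Qed.

(** Multiplying by [c] rather than dividing keeps the case [c = 0], which occurs for [A = 0]. *)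
Lemma Rint_expRM (c p q : R) : p <= q ->
  c * \int[mu]_(s in `[p, q]) expR (c * s) = expR (c * q) - expR (c * p).
Proof.
rewrite le_eqVlt => /predU1P[<-|pq]; first by rewrite set_itv1 Rintegral_set1 mulr0 subrr.
have dF x : is_derive x (1 : R) (fun s => expR (c * s)) (c * expR (c * x)).
  have d1 : is_derive x (1 : R) (c \*: (id : R -> R^o)) c.
    by apply: is_derive_eq; rewrite /GRing.scale/= mulr1.
  have := @is_derive1_comp _ expR (c \*: (id : R -> R^o)) x (expR (c * x)) c (is_derive_expR _) d1.
  by rewrite mulrC.
rewrite -RintegralZl//; last exact: ibl_expRM.
rewrite /Rintegral (@continuous_FTC2 _ (fun s => c * expR (c * s)) (fun s => expR (c * s)))//.
- apply: continuous_subspaceT => s; apply: cvgM; first exact: cvg_cst.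
  exact: continuous_expRM.
- split.
  + by move=> x _; case: (dF x).
  + by apply: cvg_at_right_filter; exact: continuous_expRM.
  + by apply: cvg_at_left_filter; exact: continuous_expRM.
- by move=> x _; rewrite derive1E; case: (dF x).
Qed.

End Exponential.

Section Gronwall.
Context {R : realType}.
Local Notation mu := (@lebesgue_measure R).
Variable T : R.
Hypothesis T0 : 0 < T.
Local Notation D := (`[0, T]%classic).

(** With [M] the supremum of [y / W] (or 0 if that is negative) for [W = exp (2 a t)], the
    inequality gives [M <= C + M / 2]; the boundedness of [y] makes [M] finite. *)
Lemma gronwall (y : R -> R) (a C : R) : 0 <= a -> 0 <= C -> ibl mu D y ->
  (exists M, forall t, D t -> y t <= M) ->
  (forall t, D t -> y t <= C + a * \int[mu]_(s in `[0, t]) y s) ->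
  forall t, D t -> y t <= 2 * C * expR (2 * a * T).
Proof.
move=> a0 C0 Iy [M0 HM0] Hy; pose W s := expR (2 * a * s).
have Wgt s : 0 < W s by exact: expR_gt0.
have W1 s : D s -> 1 <= W s.
  rewrite /= in_itv/= => /andP[s0 _]; rewrite -expR0 ler_expR.
  by rewrite mulr_ge0// mulr_ge0.
have WT s : D s -> W s <= expR (2 * a * T).
  by rewrite /= in_itv/= => /andP[_ sT]; rewrite ler_expR ler_wpM2l// mulr_ge0.
have D0 : D 0 by rewrite /= in_itv/= lexx ltW.
pose Q := [set y s / W s | s in D].
have Qub : has_ubound Q.
  exists (Num.max M0 0) => _ [s Ds <-]; rewrite ler_pdivrMr//.
  apply: (le_trans (HM0 s Ds)).
  apply: (@le_trans _ _ (Num.max M0 0)); first by rewrite le_max lexx.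
  by rewrite ler_peMr ?W1// le_max lexx orbT.
pose M := Num.max (sup Q) 0.
have M00 : 0 <= M by rewrite le_max lexx orbT.
have yM s : D s -> y s <= M * W s.
  move=> Ds; rewrite -ler_pdivrMr//; apply: (@le_trans _ _ (sup Q)).
    by apply: ub_le_sup => //; exists s.
  by rewrite le_max lexx.
have key t : D t -> y t / W t <= C + M / 2.
  move=> Dt; rewrite ler_pdivrMr//; apply: le_trans (Hy t Dt) _.
  have := Dt; rewrite /= in_itv/= => /andP[t0 tT].
  have IWt : ibl mu `[0, t] W by exact: ibl_expRM.
  have h : \int[mu]_(s in `[0, t]) y s <= M * \int[mu]_(s in `[0, t]) W s.
    rewrite -RintegralZl//; apply: Rint_le => //; [exact: ibl_itv Iy|exact: iblZ|].
    by move=> s /(sub_itvcc (lexx 0) tT) Ds; exact: yM.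
  have hW : 2 * a * \int[mu]_(s in `[0, t]) W s <= W t.
    by rewrite Rint_expRM// mulr0 expR0 lerBlDr lerDl ler01.
  have h1 := ler_wpM2l a0 h; have h2 := ler_wpM2l M00 hW.
  have h3 : C <= C * W t by rewrite ler_peMr// W1.
  move: (\int[mu]_(s in _) y s) (\int[mu]_(s in _) W s) h1 h2 => Y J h1 h2.
  have -> : (C + M / 2) * W t = C * W t + M * W t / 2 by ring.
  have h4 : a * (M * J) <= M * W t / 2.
    have -> : a * (M * J) = M * (2 * a * J) / 2 by field.
    by rewrite ler_pM2r// invr_gt0.
  by apply: lerD => //; exact: le_trans h1 h4.
have MC : M <= 2 * C.
  have : M <= C + M / 2.
    rewrite ge_max; apply/andP; split; last by rewrite addr_ge0// divr_ge0.
    by apply: ge_sup; [exists (y 0 / W 0), 0|move=> _ [s Ds <-]; exact: key].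
  by lra.
move=> t Dt; apply: le_trans (yM t Dt) _; apply: ler_pM => //; first exact: ltW.
exact: WT.
Qed.

End Gronwall.

Section LinearEquation.
Context {R : realType} {n : nat}.
Local Notation mu := (@lebesgue_measure R).
Local Notation V := 'cV[R]_n.
Variables (T : R) (A : 'M[R]_n).
Hypothesis T0 : 0 < T.
Local Notation D := (`[0, T]%classic).

Lemma picard_forward (F : R -> V) : (forall i, {within D, continuous (fun t => F t i 0)}) ->
  exists y : R -> V, (forall i, {within D, continuous (fun t => y t i 0)}) /\
    forall t, D t -> y t = F t + vint `[0, t] (fun s => A *m y s).
Proof.
pose a := mx_sum A; have a0 : 0 <= 2 * a by rewrite mulr_ge0// mx_sum_ge0.
apply: (@picard R n T A (fun t => `[0, t]%classic) (fun s => expR (2 * a * s))).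
- by move=> t _; exact: measurable_itv.
- by move=> t; rewrite /= in_itv/= => /andP[_ tT]; exact: sub_itvcc.
- by move=> f; exact: within_prim.
- move=> t; rewrite /= in_itv/= => /andP[t0 _].
  by rewrite -[leLHS]expR0 ler_expR mulr_ge0.
- exact: ibl_expRM.
- exists (expR (2 * a * T)) => t; rewrite /= in_itv/= => /andP[_ tT].
  by rewrite ler_expR ler_wpM2l.
- move=> t; rewrite /= in_itv/= => /andP[t0 _].
  have := Rint_expRM (2 * a) t0; rewrite mulr0 expR0 -/a.
  by move: (\int[mu]_(s in _) _) (expR _) => J w; lra.
Qed.

Lemma picard_backward (F : R -> V) : (forall i, {within D, continuous (fun t => F t i 0)}) ->
  exists y : R -> V, (forall i, {within D, continuous (fun t => y t i 0)}) /\
    forall t, D t -> y t = F t + vint `[t, T] (fun s => A *m y s).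
Proof.
pose a := mx_sum A; have a0 : 0 <= 2 * a by rewrite mulr_ge0// mx_sum_ge0.
(* The forward weight reversed in time, [exp (2 a (T - s))]. *)
pose W s := expR (2 * a * T) * expR ((- (2 * a)) * s).
apply: (@picard R n T A (fun t => `[t, T]%classic) W).
- by move=> t _; exact: measurable_itv.
- by move=> t; rewrite /= in_itv/= => /andP[t0 _]; exact: sub_itvcc.
- by move=> f; exact: within_prim_back.
- move=> t; rewrite /= in_itv/= => /andP[_ tT].
  rewrite /W -expRD -[leLHS]expR0 ler_expR mulNr -mulrBr mulr_ge0// subr_ge0//.
- by apply: iblZ => //; exact: ibl_expRM.
- exists (expR (2 * a * T)) => t; rewrite /= in_itv/= => /andP[t0 _].
  by rewrite /W ler_piMr ?expR_ge0// -[leRHS]expR0 ler_expR mulNr oppr_le0 mulr_ge0.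
- move=> t; rewrite /= in_itv/= => /andP[_ tT].
  rewrite /W RintegralZl//; last exact: ibl_expRM.
  have := Rint_expRM (- (2 * a)) tT; rewrite -/a.
  set J := \int[mu]_(s in _) _; have := expR_gt0 (2 * a * T).
  have := expR_gt0 (- (2 * a) * T).
  move: (expR (2 * a * T)) (expR (- (2 * a) * T)) (expR (- (2 * a) * t)) => e1 e2 e3.
  move=> h2 h1 E; have -> : a * (e1 * J) = e1 * (a * J) by ring.
  have -> : a * J = (e3 - e2) / 2 by lra.
  by rewrite -mulrA ler_pM2l// ler_pM2r ?invr_gt0//; lra.
Qed.

Lemma linear_bound (f z : R -> V) C : 0 <= C ->
  (forall i, {within D, continuous (fun t => z t i 0)}) ->
  (forall t, D t -> z t = f t + vint `[0, t] (fun s => A *m z s)) ->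
  (forall t, D t -> enorm (f t) <= C) ->
  forall t, D t -> enorm (z t) <= 2 * C * expR (2 * mx_sum A * T).
Proof.
move=> C0 cz zE fC.
have Iz : vibl D z by move=> i; exact: within_ibl.
apply: gronwall => //; first exact: mx_sum_ge0.
- exact: vibl_enorm.
- have /choice[M HM] : forall i, exists M, forall t, D t -> `|z t i 0| <= M.
    by move=> i; have [M _] := within_bounded (cz i); exists M.
  exists (\sum_i M i) => t Dt; apply: le_trans (enorm_le_sum _) _.
  by apply: ler_sum => i _; exact: HM.
move=> t Dt; have := Dt; rewrite /= in_itv/= => /andP[t0 tT].
have Izt : vibl `[0, t] z by move=> i; exact: ibl_itv (Iz i).
rewrite {1}zE//; apply: le_trans (ler_enormD _ _) _; apply: lerD; first exact: fC.
apply: le_trans (enorm_vint _ _) _ => //; first exact: vibl_mulmx.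
rewrite -RintegralZl//; last exact: vibl_enorm.
apply: Rint_le => //.
- by apply: vibl_enorm => //; exact: vibl_mulmx.
- by apply: iblZ => //; exact: vibl_enorm.
- by move=> s _; exact: enorm_mulmx.
Qed.

End LinearEquation.

Section SquareIntegrableVectors.
Context {R : realType} {n : nat}.
Local Notation mu := (@lebesgue_measure R).
Implicit Types (f g : R -> 'cV[R]_n) (E : set (measurableTypeR R)).

Definition vsqi E f : Prop := forall i, sqi mu E (fun s => f s i 0).

Lemma vsqi_mfun E f : measurable E -> vsqi E f -> measurable_fun E f.
Proof.
by move=> mE Sf; apply/(measurable_fun_cVP _ mE) => i; have [] := Sf i.
Qed.

Lemma vsqi_enorm E f : measurable E -> vsqi E f -> sqi mu E (fun s => enorm (f s)).
Proof.
move=> mE Sf; split.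
  by apply: (measurableT_comp (@measurable_enorm R n)); exact: vsqi_mfun.
apply: (@eq_ibl _ _ _ _ _ mE (fun s => \sum_i f s i 0 ^+ 2)).
  by move=> s _; rewrite sqr_enormE.
by apply: ibl_sum => // i _; have [] := Sf i.
Qed.

Lemma vsqi_le E f (g : R -> R) : measurable E -> measurable_fun E f ->
  (forall s, E s -> enorm (f s) <= g s) -> sqi mu E g -> vsqi E f.
Proof.
move=> mE mf fg Ig i; apply: (@sqi_le _ _ _ _ _ mE _ g) => //.
  by have /measurable_fun_cVP := mf; apply.
by move=> s Es; apply: le_trans (coord_enorm _ _) (fg s Es).
Qed.

Lemma vsqiD E f g : measurable E -> vsqi E f -> vsqi E g -> vsqi E (fun s => f s + g s).
Proof.
by move=> mE Sf Sg i; apply: (eq_sqi mE _ (sqiD mE (Sf i) (Sg i))) => s _; rewrite mxE.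
Qed.

Lemma vsqi_mulmx m (M : 'M[R]_(m, n)) E f : measurable E -> vsqi E f ->
  forall i, sqi mu E (fun s => (M *m f s) i 0).
Proof.
move=> mE Sf i; apply: (@eq_sqi _ _ _ _ _ mE (fun s => \sum_j M i j * f s j 0)).
  by move=> s _; rewrite mxE.
by apply: sqi_sum => // j _; apply: sqiZ => //; exact: Sf.
Qed.

Lemma vsqi_vibl (a b : R) f : vsqi `[a, b] f -> vibl `[a, b] f.
Proof. by move=> Sf i; exact: sqi_ibl_itv. Qed.

Lemma vsqi_edot E f g : measurable E -> vsqi E f -> vsqi E g ->
  ibl mu E (fun s => edot (f s) (g s)).
Proof. by move=> mE Sf Sg; apply: ibl_sum => // i _; apply: sqiM. Qed.

End SquareIntegrableVectors.

(** * The controlled linear equation *)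

Section Controlled.
Context {R : realType} {d k : nat}.
Variables (A : 'M[R]_d) (B : 'M[R]_(d, k)) (T : R).
Hypothesis T0 : 0 < T.
Local Notation mu := (@lebesgue_measure R).
Local Notation X := 'cV[R]_d.
Local Notation U := 'cV[R]_k.
Local Notation D := (`[0, T]%classic).

Let mD : measurable (D : set (measurableTypeR R)). Proof. exact: measurable_itv. Qed.

Lemma control_L1P (u : R -> U) : control_Lp T 1 u <-> vibl D u.
Proof.
split=> [[mu_ Iu]|Iu].
  apply: (@vibl_le _ _ _ _ (fun s => enorm (u s))) => //.
  apply: ge0_ibl => //; first exact: (measurableT_comp (@measurable_enorm R k)).
    by move=> s _; exact: enorm_ge0.
  by under eq_integral do rewrite -[enorm _]powRr1 ?enorm_ge0//.
split; first exact: vibl_mfun.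
under eq_integral do rewrite powRr1 ?enorm_ge0//.
by apply: ibl_ltey => //; exact: vibl_enorm.
Qed.

Lemma control_L2P (u : R -> U) : control_Lp T 2 u <-> vsqi D u.
Proof.
have E (x : R) : 0 <= x -> x `^ 2 = x ^+ 2 by move=> x0; rewrite -powR_mulrn.
split=> [[mu_ Iu]|Iu].
  apply: (@vsqi_le _ _ _ _ (fun s => enorm (u s))) => //.
  split; first exact: (measurableT_comp (@measurable_enorm R k)).
  apply: ge0_ibl => //.
  - by apply: measurable_funX; exact: (measurableT_comp (@measurable_enorm R k)).
  - by move=> s _; exact: sqr_ge0.
  by under eq_integral do rewrite -E ?enorm_ge0//.
split; first exact: vsqi_mfun.
under eq_integral do rewrite E ?enorm_ge0//.
by apply: ibl_ltey => //; case: (vsqi_enorm mD Iu).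
Qed.

Lemma within_cVP n (y : R -> 'cV[R]_n) :
  {within D, continuous y} <-> forall i, {within D, continuous (fun t => y t i 0)}.
Proof.
split=> [cy i|cy].
  move=> t; apply: (@continuous_comp _ _ _ (y : subspace D -> _) (fun z : 'cV[R]_n => z i 0)).
    exact: cy.
  exact: coord_continuous.
move=> t; apply/cvg_ballP => e e0.
have H : \forall s \near nbhs (t : subspace D), forall i, `|y t i 0 - y s i 0| < e.
  by apply: filter_forall => i; have /cvgrPdist_lt/(_ _ e0) := cy i t.
by apply: filterS H => s h; split=> // i j; rewrite (ord1 j); exact: h.
Qed.

Definition clamp (t : R) : R := Num.min T (Num.max 0 t).

Lemma clampE t : D t -> clamp t = t.
Proof.
rewrite /= in_itv/= => /andP[t0 tT]; rewrite /clamp.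
by rewrite (max_idPr t0) (min_idPr tT).
Qed.

Lemma clamp_in t : D (clamp t).
Proof.
rewrite /= in_itv/= /clamp le_min (ltW T0) le_max lexx/=.
by rewrite ge_min lexx.
Qed.

Lemma solutionP x u g : solution A B T x u g <->
  [/\ forall i, {within D, continuous (fun t => g t i 0)},
      forall t, D t -> g t = x + vint `[0, t] (fun s => A *m g s + B *m u s)
    & forall t, g t = g (clamp t)].
Proof. by split=> -[h1 h2 h3]; split=> //; apply/within_cVP. Qed.

Section OneSolution.
Variables (x : X) (u : R -> U) (g : R -> X).
Hypothesis Iu : vibl D u.
Hypothesis sol : solution A B T x u g.

Lemma sol_vibl : vibl D g.
Proof. by move=> i; apply: within_ibl; have /solutionP[] := sol. Qed.

Lemma sol_velocity_vibl : vibl D (fun s => A *m g s + B *m u s).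
Proof. by apply: viblD => //; apply: vibl_mulmx => //; exact: sol_vibl. Qed.

Lemma solE t : D t -> g t = x + vint `[0, t] (fun s => A *m g s + B *m u s).
Proof. by move=> Dt; have /solutionP[_ ->] := sol. Qed.

Lemma sol_split t : D t -> g t = (x + B *m vint `[0, t] u) + vint `[0, t] (fun s => A *m g s).
Proof.
move=> Dt; have := Dt; rewrite /= in_itv/= => /andP[t0 tT].
have sub (n : nat) (f : R -> 'cV[R]_n) : vibl D f -> vibl `[0, t] f.
  by move=> If i; exact: ibl_itv (If i).
rewrite solE// vintD//; last 2 first.
- by apply: vibl_mulmx => //; apply: sub; exact: sol_vibl.
- by apply: vibl_mulmx => //; exact: sub.
rewrite [vint _ (fun s => B *m u s)]vint_mulmx//; last exact: sub.
by rewrite -addrA [B *m _ + _]addrC.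
Qed.

Lemma sol0 : g 0 = x.
Proof.
rewrite solE; last by rewrite /= in_itv/= lexx ltW.
rewrite (_ : vint _ _ = 0) ?addr0//; apply/colP => i.
by rewrite !mxE set_itv1 Rintegral_set1.
Qed.

Lemma sol_bound t : enorm (g t) <=
  2 * (enorm x + mx_sum B * \int[mu]_(s in D) enorm (u s)) * expR (2 * mx_sum A * T).
Proof.
have /solutionP[cg _ cl] := sol; rewrite cl.
apply: (@linear_bound _ _ _ A T0 (fun t => x + B *m vint `[0, t] u) g _ _ cg); last exact: clamp_in.
- rewrite addr_ge0 ?enorm_ge0// mulr_ge0 ?mx_sum_ge0//.
  by apply: Rintegral_ge0 => s _; exact: enorm_ge0.
- exact: sol_split.
move=> s; rewrite /= in_itv/= => /andP[s0 sT]; apply: le_trans (ler_enormD _ _) _.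
rewrite lerD2l; apply: le_trans (enorm_mulmx _ _) _; rewrite ler_wpM2l ?mx_sum_ge0//.
apply: le_trans (enorm_vint _ _) _ => //; first by move=> i; exact: ibl_itv (Iu i).
apply: Rint_le_itv => //; first exact: vibl_enorm.
by move=> r _; exact: enorm_ge0.
Qed.

End OneSolution.

Lemma sol_exists (x : X) (u : R -> U) : vibl D u -> exists g, solution A B T x u g.
Proof.
move=> Iu; have IBu := vibl_mulmx B mD Iu.
have cF i : {within D, continuous (fun t => (x + vint `[0, t] (fun s => B *m u s)) i 0)}.
  have -> : (fun t => (x + vint `[0, t] (fun s => B *m u s)) i 0) =
      cst (x i 0) \+ (fun t => \int[mu]_(s in `[0, t]) (B *m u s) i 0).
    by apply/funext => t; rewrite !mxE.
  apply: within_continuousD; first by apply: continuous_subspaceT => t; exact: cvg_cst.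
  exact: within_prim.
have [y [cy yE]] := picard_forward A T0 cF.
have Iy : vibl D y by move=> i; exact: within_ibl.
exists (fun t => y (clamp t)); apply/solutionP; split.
- move=> i; apply: (subspace_eq_continuous _ (cy i)) => t; rewrite inE => Dt.
  by rewrite /from_subspace/= clampE.
- move=> t Dt; have := Dt; rewrite /= in_itv/= => /andP[t0 tT].
  have sub : vibl `[0, t] y by move=> i; exact: ibl_itv (Iy i).
  have subu : vibl `[0, t] (fun s => B *m u s) by move=> i; exact: ibl_itv (IBu i).
  rewrite clampE// yE// -addrA [vint _ (fun s => B *m u s) + _]addrC -vintD//.
    congr (_ + _); apply: eq_vint => s /(sub_itvcc (lexx 0) tT) Ds.
    by rewrite clampE.
  exact: vibl_mulmx.
- by move=> t; rewrite [clamp (clamp t)]clampE//; exact: clamp_in.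
Qed.

(* Linearity reduces uniqueness and continuous dependence on the initial
   point to the a priori bound. *)
Lemma sol_dist (x x' : X) (u : R -> U) g g' : vibl D u ->
  solution A B T x u g -> solution A B T x' u g' ->
  forall t, enorm (g t - g' t) <= 2 * enorm (x - x') * expR (2 * mx_sum A * T).
Proof.
move=> Iu sg sg' t; have /solutionP[cg gE clg] := sg; have /solutionP[cg' gE' clg'] := sg'.
rewrite clg clg'; apply: (@linear_bound _ _ _ A T0 (fun=> x - x') (fun t => g t - g' t)).
- exact: enorm_ge0.
- move=> i; have -> : (fun t => (g t - g' t) i 0) = (fun t => g t i 0) \- (fun t => g' t i 0).
    by apply/funext => s; rewrite coordB.
  by apply: within_continuousB.
- move=> s Ds; have := Ds; rewrite /= in_itv/= => /andP[s0 sT].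
  have sub : vibl `[0, s] g by move=> i; exact: ibl_itv (sol_vibl sg i).
  have sub' : vibl `[0, s] g' by move=> i; exact: ibl_itv (sol_vibl sg' i).
  rewrite (sol_split Iu sg Ds) (sol_split Iu sg' Ds).
  have -> : vint `[0, s] (fun r => A *m (g r - g' r)) =
      vint `[0, s] (fun r => A *m g r) - vint `[0, s] (fun r => A *m g' r).
    rewrite -vintB//; [|exact: vibl_mulmx|exact: vibl_mulmx].
    by apply: eq_vint => r _; rewrite mulmxBr.
  by rewrite opprD addrACA; congr (_ + _); rewrite opprD addrACA subrr addr0.
- by [].
- exact: clamp_in.
Qed.

Lemma sol_unique (x : X) (u : R -> U) g g' : vibl D u ->
  solution A B T x u g -> solution A B T x u g' -> g = g'.
Proof.
move=> Iu sg sg'; apply/funext => t; apply/eqP; rewrite -subr_eq0; apply/eqP.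
apply: enorm_eq0; apply/eqP; rewrite eq_le enorm_ge0 andbT.
by apply: le_trans (sol_dist Iu sg sg' t) _; rewrite subrr enorm0 mulr0 mul0r.
Qed.

Local Notation Gam := (Gamma A B T).

Lemma ev_inj (g g' : Gam) : (forall t, ev t g = ev t g') -> g = g'.
Proof. by move=> h; apply/val_inj/funext => t; exact: h. Qed.

Lemma sol_Gamma (x : X) (u : R -> U) (g : R -> X) : vibl D u ->
  solution A B T x u g -> exists g' : Gam, forall t, ev t g' = g t.
Proof.
move=> Iu sg; have tg : (g : {uniform R -> X}) \in trajectories A B T.
  by rewrite inE; exists x, u; split=> //; exact/control_L1P.
by exists (exist (fun f => f \in trajectories A B T) (g : {uniform R -> X}) tg).
Qed.

Lemma Gamma_sol (g : Gam) : exists2 u, vibl D u & solution A B T (ev 0 g) u (fun t => ev t g).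
Proof.
case: g => g tg; have := tg; rewrite inE => -[x [u [/control_L1P Iu sg]]].
exists u => //; suff -> : ev 0 (exist (fun f => f \in trajectories A B T) g tg : Gam) = x by [].
exact: (sol0 sg).
Qed.

Lemma traj_sol (x : X) (u : R -> U) : vibl D u ->
  solution A B T x u (fun t => ev t (traj A B T x u)).
Proof.
move=> Iu; rewrite /traj; apply: (@getPex _ [set g : Gam | solution A B T x u (fun t => ev t g)]).
have [g sg] := sol_exists x Iu; have [g' gE] := sol_Gamma Iu sg; exists g' => /=.
by rewrite (_ : (fun t => ev t g') = g)//; apply/funext.
Qed.

Lemma trajE (x : X) (u : R -> U) (g : Gam) : vibl D u ->
  solution A B T x u (fun t => ev t g) -> traj A B T x u = g.
Proof.
move=> Iu sg; apply: ev_inj => t.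
by have := sol_unique Iu (traj_sol x Iu) sg => /(congr1 (fun f => f t)).
Qed.

End Controlled.

(** * The space of curves *)

Section NonmeasurableIntegrands.
Context d (S : measurableType d) (R : realType).
Variables (nu : {measure set S -> \bar R}) (E : set S).
Hypothesis mE : measurable E.
Local Open Scope ereal_scope.

Lemma ge0_integral_mono (f g : S -> \bar R) : (forall x, E x -> 0 <= f x) ->
  (forall x, E x -> f x <= g x) -> \int[nu]_(x in E) f x <= \int[nu]_(x in E) g x.
Proof.
move=> f0 fg; rewrite !ge0_integralE//; last first.
  by move=> x Ex; apply: le_trans (f0 x Ex) (fg x Ex).
apply: ge_ereal_sup => _ [h hf <-]; apply: ereal_sup_ubound; exists h => // x.
by apply: le_trans (hf x) _; apply: lee_restrict.
Qed.

(* The integral of a nonnegative function is a supremum over simple functions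
   below it, so no measurability of [f] is needed. *)
Lemma ge0_ae_eq_integral_nonmeasurable (f g : S -> \bar R) :
  (forall x, E x -> 0 <= f x) -> (forall x, E x -> 0 <= g x) ->
  measurable_fun E g -> {ae nu, forall x, E x -> f x = g x} ->
  \int[nu]_(x in E) f x = \int[nu]_(x in E) g x.
Proof.
move=> f0 g0 mg [N [mN N0 subN]].
(* Setting [g] to [0] or to [+oo] on the null set encloses [f] between measurable functions with the
   integral of [g]. *)
pose lo x := if x \in N then 0 else g x.
pose hi x := if x \in N then +oo else g x.
have meas c : measurable_fun E (fun x => if x \in N then c else g x).
  rewrite (_ : (fun x => _) = (g \_ (~` N)) \+ (cst c \_ N)).
    apply: emeasurable_funD.
      apply/(measurable_restrict _ _ _).1 => //; first exact: measurableC.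
      by apply: measurable_funS mg => // x [].
    by apply/(measurable_restrict _ _ _).1.
  apply/funext => x /=; rewrite !patchE in_setC.
  by case: (x \in N) => /=; rewrite ?add0e ?adde0.
have aeE c : (forall x, E x -> 0 <= (if x \in N then c else g x)) ->
    \int[nu]_(x in E) (if x \in N then c else g x) = \int[nu]_(x in E) g x.
  move=> c0; apply: ge0_ae_eq_integral => //; exists N; split=> // x /= /not_implyP[Ex].
  by case: ifP; rewrite ?inE.
have fgN x : E x -> x \notin N -> f x = g x.
  move=> Ex xN; apply: contrapT => fg; move/negP: xN; apply; rewrite inE.
  by apply: subN => /=; apply/not_implyP.
apply/eqP; rewrite eq_le; apply/andP; split.
  rewrite -(aeE +oo); last by move=> x Ex; case: ifP => // _; exact: g0.
  apply: ge0_integral_mono => // x Ex; case: ifP => [_|/negbT xN]; first exact: leey.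
  by rewrite fgN.
rewrite -(aeE 0); last by move=> x Ex; case: ifP => // _; exact: g0.
apply: ge0_integral_mono => x Ex; case: ifP => [_|/negbT xN] //; first exact: g0.
  exact: f0.
by rewrite fgN.
Qed.

End NonmeasurableIntegrands.

Section CurveSpace.
Context {R : realType} {d k : nat}.
Variables (A : 'M[R]_d) (B : 'M[R]_(d, k)) (T : R).
Hypothesis T0 : 0 < T.
Local Notation mu := (@lebesgue_measure R).
Local Notation X := 'cV[R]_d.
Local Notation U := 'cV[R]_k.
Local Notation D := (`[0, T]%classic).
Local Notation Gam := (Gamma A B T).

Let mD : measurable (D : set (measurableTypeR R)). Proof. exact: measurable_itv. Qed.

Definition near_curve (g g' : Gam) (e : R) : Prop :=
  forall t, D t -> enorm (ev t g - ev t g') <= e.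

Lemma ev_clamp (g : Gam) t : ev t g = ev (clamp T t) g.
Proof.
have [u _ [_ _ cl]] := Gamma_sol T0 g.
exact: cl.
Qed.

(** Curves are constant on both sides of [[0, T]], so uniform closeness on the line reduces to the
    interval; the sup and Euclidean norms differ by a factor depending on [d]. *)
Lemma Gamma_nbhsP (g : Gam) (Q : set Gam) :
  nbhs g Q <-> exists2 e, 0 < e & forall g', near_curve g g' e -> Q g'.
Proof.
split.
  rewrite nbhsE => -[Q_ [[W oW <-] gW] WQ].
  have nW : nbhs (set_val g : {uniform R -> X}) W by exact: open_nbhs_nbhs.
  move/uniform_nbhs : nW => [E [entE EW]].
  have [e /= e0 eE] : exists2 e : R, 0 < e & [set xy : X * X | ball xy.1 e xy.2] `<=` E.
    by move: entE; rewrite -entourage_ballE.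
  exists (e / 2); first by rewrite divr_gt0.
  move=> g' gg'; apply: WQ; apply: EW => t _ /=; apply: eE => /=.
  apply: enorm_lt_ball; rewrite -[set_val g t]/(ev t g) -[set_val g' t]/(ev t g').
  rewrite !(ev_clamp _ t).
  apply: le_lt_trans (gg' _ (clamp_in T0 t)) _.
  by rewrite ltr_pdivrMr// ltr_pMr// ltr1n.
move=> [e e0 eQ].
have n1 : nbhs (set_val g : {uniform R -> X})
    [set f : {uniform R -> X} | forall t, ball (set_val g t) (e / d.+1%:R) (f t)].
  apply/uniform_nbhs; exists [set xy : X * X | ball xy.1 (e / d.+1%:R) xy.2]; split.
    have p : 0 < e / d.+1%:R by rewrite divr_gt0.
    exact: (@entourage_ball _ X (PosNum p)).
  by move=> f /= H t; exact: H.
have c : {for g, continuous (set_val : Gam -> {uniform R -> X})}.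
  exact: initial_continuous.
have n2 : nbhs g (set_val @^-1` _) := c _ n1.
apply: filterS n2 => g' H; apply: eQ => t _.
have /ball_enorm := H t.
rewrite -[set_val g t]/(ev t g) -[set_val g' t]/(ev t g').
move=> /le_trans; apply; rewrite mulrA ler_pdivrMr// mulrC ler_pM2l//.
by rewrite ler_nat.
Qed.

Lemma near_curve_refl (g : Gam) e : 0 <= e -> near_curve g g e.
Proof. by move=> e0 t _; rewrite subrr enorm0. Qed.

Lemma near_curve_trans (g g' g'' : Gam) e e' :
  near_curve g g' e -> near_curve g' g'' e' -> near_curve g g'' (e + e').
Proof.
move=> h h' t Dt; apply: le_trans (ler_enorm_distD (ev t g') _ _) _.
by apply: lerD; [exact: h|exact: h'].
Qed.

Lemma closed_tube (g : Gam) e : closed [set g' | near_curve g g' e].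
Proof.
rewrite (_ : [set g' | _] = \bigcap_(t in D) [set g' | enorm (ev t g - ev t g') <= e]).
  apply: closed_bigI => t _.
  have c : continuous (fun g' : Gam => enorm (ev t g - ev t g')).
    move=> g'; apply: (@continuous_comp _ _ _ (fun g' : Gam => ev t g - ev t g') (@enorm R d));
      last exact: continuous_enorm.
    have cc : {for g', continuous (cst (ev t g) : Gam -> X)} by apply: cst_continuous.
    exact: (continuousB cc (@continuous_ev _ _ _ A B T t g')).
  exact: (closed_comp (fun x _ => c x) (@closed_le _ e)).
by apply/seteqP; split=> g' h t; exact: h.
Qed.

Lemma nbhs_tube (g : Gam) e : 0 < e -> nbhs g [set g' | near_curve g g' e].
Proof. by move=> e0; apply/Gamma_nbhsP; exists e. Qed.

Lemma continuous_coord_ev t (i : 'I_d) : continuous (fun g : Gam => ev t g i 0).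
Proof.
move=> g; apply: (@continuous_comp _ _ _ (fun g : Gam => ev t g) (fun z : X => z i 0)).
  exact: continuous_ev.
exact: coord_continuous.
Qed.

Definition venergy n (g : R -> 'cV[R]_n) (N : nat) : R :=
  \sum_i energy T (fun t => g t i 0) N.

Lemma continuous_sum (I : Type) (s : seq I) (f : I -> Gam -> R) :
  (forall i, continuous (f i)) -> continuous (fun g => \sum_(i <- s) f i g).
Proof.
move=> cf; elim: s => [|i s IHs] g.
  by under eq_fun do rewrite big_nil; exact: cst_continuous.
under eq_fun do rewrite big_cons.
exact: (continuousD (cf i g) (IHs g)).
Qed.

Lemma continuous_energy_ev N (i : 'I_d) :
  continuous (fun g : Gam => energy T (fun t => ev t g i 0) N).
Proof.
apply: continuous_sum => j g.
have c : {for g, continuous (fun g => diff T (fun t => ev t g i 0) N j)}.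
  exact: (continuousB (@continuous_coord_ev (node T N j.+1) i g) (@continuous_coord_ev (node T N j) i g)).
under eq_fun do rewrite expr2.
have cc : {for g, continuous (cst (mesh T N)^-1 : Gam -> R)} by apply: cst_continuous.
exact: (continuousM (continuousM c c) cc).
Qed.

Lemma continuous_venergy_ev N : continuous (fun g : Gam => venergy (fun t => ev t g) N).
Proof. by apply: continuous_sum => i; exact: continuous_energy_ev. Qed.

Definition kinetic (g : Gam) : \bar R :=
  (\int[mu]_(t in `[0%R, T]) (enorm (derive1 (fun t => ev t g) t) ^+ 2)%:E)%E.

Lemma derive1_cV n (g v : R -> 'cV[R]_n) (x : 'cV[R]_n) : vibl D v ->
  (forall t, D t -> g t = x + vint `[0, t] v) ->
  {ae mu, forall t, D t -> derive1 g t = v t}.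
Proof.
move=> Iv gE; apply: (@ae_itvoo R T).
have H i : {ae mu, forall t, t \in `]0, T[ ->
    derivable (fun t => g t i 0) t 1 /\ derive1 (fun t => g t i 0) t = v t i 0}.
  have gi t : t \in `[0, T] -> g t i 0 = x i 0 + \int[mu]_(s in `[0, t]) v s i 0.
    by move=> tT; rewrite gE// !mxE.
  exact: (ftc_ae (Iv i) gi).
have {}H := @filter_forall _ _ _ _ (ae_filter_ringOfSetsType mu) H.
apply: ae_imp H => t Ht tT.
have dg : derivable g t 1.
  by apply/derivable_mxP => i j; rewrite (ord1 j); have [] := Ht i tT.
rewrite derive1E derive_mx//; apply/matrixP => i j; rewrite mxE (ord1 j).
by have [_ <-] := Ht i tT; rewrite derive1E.
Qed.

Lemma integral_enorm2 n (v : R -> 'cV[R]_n) : vsqi D v ->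
  (\int[mu]_(t in D) (enorm (v t) ^+ 2)%:E)%E =
  (\sum_i \int[mu]_(t in D) (v t i 0 ^+ 2))%:E.
Proof.
move=> Sv; rewrite integralE_fin//; last by case: (vsqi_enorm mD Sv).
congr (_%:E); rewrite -Rint_sum//; last by move=> i _; case: (Sv i).
by apply: eq_Rintegral => t _; rewrite sqr_enormE.
Qed.

Lemma energy_of_kinetic n (y v : R -> 'cV[R]_n) (x : 'cV[R]_n) (M : R) : vibl D v ->
  (forall t, D t -> y t = x + vint `[0, t] v) ->
  (\int[mu]_(t in D) (enorm (v t) ^+ 2)%:E <= M%:E)%E ->
  [/\ vsqi D v, forall N, (0 < N)%N -> venergy y N <= M &
   forall s t i, D s -> D t -> (y t i 0 - y s i 0) ^+ 2 <= M * `|t - s|].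
Proof.
move=> Iv yE vM.
have Sv : vsqi D v.
  apply: (@vsqi_le _ _ _ _ (fun s => enorm (v s))) => //; first exact: vibl_mfun.
  have me : measurable_fun D (fun s => enorm (v s)) := ibl_mfun (vibl_enorm mD Iv).
  split=> //; apply: ge0_ibl => //; first exact: measurable_funX.
    by move=> s _; exact: sqr_ge0.
  by apply: le_lt_trans vM _; rewrite ltry.
have sumM : \sum_i \int[mu]_(t in D) (v t i 0 ^+ 2) <= M.
  by rewrite -lee_fin -integral_enorm2.
have y0 i : y 0 i 0 = x i 0.
  rewrite yE; last by rewrite /= in_itv/= lexx ltW.
  by rewrite !mxE set_itv1 Rintegral_set1 addr0.
have prim i t : D t -> \int[mu]_(s in `[0, t]) v s i 0 = y t i 0 - y 0 i 0.
  by move=> Dt; rewrite y0 yE// !mxE [RHS]addrC addKr.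
split=> //.
  move=> N N0; apply: le_trans sumM; apply: ler_sum => i _.
  by have [_] := energy_le_sqr T0 N0 (Sv i) (prim i).
move=> s t i Ds Dt; have := prim_mod (Sv i) Ds Dt; rewrite !prim//.
have -> : y t i 0 - y 0 i 0 - (y s i 0 - y 0 i 0) = y t i 0 - y s i 0 by ring.
move=> /le_trans; apply; rewrite mulrC ler_wpM2r//.
apply: le_trans sumM; rewrite (bigD1 i)//= lerDl.
by apply: sumr_ge0 => j _; apply: Rintegral_ge0 => r _; exact: sqr_ge0.
Qed.

Lemma energy_ge0 (f : R -> R) N : (0 < N)%N -> 0 <= energy T f N.
Proof.
move=> N0; apply: sumr_ge0 => j _.
by rewrite divr_ge0 ?sqr_ge0// ltW// mesh_gt0.
Qed.

(** [energy_prim] is applied to each coordinate, where it gives the bound [M] for each one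
    separately; [energy_sup] then recovers the bound [M] for their sum. *)
Lemma kinetic_of_energy n (y : R -> 'cV[R]_n) (M : R) : 0 <= M ->
  (forall s t i, D s -> D t -> (y t i 0 - y s i 0) ^+ 2 <= M * `|t - s|) ->
  (forall m, venergy y (2 ^ m) <= M) ->
  exists w, [/\ vsqi D w, forall t, D t -> y t = y 0 + vint `[0, t] w &
    (\int[mu]_(t in D) (enorm (w t) ^+ 2)%:E <= M%:E)%E].
Proof.
move=> M0 ymod yen.
have p2 m : (0 < 2 ^ m)%N by rewrite expn_gt0.
have H i : exists w, [/\ sqi mu D w, \int[mu]_(s in D) (w s ^+ 2) <= M &
    forall t, t \in `[0, T] -> \int[mu]_(s in `[0, t]) w s = y t i 0 - y 0 i 0].
  apply: (energy_prim T0 (U := fun t => y t i 0) M0 M0) => [s t sT tT|m].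
    exact: ymod.
  apply: le_trans (yen m); rewrite /venergy (bigD1 i)//= lerDl.
  by apply: sumr_ge0 => j _; exact: energy_ge0.
have [w wP] := choice H.
pose v t : 'cV[R]_n := \col_i w i t.
have Sv : vsqi D v.
  by move=> i; have [Sw _ _] := wP i; apply: (eq_sqi mD _ Sw) => s _; rewrite mxE.
exists v; split=> //.
  move=> t Dt; apply/colP => i; rewrite !mxE.
  have [_ _ /(_ t Dt) E] := wP i; rewrite (_ : \int[mu]_(s in _) _ = y t i 0 - y 0 i 0).
    by rewrite addrC subrK.
  by rewrite -E; apply: eq_Rintegral => s _; rewrite mxE.
rewrite integral_enorm2// lee_fin; apply/ler_addgt0Pr => e e0.
have en0 : 0 < e / n.+1%:R by rewrite divr_gt0.
have /choice[m mP] : forall i, exists m,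
    \int[mu]_(t in D) (v t i 0 ^+ 2) - e / n.+1%:R < energy T (fun t => y t i 0) (2 ^ m).
  move=> i; apply: (energy_sup T0 (Sv i)) => // t Dt.
  have [_ _ /(_ t Dt) <-] := wP i.
  by apply: eq_Rintegral => s _; rewrite mxE.
(* One mesh fine enough for all coordinates, since dyadic energies increase under refinement. *)
pose mm := (\max_i m i)%N.
apply: (@le_trans _ _ (\sum_i (energy T (fun t => y t i 0) (2 ^ mm) + e / n.+1%:R))).
  apply: ler_sum => i _; rewrite -lerBlDr; apply: le_trans (ltW (mP i)) _.
  by apply: (@energy_pow2_nd _ T T0 _ (m i) mm); exact: (@leq_bigmax _ m i).
rewrite big_split/= lerD ?yen// sumr_const card_ord.
have -> : e / n.+1%:R *+ n = e * (n%:R / n.+1%:R) by rewrite -[_ *+ n]mulr_natr mulrAC mulrA.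
by rewrite ler_piMr ?(ltW e0)// ler_pdivrMr// mul1r ler_nat.
Qed.

End CurveSpace.

Lemma fmap_ultra (Y Z : Type) (f : Y -> Z) (F : set_system Y) :
  UltraFilter F -> UltraFilter (f @ F).
Proof.
move=> FU; have FP : ProperFilter F by exact: ultra_proper.
split; first exact: fmap_proper_filter.
move=> G GP FG; apply/seteqP; split=> // A GA.
have [//|FA] := in_ultra_setVsetC (f @^-1` A) FU.
have GA' : G (~` A) by apply: FG.
by have [x []] := filter_ex (filterI GA GA').
Qed.

(** * Limits along an ultrafilter *)

Section UltraLimits.
Context {R : realType} (Y : Type) (F : set_system Y) (FU : UltraFilter F).
Let FP : ProperFilter F := @ultra_proper _ _ FU.

Lemma ultra_lim (f : Y -> R) (M : R) : F [set y | `|f y| <= M] ->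
  exists l : R, f y @[y --> F] --> l.
Proof.
move=> FM; have := @segment_compact R (- M) M; rewrite compact_ultra => /(_ (f @ F) (fmap_ultra f FU)).
case.
  have FM' : F [set y | `[- M, M]%classic (f y)]; last exact: FM'.
  by apply: filterS FM => y /=; rewrite in_itv/= -ler_norml.
by move=> l [_ h]; exists l.
Qed.

Lemma ultra_lim_le (f : Y -> R) (l c : R) : f y @[y --> F] --> l -> F [set y | f y <= c] -> l <= c.
Proof. by move=> fl fc; apply: (cvgr_to_le fl); exact: fc. Qed.

Lemma ultra_lim_ge (f : Y -> R) (l c : R) : f y @[y --> F] --> l -> F [set y | c <= f y] -> c <= l.
Proof. by move=> fl fc; apply: (cvgr_to_ge fl); exact: fc. Qed.

Lemma cvg_bigsum (I : Type) (s : seq I) (f : I -> Y -> R) (l : I -> R) :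
  (forall i, f i y @[y --> F] --> l i) ->
  \sum_(i <- s) f i y @[y --> F] --> \sum_(i <- s) l i.
Proof.
move=> fl; elim: s => [|i s IHs].
  by under eq_fun do rewrite big_nil; rewrite big_nil; exact: cvg_cst.
by under eq_fun do rewrite big_cons; rewrite big_cons; exact: cvgD.
Qed.

Variable T : R.
Hypothesis T0 : 0 < T.
Local Notation D := (`[0, T]%classic).

Lemma node_near N t : (0 < N)%N -> D t ->
  exists2 j, (j < N)%N & node T N j <= t <= node T N j.+1.
Proof.
move=> N0; rewrite /= in_itv/= => /andP[t0 tT].
have h0 := mesh_gt0 T0 N0.
have [tN|tN] := eqVneq t T.
  exists N.-1; first by rewrite prednK.
  by rewrite prednK// nodeN// tN lexx andbT node_leT// leq_pred.
have q0 : 0 <= t / mesh T N by rewrite divr_ge0// ltW.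
have /andP[h1 h2] := truncn_itv q0.
exists (Num.trunc (t / mesh T N)); last first.
  apply/andP; split; rewrite /node; first by rewrite -ler_pdivlMr.
  by rewrite -ler_pdivrMr// ltW.
rewrite -(ltr_nat R); apply: le_lt_trans h1 _.
by rewrite ltr_pdivrMr// -[ltRHS]/(node T N N) nodeN// lt_neqAle tN.
Qed.

Lemma mesh_small c : 0 < c -> exists2 N, (0 < N)%N & mesh T N <= c.
Proof.
move=> c0; exists (Num.trunc (T / c)).+1 => //.
rewrite /mesh ler_pdivrMr// mulrC -ler_pdivrMr//.
by apply/ltW; exact: truncnS_gt.
Qed.

(** The Ascoli argument: a common Hölder modulus reduces uniform closeness to closeness at the
    finitely many nodes of a mesh. *)
Lemma uniform_ultra_lim (c : Y -> R -> R) (h : R -> R) (K : R) : 0 <= K ->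
  F [set y | forall s t, D s -> D t -> (c y t - c y s) ^+ 2 <= K * `|t - s|] ->
  (forall s t, D s -> D t -> (h t - h s) ^+ 2 <= K * `|t - s|) ->
  (forall t, D t -> c y t @[y --> F] --> h t) ->
  forall e, 0 < e -> F [set y | forall t, D t -> `|c y t - h t| <= e].
Proof.
move=> K0 cmod hmod cvh e e0.
have e3 : 0 < e / 3 by rewrite divr_gt0.
have [|N N0 mN] := @mesh_small ((e / 3) ^+ 2 / (K + 1)).
  by rewrite divr_gt0 ?exprn_gt0// ltr_wpDl.
have small s t : D s -> D t -> `|t - s| <= mesh T N -> forall f : R -> R,
    (f t - f s) ^+ 2 <= K * `|t - s| -> `|f t - f s| <= e / 3.
  move=> Ds Dt ts f fts; rewrite -(ler_pXn2r (ltn0Sn 1)) ?nnegrE ?(ltW e3)//.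
  rewrite real_normK ?num_real//; apply: (le_trans fts).
  apply: (@le_trans _ _ (K * mesh T N)); first by rewrite ler_wpM2l.
  apply: (@le_trans _ _ ((K + 1) * mesh T N)).
    by rewrite ler_wpM2r ?lerDl// ltW// mesh_gt0.
  by rewrite -ler_pdivlMl ?ltr_wpDl// mulrC.
have H : F [set y | forall j : 'I_N.+1, `|c y (node T N j) - h (node T N j)| <= e / 3].
  apply: filter_forall => j.
  have /cvgrPdist_le/(_ _ e3) := cvh (node T N j) (node_in T0 N0 (leq_ord j)).
  by apply: filterS => y; rewrite distrC.
apply: filterS2 cmod H => y ymod yH t Dt.
have [j jN /andP[jt tj]] := node_near N0 Dt.
have Dj : D (node T N j) by exact: (node_in T0 N0 (ltnW jN)).
have tm : `|t - node T N j| <= mesh T N.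
  by rewrite ger0_norm ?subr_ge0// -(nodeSB T N j) lerD2r.
have h1 := small _ _ Dj Dt tm (c y) (ymod _ _ Dj Dt).
have h2 := small _ _ Dj Dt tm h (hmod _ _ Dj Dt).
have h3 := yH (Ordinal (ltnW jN : (j < N.+1)%N)); rewrite /= in h3.
have -> : c y t - h t = (c y t - c y (node T N j)) + (c y (node T N j) - h (node T N j))
  + - (h t - h (node T N j)) by ring.
apply: le_trans (ler_normD _ _) _; rewrite normrN.
apply: (@le_trans _ _ (e / 3 + e / 3 + e / 3)); last by lra.
apply: lerD => //; apply: le_trans (ler_normD _ _) _.
exact: lerD.
Qed.

End UltraLimits.

(** * Compactness of the sublevel sets of the kinetic energy *)

Section CompactCurves.
Context {R : realType} {d k : nat}.
Variables (A : 'M[R]_d) (B : 'M[R]_(d, k)) (T : R).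
Hypothesis T0 : 0 < T.
Local Notation mu := (@lebesgue_measure R).
Local Notation X := 'cV[R]_d.
Local Notation U := 'cV[R]_k.
Local Notation D := (`[0, T]%classic).
Local Notation Gam := (Gamma A B T).

Let mD : measurable (D : set (measurableTypeR R)). Proof. exact: measurable_itv. Qed.
Let D0 : D 0. Proof. by rewrite /= in_itv/= lexx ltW. Qed.

Lemma kineticE (g : Gam) (v : R -> X) (x : X) : vibl D v ->
  (forall t, D t -> ev t g = x + vint `[0, t] v) ->
  kinetic g = (\int[mu]_(t in D) (enorm (v t) ^+ 2)%:E)%E.
Proof.
move=> Iv gE; apply: ge0_ae_eq_integral_nonmeasurable => //.
- by move=> t _; rewrite lee_fin sqr_ge0.
- by move=> t _; rewrite lee_fin sqr_ge0.
- apply/measurable_EFinP; apply: measurable_funX.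
  exact: ibl_mfun (vibl_enorm mD Iv).
have := derive1_cV Iv gE; apply: ae_imp => t h Dt.
by rewrite -(h Dt).
Qed.

Lemma Gamma_velocity (g : Gam) : exists2 v : R -> X, vibl D v &
  forall t, D t -> ev t g = ev 0 g + vint `[0, t] v.
Proof.
have [u Iu sg] := Gamma_sol T0 g.
exists (fun s => A *m ev s g + B *m u s).
  by apply: sol_velocity_vibl => //; exact: sg.
by move=> t Dt; exact: (solE sg Dt).
Qed.

(** Replaces a condition on an almost everywhere derivative by conditions that each involve finitely
    many values of the curve, and so are closed under pointwise limits. *)
Lemma kinetic_leP (g : Gam) (M : R) : 0 <= M ->
  (kinetic g <= M%:E)%E <->
  (forall s t i, D s -> D t -> (ev t g i 0 - ev s g i 0) ^+ 2 <= M * `|t - s|) /\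
  (forall m, venergy T (fun t => ev t g) (2 ^ m) <= M).
Proof.
move=> M0; have [v Iv gE] := Gamma_velocity g; split.
  rewrite (kineticE Iv gE) => vM.
  have [_ h1 h2] := energy_of_kinetic T0 Iv gE vM.
  by split=> // m; apply: h1; rewrite expn_gt0.
move=> [gmod gen]; have [w [Sw wE wM]] := kinetic_of_energy T0 M0 gmod gen.
by rewrite (kineticE (vsqi_vibl Sw) wE).
Qed.

Lemma kinetic_closed (M : R) : 0 <= M -> closed [set g : Gam | (kinetic g <= M%:E)%E].
Proof.
move=> M0; rewrite (_ : [set g | _] =
  (\bigcap_(q in [set q : R * R * 'I_d | D q.1.1 /\ D q.1.2])
     [set g | (ev q.1.2 g q.2 0 - ev q.1.1 g q.2 0) ^+ 2 <= M * `|q.1.2 - q.1.1|]) `&`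
  (\bigcap_m [set g | venergy T (fun t => ev t g) (2 ^ m) <= M])); last first.
  apply/seteqP; split=> g /=.
    move=> /(kinetic_leP _ M0)[h1 h2]; split; last by move=> m _; exact: h2.
    by move=> [[s t] i] [Ds Dt]; exact: h1.
  move=> [h1 h2]; apply/kinetic_leP => //; split; last by move=> m; exact: h2.
  by move=> s t i Ds Dt; exact: (h1 (s, t, i)).
apply: closedI; [apply: closed_bigI => -[[s t] i] _|apply: closed_bigI => m _].
  have c : continuous (fun g : Gam => (ev t g i 0 - ev s g i 0) ^+ 2).
    move=> g; have c1 := continuousB (@continuous_coord_ev _ _ _ A B T t i g)
      (@continuous_coord_ev _ _ _ A B T s i g).
    by under eq_fun do rewrite expr2; exact: (continuousM c1 c1).
  exact: (closed_comp (fun x _ => c x) (@closed_le _ (M * `|t - s|))).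
have c := @continuous_venergy_ev _ _ _ A B T (2 ^ m).
exact: (closed_comp (fun x _ => c x) (@closed_le _ M)).
Qed.

Definition level (M : R) : set Gam :=
  [set g | enorm (ev 0 g) <= M /\ (kinetic g <= M%:E)%E].

Lemma level_closed M : 0 <= M -> closed (level M).
Proof.
move=> M0; apply: closedI; last exact: kinetic_closed.
have c : continuous (fun g : Gam => enorm (ev 0 g)).
  move=> g; apply: (@continuous_comp _ _ _ (fun g : Gam => ev 0 g) (@enorm R d)).
    exact: continuous_ev.
  exact: continuous_enorm.
exact: (closed_comp (fun x _ => c x) (@closed_le _ M)).
Qed.

(** A generalized inverse: [B *m ginv] is a projection onto the range of [B], so [ginv] extracts a
    control from an admissible velocity. *)
Definition ginv : 'M[R]_(k, d) := (pinvmx B^T)^T.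

Lemma ginvP : B *m ginv *m B = B.
Proof.
apply: trmx_inj; rewrite !trmx_mul /ginv trmxK mulmxA mulmxKpV//.
Qed.

Lemma modulus_bound (f : R -> R) (M : R) t : 0 <= M -> D t ->
  (f t - f 0) ^+ 2 <= M * `|t - 0| -> `|f t| <= `|f 0| + Num.sqrt (M * T).
Proof.
move=> M0; rewrite /= in_itv/= => /andP[t0 tT] h.
have -> : f t = f 0 + (f t - f 0) by ring.
apply: le_trans (ler_normD _ _) _; rewrite lerD2l -sqrtr_sqr ler_sqrt ?mulr_ge0 ?(ltW T0)//.
by apply: le_trans h _; rewrite ler_wpM2l// subr0 ger0_norm.
Qed.

(** Coordinates converge pointwise along an ultrafilter, hence uniformly by the common modulus, and
    the limit inherits the energy bounds. The delicate point is that the limit still solves the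
    equation: the increments, corrected by the integral of [A *m h], stay in the range of [B]. *)
Lemma level_compact M : 0 <= M -> compact (level M).
Proof.
move=> M0; rewrite compact_ultra => F FU FM.
have FP : ProperFilter F by exact: ultra_proper.
have Fmod : F [set g : Gam | forall s t i, D s -> D t ->
    (ev t g i 0 - ev s g i 0) ^+ 2 <= M * `|t - s|].
  by apply: filterS FM => g [_ /(kinetic_leP _ M0)[]].
have Fen m : F [set g : Gam | venergy T (fun t => ev t g) (2 ^ m) <= M].
  by apply: filterS FM => g [_ /(kinetic_leP _ M0)[_ h]]; exact: h.
have lim (q : R * 'I_d) : exists l : R, ev (clamp T q.1) g q.2 0 @[g --> F] --> l.
  apply: (@ultra_lim _ _ F FU _ (M + Num.sqrt (M * T))).
  apply: filterS2 FM Fmod => g [g0 _] gmod /=.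
  apply: le_trans (modulus_bound (f := fun t => ev t g q.2 0) M0 (clamp_in T0 q.1) _) _.
    by apply: gmod => //; exact: clamp_in.
  rewrite lerD2r; exact: le_trans (coord_enorm _ _) g0.
have [l lP] := choice lim.
pose h t : X := \col_i l (t, i).
have hlim t i : D t -> ev t g i 0 @[g --> F] --> h t i 0.
  by move=> Dt; rewrite mxE; have := lP (t, i); rewrite /= clampE.
have hclamp t : h t = h (clamp T t).
  apply/colP => i; rewrite !mxE; apply: (cvg_unique _ (lP (t, i))) => //.
  by have := lP (clamp T t, i); rewrite /= (clampE (clamp_in T0 t)).
have hmod s t i : D s -> D t -> (h t i 0 - h s i 0) ^+ 2 <= M * `|t - s|.
  move=> Ds Dt; have c1 : ev t g i 0 - ev s g i 0 @[g --> F] --> h t i 0 - h s i 0 by apply: cvgB; exact: hlim.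
  have c2 : (ev t g i 0 - ev s g i 0) * (ev t g i 0 - ev s g i 0) @[g --> F] -->
      (h t i 0 - h s i 0) * (h t i 0 - h s i 0) by apply: cvgM; exact: c1.
  rewrite expr2; refine (ultra_lim_le FU c2 _).
  by apply: filterS Fmod => g H /=; rewrite -expr2; exact: H.
have hen m : venergy T h (2 ^ m) <= M.
  have N0 : (0 < 2 ^ m)%N by rewrite expn_gt0.
  suff c : venergy T (fun t => ev t g) (2 ^ m) @[g --> F] --> venergy T h (2 ^ m).
    exact: (ultra_lim_le FU c (Fen m)).
  apply: cvg_bigsum => // i; apply: cvg_bigsum => // j.
  have Dj1 : D (node T (2 ^ m) j.+1) by exact: (node_in T0 N0 (ltn_ord j)).
  have Dj : D (node T (2 ^ m) j) by exact: (node_in T0 N0 (ltnW (ltn_ord j))).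
  have c1 : ev (node T (2 ^ m) j.+1) g i 0 - ev (node T (2 ^ m) j) g i 0 @[g --> F] --> h (node T (2 ^ m) j.+1) i 0 - h (node T (2 ^ m) j) i 0 by apply: cvgB; exact: hlim.
  rewrite expr2; under eq_fun do rewrite expr2.
  by apply: cvgM; [apply: cvgM; exact: c1|exact: cvg_cst].
have [w [Sw wE wM]] := kinetic_of_energy T0 M0 hmod hen.
have Iw := vsqi_vibl Sw.
have unif e : 0 < e -> F [set g : Gam | forall t, D t -> enorm (ev t g - h t) <= e].
  move=> e0; have ed : 0 < e / d.+1%:R by rewrite divr_gt0.
  have : F [set g : Gam | forall i t, D t -> `|ev t g i 0 - h t i 0| <= e / d.+1%:R].
    apply: filter_forall => i.
    apply: (uniform_ultra_lim FU T0 M0) ed => //; last by move=> t Dt; exact: hlim.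
      by apply: filterS Fmod => g H s t; exact: H.
    by move=> s t; exact: hmod.
  apply: filterS => g H t Dt; apply: le_trans (enorm_le_sum _) _.
  apply: (@le_trans _ _ (\sum_(i < d) e / d.+1%:R)).
    by apply: ler_sum => i _; rewrite coordB; exact: H.
  rewrite sumr_const card_ord -[_ *+ d]mulr_natr mulrAC -mulrA ler_piMr ?(ltW e0)//.
  by rewrite ler_pdivrMr// mul1r ler_nat.
have Ih : vibl D h.
  apply: (@eq_vibl _ _ _ (fun t => h 0 + vint `[0, t] w)) => //.
    by move=> t Dt; rewrite -wE.
  move=> i; apply: within_ibl.
  have -> : (fun s => (h 0 + vint `[0, s] w) i 0) =
      cst (h 0 i 0) \+ (fun s => \int[mu]_(r in `[0, s]) w r i 0).
    by apply/funext => s; rewrite coordD [vint _ _ _ _]mxE.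
  apply: within_continuousD; first by apply: continuous_subspaceT => t; exact: cvg_cst.
  exact: within_prim.
(* The kernel of [Nm] is the range of [B], so membership in that range becomes a linear equation
   that survives uniform limits. *)
pose Nm : 'M[R]_d := B *m ginv - 1%:M.
have constraint t : D t -> Nm *m (h t - h 0 - vint `[0, t] (fun s => A *m h s)) = 0.
  move=> Dt; have := Dt; rewrite /= in_itv/= => /andP[t0 tT].
  have Iht : vibl `[0, t] h by move=> i; exact: ibl_itv (Ih i).
  apply: enorm_eq0; apply/eqP; rewrite eq_le enorm_ge0 andbT; apply/ler_addgt0Pr => e e0.
  rewrite add0r; pose K := mx_sum Nm * (2 + mx_sum A * T) + 1.
  have K0 : 0 < K.
    by rewrite ltr_wpDl// mulr_ge0 ?mx_sum_ge0// addr_ge0// mulr_ge0 ?mx_sum_ge0// ltW.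
  have ek : 0 < e / K by rewrite divr_gt0.
  have [g gh] := filter_ex (unif _ ek).
  have [u Iu sg] := Gamma_sol T0 g.
  have Ig := sol_vibl sg; have Igt : vibl `[0, t] (fun s => ev s g) by move=> i; exact: ibl_itv (Ig i).
  have E0 : Nm *m (ev t g - ev 0 g - vint `[0, t] (fun s => A *m ev s g)) = 0.
    rewrite (sol_split Iu sg Dt).
    have -> : ev 0 g + B *m vint `[0, t] u + vint `[0, t] (fun s => A *m ev s g) - ev 0 g -
      vint `[0, t] (fun s => A *m ev s g) = B *m vint `[0, t] u.
      by rewrite addrAC addrK addrC addKr.
    by rewrite mulmxBl mul1mx mulmxA ginvP subrr.
  have -> : Nm *m (h t - h 0 - vint `[0, t] (fun s => A *m h s)) =
    Nm *m ((h t - ev t g) - (h 0 - ev 0 g) - vint `[0, t] (fun s => A *m (h s - ev s g))).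
    rewrite -[LHS]subr0 -[X in _ - X]E0 -mulmxBr; congr (_ *m _).
    have -> : vint `[0, t] (fun s => A *m (h s - ev s g)) =
        vint `[0, t] (fun s => A *m h s) - vint `[0, t] (fun s => A *m ev s g).
      rewrite -vintB//; [|exact: vibl_mulmx|exact: vibl_mulmx].
      by apply: eq_vint => s _; rewrite mulmxBr.
    by apply/colP => i; rewrite !(coordB, coordD); ring.
  apply: le_trans (enorm_mulmx _ _) _.
  apply: (@le_trans _ _ (mx_sum Nm * ((2 + mx_sum A * T) * (e / K)))); last first.
    rewrite mulrA [leRHS](_ : e = K * (e / K)); last first.
      by rewrite mulrCA divff ?gt_eqF// mulr1.
    by rewrite ler_wpM2r ?(ltW ek)// /K lerDl.
  rewrite ler_wpM2l ?mx_sum_ge0//; apply: le_trans (ler_enormB _ _) _.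
  rewrite mulrDl; apply: lerD.
    apply: le_trans (ler_enormB _ _) _; rewrite mulr_natl mulr2n.
    by apply: lerD; rewrite enorm_distC; apply: gh.
  have Id : vibl `[0, t] (fun s => h s - ev s g) by exact: viblB.
  apply: le_trans (enorm_vint _ _) _ => //; first exact: vibl_mulmx.
  apply: (@le_trans _ _ (\int[mu]_(s in `[0, t]) (mx_sum A * (e / K)))).
    apply: Rint_le => //.
    - by apply: vibl_enorm => //; exact: vibl_mulmx.
    - exact: ibl_cst_itv.
    - move=> s /(sub_itvcc (lexx 0) tT) Ds; apply: le_trans (enorm_mulmx _ _) _.
      by rewrite ler_wpM2l ?mx_sum_ge0// enorm_distC; exact: gh.
  rewrite Rintegral_cst//.
  have -> : fine (mu `[0, t]) = t by rewrite mu_itv// subr0.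
  by rewrite mulrAC ler_wpM2r ?(ltW ek)// ler_wpM2l ?mx_sum_ge0.
(* Only the integral of [B *m u] has to match; [constraint] provides this at the level of
   primitives. *)
pose u s := ginv *m (w s - A *m h s).
have IAh := vibl_mulmx A mD Ih.
have Iu : vibl D u by apply: vibl_mulmx => //; exact: viblB.
have sol : solution A B T (h 0) u h.
  apply/solutionP; split=> //.
    move=> i; have c : {within D, continuous (cst (h 0 i 0) \+ (fun s => \int[mu]_(r in `[0, s]) w r i 0))}.
      apply: within_continuousD; first by apply: continuous_subspaceT => t; exact: cvg_cst.
      exact: within_prim.
    apply: (subspace_eq_continuous _ c) => t; rewrite inE => Dt.
    by rewrite /from_subspace/= (wE t Dt) coordD [vint _ _ _ _]mxE.
  move=> t Dt; have := Dt; rewrite /= in_itv/= => /andP[t0 tT].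
  have IAht : vibl `[0, t] (fun s => A *m h s) by move=> i; exact: ibl_itv (IAh i).
  have Iwt : vibl `[0, t] w by move=> i; exact: ibl_itv (Iw i).
  have Iut : vibl `[0, t] (fun s => B *m u s).
    by apply: vibl_mulmx => // i; exact: ibl_itv (Iu i).
  rewrite vintD//.
  have -> : vint `[0, t] (fun s => B *m u s) = h t - h 0 - vint `[0, t] (fun s => A *m h s).
    transitivity (B *m ginv *m (h t - h 0 - vint `[0, t] (fun s => A *m h s))).
      have -> : h t - h 0 = vint `[0, t] w by rewrite (wE t Dt) addrC addKr.
      rewrite -vintB// -vint_mulmx//; last exact: viblB.
      by apply: eq_vint => s _; rewrite /u mulmxA.
    by apply/eqP; rewrite -subr_eq0; apply/eqP; rewrite -[RHS](constraint t Dt) mulmxBl mul1mx.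
  by rewrite [vint _ _ + _]addrC subrK addrC subrK.
have [g0 g0E] := sol_Gamma Iu sol.
exists g0; split.
  split.
    rewrite /level /= g0E; apply/ler_addgt0Pr => e e0.
    have [g [gM gh]] := filter_ex (filterI FM (unif _ e0)).
    have -> : h 0 = ev 0 g + (h 0 - ev 0 g) by rewrite addrC subrK.
    apply: le_trans (ler_enormD _ _) _; apply: lerD; first by case: gM.
    by rewrite enorm_distC; exact: gh.
  rewrite (@kineticE g0 w (h 0))//.
  by move=> t Dt; rewrite g0E wE.
move=> Q /(Gamma_nbhsP T0)[e e0 eQ]; apply: filterS (unif _ e0) => g gh; apply: eQ => t Dt.
by rewrite g0E enorm_distC; exact: gh.
Qed.

End CompactCurves.

(** * Tight limits of measures *)

Section MeasureProbability.
Context {R : realType} {disp : measure_display} {S : measurableType disp}.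
Variable mu : {measure set S -> \bar R}.
Hypothesis mu1 : mu setT = 1%E.

Let p E := mu E.

HB.instance Definition _ := Measure.copy p mu.
HB.instance Definition _ := Measure_isProbability.Build _ S R p mu1.

Lemma measure_probability : exists eta : probability S R, forall E, eta E = mu E.
Proof. by exists p. Qed.

End MeasureProbability.

Section TightLimit.
Import finmap.
Context {R : realType} {d k : nat}.
Variables (A : 'M[R]_d) (B : 'M[R]_(d, k)) (T : R).
Hypothesis T0 : 0 < T.
Local Notation S := (Gamma A B T).

Lemma Gamma_regular (x : S) (G : set S) : open G -> G x ->
  exists W C : set S, [/\ open W, closed C, W x, W `<=` C & C `<=` G].
Proof.
move=> oG Gx; have /(Gamma_nbhsP T0)[e e0 eG] : nbhs x G by exact: open_nbhs_nbhs.
exists (interior [set g | near_curve x g e]), [set g | near_curve x g e]; split.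
- exact: open_interior.
- exact: closed_tube.
- exact: nbhs_tube.
- exact: interior_subset.
- by move=> g; exact: eG.
Qed.

Lemma open_measurable_Gamma (G : set S) : open G -> measurable G.
Proof. by move=> oG; exact: sub_sigma_algebra. Qed.

Lemma closed_measurable_Gamma (C : set S) : closed C -> measurable C.
Proof.
by move=> cC; rewrite -[C]setCK; apply: measurableC; apply: open_measurable_Gamma; exact: closed_openC.
Qed.

Variable h : set S -> R.
Hypothesis h_ge0 : forall E, 0 <= h E.
Hypothesis hT : h setT = 1.
Hypothesis h_add : forall E F, measurable E -> measurable F -> E `&` F = set0 ->
  h (E `|` F) = h E + h F.
Hypothesis h_tight : forall e, 0 < e -> exists C, [/\ compact C, closed C & 1 - e <= h C].

(** Closedness is carried along with compactness so that these sets are Borel. *)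
Let kc : set (set S) := [set C | compact C /\ closed C].
Let mkc C : kc C -> measurable C.
Proof. by case=> _; exact: closed_measurable_Gamma. Qed.

Let h_mono E F : measurable E -> measurable F -> E `<=` F -> h E <= h F.
Proof.
move=> mE mF EF; rewrite -(setDUK EF) h_add ?lerDl//; first exact: measurableD.
by rewrite setDIK.
Qed.

Let h_le1 E : measurable E -> h E <= 1.
Proof. by move=> mE; rewrite -hT; exact: h_mono. Qed.

Let h0 : h set0 = 0.
Proof.
have := @h_add set0 set0 measurable0 measurable0 (setI0 _).
by rewrite setU0; lra.
Qed.

Let h_sub E F : measurable E -> measurable F -> h (E `|` F) <= h E + h F.
Proof.
move=> mE mF; have -> : E `|` F = E `|` (F `\` E) by rewrite setDE setUIr setUv setIT.
rewrite h_add//; [|exact: measurableD|by rewrite setDIK].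
by rewrite lerD2l; apply: h_mono => //; exact: measurableD.
Qed.

Let h_bigsub (E : nat -> set S) n : (forall i, measurable (E i)) ->
  h (\big[setU/set0]_(i < n) E i) <= \sum_(i < n) h (E i).
Proof.
move=> mE; elim: n => [|n IHn]; first by rewrite !big_ord0 h0.
rewrite !big_ord_recr/=; apply: le_trans (h_sub _ _) _ => //.
  by apply: bigsetU_measurable => i _; exact: mE.
by rewrite lerD2r.
Qed.

(** [h] is only finitely additive. As in the Riesz construction, values on open sets are rebuilt
    from compact sets, for which countable open covers reduce to finite ones, and [outer] then
    extends them to all sets. *)
Definition inner (G : set S) : \bar R :=
  ereal_sup [set (h C)%:E | C in [set C | kc C /\ C `<=` G]].

Lemma inner_ub C G : kc C -> C `<=` G -> ((h C)%:E <= inner G)%E.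
Proof. by move=> kC CG; apply: ereal_sup_ubound; exists C. Qed.

Lemma kc0 : kc set0. Proof. by split; [exact: compact0|exact: closed0]. Qed.

Lemma inner_ge0 G : (0 <= inner G)%E.
Proof. by rewrite -[X in (X <= _)%E]/(0%:E) -h0; apply: inner_ub => //; exact: kc0. Qed.

Lemma inner_le_h G : measurable G -> (inner G <= (h G)%:E)%E.
Proof.
move=> mG; apply: ge_ereal_sup => _ [C [kC CG] <-]; rewrite lee_fin.
by apply: h_mono => //; exact: mkc.
Qed.

Lemma inner_mono G G' : G `<=` G' -> (inner G <= inner G')%E.
Proof.
move=> GG'; apply: ge_ereal_sup => _ [C [kC CG] <-].
by apply: inner_ub => //; exact: subset_trans GG'.
Qed.

Lemma inner_fin G : inner G \is a fin_num.
Proof.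
rewrite ge0_fin_numE ?inner_ge0//; apply: (@le_lt_trans _ _ 1%:E); last by rewrite ltry.
apply: ge_ereal_sup => _ [C [kC _] <-]; rewrite lee_fin; apply: h_le1; exact: mkc.
Qed.

Lemma inner_approx G e : 0 < e ->
  exists C, [/\ kc C, C `<=` G & (inner G <= (h C + e)%:E)%E].
Proof.
move=> e0; have [_ [C [kC CG] <-] lt] := ub_ereal_sup_adherent e0 (inner_fin G).
exists C; split=> //; rewrite EFinD -leeBlDr//; exact: ltW.
Qed.

(* A compact set covered by open sets splits, by regularity, into finitely
   many compact pieces each lying in one of them. *)
Lemma kc_split C (G : nat -> set S) : kc C -> (forall n, open (G n)) ->
  C `<=` \bigcup_n G n ->
  exists n, ((h C)%:E <= \sum_(i < n) inner (G i))%E.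
Proof.
move=> [cC clC] oG CG.
have /choice[q qP] : forall x : S, exists q : nat * (set S * set S), C x ->
    [/\ open q.2.1, closed q.2.2, q.2.1 x, q.2.1 `<=` q.2.2 & q.2.2 `<=` G q.1].
  move=> x; have [Cx|nCx] := pselect (C x); last by exists (0%N, (set0, set0)).
  have [n _ Gx] := CG x Cx; have [W [K [? ? ? ? ?]]] := Gamma_regular (oG n) Gx.
  by exists (n, (W, K)).
have := cC; rewrite compact_cover => /(_ S C (fun x => (q x).2.1)) [||D' D'C cov].
- by move=> x Cx; have [] := qP x Cx.
- by move=> x Cx; exists x => //; have [] := qP x Cx.
have D'P x : [set` D'] x -> C x by move=> /= xD; exact: (set_mem (D'C _ xD)).
pose n := (\max_(x <- finmap.enum_fset D') (q x).1).+1.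
(* The finitely many closed pieces of the subcover, grouped by the index of the open set that
   contains them. *)
pose P i : set S := C `&` \bigcup_(x in [set x | [set` D'] x /\ (q x).1 = i]) (q x).2.2.
have kP i : kc (P i).
  have cl : closed (\bigcup_(x in [set x | [set` D'] x /\ (q x).1 = i]) (q x).2.2).
    apply: closed_bigcup.
      by apply: (@sub_finite_set _ _ [set` D']) => [x [] //|]; exact: finite_fset.
    by move=> x [/D'P Cx _]; have [] := qP x Cx.
  split; first exact: compact_closedI.
  exact: closedI.
exists n; apply: (@le_trans _ _ (\sum_(i < n) (h (P i))%:E)%E); last first.
  apply: lee_sum => i _; apply: inner_ub => // x [_ [y [/D'P Cy yi] qyx]].
  by have [_ _ _ _] := qP y Cy; rewrite yi; apply.
rewrite sumEFin lee_fin; apply: (le_trans _ (h_bigsub n (fun i => mkc (kP i)))).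
apply: h_mono; [exact: mkc|by apply: bigsetU_measurable => i _; exact: mkc|].
move=> x Cx; have [y /= yD' qyx] := cov x Cx.
have Cy := D'P y yD'; have [_ _ _ WK _] := qP y Cy.
have yn : ((q y).1 < n)%N by rewrite /n ltnS; exact: (@leq_bigmax_seq _ _ xpredT (fun x => (q x).1) y yD' isT).
rewrite -bigcup_mkord; exists (q y).1 => //; split=> //; exists y => //.
exact: WK.
Qed.

Lemma inner_bigcup (G : nat -> set S) : (forall n, open (G n)) ->
  (inner (\bigcup_n G n) <= \sum_(n <oo) inner (G n))%E.
Proof.
move=> oG; apply: ge_ereal_sup => _ [C [kC CG] <-].
have [n hn] := kc_split kC oG CG; apply: le_trans hn _.
rewrite -(big_mkord xpredT (fun i => inner (G i))).
by apply: nneseries_lim_ge => i _ _; exact: inner_ge0.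
Qed.

Definition outer (E : set S) : \bar R :=
  ereal_inf [set inner G | G in [set G | open G /\ E `<=` G]].

Lemma outer_lb E G : open G -> E `<=` G -> (outer E <= inner G)%E.
Proof. by move=> oG EG; apply: ereal_inf_lbound; exists G. Qed.

Lemma outer_open G : open G -> outer G = inner G.
Proof.
move=> oG; apply/eqP; rewrite eq_le outer_lb//=.
by apply: le_ereal_inf_tmp => _ [G' [_ GG'] <-]; exact: inner_mono.
Qed.

Lemma outer_ge0 E : (0 <= outer E)%E.
Proof. by apply: le_ereal_inf_tmp => _ [G _ <-]; exact: inner_ge0. Qed.

Lemma outer_fin E : outer E \is a fin_num.
Proof.
rewrite ge0_fin_numE ?outer_ge0//; apply: le_lt_trans (outer_lb openT (@subsetT _ E)) _.
by rewrite -ge0_fin_numE ?inner_ge0 ?inner_fin.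
Qed.

Lemma outer0 : outer set0 = 0%E.
Proof.
rewrite outer_open; last exact: open0.
apply/eqP; rewrite eq_le inner_ge0 andbT; apply: le_trans (inner_le_h measurable0) _.
by rewrite h0.
Qed.

Lemma outer_mono : {homo outer : E F / E `<=` F >-> (E <= F)%E}.
Proof.
move=> E F EF; apply: le_ereal_inf_tmp => _ [G [oG FG] <-].
by apply: outer_lb => //; exact: subset_trans FG.
Qed.

Lemma outer_sigma : sigma_subadditive outer.
Proof.
move=> E; apply/lee_addgt0Pr => e e0.
have /choice[G GP] : forall n, exists G, [/\ open G, E n `<=` G &
    (inner G <= outer (E n) + (e / (2 ^ n.+1)%:R)%:E)%E].
  move=> n; have en : 0 < e / (2 ^ n.+1)%:R by rewrite divr_gt0// ltr0n expn_gt0.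
  have [_ [G [oG EG] <-] lt] := lb_ereal_inf_adherent en (outer_fin (E n)).
  by exists G; split=> //; exact: ltW.
have oG n : open (G n) by have [] := GP n.
have EG : \bigcup_n E n `<=` \bigcup_n G n.
  by move=> x [n _ Ex]; exists n => //; have [_ H _] := GP n; exact: H.
apply: le_trans (outer_lb (bigcup_open (fun n _ => oG n)) EG) _.
apply: le_trans (inner_bigcup oG) _.
apply: le_trans (epsilon_trick _ _ (ltW e0)) => //; last by move=> n; exact: outer_ge0.
by apply: lee_nneseries => [n _ _|n _]; [exact: inner_ge0|have [] := GP n].
Qed.

HB.instance Definition _ := isOuterMeasure.Build R S outer outer0 outer_ge0 outer_mono outer_sigma.

(** Given an open [G] around the test set, a compact [C1] nearly fills [G] minus [F], and a compact
    [C0] nearly fills [G] minus [C1], which contains [G] meet [F]. The two are disjoint, so finite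
    additivity of [h] bounds the sum by [inner G]. *)
Lemma closed_caratheodory F : closed F -> caratheodory_measurable outer F.
Proof.
move=> cF; apply: le_caratheodory_measurable => E.
apply: le_ereal_inf_tmp => _ [G [oG EG] <-].
have oGF : open (G `&` ~` F) by apply: openI => //; exact: closed_openC.
apply/lee_addgt0Pr => e e0; have e2 : 0 < e / 2 by rewrite divr_gt0.
have [C1 [k1 C1G h1]] := inner_approx (G `&` ~` F) e2.
have oG1 : open (G `&` ~` C1) by apply: openI => //; apply: closed_openC; case: k1.
have [C0 [k0 C0G h2]] := inner_approx (G `&` ~` C1) e2.
have le1 : (outer (E `&` F) <= (h C0 + e / 2)%:E)%E.
  apply: le_trans h2; apply: outer_lb => // x [Ex Fx]; split; first exact: EG.
  by move=> /C1G[].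
have le2 : (outer (E `&` ~` F) <= (h C1 + e / 2)%:E)%E.
  by apply: le_trans h1; apply: outer_lb => // x [Ex Fx]; split => //; exact: EG.
apply: le_trans (leeD le1 le2) _; rewrite -EFinD.
have -> : h C0 + e / 2 + (h C1 + e / 2) = h (C0 `|` C1) + e.
  rewrite h_add; [|exact: mkc|exact: mkc|].
    by field.
  by apply/seteqP; split=> // x [/C0G[]].
rewrite EFinD leeD2r//; apply: inner_ub.
  by split; [apply: compactU; [case: k0|case: k1]|apply: closedU; [case: k0|case: k1]].
by move=> x [/C0G[]|/C1G[]].
Qed.

Lemma measurable_caratheodory (E : set S) : measurable E -> caratheodory_measurable outer E.
Proof.
apply: smallest_sub; last first.
  move=> G oG; rewrite -[G]setCK; apply: caratheodory_measurable_setC.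
  by apply: closed_caratheodory; exact: open_closedC.
split.
- exact: caratheodory_measurable_set0.
- by move=> C; rewrite setTD; exact: caratheodory_measurable_setC.
- by move=> C; exact: caratheodory_measurable_bigcup.
Qed.

Lemma outer_sigma_additive : semi_sigma_additive outer.
Proof.
move=> E mE tE mUE.
apply: (@caratheodory_measure_sigma_additive R S outer) => //.
- by move=> n; exact: measurable_caratheodory.
- exact: measurable_caratheodory.
Qed.

(** On open sets the measure is [inner], which lies below [h] by monotonicity; tightness keeps the
    total mass equal to 1. Mass of [h] in an open set may end up on its boundary, hence an
    inequality. *)
Theorem tight_limit : exists eta : probability S R,
  forall G, open G -> (eta G <= (h G)%:E)%E.
Proof.
pose m := isMeasure.Build _ S R outer outer0 outer_ge0 outer_sigma_additive.
pose mm : {measure set S -> \bar R} := HB.pack outer m.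
have mm1 : mm setT = 1%E.
  rewrite -[LHS]/(outer setT) outer_open; last exact: openT.
  apply/eqP; rewrite eq_le; apply/andP; split.
    by apply: le_trans (inner_le_h measurableT) _; rewrite hT.
  apply/lee_addgt0Pr => e e0; have [C [cC clC hC]] := h_tight e0.
  apply: (@le_trans _ _ ((h C)%:E + e%:E)%E); first by rewrite -EFinD lee_fin; lra.
  by rewrite leeD2r//; exact: inner_ub.
have [eta etaE] := measure_probability mm1.
exists eta.
move=> G oG; rewrite etaE -[X in (X <= _)%E]/(outer G) outer_open//.
by apply: inner_le_h; exact: open_measurable_Gamma.
Qed.

End TightLimit.

(** * Running costs *)

Section LineDerivative.
Context {R : realType} {V : normedModType R}.

Lemma line_derive (f : V -> R) (z w : V) (s : R) : differentiable f (z + s *: w) ->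
  is_derive s 1 (fun s : R => f (z + s *: w)) ('D_w f (z + s *: w)).
Proof.
move=> df.
have E : (fun h : R => h^-1 *: (((fun s : R => f (z + s *: w)) \o shift s) (h *: 1) - f (z + s *: w))) =
    (fun h : R => h^-1 *: ((f \o shift (z + s *: w)) (h *: w) - f (z + s *: w))).
  apply/funext => h /=; congr (_ *: (f _ - _)).
  by rewrite [h *: 1]mulr1 scalerDl addrCA.
split; first by rewrite /derivable E; exact: diff_derivable.
by rewrite /derive E.
Qed.

Lemma derive_eq (W : normedModType R) (f : V -> R) (g : W -> R) (x v : V) (y w : W) :
  (forall h : R, f (h *: v + x) - f x = g (h *: w + y) - g y) -> 'D_v f x = 'D_w g y.
Proof.
move=> fg; rewrite /derive.
have -> // : (fun h : R => h^-1 *: ((f \o shift x) (h *: v) - f x)) =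
  (fun h : R => h^-1 *: ((g \o shift y) (h *: w) - g y)).
by apply/funext => h /=; rewrite fg.
Qed.

Lemma taylor1 (f : V -> R) (z w : V) : (forall y, differentiable f y) ->
  exists c, f (z + w) - f z = 'D_w f (z + c *: w).
Proof.
move=> df; have [|c _] := @MVT R (fun s : R => f (z + s *: w)) (fun s => 'D_w f (z + s *: w))
  0 1 ltr01 (fun s _ => line_derive (df _)) _.
  by apply: derivable_within_continuous => s _; have [] := line_derive (df (z + s *: w)).
by by rewrite scale1r scale0r addr0 subr0 mulr1 => ->; exists c.
Qed.

End LineDerivative.

(** Derivatives are taken along this sequence so that they are countable limits of difference
    quotients, to which measurability and dominated convergence apply. *)
Lemma harmonic_dnbhs (R : realType) : n.+1%:R^-1 @[n --> \oo] --> (0 : R)^'.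
Proof.
move=> P P0; have H := @cvg_harmonic R _ P0.
apply: (@filterS _ \oo _ (fun n => (n.+1%:R^-1 : R) != 0 -> P n.+1%:R^-1) _ _ H) => n.
by apply; rewrite invr_eq0 pnatr_eq0.
Qed.

Section SecondOrder.
Context {R : realType}.

(** The mean value theorem is applied to [f s - s f1 0 - s^2 c / 2] and then to [f1]. *)
Lemma second_order_lower (f f1 f2 : R -> R) c :
  (forall s : R, is_derive s 1 f (f1 s)) -> (forall s : R, is_derive s 1 f1 (f2 s)) ->
  (forall s, c <= f2 s) -> f 0 + f1 0 + c / 2 <= f 1.
Proof.
move=> df df1 cf2.
pose h s : R := f s - s * f1 0 - s * s * (c / 2).
have dh s : is_derive s (1 : R) h (f1 s - f1 0 - s * c).
  have -> : h = f - (fun s => s * f1 0) - (fun s => s * s * (c / 2)) by [].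
  have d1 : is_derive s (1 : R) (fun s => s * f1 0) (f1 0).
    have := @is_deriveZ _ _ _ id (f1 0) s 1 1 _; move/(_ (is_derive_id _ _)).
    have -> : (f1 0 \*: id) = (fun s => s * f1 0) by apply/funext => r; rewrite /= mulrC.
    by rewrite [_ *: 1]mulr1.
  have d2 : is_derive s (1 : R) (fun s => s * s * (c / 2)) (s * c).
    have d3 := @is_deriveM _ _ id id s 1 1 1 (is_derive_id _ _) (is_derive_id _ _).
    have := @is_deriveZ _ _ _ (id * id : R -> R) (c / 2) s 1 _ d3.
    have -> : (c / 2 \*: (id * id : R -> R)) = (fun s => s * s * (c / 2)) by apply/funext => r; exact: mulrC.
    by congr (is_derive _ _ _ _); rewrite /GRing.scale/=; field.
  by apply: is_deriveB.
have [|x] := @MVT R h (fun s => f1 s - f1 0 - s * c) 0 1 ltr01 (fun s _ => dh s) _.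
  by apply: derivable_within_continuous => s _; have [] := dh s.
move: x => r; rewrite in_itv/= => /andP[r0 r1]; rewrite subr0 mulr1 => hr.
have [|y _] := @MVT R f1 f2 0 r r0 (fun s _ => df1 s) _.
  by apply: derivable_within_continuous => s _; have [] := df1 s.
move=> hy.
have : 0 <= h 1 - h 0.
  by rewrite hr hy subr0 -mulrC -mulrBr mulr_ge0 ?(ltW r0)// subr_ge0.
by rewrite /h !mul0r mul1r mul1r !subr0; lra.
Qed.

End SecondOrder.

Local Notation bas := Defs.basis.

Definition gradx {R : realType} {d k} (f : 'cV[R]_d -> 'cV[R]_k -> R) x u := grad (fun y => f y u) x.
Definition gradu {R : realType} {d k} (f : 'cV[R]_d -> 'cV[R]_k -> R) x u := grad (f x) u.

(** The consequences of the standing assumptions for the cost at a fixed measure, with constants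
    common to all measures. Second derivatives no longer appear: strong convexity and Lipschitz
    bounds stand for them. *)
Record lagrangian {R : realType} {d k : nat} (C0 C : R) (f : 'cV[R]_d -> 'cV[R]_k -> R) : Prop := {
  lag_cont : continuous (fun z : 'cV[R]_d * 'cV[R]_k => f z.1 z.2);
  lag_diffx : forall u x, differentiable (fun y => f y u) x;
  lag_dir : forall x u y w,
    n.+1%:R * (f (x + n.+1%:R^-1 *: y) (u + n.+1%:R^-1 *: w) - f x u) @[n --> \oo] -->
    edot (gradx f x u) y + edot (gradu f x u) w;
  lag_diffq : forall x u i, n.+1%:R * (f x (u + n.+1%:R^-1 *: bas i) - f x u) @[n --> \oo] -->
    gradu f x u i 0;
  lag_convex : forall x u v,
    f x u + edot (gradu f x u) (v - u) + C0^-1 * enorm (v - u) ^+ 2 / 2 <= f x v;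
  lag_gradu_lip : forall x y u,
    enorm (gradu f y u - gradu f x u) <= C * (1 + enorm u) * enorm (y - x);
  lag_gradu : forall x u, enorm (gradu f x u) <= C * (1 + enorm u);
  lag_gradx : forall x u, enorm (gradx f x u) <= C * (1 + enorm u ^+ 2);
  lag_lip : forall x y u, `|f y u - f x u| <= C * (1 + enorm u ^+ 2) * enorm (y - x);
  lag_growth : forall x u, `|f x u| <= C * (1 + enorm u ^+ 2);
  lag_coercive : forall x u, C0^-1 / 4 * enorm u ^+ 2 - C <= f x u }.

Section LagrangianEstimates.
Context {R : realType} {d k : nat}.
Local Notation X := 'cV[R]_d.
Local Notation U := 'cV[R]_k.
Variable f : X -> U -> R.
Let F (z : X * U) := f z.1 z.2.
Hypothesis FC2 : is_C2 F.
Variables C0 C1 C2 : R.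
Hypotheses (C00 : 0 < C0) (C10 : 0 <= C1) (C20 : 0 <= C2).
Hypothesis hess_lower : forall x u, loewner_le (C0^-1)%:M (hessian (f x) u).
Hypothesis hess_upper : forall x u, loewner_le (hessian (f x) u) C0%:M.
Hypothesis mixed_bound : forall x u, opnorm (mixed_hessian f x u) <= C1 * (1 + enorm u).
Hypothesis origin_bound : forall x,
  `|f x 0| + enorm (gradx f x 0) + enorm (gradu f x 0) <= C2.

Let dF z : differentiable F z. Proof. by case: FC2 => -[]. Qed.
Let dDF v z : differentiable ('D_v F) z. Proof. by case: FC2 => _ /(_ v)[]. Qed.

Lemma lineU (f' : X * U -> R) x u v : 'D_v (fun u => f' (x, u)) u = 'D_((0 : X), v) f' (x, u).
Proof.
apply: derive_eq => h; congr (f' _ - _).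
by apply: injective_projections => //=; rewrite scaler0 add0r.
Qed.

Lemma lineX (f' : X * U -> R) x u v : 'D_v (fun x => f' (x, u)) x = 'D_(v, (0 : U)) f' (x, u).
Proof.
apply: derive_eq => h; congr (f' _ - _).
by apply: injective_projections => //=; rewrite scaler0 add0r.
Qed.

Lemma basis_sum n (v : 'cV[R]_n) : v = \sum_i v i 0 *: bas i.
Proof.
apply/colP => j; rewrite summxE (bigD1 j)//= big1 ?addr0.
  by rewrite !mxE !eqxx mulr1.
by move=> i ij; rewrite !mxE eq_sym (negbTE ij) mulr0.
Qed.

Lemma dirU (f' : X * U -> R) z v : differentiable f' z ->
  'D_((0 : X), v) f' z = \sum_j v j 0 * 'D_((0 : X), bas j) f' z.
Proof.
move=> df'; rewrite deriveE//.
have -> : ((0 : X), v) = \sum_j v j 0 *: ((0 : X), bas j).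
  rewrite [v in LHS]basis_sum; elim/big_rec2 : _ => // j y1 y2 _ E.
  by rewrite -E; apply: injective_projections => /=; rewrite ?scaler0 ?add0r.
rewrite linear_sum; apply: eq_bigr => j _.
by rewrite linearZ/= deriveE.
Qed.

Lemma dirX (f' : X * U -> R) z v : differentiable f' z ->
  'D_(v, (0 : U)) f' z = \sum_j v j 0 * 'D_(bas j, (0 : U)) f' z.
Proof.
move=> df'; rewrite deriveE//.
have -> : (v, (0 : U)) = \sum_j v j 0 *: (bas j, (0 : U)).
  rewrite [v in LHS]basis_sum; elim/big_rec2 : _ => // j y1 y2 _ E.
  by rewrite -E; apply: injective_projections => /=; rewrite ?scaler0 ?add0r.
rewrite linear_sum; apply: eq_bigr => j _.
by rewrite linearZ/= deriveE.
Qed.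

Lemma graduE x u v : 'D_((0 : X), v) F (x, u) = edot (gradu f x u) v.
Proof.
rewrite dirU//; apply: eq_bigr => j _; rewrite mxE mulrC; congr (_ * _).
by rewrite -lineU.
Qed.

Lemma gradxE x u v : 'D_(v, (0 : U)) F (x, u) = edot (gradx f x u) v.
Proof.
rewrite dirX//; apply: eq_bigr => j _; rewrite mxE mulrC; congr (_ * _).
by rewrite -lineX.
Qed.

Lemma dirE x u y w : 'D_(y, w) F (x, u) = edot (gradx f x u) y + edot (gradu f x u) w.
Proof.
rewrite -gradxE -graduE !deriveE// -(linearD ('d F (x, u))); congr ('d F _ _).
by apply: injective_projections => /=; rewrite ?addr0 ?add0r.
Qed.

Let gu j z := 'D_((0 : X), bas j) F z.
Let guE x u j : gradu f x u j 0 = gu j (x, u).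
Proof. by rewrite mxE /gu -lineU. Qed.

Lemma hessE x u i j : hessian (f x) u i j = 'D_((0 : X), bas i) (gu j) (x, u).
Proof.
rewrite mxE -lineU; congr ('D_(bas i) _ u); apply/funext => v.
by rewrite /gu -lineU.
Qed.

Lemma mixedE x u i j : mixed_hessian f x u i j = 'D_(bas i, (0 : U)) (gu j) (x, u).
Proof.
rewrite mxE -lineX; congr ('D_(bas i) _ x); apply/funext => y.
by rewrite /gu -lineU.
Qed.

Let zline x u (v : U) (s : R) : ((x, u) : X * U) + s *: ((0 : X), v) = (x, u + s *: v).
Proof. by apply: injective_projections => /=; rewrite ?scaler0 ?addr0. Qed.

Lemma along_u x u v (s : R) :
  is_derive s 1 (fun s : R => f x (u + s *: v)) (edot (gradu f x (u + s *: v)) v) /\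
  is_derive s 1 (fun s : R => edot (gradu f x (u + s *: v)) v)
    (edot v (hessian (f x) (u + s *: v) *m v)).
Proof.
split.
  have := @line_derive _ _ F (x, u) (0, v) s (dF _); rewrite zline graduE.
  by congr (is_derive _ _ _ _); apply/funext => r; rewrite zline.
have E : (fun s : R => edot (gradu f x (u + s *: v)) v) =
    \sum_(j < k) (v j 0 \*: (fun s : R => gu j ((x, u) + s *: ((0 : X), v)))).
  apply/funext => r; rewrite fct_sumE; apply: eq_bigr => j _.
  by rewrite guE -zline mulrC.
rewrite E.
have -> : edot v (hessian (f x) (u + s *: v) *m v) =
    \sum_(j < k) v j 0 *: 'D_((0 : X), v) (gu j) ((x, u) + s *: ((0 : X), v)).
  rewrite /edot; under eq_bigr do rewrite mxE big_distrr/=.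
  rewrite exchange_big/=; apply: eq_bigr => j _; rewrite zline dirU; last exact: dDF.
  rewrite /GRing.scale/= big_distrr/=; apply: eq_bigr => i _; rewrite hessE; ring.
apply: is_derive_sum => j; apply: is_deriveZ.
exact: line_derive (dDF _ _).
Qed.

Lemma f_lower x u v :
  f x u + edot (gradu f x u) (v - u) + C0^-1 * enorm (v - u) ^+ 2 / 2 <= f x v.
Proof.
set w := v - u.
have := @second_order_lower R _ _ _ (C0^-1 * enorm w ^+ 2)
  (fun s => (along_u x u w s).1) (fun s => (along_u x u w s).2).
rewrite scale0r addr0 scale1r [u + w]addrC subrK; apply=> s.
apply: le_trans (hess_lower x (u + s *: w) w).
by rewrite mul_scalar_mx edotZr sqr_enorm.
Qed.

Lemma f_upper x u v :
  f x v <= f x u + edot (gradu f x u) (v - u) + C0 * enorm (v - u) ^+ 2 / 2.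
Proof.
set w := v - u.
have := @second_order_lower R _ _ _ (- (C0 * enorm w ^+ 2))
  (fun s => @is_deriveN _ _ _ _ _ _ _ (along_u x u w s).1) (fun s => @is_deriveN _ _ _ _ _ _ _ (along_u x u w s).2).
rewrite /= !fctE scale0r addr0 scale1r [u + w]addrC subrK => H.
suff : - f x u - edot (gradu f x u) w - C0 * enorm w ^+ 2 / 2 <= - f x v by lra.
rewrite -[X in _ - X]opprK -mulNr opprK; apply: H => s.
rewrite lerN2; apply: le_trans (hess_upper x (u + s *: w) w) _.
by rewrite mul_scalar_mx edotZr sqr_enorm.
Qed.

Let zlineX x u (y : X) (s : R) : ((x, u) : X * U) + s *: (y, (0 : U)) = (x + s *: y, u).
Proof. by apply: injective_projections => /=; rewrite ?scaler0 ?addr0. Qed.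

Lemma gu_lip j x y u : `|gu j (y, u) - gu j (x, u)| <= C1 * (1 + enorm u) * enorm (y - x).
Proof.
set w := y - x.
have [c] := @taylor1 _ _ (gu j) (x, u) (w, (0 : U)) (dDF _).
rewrite -[in gu j (_ + _)](scale1r (w, (0 : U))) zlineX scale1r [x + w]addrC subrK zlineX => ->.
rewrite dirX; last exact: dDF.
have -> : \sum_i w i 0 * 'D_(bas i, 0) (gu j) (x + c *: w, u) =
    edot w (mixed_hessian f (x + c *: w) u *m bas j).
  apply: eq_bigr => i _; congr (_ * _); rewrite mxE (bigD1 j)//= big1 ?addr0.
    by rewrite !mxE !eqxx mulr1 -mixedE mxE.
  by move=> l lj; rewrite [bas j _ _]mxE (negbTE lj) mulr0.
apply: le_trans (normr_edot _ _) _; rewrite mulrC ler_wpM2r ?enorm_ge0//.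
apply: le_trans (enorm_opnorm _ _) _.
have -> : enorm (bas j : U) = 1.
  rewrite /enorm /edot (bigD1 j)//= big1 ?addr0.
    by rewrite !mxE !eqxx mulr1 sqrtr1.
  by move=> l lj; rewrite !mxE (negbTE lj) mul0r.
by rewrite mulr1.
Qed.

Lemma gradu_lip x y u :
  enorm (gradu f y u - gradu f x u) <= k%:R * C1 * (1 + enorm u) * enorm (y - x).
Proof.
apply: le_trans (enorm_le_sum _) _.
apply: (@le_trans _ _ (\sum_(j < k) C1 * (1 + enorm u) * enorm (y - x))).
  by apply: ler_sum => j _; rewrite coordB !guE gu_lip.
by rewrite sumr_const card_ord -[X in X <= _]mulr_natl !mulrA.
Qed.

Lemma f_bound_upper x u : f x u <= C2 + C2 * enorm u + C0 * enorm u ^+ 2 / 2.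
Proof.
have := f_upper x 0 u; rewrite subr0 => H; apply: le_trans H _; rewrite lerD2r.
have := origin_bound x; have := edot_le (gradu f x 0) u; have := ler_norm (f x 0).
have := enorm_ge0 (gradx f x 0); have := normr_ge0 (f x 0); have := enorm_ge0 (gradu f x 0).
move=> h1 h2 h3 h4 h5 h6; apply: lerD; first by lra.
by apply: (le_trans h5); rewrite ler_wpM2r ?enorm_ge0//; lra.
Qed.

Lemma f_bound_lower x u : - C2 - C2 * enorm u + C0^-1 * enorm u ^+ 2 / 2 <= f x u.
Proof.
have := f_lower x 0 u; rewrite subr0 => H; apply: le_trans H; rewrite lerD2r.
have := origin_bound x; have := normr_edot (gradu f x 0) u; have := ler_norm (- f x 0).
have := enorm_ge0 (gradx f x 0); have := normr_ge0 (f x 0); have := enorm_ge0 (gradu f x 0).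
rewrite normrN => h1 h2 h3 h4; rewrite ler_norml => /andP[h5 _] h6.
have : enorm (gradu f x 0) * enorm u <= C2 * enorm u by rewrite ler_wpM2r ?enorm_ge0//; lra.
lra.
Qed.

(** A convex function of quadratic growth has a gradient of linear growth: the tangent at [u] is
    compared with the values at distance [1 + |u|] along each axis, in both directions. *)
Lemma gradu_growth x u : enorm (gradu f x u) <= k%:R * (5 * C2 + 2 * C0) * (1 + enorm u).
Proof.
set N := 1 + enorm u.
have u0 := enorm_ge0 u.
have N1 : 1 <= N by rewrite /N; lra.
have co (s : R) j : `|s| = N -> gradu f x u j 0 * s <= (5 * C2 + 2 * C0) * (N * N).
  move=> sN; pose v : U := u + s *: bas j.
  have eb : enorm (s *: bas j : U) = N.
    rewrite enormZ sN /enorm /edot (bigD1 j)//= big1 ?addr0.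
      by rewrite !mxE !eqxx mulr1 sqrtr1 mulr1.
    by move=> l lj; rewrite !mxE (negbTE lj) mul0r.
  have vu : v - u = s *: bas j by rewrite /v addrAC subrr add0r.
  have := f_lower x u v; rewrite vu eb.
  have -> : edot (gradu f x u) (s *: bas j) = gradu f x u j 0 * s.
    rewrite edotZr mulrC; congr (_ * _); rewrite /edot (bigD1 j)//= big1 ?addr0.
      by rewrite [bas j _ _]mxE !eqxx mulr1.
    by move=> l lj; rewrite [bas j _ _]mxE (negbTE lj) mulr0.
  have := f_bound_upper x v; have := f_bound_lower x u.
  have ev : enorm v <= 2 * N.
    by apply: (le_trans (ler_enormD _ _)); rewrite eb /N; lra.
  have ev2 : enorm v ^+ 2 <= 4 * (N * N).
    have -> : 4 * (N * N) = (2 * N) ^+ 2 by ring.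
    by rewrite ler_pXn2r ?nnegrE ?enorm_ge0//; lra.
  have p1 : 0 <= C0^-1 * N ^+ 2 / 2 by rewrite divr_ge0// mulr_ge0 ?invr_ge0 ?(ltW C00)// sqr_ge0.
  have p2 : 0 <= C0^-1 * enorm u ^+ 2 / 2 by rewrite divr_ge0// mulr_ge0 ?invr_ge0 ?(ltW C00)// sqr_ge0.
  have NN : N <= N * N by rewrite ler_peMl//; lra.
  have q1 : C2 * enorm v <= 2 * (C2 * (N * N)).
    by rewrite mulrCA ler_wpM2l//; apply: le_trans ev _; rewrite ler_wpM2l.
  have q2 : C2 * enorm u <= C2 * (N * N).
    by rewrite ler_wpM2l//; apply: le_trans NN; rewrite /N lerDr.
  have q3 : C0 * enorm v ^+ 2 <= 4 * (C0 * (N * N)) by rewrite [leRHS]mulrCA ler_wpM2l// ltW.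
  have q4 : C2 <= C2 * (N * N) by rewrite ler_peMr//; exact: le_trans NN.
  have -> : (5 * C2 + 2 * C0) * (N * N) = 5 * (C2 * (N * N)) + 2 * (C0 * (N * N)) by ring.
  move: (C0^-1 * N ^+ 2 / 2) (C0^-1 * enorm u ^+ 2 / 2) p1 p2 => a b.
  move: (f x v) (f x u) (gradu f x u j 0 * s) => fv fu q.
  move: (C0 * enorm v ^+ 2) q3 (C2 * enorm v) q1 (C2 * enorm u) q2 => a1 q3 a2 q1 a3 q2.
  move: (C2 * (N * N)) (C0 * (N * N)) q1 q2 q3 q4 => b1 b2.
  clear ev ev2 NN eb vu; lra.
apply: le_trans (enorm_le_sum _) _.
apply: (@le_trans _ _ (\sum_(j < k) (5 * C2 + 2 * C0) * N)); last first.
  by rewrite sumr_const card_ord -[X in X <= _]mulr_natl !mulrA.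
apply: ler_sum => j _; rewrite -(ler_pM2r (_ : 0 < N)); last by lra.
rewrite -mulrA; have [g0|g0] := leP 0 (gradu f x u j 0).
  by rewrite ger0_norm//; apply: co; rewrite ger0_norm//; lra.
by rewrite ltr0_norm// mulNr -mulrN; apply: co; rewrite normrN ger0_norm//; lra.
Qed.

(** The derivative in [x] is bounded directly only at [u = 0]. The rest is the variation of
    [f y - f x] along the segment from [0] to [u], controlled by the mixed derivative. *)
Lemma f_lip x y u : `|f y u - f x u| <= (C2 + 2 * (k%:R * C1)) * (1 + enorm u ^+ 2) * enorm (y - x).
Proof.
have u0 := enorm_ge0 u; have w0 := enorm_ge0 (y - x).
have h1 : `|f y 0 - f x 0| <= C2 * enorm (y - x).
  set w := y - x.
  have [c] := @taylor1 _ _ F (x, 0) (w, (0 : U)) dF.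
  rewrite -[in F (_ + _)](scale1r (w, (0 : U))) zlineX scale1r [x + w]addrC subrK zlineX gradxE.
  rewrite /F/= => ->; apply: le_trans (normr_edot _ _) _; rewrite ler_wpM2r//.
  have := origin_bound (x + c *: w); have := enorm_ge0 (gradu f (x + c *: w) 0).
  have := normr_ge0 (f (x + c *: w) 0); lra.
pose h s := f y (s *: u) - f x (s *: u).
have dh s : is_derive s (1 : R) h (edot (gradu f y (s *: u) - gradu f x (s *: u)) u).
  rewrite edotBl; have -> : h = (fun s : R => f y (0 + s *: u)) - (fun s : R => f x (0 + s *: u)).
    by apply/funext => r; rewrite /h !fctE add0r.
  have := (along_u y 0 u s).1; have := (along_u x 0 u s).1; rewrite !add0r => a b.
  exact: is_deriveB.
have [|c] := @MVT R h (fun s => edot (gradu f y (s *: u) - gradu f x (s *: u)) u) 0 1 ltr01 (fun s _ => dh s) _.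
  by apply: derivable_within_continuous => s _; have [] := dh s.
rewrite in_itv/= => /andP[c0 c1]; rewrite subr0 mulr1 /h scale1r scale0r => E.
have h2 : `|(f y u - f x u) - (f y 0 - f x 0)| <= k%:R * C1 * (1 + enorm u) * enorm (y - x) * enorm u.
  rewrite E; apply: le_trans (normr_edot _ _) _; rewrite ler_wpM2r//.
  apply: le_trans (gradu_lip _ _ _) _; rewrite ler_wpM2r// ler_wpM2l ?mulr_ge0//.
  by rewrite lerD2l enormZ gtr0_norm// ler_piMl// ltW.
have -> : f y u - f x u = (f y u - f x u - (f y 0 - f x 0)) + (f y 0 - f x 0) by ring.
apply: le_trans (ler_normD _ _) _; apply: le_trans (lerD h2 h1) _.
rewrite mulrAC -mulrDl ler_wpM2r//.
set K := k%:R * C1; have K0 : 0 <= K by rewrite mulr_ge0.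
have a1 : (1 + enorm u) * enorm u <= 2 * (1 + enorm u ^+ 2).
  have := sqr_ge0 (enorm u - 1); rewrite sqrrB1 expr2 mulrDl mul1r mulr2n.
  have := mulr_ge0 u0 u0; move: (enorm u * enorm u) => q; lra.
have a2 : C2 * 1 <= C2 * (1 + enorm u ^+ 2) by rewrite ler_wpM2l// lerDl sqr_ge0.
have a3 := ler_wpM2l K0 a1.
rewrite mulr1 in a2.
have -> : (C2 + 2 * K) * (1 + enorm u ^+ 2) =
  C2 * (1 + enorm u ^+ 2) + K * (2 * (1 + enorm u ^+ 2)) by ring.
by rewrite addrC -mulrA; apply: lerD.
Qed.

Lemma gradx_growth x u :
  enorm (gradx f x u) <= d%:R * (C2 + 2 * (k%:R * C1)) * (1 + enorm u ^+ 2).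
Proof.
set K := C2 + 2 * (k%:R * C1).
apply: le_trans (enorm_le_sum _) _.
apply: (@le_trans _ _ (\sum_(j < d) K * (1 + enorm u ^+ 2))); last first.
  by rewrite sumr_const card_ord -[X in X <= _]mulr_natl !mulrA.
apply: ler_sum => j _.
have eb : enorm (bas j : X) = 1.
  rewrite /enorm /edot (bigD1 j)//= big1 ?addr0.
    by rewrite !mxE !eqxx mulr1 sqrtr1.
  by move=> l lj; rewrite !mxE (negbTE lj) mul0r.
have dd : derivable F (x, u) (bas j, 0) by exact: diff_derivable.
have -> : gradx f x u j 0 = 'D_(bas j, 0) F (x, u) by rewrite mxE -lineX.
have FF : Filter ((0 : R)^') by typeclasses eauto.
have c := @cvg_norm _ _ _ (0 : R)^' FF _ _ dd.
apply: (cvgr_to_le c); near=> h.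
have h0 : h != 0 by near: h; exact: nbhs_dnbhs_neq.
rewrite normrZ normfV ler_pdivrMl ?normr_gt0// /F/= scaler0 add0r.
apply: le_trans (f_lip _ _ _) _; rewrite addrK enormZ eb mulr1 mulrC//.
Unshelve. all: by end_near.
Qed.

Lemma dir_cvg x u y w :
  n.+1%:R * (f (x + n.+1%:R^-1 *: y) (u + n.+1%:R^-1 *: w) - f x u) @[n --> \oo] -->
  edot (gradx f x u) y + edot (gradu f x u) w.
Proof.
rewrite -dirE; have dd : derivable F (x, u) (y, w) by exact: diff_derivable.
have H := @cvg_comp _ _ _ (fun n : nat => n.+1%:R^-1 : R) _ _ _ _ (@harmonic_dnbhs R) dd.
apply: cvg_trans H; apply: near_eq_cvg; near=> n.
rewrite /= invrK /F/=; congr (_ * (f _ _ - _)); exact: addrC.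
Unshelve. all: by end_near.
Qed.

Lemma diffq_cvg x u i :
  n.+1%:R * (f x (u + n.+1%:R^-1 *: bas i) - f x u) @[n --> \oo] --> gradu f x u i 0.
Proof.
have := @dir_cvg x u 0 (bas i); rewrite edot0r add0r.
have -> : edot (gradu f x u) (bas i) = gradu f x u i 0.
  rewrite /edot (bigD1 i)//= big1 ?addr0.
    by rewrite [bas i _ _]mxE !eqxx mulr1.
  by move=> l lj; rewrite [bas i _ _]mxE (negbTE lj) mulr0.
by under eq_fun do rewrite scaler0 addr0.
Qed.

Lemma lagrangian_of_C2 (C : R) :
  k%:R * C1 <= C -> k%:R * (5 * C2 + 2 * C0) <= C -> C2 + 2 * (k%:R * C1) <= C ->
  d%:R * (C2 + 2 * (k%:R * C1)) <= C -> 2 * C2 + C0 + C0 * C2 ^+ 2 <= C ->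
  lagrangian C0 C f.
Proof.
move=> h1 h2 h3 h4 h5; have C0n : 0 <= C0 by exact: ltW.
have sq u : 0 <= enorm (u : U) ^+ 2 by exact: sqr_ge0.
have w1 (u : U) : 0 <= 1 + enorm u by rewrite addr_ge0 ?enorm_ge0.
have w2 (u : U) : 0 <= 1 + enorm u ^+ 2 by rewrite addr_ge0.
have C22 : 0 <= C0 * C2 ^+ 2 by rewrite mulr_ge0 ?sqr_ge0.
have up x u : f x u <= C * (1 + enorm u ^+ 2).
  apply: le_trans (f_bound_upper x u) _.
  have e1 : C2 * enorm u <= C2 * (1 + enorm u ^+ 2).
    rewrite ler_wpM2l//; have := sqr_ge0 (enorm u - 1); have := sq u.
    by rewrite sqrrB1; have := enorm_ge0 u; lra.
  have e2 : 0 <= C2 * enorm u ^+ 2 by exact: mulr_ge0.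
  have e3 : 0 <= C0 * enorm u ^+ 2 by exact: mulr_ge0.
  have : (2 * C2 + C0) * (1 + enorm u ^+ 2) <= C * (1 + enorm u ^+ 2).
    by rewrite ler_wpM2r//; lra.
  move: e1 e2 e3; move: (enorm u ^+ 2) (enorm u) => q p; lra.
have lo x u : C0^-1 / 4 * enorm u ^+ 2 - C <= f x u.
  apply: le_trans (f_bound_lower x u).
  (* Half of the quadratic term of [f_bound_lower] absorbs the linear one by completing a square. *)
  have e1 : C2 * enorm u <= C0^-1 / 4 * enorm u ^+ 2 + C0 * C2 ^+ 2.
    have e2 : 0 <= C0^-1 * (enorm u / 2 - C0 * C2) ^+ 2.
      by rewrite mulr_ge0 ?invr_ge0 ?sqr_ge0.
    have -> : C2 * enorm u = C0^-1 / 4 * enorm u ^+ 2 + C0 * C2 ^+ 2 -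
      C0^-1 * (enorm u / 2 - C0 * C2) ^+ 2 by field; rewrite gt_eqF.
    by rewrite gerBl.
  move: e1; move: (C0 * C2 ^+ 2) (enorm u ^+ 2) (C2 * enorm u) C22 h5 => a b c C22 h5.
  have -> : C0^-1 * b / 2 = C0^-1 / 4 * b + C0^-1 / 4 * b by field; rewrite gt_eqF.
  have E e : c <= e + a -> e - C <= - C2 - c + (e + e) by have := C20; lra.
  exact: E.
split.
- by move=> z; apply: differentiable_continuous; exact: dF.
- move=> u x.
  have -> : (fun y => f y u) = F \o (fun y : X => (y, u)) by [].
  apply: differentiable_comp; last exact: dF.
  by apply: differentiable_pair => //; exact: differentiable_cst.
- exact: dir_cvg.
- exact: diffq_cvg.
- exact: f_lower.
- move=> x y u; apply: le_trans (gradu_lip _ _ _) _.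
  by rewrite ler_wpM2r ?enorm_ge0// ler_wpM2r.
- by move=> x u; apply: le_trans (gradu_growth _ _) _; rewrite ler_wpM2r.
- by move=> x u; apply: le_trans (gradx_growth _ _) _; rewrite ler_wpM2r.
- move=> x y u; apply: le_trans (f_lip _ _ _) _.
  by rewrite ler_wpM2r ?enorm_ge0// ler_wpM2r.
- move=> x u; rewrite ler_norml up andbT; apply: le_trans (lo x u).
  have e1 : 0 <= C0^-1 / 4 * enorm u ^+ 2 by rewrite mulr_ge0 ?divr_ge0 ?invr_ge0.
  have : 0 <= C * enorm u ^+ 2 by rewrite mulr_ge0//; have := C20; lra.
  by rewrite mulrDr mulr1; lra.
- exact: lo.
Qed.

End LagrangianEstimates.

Theorem lagrangianP {R : realType} {d k : nat}
    (L : 'cV[R]_d -> 'cV[R]_k -> probability 'cV[R]_d R -> R) :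
  running_cost_assumptions L ->
  exists C0 C : R, [/\ 0 < C0, 0 <= C & forall m, finite_moment 1 m ->
    lagrangian C0 C (fun x u => L x u m)].
Proof.
move=> [LC2 _ [C0 [C1 [C2 [C00 C10 C20 H]]]]].
pose a1 := k%:R * C1; pose a2 := k%:R * (5 * C2 + 2 * C0); pose a3 := C2 + 2 * (k%:R * C1).
pose a4 := d%:R * (C2 + 2 * (k%:R * C1)); pose a5 := 2 * C2 + C0 + C0 * C2 ^+ 2.
have C0n := ltW C00.
have p1 : 0 <= a1 by rewrite mulr_ge0.
have p3 : 0 <= a3 by rewrite addr_ge0// mulr_ge0.
have p2 : 0 <= a2 by rewrite mulr_ge0// addr_ge0// mulr_ge0.
have p4 : 0 <= a4 by rewrite mulr_ge0.
have p5 : 0 <= a5 by rewrite !addr_ge0// mulr_ge0// sqr_ge0.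
exists C0, (a1 + a2 + a3 + a4 + a5); split; [by []|exact: (addr_ge0 (addr_ge0 (addr_ge0 (addr_ge0 p1 p2) p3) p4) p5)|].
move=> m mP; apply: (@lagrangian_of_C2 _ _ _ _ _ C0 C1 C2) => //.
- exact: LC2.
- by move=> x u; have [] := H x u m mP.
- by move=> x u; have [] := H x u m mP.
- by move=> x u; have [] := H x u m mP.
- by move=> x; have [] := H x 0 m mP.
- by rewrite -/a1; lra.
- by rewrite -/a2; lra.
- by rewrite -/a3; lra.
- by rewrite -/a4; lra.
- by rewrite -/a5; lra.
Qed.

(** * Mixtures and couplings *)

Section Mixtures.
Context {R : realType} {disp : measure_display} {S : measurableType disp}.
Variables (I : finType) (w : I -> R) (P : I -> probability S R).
Hypotheses (w0 : forall i, 0 <= w i) (w1 : \sum_i w i = 1).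

(** Sums of measures are indexed by [nat], so [I] is enumerated; indices beyond its cardinal carry
    the zero measure. *)
Let m_ (j : nat) : {measure set S -> \bar R} :=
  if insub j is Some i then mscale (NngNum (w0 (enum_val (i : 'I_#|I|)))) (P (enum_val i)) else mzero.

Let sum_enum (F : I -> \bar R) : (\sum_(j < #|I|) F (enum_val j) = \sum_i F i)%E.
Proof. by rewrite -big_enum_val. Qed.

Lemma mixture : exists Q : probability S R,
  (forall E, Q E = \sum_i (w i)%:E * P i E)%E /\
  forall f, measurable_fun setT f -> (forall x, (0 <= f x)%E) ->
    (\int[Q]_x f x = \sum_i (w i)%:E * \int[P i]_x f x)%E.
Proof.
have mE E : (msum m_ #|I| E = \sum_i (w i)%:E * P i E)%E.
  rewrite -sum_enum /msum; apply: eq_bigr => j _.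
  by rewrite /m_ valK.
have m1 : msum m_ #|I| setT = 1%E.
  rewrite mE; under eq_bigr do rewrite probability_setT mule1.
  by rewrite sumEFin w1.
have [Q QE] := measure_probability m1.
exists Q; split; first by move=> E; rewrite QE -mE.
move=> f mf f0; transitivity (\int[msum m_ #|I|]_x f x)%E.
  by apply: eq_measure_integral => E _ _; rewrite QE.
rewrite ge0_integral_measure_sum// -sum_enum; apply: eq_bigr => j _.
by rewrite /m_ valK ge0_integral_mscale.
Qed.

End Mixtures.

Section ImageProbability.
Context {R : realType} {d1 d2 : measure_display} {S : measurableType d1} {S' : measurableType d2}.

Lemma image_probability (P : probability S R) (f : S -> S') : measurable_fun setT f ->
  exists Q : probability S' R, (forall E, Q E = P (f @^-1` E)) /\
  forall g, measurable_fun setT g -> (forall x, (0 <= g x)%E) ->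
    (\int[Q]_x g x = \int[P]_x g (f x))%E.
Proof.
move=> mf; pose mF := isMeasurableFun.Build _ _ S S' f mf.
pose F : {mfun S >-> S'} := HB.pack f mF.
exists (distribution P F); split => //.
by move=> g mg g0; rewrite ge0_integral_distribution.
Qed.

End ImageProbability.

Section Fibres.
Context {R : realType} {disp : measure_display} {S : measurableType disp} {X : Type}.
Variables (P : probability S R) (I : finType) (f : S -> I).
Hypothesis mf : forall k, measurable (f @^-1` [set k]).

Definition mass k : R := fine (P (f @^-1` [set k])).

Lemma mass_ge0 k : 0 <= mass k. Proof. by rewrite /mass fine_ge0. Qed.

Lemma probability_fibre (a : I -> X) (E : set X) :
  P ((a \o f) @^-1` E) = (\sum_k mass k * \1_E (a k))%:E.
Proof.
have -> : (a \o f) @^-1` E = \bigcup_(k in [set k | E (a k)]) f @^-1` [set k].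
  apply/seteqP; split=> s /=; first by move=> Es; exists (f s).
  by move=> [k /= Ek ->].
rewrite measure_fin_bigcup//; last 2 first.
- exact: finite_finset.
- by move=> k l _ _ [s [/= -> ->]].
have -> : [set k | E (a k)] = [set` (fun k => `[< E (a k) >])].
  by apply/seteqP; split=> k /= /asboolP.
rewrite -(@bigfs _ _ _ _ (index_enum I)) ?index_enum_uniq//; last first.
  by move=> k _; rewrite mem_index_enum.
rewrite big_mkcond -sumEFin; apply: eq_bigr => k _; rewrite indicE.
case: asboolP => Ek; last by rewrite memNset ?mulr0.
by rewrite mem_set// mulr1 /mass fineK// fin_num_measure.
Qed.

End Fibres.

(** * Upper bounds for the Kantorovich-Rubinstein distance *)

Section WassersteinBounds.
Context {R : realType} {n : nat}.
Local Notation X := 'cV[R]_n.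
Implicit Types m : probability X R.

Lemma measurable_dist : measurable_fun setT (fun z : X * X => enorm (z.1 - z.2)).
Proof.
apply: (measurableT_comp (@measurable_enorm R n)); apply/measurable_fun_cVP => // i.
under eq_fun do rewrite coordB.
apply: measurable_funB.
  exact: (measurableT_comp (@measurable_coord R n i) measurable_fst).
exact: (measurableT_comp (@measurable_coord R n i) measurable_snd).
Qed.

Let mdist : measurable_fun setT (fun z : X * X => (enorm (z.1 - z.2))%:E).
Proof. by apply/measurable_EFinP; exact: measurable_dist. Qed.

Lemma d1_coupling m m' pi : coupling m m' pi ->
  (d1 m m' <= \int[pi]_z (enorm (z.1 - z.2))%:E)%E.
Proof. by move=> c; apply: ereal_inf_lbound; exists pi. Qed.

(** The law of the pair [(f, g)] under [P] is a coupling. *)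
Lemma d1_image (disp : measure_display) (S : measurableType disp) (P : probability S R)
    (f g : S -> X) m m' :
  measurable_fun setT f -> measurable_fun setT g ->
  (forall E, measurable E -> m E = P (f @^-1` E)) ->
  (forall E, measurable E -> m' E = P (g @^-1` E)) ->
  (d1 m m' <= \int[P]_s (enorm (f s - g s))%:E)%E.
Proof.
move=> mf mg mE mE'.
have mfg : measurable_fun setT (fun s => (f s, g s)) by exact: measurable_fun_pair.
have [pi [piE piI]] := image_probability P mfg.
rewrite -(piI (fun z => (enorm (z.1 - z.2))%:E))//; last first.
  by move=> z; rewrite lee_fin enorm_ge0.
apply: d1_coupling => E mE0; rewrite !piE mE// mE'//; split; congr (P _).
  by apply/seteqP; split=> s //= [].
by apply/seteqP; split=> s //= [].
Qed.

(* The common part of the weights is left in place, and the excess of the first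
   is sent to the excess of the second by the product plan. *)
Lemma d1_simple (disp : measure_display) (S : measurableType disp) (P P' : probability S R)
    (I : finType) (f : S -> I) (a : I -> X) (M : R) m m' :
  (forall k, measurable (f @^-1` [set k])) -> (forall k, enorm (a k) <= M) ->
  (forall E, measurable E -> m E = P ((a \o f) @^-1` E)) ->
  (forall E, measurable E -> m' E = P' ((a \o f) @^-1` E)) ->
  (d1 m m' <= (2 * M * \sum_k `|mass P f k - mass P' f k|)%:E)%E.
Proof.
move=> mf aM mE mE'.
pose p := mass P f; pose q := mass P' f.
have p1 : \sum_k p k = 1.
  have := probability_fibre P mf a setT; rewrite preimage_setT probability_setT => -[->].
  by apply: eq_bigr => k _; rewrite indicT mulr1.
have q1 : \sum_k q k = 1.
  have := probability_fibre P' mf a setT; rewrite preimage_setT probability_setT => -[->].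
  by apply: eq_bigr => k _; rewrite indicT mulr1.
pose u k := Num.max 0 (p k - q k); pose v k := Num.max 0 (q k - p k).
have u0 k : 0 <= u k by rewrite le_max lexx.
have v0 k : 0 <= v k by rewrite le_max lexx.
have uvE k : u k - v k = p k - q k.
  by rewrite /u /v; have [h|h] := leP (p k) (q k); [rewrite max_l ?max_r|rewrite max_r ?max_l]; lra.
have uv : \sum_k u k = \sum_k v k.
  by apply/eqP; rewrite -subr_eq0 -sumrB (eq_bigr _ (fun k _ => uvE k)) sumrB p1 q1 subrr.
pose De := \sum_k u k.
have De0 : 0 <= De by apply: sumr_ge0.
(* The excess [De] may vanish, and then so do [u] and [v]; division by zero gives the right value in
   that case. *)
have DeV x : 0 <= x <= De -> x * De / De = x.
  move=> /andP[x0 xD]; have [D0|D0] := eqVneq De 0; last by rewrite mulfK.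
  have -> : x = 0 by apply/eqP; rewrite eq_le x0 andbT -D0.
  by rewrite !mul0r.
have uD k : 0 <= u k <= De by rewrite u0 /De (bigD1 k)//= lerDl sumr_ge0.
have vD k : 0 <= v k <= De by rewrite v0 /De uv (bigD1 k)//= lerDl sumr_ge0.
(* Here [p - u] is the common part [min p q], kept on the diagonal. *)
pose c (z : I * I) : R := (z.1 == z.2)%:R * (p z.1 - u z.1) + u z.1 * v z.2 / De.
have pu k : 0 <= p k - u k.
  rewrite subr_ge0 ge_max mass_ge0 lerBlDr lerDl; exact: mass_ge0.
have c0 z : 0 <= c z by rewrite addr_ge0 ?mulr_ge0 ?invr_ge0.
have pair_sum (F : I * I -> R) : \sum_z F z = \sum_k \sum_l F (k, l).
  by rewrite (pair_big xpredT xpredT (fun k l => F (k, l))); apply: eq_bigr => -[].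
have diag (F : I -> R) k : \sum_l (k == l)%:R * F l = F k.
  rewrite (bigD1 k)//= eqxx mul1r big1 ?addr0// => l /negbTE; rewrite eq_sym => ->.
  by rewrite mul0r.
have row k : \sum_l c (k, l) = p k.
  have E2 : \sum_l u k * v l / De = u k by rewrite -mulr_suml -mulr_sumr -uv -/De DeV.
  rewrite big_split/= E2.
  rewrite (eq_bigr (fun l => (k == l)%:R * (p k - u k)))// (diag (fun=> p k - u k)).
  by rewrite subrK.
have col l : \sum_k c (k, l) = q l.
  have E2 : \sum_k u k * v l / De = v l by rewrite -!mulr_suml -/De [De * _]mulrC DeV.
  rewrite big_split/= E2.
  rewrite (eq_bigr (fun k => (l == k)%:R * (p k - u k))); last by move=> k _; rewrite eq_sym.
  by rewrite (diag (fun k => p k - u k)); have := uvE l; lra.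
have c1 : \sum_z c z = 1 by rewrite pair_sum (eq_bigr _ (fun k _ => row k)).
have [pi [piE piI]] := mixture (fun z : I * I => \d_(a z.1, a z.2) : probability (X * X)%type R) c0 c1.
have dE (z : I * I) (F : set (X * X)) :
    (\d_(a z.1, a z.2) : probability (X * X)%type R) F = ((a z.1, a z.2) \in F)%:R%:E.
  exact: diracE.
have cpl : coupling m m' pi.
  move=> E mE0; rewrite !piE mE// mE'// !(probability_fibre _ mf); split.
    under eq_bigr do rewrite dE -EFinM; rewrite sumEFin; congr (_%:E).
    rewrite pair_sum; apply: eq_bigr => k _; rewrite -/p -row mulr_suml.
    apply: eq_bigr => l _; rewrite indicE; congr (_ * _%:R).
    by congr nat_of_bool; apply/idP/idP; rewrite !inE /=; tauto.
  under eq_bigr do rewrite dE -EFinM; rewrite sumEFin; congr (_%:E).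
  rewrite pair_sum exchange_big/=; apply: eq_bigr => l _; rewrite -/q -col mulr_suml.
  apply: eq_bigr => k _; rewrite indicE; congr (_ * _%:R).
  by congr nat_of_bool; apply/idP/idP; rewrite !inE /=; tauto.
apply: le_trans (d1_coupling cpl) _.
rewrite piI//; last by move=> z; rewrite lee_fin enorm_ge0.
under eq_bigr => z _.
  have -> : (\int[(\d_(a z.1, a z.2) : probability (X * X)%type R)]_x (enorm (x.1 - x.2))%:E =
    (enorm (a z.1 - a z.2))%:E)%E by rewrite integral_dirac// diracE mem_setT mul1e.
  rewrite -EFinM.
  over.
rewrite sumEFin lee_fin pair_sum /=.
apply: (@le_trans _ _ (\sum_k \sum_l u k * v l / De * (2 * M))).
  apply: ler_sum => k _; apply: ler_sum => l _; rewrite /c /=.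
  have [->|kl] := eqVneq k l.
    rewrite subrr enorm0 mulr0 mulr_ge0 ?mulr_ge0 ?invr_ge0//.
    by rewrite (le_trans (enorm_ge0 (a l)) (aM l)).
  rewrite mul0r add0r ler_wpM2l ?mulr_ge0 ?invr_ge0//.
  by apply: le_trans (ler_enormB _ _) _; have := aM k; have := aM l; lra.
have E2 k : \sum_l u k * v l / De * (2 * M) = u k * (2 * M).
  by rewrite -mulr_suml -mulr_suml -mulr_sumr -uv -/De DeV.
rewrite (eq_bigr _ (fun k _ => E2 k)).
rewrite -mulr_suml mulrC ler_wpM2l//.
  case: (pickP I) => [k _|I0]; last first.
    by move: p1; rewrite big1 => [/eqP|k]; [rewrite eq_sym oner_eq0|have := I0 k].
  by rewrite mulr_ge0// (le_trans (enorm_ge0 (a k)) (aM k)).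
by apply: ler_sum => k _; rewrite ge_max normr_ge0 ler_norm.
Qed.

End WassersteinBounds.

(** * Convergence of the flows of marginals *)

Section OpenDomination.
Context {R : realType} {n : nat}.
Local Notation X := 'cV[R]_n.

Lemma closed_exhaustion (G : set X) : open G -> exists F : nat -> set X,
  [/\ forall i, closed (F i), {homo F : i j / (i <= j)%N >-> (i <= j)%O} & \bigcup_i F i = G].
Proof.
move=> oG; pose F i : set X := \bigcap_(y in ~` G) [set x | i.+1%:R^-1 <= enorm (x - y)].
exists F; split.
- move=> i; apply: closed_bigI => y _.
  have c : continuous (fun x : X => enorm (x - y)).
    move=> x; apply: (@continuous_comp _ _ _ (fun x : X => x - y) (@enorm R n)).
      by apply: continuousB => //; exact: cst_continuous.
    exact: continuous_enorm.
  exact: (closed_comp (fun x _ => c x) (@closed_ge _ (i.+1%:R^-1))).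
- move=> i j ij; apply/subsetPset => x Fx y Gy /=; apply: le_trans (Fx y Gy).
  by rewrite lef_pV2 ?posrE// ler_nat.
- apply/seteqP; split=> [x [i _ Fx]|x Gx].
    apply: contrapT => nG; have := Fx x nG; rewrite /= subrr enorm0.
    by rewrite leNgt invr_gt0 ltr0n.
  have /nbhs_enormP[e e0 eG] : nbhs x G by exact: open_nbhs_nbhs.
  exists (Num.trunc e^-1) => // y nGy /=; rewrite leNgt; apply/negP => h; apply: nGy.
  apply: eG; apply: (lt_le_trans h); rewrite -[leRHS]invrK lef_pV2 ?posrE ?invr_gt0//.
  exact/ltW/truncnS_gt.
Qed.

(** Complements reverse the inequality on closed sets because both masses are 1; exhausting an open
    set by closed ones turns it into an equality on open sets, which form a generating family stable
    under intersection. *)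
Lemma probability_eq_of_open_le (P Q : probability X R) :
  (forall G, open G -> (P G <= Q G)%E) -> forall E, measurable E -> P E = Q E.
Proof.
move=> PQ.
have mo (G : set X) : open G -> measurable G by move=> oG; exact: sub_sigma_algebra.
have mc (F : set X) : closed F -> measurable F.
  by move=> cF; rewrite -[F]setCK; apply: measurableC; apply: mo; exact: closed_openC.
have cle (F : set X) : closed F -> (Q F <= P F)%E.
  move=> cF; have := PQ (~` F) (closed_openC cF).
  rewrite !probability_setC; [|exact: mc..].
  have fP := fin_num_measure P F (mc F cF); have fQ := fin_num_measure Q F (mc F cF).
  by rewrite -(fineK fP) -(fineK fQ) -!(EFinB 1) !lee_fin lerD2l lerN2.
have oe (G : set X) : open G -> P G = Q G.
  move=> oG; apply/eqP; rewrite eq_le PQ//=.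
  have [F [cF hF FG]] := closed_exhaustion oG.
  have mU : measurable (\bigcup_i F i) by rewrite FG; exact: mo.
  have cQ := nondecreasing_cvg_mu (mu := Q) (fun i => mc _ (cF i)) mU hF.
  rewrite FG in cQ; apply: (cvge_to_le cQ); near=> i => /=.
  apply: le_trans (cle _ (cF i)) _; apply: le_measure; rewrite ?inE; [exact: mc|exact: mo|].
  by rewrite -FG; exact: bigcup_sup.
apply: (@measure_unique _ R X open (fun=> setT)) => //.
- by move=> A B; exact: openI.
- by move=> _; exact: openT.
- by apply/seteqP; split=> // x _; exists 0%N.
- by move=> _; apply: le_lt_trans (probability_le1 P measurableT) _; rewrite ltry.
Unshelve. all: by end_near.
Qed.

End OpenDomination.

(** * Lower semicontinuous integrands *)

Section LowerSemicontinuous.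
Context {R : realType} {disp : measure_display} {S : measurableType disp}.

(** A lower Riemann sum of the layer-cake formula with step [1 / n] and height at most [N / n]; it
    is a finite combination of indicators of strict superlevel sets of [f]. *)
Let stair (f : S -> \bar R) (n N : nat) (x : S) : R :=
  \sum_(j < N) n%:R^-1 * \1_[set x | (((j.+1)%:R / n%:R)%:E < f x)%E] x.

Let stairS f n N x : stair f n N.+1 x =
  stair f n N x + n%:R^-1 * (((N.+1)%:R / n%:R)%:E < f x)%E%:R.
Proof.
rewrite /stair big_ord_recr/= indicE; congr (_ + _ * _%:R).
by congr nat_of_bool; apply/idP/idP; rewrite inE.
Qed.

Let stair_ge0 f n N x : 0 <= stair f n N x.
Proof. by apply: sumr_ge0 => j _; rewrite mulr_ge0 ?invr_ge0. Qed.

Let stair_le f n N x : (0 <= f x)%E -> ((stair f n N x)%:E <= f x)%E.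
Proof.
move=> f0; suff [] : ((stair f n N x)%:E <= f x)%E /\ stair f n N x <= N%:R / n%:R by [].
elim: N => [|N [IH1 IH2]]; first by rewrite /stair big_ord0 mul0r lexx.
rewrite stairS; have [lt|le] := ltP ((N.+1)%:R / n%:R)%:E (f x).
  have h : stair f n N x + n%:R^-1 * 1 <= N.+1%:R / n%:R.
    by rewrite mulr1 -natr1 mulrDl mul1r lerD2r.
  by split=> //; apply: le_trans (ltW lt); rewrite lee_fin.
rewrite mulr0 addr0; split=> //; apply: (le_trans IH2).
by rewrite ler_wpM2r ?invr_ge0// ler_nat.
Qed.

Let stair_ge f n N x y : (y%:E < f x)%E ->
  stair f n N x = N%:R / n%:R \/ y - n%:R^-1 <= stair f n N x.
Proof.
move=> yf; elim: N => [|N IH]; first by left; rewrite /stair big_ord0 mul0r.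
rewrite stairS; case: IH => [E|h]; last first.
  by right; apply: (le_trans h); rewrite lerDl mulr_ge0 ?invr_ge0.
have [lt|le] := ltP ((N.+1)%:R / n%:R)%:E (f x).
  by left; rewrite E mulr1 -natr1 mulrDl mul1r.
right; rewrite mulr0 addr0 E lerBlDr.
have := lt_le_trans yf le; rewrite lte_fin -natr1 mulrDl mul1r; exact: ltW.
Qed.

Let stair_ge' f n x y : (0 < n)%N -> (y%:E < f x)%E -> y <= n%:R ->
  y - n%:R^-1 <= stair f n (n * n) x.
Proof.
move=> n0 yf yn; have [->|//] := stair_ge n (n * n) yf.
by rewrite natrM mulfK ?pnatr_eq0 -?lt0n// lerBlDr (le_trans yn)// lerDl invr_ge0.
Qed.

Let stair_cvg f x : (0 <= f x)%E -> (stair f n (n * n) x)%:E @[n --> \oo] --> f x.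
Proof.
move=> f0; case E : (f x) f0 => [y| |//] f0.
  apply/cvg_EFin; first by near=> n.
  apply/cvgrPdist_le => e e0; near=> n.
  have n0 : (0 < n)%N by near: n; exact: nbhs_infty_gt.
  have up := @stair_le f n (n * n) x; rewrite E lee_fin in up.
  rewrite ger0_norm ?subr_ge0; last exact: up.
  have [y0|y0] := leP y e; first by apply: le_trans y0; rewrite gerBl stair_ge0.
  have ne : n%:R^-1 <= e / 2.
    rewrite -[leRHS]invrK lef_pV2 ?posrE ?invr_gt0 ?divr_gt0 ?ltr0n//.
    by near: n; exact: nbhs_infty_ger.
  have yn : y <= n%:R by near: n; exact: nbhs_infty_ger.
  have h := @stair_ge' f n x (y - e / 2) n0; rewrite E lte_fin in h.
  have /h{h} : y - e / 2 < y by rewrite ltrBlDr ltrDl divr_gt0.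
  have e2 : 0 < e / 2 by rewrite divr_gt0.
  have yen : y - e / 2 <= n%:R by apply: le_trans yn; lra.
  by move/(_ yen) => /=; lra.
apply/cvgeyPge => M; near=> n; rewrite lee_fin.
have n0 : (0 < n)%N by near: n; exact: nbhs_infty_gt.
have h := @stair_ge' f n x n%:R n0; rewrite E ltry in h.
apply: le_trans (h isT (lexx _)); rewrite lerBrDr.
apply: (@le_trans _ _ (M + 1)); last by near: n; exact: nbhs_infty_ger.
by rewrite lerD2l invf_le1 ?ltr0n// ler1n.
Unshelve. all: by end_near.
Qed.

(** The integral of a staircase involves finitely many superlevel sets, on which [eta] is below [h]
    and the masses of [nu y] tend to [h]. Fatou's lemma then passes from the staircases to [f]. *)
Lemma integral_lsc_le (Y : Type) (F : set_system Y) (FU : UltraFilter F)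
    (nu : Y -> probability S R) (eta : probability S R) (h : set S -> R)
    (f : S -> \bar R) (r : R) : (forall x, (0 <= f x)%E) ->
  (forall c : R, 0 <= c -> measurable [set x | (c%:E < f x)%E]) ->
  (forall c : R, 0 <= c -> (eta [set x | (c%:E < f x)%E] <= (h [set x | (c%:E < f x)%E])%:E)%E) ->
  (forall E, measurable E -> fine (nu y E) @[y --> F] --> h E) ->
  F [set y | (\int[nu y]_x f x <= r%:E)%E] ->
  (\int[eta]_x f x <= r%:E)%E.
Proof.
move=> f0 mf etah nuh Fr; have FP : ProperFilter F by exact: ultra_proper.
have c0 n (j : nat) : 0 <= j.+1%:R / n%:R :> R by rewrite divr_ge0.
have mi n j : measurable_fun setT (\1_[set x | (((j.+1)%:R / n%:R)%:E < f x)%E] : S -> R).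
  exact/measurable_indic/mf.
have Is (P : probability S R) n : (\int[P]_x (stair f n (n * n) x)%:E)%E =
    (\sum_(j < n * n) n%:R^-1 * fine (P [set x | (((j.+1)%:R / n%:R)%:E < f x)%E]))%:E.
  have -> : (\int[P]_x (stair f n (n * n) x)%:E = \int[P]_x \sum_(j < n * n) (n%:R^-1 * \1_[set x | (((j.+1)%:R / n%:R)%:E < f x)%E] x)%:E)%E.
    by apply: eq_integral => x _; rewrite sumEFin.
  rewrite ge0_integral_sum//; last first.
    by move=> j; apply/measurable_EFinP; apply: measurable_funM; [exact: measurable_cst|exact: mi].
  rewrite -sumEFin; apply: eq_bigr => j _.
  have -> : (\int[P]_x (n%:R^-1 * \1_[set x | (((j.+1)%:R / n%:R)%:E < f x)%E] x)%:E =
    \int[P]_x ((n%:R^-1)%:E * (\1_[set x | (((j.+1)%:R / n%:R)%:E < f x)%E] x)%:E))%E.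
    by apply: eq_integral => x _; rewrite EFinM.
  rewrite ge0_integralZl ?lee_fin ?invr_ge0//; last first.
    by apply/measurable_EFinP; exact: mi.
  rewrite integral_indic// ?setIT; last exact: mf.
  by rewrite [RHS]EFinM fineK// fin_num_measure//; exact: mf.
have ms n : measurable_fun setT (fun x => (stair f n (n * n) x)%:E).
  apply/measurable_EFinP; apply: measurable_sum => j; apply: measurable_funM; [exact: measurable_cst|exact: mi].
have le n : (\int[eta]_x (stair f n (n * n) x)%:E <= r%:E)%E.
  apply: (@le_trans _ _ (\sum_(j < n * n) n%:R^-1 * h [set x | (((j.+1)%:R / n%:R)%:E < f x)%E])%:E).
    rewrite Is lee_fin; apply: ler_sum => j _; rewrite ler_wpM2l ?invr_ge0//.
    rewrite -lee_fin fineK; first exact: etah.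
    by rewrite fin_num_measure//; exact: mf.
  rewrite lee_fin; have c : \sum_(j < n * n) n%:R^-1 * fine (nu y [set x | (((j.+1)%:R / n%:R)%:E < f x)%E]) @[y --> F] -->
     \sum_(j < n * n) n%:R^-1 * h [set x | (((j.+1)%:R / n%:R)%:E < f x)%E].
    apply: cvg_bigsum => j; apply: cvgM; first exact: cvg_cst.
    by apply: nuh; exact: mf.
  apply: (cvgr_to_le c); apply: filterS Fr => y; rewrite -lee_fin -Is; apply: le_trans.
  by apply: ge0_integral_mono => // x _; [rewrite lee_fin|exact: stair_le].
apply: (@le_trans _ _ (\int[eta]_x limn_einf (fun n => (stair f n (n * n) x)%:E))%E).
  apply: ge0_integral_mono => // x _; have c := stair_cvg (f0 x).
  by have [-> _] := cvg_limn_einf_sup c.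
apply: le_trans (fatou eta measurableT ms _) _ => //.
  by move=> n x _; rewrite lee_fin.
rewrite limn_einf_lim; apply: lime_le; first exact: is_cvg_einfs.
near=> n; apply: le_trans (le n); apply: ereal_inf_lbound.
by exists n => //=; rewrite leqnn.
Unshelve. all: by end_near.
Qed.

End LowerSemicontinuous.

Section PowerBounds.
Context {R : realType}.

Lemma ler_one_powR (x a : R) : 0 <= x -> 1 <= a -> x <= 1 + x `^ a.
Proof.
move=> x0 a1; have [x1|x1] := leP x 1; first by rewrite (le_trans x1)// lerDl powR_ge0.
apply: (@le_trans _ _ (x `^ a)); last by rewrite lerDr.
by rewrite -[leLHS](powRr1 x0) ler_powR// ltW.
Qed.

Lemma lee_one_poweR (x : \bar R) (a : R) : (0 <= x)%E -> 1 <= a -> (x <= 1 + x `^ a)%E.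
Proof.
case: x => [x| |//] x0 a1; first by rewrite poweR_EFin -EFinD lee_fin ler_one_powR.
by rewrite poweRyr ?gt_eqF ?(lt_le_trans ltr01)// addey.
Qed.

Lemma powRD_le (x y a : R) : 0 <= x -> 0 <= y -> 0 <= a ->
  (x + y) `^ a <= 2 `^ a * (x `^ a + y `^ a).
Proof.
move=> x0 y0 a0; wlog xy : x y x0 y0 / x <= y.
  move=> H; have [xy|yx] := leP x y; first exact: H.
  by rewrite [x + y]addrC [X in _ * X]addrC; apply: H => //; exact: ltW.
apply: (@le_trans _ _ ((2 * y) `^ a)).
  by apply: ge0_ler_powR => //; rewrite ?nnegrE ?addr_ge0 ?mulr_ge0//; lra.
by rewrite powRM// ler_wpM2l ?powR_ge0// lerDr powR_ge0.
Qed.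

Lemma markov_le {disp} {S : measurableType disp} (P : probability S R) (E : set S)
    (f : S -> \bar R) (c : R) : measurable E -> 0 <= c -> (forall x, (0 <= f x)%E) ->
  (forall x, E x -> (c%:E <= f x)%E) -> (c%:E * P E <= \int[P]_x f x)%E.
Proof.
move=> mE c0 f0 cf; rewrite -[E]setIT -integral_indic// -ge0_integralZl ?lee_fin//; last first.
  exact/measurable_EFinP/measurable_indic.
apply: ge0_integral_mono => // x _; first by rewrite -EFinM lee_fin mulr_ge0.
rewrite indicE; have [|] := boolP (x \in E).
  by rewrite inE mule1; exact: cf.
by rewrite mule0.
Qed.

End PowerBounds.

(** * Moments, tightness and limits in [PGamma] *)

Section Velocity.
Context {R : realType} {d k : nat}.
Variables (A : 'M[R]_d) (B : 'M[R]_(d, k)) (T : R).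
Hypothesis T0 : 0 < T.
Local Notation mu := (@lebesgue_measure R).
Local Notation X := 'cV[R]_d.
Local Notation D := (`[0, T]%classic).
Local Notation Gam := (Gamma A B T).
Local Notation Pr := (probability Gam R).
Implicit Types (g : Gam) (eta : Pr).

Let D0 : D 0. Proof. by rewrite /= in_itv/= lexx ltW. Qed.

Lemma kinetic_ge0 g : (0 <= kinetic g)%E.
Proof. by apply: integral_ge0 => t _; rewrite lee_fin sqr_ge0. Qed.

Lemma velocityE g : velocity_norm2 g = (kinetic g `^ 2^-1)%E.
Proof. by []. Qed.

Lemma velocity_ge0 g : (0 <= velocity_norm2 g)%E.
Proof. by rewrite velocityE poweR_ge0. Qed.

(** The velocity norm to the power [a] is the kinetic energy to the power [a / 2], and [2 / a]
    inverts that exponent. Superlevel sets are thus complements of closed sets. *)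
Lemma velocity_gtE (a c : R) : 0 < a -> 0 <= c ->
  [set g | (c%:E < velocity_norm2 g `^ a)%E] = ~` [set g : Gam | (kinetic g <= (c `^ (2 / a))%:E)%E].
Proof.
move=> a0 c0; have E g : (velocity_norm2 g `^ a = kinetic g `^ (2^-1 * a))%E.
  by rewrite velocityE poweRrM.
have i0 (x : \bar R) : (0 <= x)%E -> x \in `[0, +oo%E]%R by move=> x0; rewrite in_itv/= x0 leey.
have b0 : 0 <= 2^-1 * a by rewrite mulr_ge0 ?invr_ge0 ?ltW.
have b0' : 0 <= 2 / a by rewrite divr_ge0 ?ltW.
have ab : 2 / a * (2^-1 * a) = 1 by field; rewrite gt_eqF.
have ab' : 2^-1 * a * (2 / a) = 1 by field; rewrite gt_eqF.
apply/seteqP; split=> g /=; rewrite E ltNge => /negP h.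
  move=> kc; apply: h; have := gt0_ler_poweR b0 (i0 _ (kinetic_ge0 g)) (i0 _ _) kc.
  by rewrite poweR_EFin -powRrM ab powRr1//; apply; rewrite lee_fin powR_ge0.
apply/negP => kc; move/negP: h; apply; have := gt0_ler_poweR b0' (i0 _ _) (i0 _ _) kc.
rewrite -poweRrM ab' poweRe1 ?kinetic_ge0// poweR_EFin; apply; first exact: poweR_ge0.
by rewrite lee_fin.
Qed.

Lemma open_velocity_gt (a c : R) : 0 < a -> 0 <= c -> open [set g : Gam | (c%:E < velocity_norm2 g `^ a)%E].
Proof.
move=> a0 c0; rewrite velocity_gtE//; apply: closed_openC.
by apply: kinetic_closed => //; exact: powR_ge0.
Qed.

Lemma measurable_velocity_powR (a : R) : 0 < a ->
  measurable_fun setT (fun g => (velocity_norm2 g `^ a)%E).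
Proof.
move=> a0; apply: (measurability _ (ErealGenOInfty.measurableE R)) => _ [_ [c ->] <-].
rewrite setTI; have [c0|c0] := leP 0 c.
  rewrite (_ : _ @^-1` _ = [set g : Gam | (c%:E < velocity_norm2 g `^ a)%E]).
    by apply: open_measurable_Gamma; exact: open_velocity_gt.
  by apply/seteqP; split=> g /=; rewrite in_itv/= andbT.
rewrite (_ : _ @^-1` _ = setT)//; apply/seteqP; split=> g //= _; rewrite in_itv/= andbT.
by apply: lt_le_trans (poweR_ge0 _ _); rewrite lte_fin.
Qed.

(** Cauchy-Schwarz in time for each coordinate. The factor is [d.+1] so that it stays positive when
    [d = 0], which makes the bound infinite for a curve of infinite energy. *)
Lemma ev_increment g s t : D s -> D t ->
  ((enorm (ev t g - ev s g))%:E <= (Num.sqrt (d.+1%:R * `|t - s|))%:E * velocity_norm2 g)%E.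
Proof.
move=> Ds Dt; have [->|ts] := eqVneq t s.
  by rewrite subrr enorm0 mule_ge0 ?velocity_ge0// lee_fin sqrtr_ge0.
have c0 : 0 < Num.sqrt (d.+1%:R * `|t - s|).
  by rewrite sqrtr_gt0 mulr_gt0// normr_gt0 subr_eq0.
have := kinetic_ge0 g; case E : (kinetic g) => [K| |//] K0; last first.
  by rewrite velocityE E poweRyr ?invr_eq0 ?pnatr_eq0// gt0_muley ?lte_fin// leey.
rewrite lee_fin in K0; have KE : (kinetic g <= K%:E)%E by rewrite E.
have [h _] := (kinetic_leP T0 g K0).1 KE.
rewrite velocityE E poweR_EFin -EFinM lee_fin powR12_sqrt// -sqrtrM ?mulr_ge0//.
rewrite -[leLHS]ger0_norm ?enorm_ge0// -sqrtr_sqr ler_sqrt; last by rewrite !mulr_ge0.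
rewrite sqr_enormE; apply: (@le_trans _ _ (\sum_(i < d) K * `|t - s|)).
  by apply: ler_sum => i _; rewrite coordB; exact: h.
rewrite sumr_const card_ord -[X in X <= _]mulr_natl [leLHS](_ : _ = d%:R * `|t - s| * K); last by ring.
by rewrite ler_wpM2r// ler_wpM2r// ler_nat.
Qed.

Variables (a r : R) (m0 : probability X R).
Hypothesis a1 : 1 < a.
Hypothesis m0a : finite_moment a m0.
Let a0 : 0 < a. Proof. exact: lt_trans a1. Qed.

Let mev t : measurable_fun setT (fun g : Gam => enorm (ev t g)).
Proof. exact: (measurableT_comp (@measurable_enorm R d) (@measurable_ev _ _ _ A B T t)). Qed.

Let mom0 : exists2 b, 0 <= b & forall eta, PGamma a m0 r eta ->
  (\int[eta]_g (enorm (ev 0 g) `^ a)%:E <= b%:E)%E.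
Proof.
have mm : moment a m0 \is a fin_num.
  by rewrite ge0_fin_numE//; apply: integral_ge0 => x _; rewrite lee_fin powR_ge0.
exists (fine (moment a m0)).
  by apply: fine_ge0; apply: integral_ge0 => x _; rewrite lee_fin powR_ge0.
move=> eta [_ e0]; rewrite fineK//.
have mp : measurable_fun setT (fun x : X => (enorm x `^ a)%:E).
  apply/measurable_EFinP; apply: (measurableT_comp (measurable_powR a)).
  exact: measurable_enorm.
rewrite -(ge0_integral_distribution (ev 0 : {RV eta >-> X}) mp); last first.
  by move=> x; rewrite lee_fin powR_ge0.
rewrite le_eqVlt; apply/orP; left; apply/eqP.
by apply: eq_measure_integral => E mE _; exact: e0.
Qed.

Lemma r_ge0 eta : PGamma a m0 r eta -> 0 <= r.
Proof.
move=> [h _]; rewrite -lee_fin; apply: le_trans h; apply: integral_ge0 => g _.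
exact: poweR_ge0.
Qed.

Lemma marginal_moment : exists2 b, 0 <= b & forall eta t, PGamma a m0 r eta -> D t ->
  (\int[eta]_g (enorm (ev t g) `^ a)%:E <= b%:E)%E.
Proof.
have [b b0 H0] := mom0; pose K := Num.sqrt (d.+1%:R * T) `^ a.
have K0 : 0 <= K by exact: powR_ge0.
exists (2 `^ a * (b + K * Num.max 0 r)).
  by rewrite mulr_ge0 ?powR_ge0// addr_ge0// mulr_ge0// le_max lexx.
move=> eta t eP Dt; have r0 := r_ge0 eP; rewrite max_r//.
have mV := measurable_velocity_powR a0.
have mp : measurable_fun setT (fun g : Gam => (enorm (ev 0 g) `^ a)%:E).
  by apply/measurable_EFinP; exact: (measurableT_comp (measurable_powR a) (mev 0)).
have V0 g : (0 <= velocity_norm2 g `^ a)%E by exact: poweR_ge0.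
apply: (@le_trans _ _ (\int[eta]_g ((2 `^ a)%:E * ((enorm (ev 0 g) `^ a)%:E + K%:E * velocity_norm2 g `^ a)))%E).
  apply: ge0_integral_mono => [g _|g _]; first by rewrite lee_fin powR_ge0.
  have := ev_increment g D0 Dt; have := velocity_ge0 g.
  case E : (velocity_norm2 g) => [v| |//] v0 h; last first.
    rewrite poweRyr ?gt_eqF//; have [Kp|] := ltP 0 K; last first.
      rewrite le_eqVlt ltNge K0 orbF /K powR_eq0 sqrtr_eq0 leNgt mulr_gt0//.
    by rewrite gt0_muley ?lte_fin// addey// gt0_muley ?leey// lte_fin powR_gt0.
  rewrite poweR_EFin -(EFinM K) -EFinD -EFinM lee_fin; rewrite -EFinM lee_fin in h.
  rewrite lee_fin in v0.
  have t0T : `|t - 0| <= T.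
    by move: Dt; rewrite /= in_itv/= subr0 => /andP[? ?]; rewrite ger0_norm.
  have h2 : enorm (ev t g) <= enorm (ev 0 g) + Num.sqrt (d.+1%:R * T) * v.
    have -> : ev t g = ev 0 g + (ev t g - ev 0 g) by rewrite addrC subrK.
    apply: le_trans (ler_enormD _ _) _; rewrite lerD2l; apply: (le_trans h).
    by rewrite ler_wpM2r// ler_sqrt ?mulr_ge0 ?(ltW T0)// ler_wpM2l.
  apply: (@le_trans _ _ ((enorm (ev 0 g) + Num.sqrt (d.+1%:R * T) * v) `^ a)).
    by apply: ge0_ler_powR; rewrite ?nnegrE ?(ltW a0) ?enorm_ge0 ?addr_ge0 ?mulr_ge0 ?sqrtr_ge0 ?enorm_ge0.
  rewrite /K -powRM ?sqrtr_ge0//; apply: powRD_le; rewrite ?enorm_ge0 ?(ltW a0)// mulr_ge0// sqrtr_ge0.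
rewrite ge0_integralZl ?lee_fin ?powR_ge0//; last 2 first.
- by apply: emeasurable_funD => //; apply: emeasurable_funM => //; exact: measurable_cst.
- by move=> g _; rewrite adde_ge0 ?lee_fin ?powR_ge0// mule_ge0.
rewrite EFinM lee_wpmul2l ?lee_fin ?powR_ge0//.
rewrite ge0_integralD//; last 3 first.
- by move=> g _; rewrite lee_fin powR_ge0.
- by move=> g _; rewrite mule_ge0.
- by apply: emeasurable_funM => //; exact: measurable_cst.
rewrite EFinD; apply: leeD; first by exact: (H0 _ eP).
rewrite ge0_integralZl ?lee_fin// EFinM lee_wpmul2l ?lee_fin//.
by case: eP.
Qed.

Lemma ball_tail (e : R) : 0 < e -> exists2 M : R, 0 <= M & forall eta t, PGamma a m0 r eta -> D t ->
  (eta [set g : Gam | (M < enorm (ev t g))%R] <= e%:E)%E.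
Proof.
move=> e0; have [b b0 H] := marginal_moment.
exists ((b / e + 1) `^ a^-1); first exact: powR_ge0.
have be : 0 < b / e + 1 by rewrite ltr_wpDl// divr_ge0// ltW.
move=> eta t eP Dt; set E := [set g | _].
have mE : measurable E.
  rewrite (_ : E = setT `&` (fun g : Gam => enorm (ev t g)) @^-1` `](b / e + 1) `^ a^-1, +oo[%classic); last first.
    by apply/seteqP; split=> g; rewrite /E /= in_itv/= andbT; [split|case].
  by apply: mev => //; exact: measurable_itv.
have := @markov_le R _ _ eta E (fun g => (enorm (ev t g) `^ a)%:E) (b / e + 1) mE (ltW be).
move=> /(_ _ _)M; have {}M : ((b / e + 1)%:E * eta E <= b%:E)%E.
  apply: le_trans (M _ _) (H _ _ eP Dt) => g; first by rewrite lee_fin powR_ge0.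
  rewrite /E /= lee_fin => h.
  have -> : b / e + 1 = ((b / e + 1) `^ a^-1) `^ a.
    by rewrite -powRrM mulVf ?gt_eqF// powRr1// ltW.
  by apply: ge0_ler_powR; rewrite ?nnegrE ?(ltW a0) ?powR_ge0 ?enorm_ge0// ltW.
have fE : eta E \is a fin_num by exact: fin_num_measure.
rewrite -(fineK fE) lee_fin; rewrite -(fineK fE) -EFinM lee_fin in M.
rewrite -(ler_pM2l be); apply: (le_trans M).
by rewrite mulrDl divfK ?gt_eqF// lerDl mul1r ltW.
Qed.

(** Markov's inequality for the initial point and for the velocity, half of [e] each. With
    [level_compact] this is uniform tightness of [PGamma]. *)
Lemma level_tight (e : R) : 0 < e -> exists2 M : R, 0 <= M & forall eta, PGamma a m0 r eta ->
  (eta (~` level M : set Gam) <= e%:E)%E.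
Proof.
move=> e0; have e2 : 0 < e / 2 by rewrite divr_gt0.
have [M1 M10 H1] := ball_tail e2.
(* The threshold must be chosen before any [eta], while [r_ge0] needs one; hence the positive part
   of [r]. *)
pose c := 2 * Num.max 0 r / e + 1.
have c0 : 0 < c by rewrite ltr_wpDl// divr_ge0 ?mulr_ge0 ?le_max ?lexx// ltW.
pose M2 := c `^ (2 / a); pose M := Num.max M1 M2.
have M0 : 0 <= M by rewrite le_max M10.
exists M => // eta eP; pose E := [set g : Gam | (c%:E < velocity_norm2 g `^ a)%E].
have mE : measurable E by apply: open_measurable_Gamma; apply: open_velocity_gt => //; exact: ltW.
have hE : (eta E <= (e / 2)%:E)%E.
  have := @markov_le R _ _ eta E (fun g => (velocity_norm2 g `^ a)%E) c mE (ltW c0).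
  move=> /(_ _ _)H; have {}H : (c%:E * eta E <= r%:E)%E.
    apply: le_trans (H _ _) eP.1 => g; first exact: poweR_ge0.
    exact: ltW.
  have fE : eta E \is a fin_num by exact: fin_num_measure.
  rewrite -(fineK fE) lee_fin; rewrite -(fineK fE) -EFinM lee_fin in H.
  rewrite -(ler_pM2l c0); apply: (le_trans H); rewrite /c max_r ?(r_ge0 eP)//.
  have -> : (2 * r / e + 1) * (e / 2) = r + e / 2 by field; rewrite gt_eqF.
  by rewrite lerDl ltW.
pose E1 := [set g : Gam | M1 < enorm (ev 0 g)].
have mE1 : measurable E1.
  rewrite (_ : E1 = setT `&` (fun g : Gam => enorm (ev 0 g)) @^-1` `]M1, +oo[%classic); last first.
    by apply/seteqP; split=> g; rewrite /E1 /= in_itv/= andbT; [split|case].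
  by apply: mev => //; exact: measurable_itv.
apply: (@le_trans _ _ (eta (E1 `|` E))).
  apply: le_measure; rewrite ?inE.
  - apply: open_measurable_Gamma; apply: closed_openC; exact: level_closed.
  - exact: measurableU.
  - move=> g nl; have [g1|g1] := ltP M1 (enorm (ev 0 g)); first by left.
    right; rewrite /E velocity_gtE ?(ltW c0)//= => k2; apply: nl; split.
      by rewrite (le_trans g1)// le_max lexx.
    by apply: le_trans k2 _; rewrite lee_fin le_max lexx orbT.
apply: le_trans (measureU2 _ _ _) _ => //.
by rewrite [e in e%:E]splitr EFinD leeD// H1.
Qed.

Lemma marginal_moment_fin eta t : PGamma a m0 r eta -> D t ->
  finite_moment a (marginal eta t) /\ finite_moment 1 (marginal eta t).
Proof.
move=> eP Dt; have [b b0 H] := marginal_moment.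
have mp c : measurable_fun setT (fun x : X => (enorm x `^ c)%:E).
  apply/measurable_EFinP; apply: (measurableT_comp (measurable_powR c)).
  exact: measurable_enorm.
have E c : moment c (marginal eta t) = (\int[eta]_g (enorm (ev t g) `^ c)%:E)%E.
  by rewrite /moment (ge0_integral_distribution (ev t : {RV eta >-> X}) (mp c))// => x; rewrite lee_fin powR_ge0.
have ma : finite_moment a (marginal eta t).
  by rewrite /finite_moment E; apply: le_lt_trans (H _ _ eP Dt) _; rewrite ltry.
split=> //; rewrite /finite_moment.
apply: (@le_lt_trans _ _ (\int[marginal eta t]_x (1%:E + (enorm x `^ a)%:E))%E).
  apply: ge0_integral_mono => x _; first by rewrite lee_fin powR_ge0.
  by rewrite -EFinD lee_fin powRr1 ?enorm_ge0// ler_one_powR ?enorm_ge0// ltW.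
rewrite ge0_integralD//; last by move=> x _; rewrite lee_fin powR_ge0.
rewrite lte_add_pinfty// integral_cst// mul1e.
by apply: le_lt_trans (probability_le1 (marginal eta t) measurableT) _; rewrite ltry.
Qed.

(** The flow is 1/2-Hölder with a constant independent of [eta]: the pair of evaluations is a
    coupling, and the velocity norm is at most [1] plus its power [a], whose integral is at most
    [r]. *)
Lemma marginal_modulus : exists2 c, 0 <= c & forall eta s t, PGamma a m0 r eta -> D s -> D t ->
  (d1 (marginal eta t) (marginal eta s) <= (c * Num.sqrt `|t - s|)%:E)%E.
Proof.
exists (Num.sqrt d.+1%:R * (1 + Num.max 0 r)).
  by rewrite mulr_ge0 ?sqrtr_ge0// addr_ge0// le_max lexx.
move=> eta s t eP Ds Dt; have r0 := r_ge0 eP; rewrite max_r//.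
apply: le_trans (d1_image (P := eta) (f := ev t) (g := ev s) _ _ _ _) _ => //.
have mV := measurable_velocity_powR a0.
apply: (@le_trans _ _ (\int[eta]_g ((Num.sqrt (d.+1%:R * `|t - s|))%:E * (1%:E + velocity_norm2 g `^ a)))%E).
  apply: ge0_integral_mono => g _; first by rewrite lee_fin enorm_ge0.
  apply: le_trans (ev_increment g Ds Dt) _; rewrite lee_wpmul2l ?lee_fin ?sqrtr_ge0//.
  by apply: lee_one_poweR; [exact: velocity_ge0|exact: ltW].
rewrite ge0_integralZl ?lee_fin ?sqrtr_ge0//; last 2 first.
- by apply: emeasurable_funD => //; exact: measurable_cst.
- by move=> g _; rewrite adde_ge0// poweR_ge0.
rewrite ge0_integralD//; last by move=> g _; exact: poweR_ge0.
rewrite integral_cst// mul1e (_ : eta setT = 1%E); last exact: probability_setT.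
have -> : Num.sqrt d.+1%:R * (1 + r) * Num.sqrt `|t - s| = Num.sqrt (d.+1%:R * `|t - s|) * (1 + r).
  by rewrite sqrtrM//; ring.
by rewrite EFinM lee_wpmul2l ?lee_fin ?sqrtr_ge0// EFinD leeD2l//; case: eP.
Qed.

(** The limits of the masses form a finitely additive tight [h], and [tight_limit] supplies [eta].
    The velocity moment passes to [eta] because its strict superlevel sets are open. *)
Theorem limit_measure (Y : Type) (F : set_system Y) (FU : UltraFilter F) (nu : Y -> Pr) :
  F [set y | PGamma a m0 r (nu y)] ->
  exists h : set Gam -> R, exists eta : Pr, [/\ forall E, measurable E -> fine (nu y E) @[y --> F] --> h E,
    PGamma a m0 r eta & forall G, open G -> (eta G <= (h G)%:E)%E].
Proof.
move=> FP; have FF : ProperFilter F by exact: ultra_proper.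
have fb y E : measurable E -> 0 <= fine (nu y E) <= 1.
  move=> mE; rewrite fine_ge0//= -lee_fin fineK ?probability_le1//; exact: fin_num_measure.
have /choice[h hP] : forall E : set Gam, exists l : R, 0 <= l /\
    (measurable E -> fine (nu y E) @[y --> F] --> l).
  move=> E; have [mE|nE] := pselect (measurable E); last by exists 0.
  have [|l cl] := @ultra_lim R Y F FU (fun y => fine (nu y E)) 1.
    by apply: filterE => y /=; have /andP[? ?] := fb y E mE; rewrite ger0_norm.
  exists l; split=> //; apply: (ultra_lim_ge FU cl); apply: filterE => y /=.
  by have /andP[] := fb y E mE.
have hc E : measurable E -> fine (nu y E) @[y --> F] --> h E by exact: (hP E).2.
have [eta etah] : exists eta : Pr, forall G, open G -> (eta G <= (h G)%:E)%E.
  apply: (@tight_limit _ _ _ A B T T0 h).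
  - by move=> E; exact: (hP E).1.
  - apply: (cvg_unique _ (hc _ measurableT)) => //.
    have -> : (fun y => fine (nu y setT)) = (fun=> 1) by apply/funext => y; rewrite probability_setT.
    exact: cvg_cst.
  - move=> E1 E2 mE1 mE2 E12; apply: (cvg_unique _ (hc _ (measurableU _ _ mE1 mE2))) => //.
    have -> : (fun y => fine (nu y (E1 `|` E2))) = (fun y => fine (nu y E1) + fine (nu y E2)).
      apply/funext => y; rewrite measureU// fineD//; exact: fin_num_measure.
    by apply: cvgD; exact: hc.
  - move=> e e0; have [M M0 HM] := level_tight e0; exists (level M : set Gam).
    split; [exact: level_compact|exact: level_closed|].
    have ml : measurable (level M : set Gam).
      by apply: closed_measurable_Gamma; exact: level_closed.
    apply: (ultra_lim_ge FU (hc _ ml)); apply: filterS FP => y /HM /=.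
    have fl := fin_num_measure (nu y) _ ml.
    by rewrite probability_setC// -(fineK fl) -(EFinB 1) lee_fin; lra.
exists h, eta; split=> //; split.
  apply: (@integral_lsc_le R _ Gam Y F FU nu eta h) => //.
  - by move=> g; exact: poweR_ge0.
  - by move=> c c0; apply: open_measurable_Gamma; exact: open_velocity_gt.
  - by move=> c c0; apply: etah; exact: open_velocity_gt.
  - by apply: filterS FP => y [].
(* The initial marginal of [eta] is below that of the limit, which is [m0], on open sets; between
   probabilities this forces equality. *)
apply: probability_eq_of_open_le => G oG.
have oG' : open (ev 0 @^-1` G : set Gam).
  by have /continuousP := @continuous_ev _ _ _ A B T 0; apply.
have := etah _ oG'; rewrite -[X in (X <= _)%E]/(marginal eta 0 G) => h1; apply: (le_trans h1).
have mG : measurable G by exact: sub_sigma_algebra.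
have c := hc _ (open_measurable_Gamma oG').
have fm : m0 G \is a fin_num by exact: fin_num_measure.
rewrite -(fineK fm) lee_fin; apply: (ultra_lim_le FU c); apply: filterS FP => y [_ /(_ G mG) E] /=.
by rewrite -E.
Qed.

End Velocity.

Lemma measurable_fibre {d1 d2 : measure_display} {S : measurableType d1} {S' : measurableType d2}
    (I : finType) (f : S -> I) (a : I -> S') :
  (forall k, measurable (f @^-1` [set k])) -> measurable_fun setT (a \o f).
Proof.
move=> mf _ E _; rewrite setTI.
have -> : (a \o f) @^-1` E = \bigcup_(k in [set k | E (a k)]) f @^-1` [set k].
  apply/seteqP; split=> s /=; first by move=> Es; exists (f s).
  by move=> [k /= Ek ->].
by apply: fin_bigcup_measurable => //; exact: finite_finset.
Qed.

Lemma measure_finU_le {R : realType} {disp : measure_display} {S : measurableType disp}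
    (P : probability S R) (I : finType) (E : I -> set S) : (forall i, measurable (E i)) ->
  (P (\bigcup_i E i) <= \sum_i P (E i))%E.
Proof.
move=> mE; have mU : measurable (\bigcup_i E i).
  by apply: fin_bigcup_measurable => //; exact: finite_finset.
apply: le_trans (content_sub_fsum P (D := setT) _ _ mU _) _ => //.
have -> : [set: I] = [set` (fun=> true) : pred I] by apply/seteqP; split.
rewrite -(@bigfs _ _ _ _ (index_enum I)) ?index_enum_uniq//.
by move=> i _; rewrite mem_index_enum.
Qed.

(** * Convergence of marginals, uniformly in time *)

Section FlowConvergence.
Import finmap.
Context {R : realType} {d k : nat}.
Variables (A : 'M[R]_d) (B : 'M[R]_(d, k)) (T : R).
Hypothesis T0 : 0 < T.
Local Notation X := 'cV[R]_d.
Local Notation D := (`[0, T]%classic).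
Local Notation Gam := (Gamma A B T).
Local Notation Pr := (probability Gam R).
Variables (a r : R) (m0 : probability X R).
Hypothesis a1 : 1 < a.
Hypothesis m0a : finite_moment a m0.
Variables (Y : Type) (F : set_system Y) (FU : UltraFilter F) (nu : Y -> Pr).
Variables (h : set Gam -> R) (eta : Pr).
Hypothesis Fnu : F [set y | PGamma a m0 r (nu y)].
Hypothesis nuh : forall E, measurable E -> fine (nu y E) @[y --> F] --> h E.
Hypothesis etaP : PGamma a m0 r eta.
Hypothesis etah : forall G, open G -> (eta G <= (h G)%:E)%E.

Let FF : ProperFilter F := @ultra_proper _ _ FU.
Let a0 : 0 < a. Proof. exact: lt_trans a1. Qed.
Let tube (g : Gam) (e : R) : set Gam := [set g' | near_curve g g' e].

Let tube_mono g e e' : e <= e' -> tube g e `<=` tube g e'.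
Proof. by move=> ee' g' h' t Dt; exact: le_trans (h' t Dt) ee'. Qed.

Let tube_interior g e e' : e < e' -> tube g e `<=` interior (tube g e').
Proof.
move=> ee' g' h'; have e0 : 0 < e' - e by rewrite subr_gt0.
rewrite /interior /=; apply: filterS (nbhs_tube T0 g' e0) => g'' h''.
by have := near_curve_trans h' h''; rewrite addrC subrK.
Qed.

Let sphere g e : set Gam := tube g e `\` interior (tube g e).

Let mopen (G : set Gam) : open G -> measurable G. Proof. exact: open_measurable_Gamma. Qed.
Let mtube g e : measurable (tube g e).
Proof. by apply: closed_measurable_Gamma; exact: closed_tube. Qed.
Let mint g e : measurable (interior (tube g e)).
Proof. by apply: mopen; exact: open_interior. Qed.
Let msphere g e : measurable (sphere g e). Proof. exact: measurableD. Qed.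

Let massE (E : set Gam) : measurable E -> eta E = (fine (eta E))%:E.
Proof. by move=> mE; rewrite fineK// fin_num_measure. Qed.

Let sphere_sum g (rho : nat -> R) J : {homo rho : i j / (i < j)%N >-> i < j} ->
  \sum_(j < J) fine (eta (sphere g (rho j))) <= 1.
Proof.
move=> mono.
have tr : trivIset setT (fun j => sphere g (rho j)).
  apply/trivIsetP => i j _ _ ij; wlog ij' : i j ij / (i < j)%N.
    by move=> H; have := ij; rewrite neq_ltn => /orP[|] lt; [|rewrite setIC]; apply: H => //; rewrite eq_sym.
  apply/seteqP; split=> // x [[xi _] [_ nx]]; apply: nx.
  exact: tube_interior (mono _ _ ij') _ xi.
have := measure_bigsetU eta (fun j => msphere g (rho j)) tr J.
rewrite (eq_bigr (fun j : 'I_J => (fine (eta (sphere g (rho j))))%:E)); last by move=> j _; exact: massE.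
rewrite sumEFin -lee_fin => <-; apply: probability_le1.
by apply: bigsetU_measurable.
Qed.

(** Pigeonhole on [J > n / del] radii: around each centre the boundaries of concentric tubes are
    disjoint and have total mass at most 1, so some radius is good for all [n] centres together. *)
Lemma small_spheres n (c : 'I_n -> Gam) (e1 e2 del : R) : e1 < e2 -> 0 < del ->
  exists2 rho, e1 < rho <= e2 & \sum_i fine (eta (sphere (c i) rho)) <= del.
Proof.
move=> e12 del0; pose J := (Num.trunc (n%:R / del)).+1.
have J0 : 0 < J%:R :> R by rewrite ltr0n.
pose rho (j : nat) := e1 + (e2 - e1) * (j.+1%:R / J%:R).
have e0 : 0 < e2 - e1 by rewrite subr_gt0.
have mono : {homo rho : i j / (i < j)%N >-> i < j}.
  by move=> i j ij; rewrite ltrD2l ltr_pM2l// ltr_pM2r ?invr_gt0// ltr_nat ltnS.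
apply: contrapT => nex.
have big : \sum_(j < J) del < \sum_(j < J) \sum_i fine (eta (sphere (c i) (rho j))).
  apply: ltr_sum; first by apply/hasP; exists ord0; rewrite ?mem_index_enum.
  move=> j _; rewrite ltNge; apply/negP => le; apply: nex; exists (rho j) => //.
  rewrite ltrDl mulr_gt0 ?divr_gt0//= -lerBrDl ler_piMr ?(ltW e0)//.
  by rewrite ler_pdivrMr// mul1r ler_nat.
have : \sum_(j < J) \sum_i fine (eta (sphere (c i) (rho j))) <= n%:R.
  rewrite exchange_big/=; apply: (@le_trans _ _ (\sum_(i < n) 1)).
    by apply: ler_sum => i _; exact: sphere_sum.
  by rewrite sumr_const card_ord.
rewrite leNgt => /negP; apply; apply: le_lt_trans big.
rewrite sumr_const card_ord -[_ *+ J]mulr_natl -ler_pdivrMr//.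
exact/ltW/truncnS_gt.
Qed.

(** The cells must be open, where [eta] is below [h], and disjoint. Finitely many tubes cover a
    compact level; each open tube is deprived of the earlier closed ones, and what is lost lies
    outside the level or on the boundaries, whose mass is small. *)
Lemma disjoint_cover (e del : R) : 0 < e -> 0 < del ->
  exists n (c : 'I_n -> Gam) (E : 'I_n -> set Gam),
  [/\ forall i, open (E i), forall i j g, E i g -> E j g -> i = j,
      forall i g, E i g -> near_curve (c i) g e &
      fine (eta (~` \bigcup_i E i)) <= del].
Proof.
move=> e0 del0; have del2 : 0 < del / 2 by rewrite divr_gt0.
have [M M0 HM] := @level_tight R d k A B T T0 a r m0 a1 m0a _ del2.
have := @level_compact R d k A B T T0 M M0; rewrite compact_cover.
move=> /(_ _ setT (fun c => interior (tube c (e / 2))))[||D' _ cov].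
- by move=> c _; exact: open_interior.
- move=> g _; exists g => //; apply: (@tube_interior g 0); first by rewrite divr_gt0.
  exact: near_curve_refl.
pose n := size (finmap.enum_fset D'); pose c (i : 'I_n) := nth point (finmap.enum_fset D') i.
have [||rho /andP[rho1 rho2] rhoS] := @small_spheres n c (e / 2) e (del / 2) => //; first by lra.
pose E i : set Gam := interior (tube (c i) rho) `&`
  ~` (\bigcup_(l in [set l : 'I_n | (l < i)%N]) tube (c l) rho).
exists n, c, E; split.
- move=> i; apply: openI; first exact: open_interior.
  apply: closed_openC; apply: closed_bigcup; first exact: finite_finset.
  by move=> l _; exact: closed_tube.
- have lt i j g : E i g -> E j g -> (i <= j)%N.
    move=> [_ ni] [/interior_subset tj _]; rewrite leqNgt; apply/negP => ji.
    by apply: ni; exists j.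
  by move=> i j g Ei Ej; apply/val_inj/eqP; rewrite eqn_leq (lt _ _ g)//= (lt _ _ g).
- move=> i g [/interior_subset gi _]; exact: tube_mono rho2 _ gi.
have mE i : measurable (E i).
  apply: measurableI => //; apply: measurableC.
  by apply: fin_bigcup_measurable => //; exact: finite_finset.
have mU : measurable (~` \bigcup_i E i).
  by apply: measurableC; apply: fin_bigcup_measurable => //; exact: finite_finset.
have ml : measurable (~` level M : set Gam).
  by apply: mopen; apply: closed_openC; exact: level_closed.
have mS : measurable (\bigcup_i sphere (c i) rho).
  by apply: fin_bigcup_measurable => //; exact: finite_finset.
have sub : (~` \bigcup_i E i) `<=` (~` level M) `|` \bigcup_i sphere (c i) rho.
  move=> g nE; have [gl|] := pselect (level M g); last by left.
  right; have [c' /= c'D gc'] := cov g gl.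
  have ci : (index c' (finmap.enum_fset D') < n)%N by rewrite index_mem.
  have ex : exists i : 'I_n, `[< tube (c i) rho g >].
    exists (Ordinal ci); apply/asboolP; rewrite /c/= nth_index//.
    by apply: tube_mono (ltW rho1) _ _; exact: interior_subset gc'.
  (* The first closed tube containing [g]: if [g] were interior to it, [g] would lie in the cell of
     that index. *)
  have [i /asboolP gi imin] := @arg_minnP _ (xchoose ex) (fun i => `[< tube (c i) rho g >]) val (xchooseP ex).
  exists i => //; split=> // gint; apply: nE; exists i => //; split=> // -[l /= li gl'].
  by have := imin l; rewrite (asboolT gl') => /(_ isT); rewrite leqNgt li.
rewrite -lee_fin -massE//; apply: (@le_trans _ _ (eta ((~` level M) `|` \bigcup_i sphere (c i) rho))).
  have mU' : measurable ((~` level M) `|` \bigcup_i sphere (c i) rho) by exact: measurableU.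
  by apply: (le_measure _ (mem_set mU) (mem_set mU')).
apply: le_trans (measureU2 _ _ _) _ => //.
rewrite [del in del%:E]splitr EFinD leeD ?HM//.
apply: (@le_trans _ _ (\sum_i eta (sphere (c i) rho))%E); first exact: measure_finU_le.
rewrite (eq_bigr (fun i => (fine (eta (sphere (c i) rho)))%:E)); last by move=> i _; exact: massE.
by rewrite sumEFin lee_fin.
Qed.

(** Since [a > 1], a bound on the moment of order [a] makes the first moments uniformly small beyond
    a large level [K]. *)
Lemma tail_young K x : 0 < K -> 0 <= x -> x <= K + x `^ a / K `^ (a - 1) /\
  (K <= x -> x <= x `^ a / K `^ (a - 1)).
Proof.
move=> K0 x0; have q0 : 0 < K `^ (a - 1) by exact: powR_gt0.
have H : K <= x -> x <= x `^ a / K `^ (a - 1).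
  move=> Kx; rewrite ler_pdivlMr//; have xp : 0 < x by exact: lt_le_trans Kx.
  have {2}-> : a = 1 + (a - 1) by ring.
  have -> : x `^ (1 + (a - 1)) = x * x `^ (a - 1).
    rewrite [LHS]powRD; first by rewrite powRr1.
    by apply/implyP => _; rewrite gt_eqF.
  rewrite ler_wpM2l//.
  by apply: ge0_ler_powR; rewrite ?nnegrE ?(ltW K0)// subr_ge0 ltW.
split=> //; have [/ltW xK|Kx] := ltP x K.
  by apply: (le_trans xK); rewrite lerDl divr_ge0 ?powR_ge0.
by apply: (le_trans (H Kx)); rewrite lerDr ltW.
Qed.

Lemma tail_weight (b e : R) : 0 <= b -> 0 < e -> exists2 K, 0 < K & b / K `^ (a - 1) <= e.
Proof.
move=> b0 e0; have be : 0 < b / e + 1 by rewrite ltr_wpDl// divr_ge0// ltW.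
exists ((b / e + 1) `^ (a - 1)^-1); first exact: powR_gt0.
rewrite -powRrM mulVf ?powRr1 ?(ltW be)//; last by rewrite gt_eqF// subr_gt0.
by rewrite ler_pdivrMr// mulrDr mulr1 mulrCA divff ?gt_eqF// mulr1 lerDl ltW.
Qed.

Section Rounding.
Variables (n : nat) (c : 'I_n -> Gam) (E : 'I_n -> set Gam) (e : R).
Hypotheses (oE : forall i, open (E i)) (dE : forall i j g, E i g -> E j g -> i = j).
Hypothesis cE : forall i g, E i g -> near_curve (c i) g e.

Definition cell (g : Gam) : option 'I_n := [pick i | `[< E i g >]].

Lemma cell_some i : cell @^-1` [set Some i] = E i.
Proof.
apply/seteqP; split=> g; rewrite /cell /=; case: pickP => [j /asboolP Ej|no] //.
- by move=> [<-].
- by move=> Ei; rewrite (dE Ej Ei).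
- by move=> Ei; have := no i; rewrite asboolT.
Qed.

Lemma cell_none : cell @^-1` [set None] = ~` \bigcup_i E i.
Proof.
apply/seteqP; split=> g; rewrite /cell /=; case: pickP => [j /asboolP Ej|no] //.
  by move=> _ [i _ Ei]; have := no i; rewrite asboolT.
by move=> H; exfalso; apply: H; exists j.
Qed.

Lemma measurable_cell q : measurable (cell @^-1` [set q]).
Proof.
case: q => [i|]; first by rewrite cell_some; exact: mopen.
rewrite cell_none; apply: measurableC; apply: fin_bigcup_measurable.
  exact: finite_finset.
by move=> i _; exact: mopen.
Qed.

(* Values beyond the level [K] are sent to the origin, so that a small error on
   the masses of the cells has a small cost whatever the centres are. *)
Definition rounded (K t : R) (q : option 'I_n) : X :=
  if q is Some i then (if enorm (ev t (c i)) <= K then ev t (c i) else 0) else 0.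

Lemma rounded_le K t q : 0 <= K -> enorm (rounded K t q) <= K.
Proof.
move=> K0; case: q => [i|] /=; last by rewrite enorm0.
by case: ifPn => //; rewrite enorm0.
Qed.

Lemma rounding_cost K t g : 0 < K -> 0 < e -> D t ->
  enorm (ev t g - rounded (K + e) t (cell g)) <=
  e + (K * \1_(cell @^-1` [set None]) g + (K `^ (a - 1))^-1 * enorm (ev t g) `^ a).
Proof.
move=> K0 e0 Dt; have [y1 y2] := tail_young K0 (enorm_ge0 (ev t g)).
have p0 : 0 <= (K `^ (a - 1))^-1 * enorm (ev t g) `^ a by rewrite mulr_ge0 ?invr_ge0 ?powR_ge0.
rewrite [_ / _]mulrC in y1 y2; case E0 : (cell g) => [i|] /=; last first.
  by rewrite indicE mem_set//= mulr1 subr0; lra.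
rewrite indicE memNset ?mulr0 ?add0r//=; last by rewrite E0.
have Ei : E i g by rewrite -cell_some.
have near := cE Ei Dt; case: ifPn => [_|].
  by rewrite enorm_distC; lra.
(* The cut is at [K + e]: a centre beyond it forces the curve, which is within [e], beyond [K],
   where the tail estimate applies. *)
rewrite -ltNge subr0 => lt; suff : K <= enorm (ev t g) by move=> /y2; lra.
have := ler_enormD (ev t (c i) - ev t g) (ev t g); rewrite subrK; lra.
Qed.

Lemma rounded_moment (P : Pr) (K t : R) (m : probability X R) : 0 <= K ->
  (forall G, m G = P ((rounded K t \o cell) @^-1` G)) -> finite_moment 1 m.
Proof.
move=> K0 mE; have mr : measurable_fun setT (rounded K t \o cell).
  by apply: measurable_fibre; exact: measurable_cell.
have [Q [QE QI]] := image_probability P mr.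
rewrite /finite_moment /moment (_ : \int[m]_x _ = \int[Q]_x (enorm x `^ 1)%:E)%E; last first.
  by apply: eq_measure_integral => G mG _; rewrite mE QE.
rewrite QI; last 2 first.
- apply/measurable_EFinP; apply: (measurableT_comp (measurable_powR 1)).
  exact: measurable_enorm.
- by move=> x; rewrite lee_fin powR_ge0.
apply: (@le_lt_trans _ _ (\int[P]_x K%:E)%E).
  apply: ge0_integral_mono => g _; first by rewrite lee_fin powR_ge0.
  by rewrite lee_fin powRr1 ?enorm_ge0// rounded_le.
rewrite integral_cst// (_ : P setT = 1%E) ?mule1 ?ltry//; exact: probability_setT.
Qed.

Lemma rounding_d1 (P : Pr) (K t b : R) (m : probability X R) : 0 < K -> 0 < e -> D t ->
  (\int[P]_g (enorm (ev t g) `^ a)%:E <= b%:E)%E ->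
  (forall G, m G = P ((rounded (K + e) t \o cell) @^-1` G)) ->
  (d1 (marginal P t) m <= (e + (K * fine (P (cell @^-1` [set None])) + (K `^ (a - 1))^-1 * b))%:E)%E.
Proof.
move=> K0 e0 Dt Pb mE; have q0 : 0 <= (K `^ (a - 1))^-1 by rewrite invr_ge0 powR_ge0.
have mr : measurable_fun setT (rounded (K + e) t \o cell).
  by apply: measurable_fibre; exact: measurable_cell.
apply: le_trans (d1_image (P := P) (f := ev t) (g := rounded (K + e) t \o cell) _ _ _ _) _ => //.
apply: (@le_trans _ _ (\int[P]_g (e%:E + (K%:E * (\1_(cell @^-1` [set None]) g)%:E +
    ((K `^ (a - 1))^-1)%:E * (enorm (ev t g) `^ a)%:E)))%E).
  apply: ge0_integral_mono => g _; first by rewrite lee_fin enorm_ge0.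
  by rewrite -!EFinM -!EFinD lee_fin; exact: rounding_cost.
have mn := measurable_cell None.
have mi : measurable_fun setT (fun g => (\1_(cell @^-1` [set None]) g)%:E : \bar R).
  by apply/measurable_EFinP; exact: measurable_indic.
have mp : measurable_fun setT (fun g : Gam => (enorm (ev t g) `^ a)%:E).
  apply/measurable_EFinP; apply: (measurableT_comp (measurable_powR a)).
  exact: (measurableT_comp (@measurable_enorm R d) (@measurable_ev _ _ _ A B T t)).
have mc (x : R) (f : Gam -> \bar R) : measurable_fun setT f -> measurable_fun setT (fun g => x%:E * f g)%E.
  by move=> mf; apply: emeasurable_funM => //; exact: measurable_cst.
have p1 g : (0 <= K%:E * (\1_(cell @^-1` [set None]) g)%:E)%E.
  by rewrite -EFinM lee_fin mulr_ge0// ltW.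
have p2 g : (0 <= ((K `^ (a - 1))^-1)%:E * (enorm (ev t g) `^ a)%:E)%E.
  by rewrite -EFinM lee_fin mulr_ge0// powR_ge0.
rewrite ge0_integralD//; last 3 first.
- by move=> g _; rewrite lee_fin ltW.
- by move=> g _; exact: adde_ge0.
- by apply: emeasurable_funD; exact: mc.
rewrite EFinD leeD//.
  by rewrite integral_cst// (_ : P setT = 1%E) ?mule1//; exact: probability_setT.
rewrite ge0_integralD//; [|exact: mc..].
rewrite EFinD leeD//.
  rewrite ge0_integralZl ?lee_fin ?(ltW K0)//.
  by rewrite integral_indic// setIT EFinM fineK// fin_num_measure.
rewrite ge0_integralZl ?lee_fin//; last by move=> g _; rewrite lee_fin powR_ge0.
by rewrite EFinM lee_wpmul2l ?lee_fin.
Qed.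

(** On each open cell [eta] is below [h], and both have total mass 1. The excess of [h] over the
    cells therefore equals its deficit on the remainder, at most [del], and the total variation in
    the limit is at most [2 * del]. *)
Lemma cell_masses (del : R) : 0 < del -> fine (eta (~` \bigcup_i E i)) <= del ->
  F [set y | \sum_q `|mass (nu y) cell q - mass eta cell q| <= 3 * del /\
     mass (nu y) cell None <= 2 * del].
Proof.
move=> del0 en; pose hm q := h (cell @^-1` [set q]).
have cv q : mass (nu y) cell q @[y --> F] --> hm q by apply: nuh; exact: measurable_cell.
have sum1 (P : Pr) : \sum_q mass P cell q = 1.
  have := probability_fibre P measurable_cell id setT; rewrite preimage_setT probability_setT => -[->].
  by apply: eq_bigr => q _; rewrite indicT mulr1.
have hsum : \sum_q hm q = 1.
  have := cvg_bigsum FU (s := index_enum (option 'I_n)) cv.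
  have -> : (fun y => \sum_q mass (nu y) cell q) = (fun=> 1) by apply/funext => y; exact: sum1.
  by move=> cv1; apply/esym; apply: (cvg_unique _ _ cv1) => //; exact: cvg_cst.
have some i : mass eta cell (Some i) <= hm (Some i).
  by rewrite -lee_fin /mass /hm cell_some -massE; [exact: etah|exact: mopen].
have opt (f : option 'I_n -> R) : \sum_q f q = f None + \sum_i f (Some i).
  rewrite (bigD1 None)//=; congr (_ + _).
  rewrite (reindex_omap Some id) /=; last by case.
  by apply: eq_bigl => i; rewrite eqxx.
have h0 : 0 <= hm None.
  by apply: (ultra_lim_ge FU (cv None)); apply: filterE => y; exact: mass_ge0.
have enn : mass eta cell None <= del by rewrite /mass cell_none.
have excess : \sum_i (hm (Some i) - mass eta cell (Some i)) = mass eta cell None - hm None.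
  by rewrite sumrB; have := sum1 eta; have := hsum; rewrite !opt; lra.
have ex0 : 0 <= \sum_i (hm (Some i) - mass eta cell (Some i)).
  by apply: sumr_ge0 => i _; rewrite subr_ge0.
have lim2 : \sum_q `|hm q - mass eta cell q| <= 2 * del.
  rewrite opt; have -> : \sum_i `|hm (Some i) - mass eta cell (Some i)| =
      mass eta cell None - hm None.
    by rewrite -excess; apply: eq_bigr => i _; rewrite ger0_norm ?subr_ge0.
  by rewrite ler0_norm; lra.
have cs : \sum_q `|mass (nu y) cell q - mass eta cell q| @[y --> F] --> \sum_q `|hm q - mass eta cell q|.
  apply: cvg_bigsum => // q; apply: cvg_norm; apply: cvgB; first exact: cv.
  exact: cvg_cst.
apply: filterI.
  have lt : \sum_q `|hm q - mass eta cell q| < 3 * del by lra.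
  by apply: filterS (cvgr_lt _ cs _ lt) => y /ltW.
have lt : hm None < 2 * del by lra.
by apply: filterS (cvgr_lt _ (cv None) _ lt) => y /ltW.
Qed.

End Rounding.

(** Both marginals are rounded to the centres of the cells. The cells do not depend on [t] and
    curves stay near their centres at all times, whence the uniformity. The estimate is kept as a
    chain through the two rounded measures, along which cost differences are added up. *)
Theorem flow_convergence (e : R) : 0 < e -> F [set y | forall t, D t ->
  exists m1 m2, [/\ finite_moment 1 m1, finite_moment 1 m2, (d1 (marginal (nu y) t) m1 <= e%:E)%E,
    (d1 m1 m2 <= e%:E)%E & (d1 (marginal eta t) m2 <= e%:E)%E]].
Proof.
move=> e0; have e3 : 0 < e / 3 by rewrite divr_gt0.
have [b b0 Hb] := @marginal_moment R d k A B T T0 a r m0 a1 m0a.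
have [K K0 Kb] := tail_weight b0 e3.
pose w := e / 3; pose del := e / (6 * (K + w)).
have Kw : 0 < K + w by rewrite addr_gt0.
have del0 : 0 < del by rewrite divr_gt0// mulr_gt0.
have Kd : K * (2 * del) <= e / 3.
  have -> : K * (2 * del) = K / (K + w) * (e / 3).
    by rewrite /del; field; rewrite gt_eqF.
  by rewrite ler_piMl ?(ltW e3)// ler_pdivrMr// mul1r lerDl ltW.
have [n [c [E [oE dE cE en]]]] := disjoint_cover e3 del0.
have Fm := cell_masses oE dE del0 en.
apply: filterS2 Fnu Fm => y yP [ysum ynone] t Dt.
have mr : measurable_fun setT (rounded c (K + w) t \o cell E).
  by apply: measurable_fibre; exact: measurable_cell.
have [m1 [m1E _]] := image_probability (nu y) mr.
have [m2 [m2E _]] := image_probability eta mr.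
have d0 : 0 <= K + w by exact: ltW.
exists m1, m2; split.
- by apply: rounded_moment m1E.
- by apply: rounded_moment m2E.
- apply: le_trans (rounding_d1 oE dE cE K0 e3 Dt (Hb _ _ yP Dt) m1E) _.
  rewrite lee_fin; have : K * mass (nu y) (cell E) None <= K * (2 * del) by rewrite ler_wpM2l// ltW.
  rewrite /mass mulrC in Kb *; rewrite [_ * b]mulrC; lra.
- apply: le_trans (d1_simple (P := nu y) (P' := eta) (f := cell E) (a := rounded c (K + w) t) (M := K + w) _ _ _ _) _ => //.
  + exact: measurable_cell.
  + by move=> q; exact: rounded_le.
  rewrite lee_fin; apply: (@le_trans _ _ (2 * (K + w) * (3 * del))).
    by rewrite ler_wpM2l// mulr_ge0.
  have -> : 2 * (K + w) * (3 * del) = e by rewrite /del; field; rewrite gt_eqF.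
  by [].
- apply: le_trans (rounding_d1 oE dE cE K0 e3 Dt (Hb _ _ etaP Dt) m2E) _.
  rewrite lee_fin cell_none//.
  have : K * fine (eta (~` \bigcup_i E i)) <= K * (2 * del) by rewrite ler_wpM2l ?(ltW K0)//; lra.
  rewrite mulrC in Kb; rewrite [_ * b]mulrC; lra.
Qed.

End FlowConvergence.

(** * Costs along curves *)

Section WeakConvergence.
Context {R : realType}.
Variable T : R.
Hypothesis T0 : 0 < T.
Local Notation mu := (@lebesgue_measure R).
Local Notation D := (`[0, T]%classic).

Let mD : measurable (D : set (measurableTypeR R)). Proof. exact: measurable_itv. Qed.

Lemma Rint_prod_young (th : R) (f g : R -> R) : 0 < th -> sqi mu D f -> sqi mu D g ->
  `|\int[mu]_(s in D) (f s * g s)| <=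
  (\int[mu]_(s in D) (f s ^+ 2)) / (2 * th) + th / 2 * \int[mu]_(s in D) (g s ^+ 2).
Proof.
move=> th0 Sf Sg; have If := Sf.2; have Ig := Sg.2.
have Ifg := sqiM mD Sf Sg.
have th2 : 0 < 2 * th by rewrite mulr_gt0.
apply: le_trans (le_normr_Rintegral mD Ifg) _.
rewrite -RintegralZr// -RintegralZl// -RintegralD//; last 2 first.
- exact: (iblZr mD).
- exact: (iblZ mD).
apply: Rint_le => //.
- exact: ibl_norm.
- by apply: (iblD mD); [exact: (iblZr mD)|exact: (iblZ mD)].
move=> s _; rewrite ler_norml; apply/andP; split.
  have : 0 <= (f s + th * g s) ^+ 2 / (2 * th) by rewrite divr_ge0 ?sqr_ge0 ?ltW.
  have -> : (f s + th * g s) ^+ 2 / (2 * th) = f s ^+ 2 / (2 * th) + th / 2 * g s ^+ 2 + f s * g s.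
    by field; rewrite gt_eqF.
  by rewrite lerNl => h; rewrite -subr_ge0 opprK.
have : 0 <= (f s - th * g s) ^+ 2 / (2 * th) by rewrite divr_ge0 ?sqr_ge0 ?ltW.
have -> : (f s - th * g s) ^+ 2 / (2 * th) = f s ^+ 2 / (2 * th) + th / 2 * g s ^+ 2 - f s * g s.
  by field; rewrite gt_eqF.
by rewrite subr_ge0.
Qed.

(** Replacing [q] by its slope on a fine dyadic mesh turns the pairing into finitely many increments
    of primitives, which tend to zero; the error is small by [energy_sup] and the bound on the
    norms. *)
Lemma weak_convergence (Y : Type) (F : set_system Y) (FU : UltraFilter F)
    (z : Y -> R -> R) (M : R) (q : R -> R) : sqi mu D q -> 0 <= M ->
  F [set y | sqi mu D (z y) /\ \int[mu]_(s in D) (z y s ^+ 2) <= M] ->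
  (forall t, D t -> \int[mu]_(s in `[0, t]) z y s @[y --> F] --> (0 : R)) ->
  forall e, 0 < e -> F [set y | `|\int[mu]_(s in D) (q s * z y s)| <= e].
Proof.
move=> Sq M0 Fz cz e e0; have FF : ProperFilter F by exact: ultra_proper.
have M1 : 0 < M + 1 by rewrite ltr_wpDl.
(* The weight in Young's inequality: small enough for the bounded factor, while the mesh chosen
   below pays for its inverse. *)
have [th th0 thE] : exists2 th : R, 0 < th & th / 2 * (M + 1) = e / 4.
  exists (e / (2 * (M + 1))); first by rewrite divr_gt0// mulr_gt0.
  by field; rewrite gt_eqF.
pose Q t := \int[mu]_(s in `[0, t]) q s.
have Q0 : Q 0 = 0 by rewrite /Q set_itv1 Rintegral_set1.
have Iq := sqi_ibl_itv Sq.
have te : 0 < th * e / 2 by rewrite divr_gt0// mulr_gt0.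
have QE t : t \in `[0, T] -> \int[mu]_(s in `[0, t]) q s = Q t - Q 0 by rewrite Q0 subr0.
have [n en] := energy_sup T0 Sq te QE.
pose N := (2 ^ n)%N; have N0 : (0 < N)%N by rewrite expn_gt0.
have pieces j (f : R -> R) : (j < N)%N -> ibl mu D f ->
    \int[mu]_(s in `[node T N j, node T N j.+1]) f s =
    \int[mu]_(s in `[0, node T N j.+1]) f s - \int[mu]_(s in `[0, node T N j]) f s.
  move=> jN If; have := @Rint_cat _ 0 (node T N j) (node T N j.+1) f.
  move=> H; rewrite H.
  - by rewrite addrAC subrr add0r.
  - exact: (node_ge0 T0).
  - exact: (node_le T0).
  - by apply: ibl_itv If => //; exact: (node_leT T0 N0).
have dist := @dist_slope R T T0 N N0 q Q Sq (fun j jN => pieces j q jN Iq).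
have Ss : sqi mu D (slope T Q N) by exact: sqi_step.
have Sr : sqi mu D (fun s => q s - slope T Q N s) by exact: sqiB.
pose sm y := \int[mu]_(s in D) (slope T Q N s * z y s).
have csm : \sum_(j < N) diff T Q N j / mesh T N *
    (\int[mu]_(s in `[0, node T N j.+1]) z y s - \int[mu]_(s in `[0, node T N j]) z y s) @[y --> F] --> (0 : R).
  have E0 : \sum_(j < N) diff T Q N j / mesh T N * (0 - 0) = 0.
    by rewrite big1// => j _; rewrite subr0 mulr0.
  rewrite -[X in _ --> X]E0.
  apply: cvg_bigsum => // j; apply: cvgM; first exact: cvg_cst.
  by apply: cvgB; apply: cz; [exact: (node_in T0 N0 (ltn_ord j))|exact: (node_in T0 N0 (ltnW (ltn_ord j)))].
have e2 : 0 < e / 2 by rewrite divr_gt0.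
have /cvgrPdist_le/(_ _ e2) Fs := csm.
apply: filterS2 Fz Fs => y [Sz zM]; rewrite sub0r normrN => sme; rewrite /=.
have Iz := sqi_ibl_itv Sz.
have -> : \int[mu]_(s in D) (q s * z y s) =
    \int[mu]_(s in D) (slope T Q N s * z y s) + \int[mu]_(s in D) ((q s - slope T Q N s) * z y s).
  rewrite -RintegralD//; [|exact: (sqiM mD)|exact: (sqiM mD)].
  by apply: eq_Rintegral => s _; ring.
apply: le_trans (ler_normD _ _) _; rewrite [e]splitr; apply: lerD.
  rewrite (Rint_step_mul T0 N0)//; move: sme; rewrite (eq_bigr (fun j : 'I_N => diff T Q N j / mesh T N *
    \int[mu]_(s in `[node T N j, node T N j.+1]) z y s))// => j _.
  by rewrite pieces.
apply: le_trans (Rint_prod_young th0 Sr Sz) _; rewrite dist.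
have h1 : (\int[mu]_(s in D) (q s ^+ 2) - energy T Q N) / (2 * th) <= e / 4.
  have E4 : th * e / 2 / (2 * th) = e / 4 by field; rewrite gt_eqF.
  rewrite -E4 ler_wpM2r ?invr_ge0 ?mulr_ge0 ?(ltW th0)//.
  by rewrite lerBlDr -lerBlDl ltW.
have h2 : th / 2 * \int[mu]_(s in D) (z y s ^+ 2) <= e / 4.
  apply: (@le_trans _ _ (th / 2 * (M + 1))).
    by rewrite ler_wpM2l ?divr_ge0 ?(ltW th0)// (le_trans zM)// lerDl.
  by rewrite thE.
by move: (lerD h1 h2); have -> : e / 4 + e / 4 = e / 2 by field.
Qed.

End WeakConvergence.

(** * Running costs depending on time *)

Section TimeLagrangian.
Context {R : realType} {d k : nat}.
Variable T : R.
Hypothesis T0 : 0 < T.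
Local Notation X := 'cV[R]_d.
Local Notation U := 'cV[R]_k.
Local Notation mu := (@lebesgue_measure R).
Local Notation D := (`[0, T]%classic).

Let mD : measurable (D : set (measurableTypeR R)). Proof. exact: measurable_itv. Qed.

Let muT : fine (mu D) = T.
Proof. by have -> : fine (mu `[0, T]) = T by rewrite mu_itv ?ltW// subr0. Qed.

(** State and control are stacked in one column, where measurability is a matter of coordinates. *)
Lemma continuous_pair_measurable (f : X -> U -> R) (E : set (measurableTypeR R)) (x : R -> X) (u : R -> U) :
  continuous (fun z : X * U => f z.1 z.2) -> measurable E ->
  measurable_fun E x -> measurable_fun E u -> measurable_fun E (fun t => f (x t) (u t)).
Proof.
move=> cf mE mx mu_.
pose G (z : 'cV[R]_(d + k)) := f (usubmx z) (dsubmx z).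
have up (z : 'cV[R]_(d + k)) : enorm (usubmx z) <= enorm z.
  rewrite ler_sqrt ?edot_ge0// /edot big_split_ord/= ler_wpDr//.
    by apply: sumr_ge0 => i _; rewrite -expr2 sqr_ge0.
  by apply: ler_sum => i _; rewrite mxE.
have dn (z : 'cV[R]_(d + k)) : enorm (dsubmx z) <= enorm z.
  rewrite ler_sqrt ?edot_ge0// /edot big_split_ord/= ler_wpDl//.
    by apply: sumr_ge0 => i _; rewrite -expr2 sqr_ge0.
  by apply: ler_sum => i _; rewrite mxE.
have cG : continuous G.
  move=> z; have cu : {for z, continuous (@usubmx R d k 1)}.
    apply/continuous_enormP => e e0; exists e => // y; apply: le_lt_trans.
    by have := up (z - y); rewrite linearB.
  have cd : {for z, continuous (@dsubmx R d k 1)}.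
    apply/continuous_enormP => e e0; exists e => // y; apply: le_lt_trans.
    by have := dn (z - y); rewrite linearB.
  have c : {for z, continuous (fun z : 'cV[R]_(d + k) => (usubmx z, dsubmx z) : X * U)}.
    exact: (cvg_pair cu cd).
  exact: (continuous_comp c (cf _)).
have -> : (fun t => f (x t) (u t)) = G \o (fun t => col_mx (x t) (u t)).
  by apply/funext => t; rewrite /G /= col_mxKu col_mxKd.
apply: (measurableT_comp (continuous_measurable_cV cG)); apply/measurable_fun_cVP => // i.
rewrite -[i]splitK; case: (fintype.split i) => j /=.
  under eq_fun do rewrite col_mxEu; exact: (measurableT_comp (measurable_coord j)).
under eq_fun do rewrite col_mxEd; exact: (measurableT_comp (measurable_coord j)).
Qed.

Lemma within_measurable_cV n (x : R -> 'cV[R]_n) : (forall i, {within D, continuous (fun t => x t i 0)}) ->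
  measurable_fun D x.
Proof.
move=> cx; apply/measurable_fun_cVP => // i; exact: ibl_mfun (within_ibl (cx i)).
Qed.

Variables (l : R -> X -> U -> R) (C0 C K : R).
Hypotheses (C00 : 0 < C0) (C_0 : 0 <= C) (K0 : 0 <= K).
Hypothesis lag : forall t, D t -> lagrangian C0 C (l t).
Hypothesis lmod : forall s t x u, D s -> D t -> `|l s x u - l t x u| <= K * Num.sqrt `|s - t|.

(** The time argument of the cost is frozen at the nodes of a mesh, and the modulus [lmod] gives
    pointwise convergence as the mesh shrinks. The endpoint [T] is set aside because [step] vanishes
    there. *)
Lemma lagrangian_measurable (x : R -> X) (u : R -> U) :
  measurable_fun D x -> measurable_fun D u -> measurable_fun D (fun t => l t (x t) (u t)).
Proof.
move=> mx mu_.
have sub : `[0, T[%classic `<=` D by move=> t /=; rewrite !in_itv/= => /andP[-> /ltW].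
suff : measurable_fun `[0, T[ (fun t => l t (x t) (u t)).
  by move/measurable_fun_itv_bndo_bndcP.
pose f n t := step T n.+1 (fun j => l (node T n.+1 j) (x t) (u t)) t.
apply: (@measurable_fun_cvg _ _ _ _ f).
  move=> n; rewrite /f /step; apply: measurable_sum => j; apply: measurable_funM.
    apply: measurable_funS sub _ => //.
    apply: continuous_pair_measurable => //.
    by apply: (lag_cont (lag _)); exact: (node_in T0 (ltn0Sn n) (ltnW (ltn_ord j))).
  have mi : measurable (`[node T n.+1 j, node T n.+1 j.+1[%classic : set (measurableTypeR R)).
    exact: measurable_itv.
  exact: measurable_indic mi.
move=> t tT; have Dt := sub _ tT; apply/cvgrPdist_le => e e0; near=> n.
have [j jN /andP[jt tj]] := node_near T0 (ltn0Sn n) Dt.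
have [i iN ti] : exists2 i, (i < n.+1)%N & t \in `[node T n.+1 i, node T n.+1 i.+1[.
  have [lt|ge] := ltP t (node T n.+1 j.+1).
    by exists j => //; rewrite in_itv/= jt.
  have E : t = node T n.+1 j.+1 by apply/eqP; rewrite eq_le tj.
  exists j.+1.
    rewrite ltn_neqAle jN andbT; apply/eqP => jn; move: tT; rewrite /= in_itv/= E jn nodeN// ltxx.
    by rewrite andbF.
  by rewrite in_itv/= -E lexx/= E -subr_gt0 nodeSB mesh_gt0.
rewrite /f (stepE T0 (ltn0Sn n) _ iN ti).
have Di : D (node T n.+1 i) by exact: (node_in T0 (ltn0Sn n) (ltnW iN)).
apply: le_trans (lmod _ _ Dt Di) _.
have dm : `|t - node T n.+1 i| <= mesh T n.+1.
  move: ti; rewrite in_itv/= => /andP[h1 /ltW h2].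
  by rewrite ger0_norm ?subr_ge0// -(nodeSB T n.+1 i) lerD2r.
apply: (@le_trans _ _ (K * Num.sqrt (mesh T n.+1))).
  by rewrite ler_wpM2l// ler_sqrt// ltW// mesh_gt0.
have mn : mesh T n.+1 <= (e / (K + 1)) ^+ 2.
  rewrite /mesh ler_pdivrMr// mulrC -ler_pdivrMr ?exprn_gt0 ?divr_gt0 ?ltr_wpDl//.
  by apply: le_trans (_ : n%:R <= _); [near: n; exact: nbhs_infty_ger|rewrite ler_nat].
apply: (@le_trans _ _ (K * (e / (K + 1)))).
  have ek : 0 <= e / (K + 1) by rewrite divr_ge0 ?(ltW e0)// addr_ge0.
  by rewrite ler_wpM2l// -[leRHS]ger0_norm// -sqrtr_sqr ler_sqrt ?sqr_ge0.
rewrite mulrA ler_pdivrMr ?ltr_wpDl// mulrC ler_wpM2l ?(ltW e0)// lerDl//.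
Unshelve. all: by end_near.
Qed.

Lemma gradu_measurable (x : R -> X) (u : R -> U) :
  measurable_fun D x -> measurable_fun D u -> measurable_fun D (fun t => gradu (l t) (x t) (u t)).
Proof.
move=> mx mu_; apply/measurable_fun_cVP => // i.
apply: (@measurable_fun_cvg _ _ _ _ (fun n t =>
  n.+1%:R * (l t (x t) (u t + n.+1%:R^-1 *: Defs.basis i) - l t (x t) (u t)))).
  move=> n; apply: measurable_funM; first exact: measurable_cst.
  apply: measurable_funB; last exact: lagrangian_measurable.
  apply: lagrangian_measurable => //; apply/measurable_fun_cVP => // j.
  rewrite (_ : (fun t => _) = (fun t => u t j 0 + (n.+1%:R^-1 *: Defs.basis i : 'cV[R]_k) j 0)).
    by apply: measurable_funD; [have /measurable_fun_cVP := mu_; apply|exact: measurable_cst].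
  by apply/funext => t; rewrite coordD.
by move=> t Dt; exact: (lag_diffq (lag Dt)).
Qed.

Lemma gradx_measurable (x : R -> X) (u : R -> U) :
  measurable_fun D x -> measurable_fun D u -> measurable_fun D (fun t => gradx (l t) (x t) (u t)).
Proof.
move=> mx mu_; apply/measurable_fun_cVP => // i.
apply: (@measurable_fun_cvg _ _ _ _ (fun n t =>
  n.+1%:R * (l t (x t + n.+1%:R^-1 *: Defs.basis i) (u t) - l t (x t) (u t)))).
  move=> n; apply: measurable_funM; first exact: measurable_cst.
  apply: measurable_funB; last exact: lagrangian_measurable.
  apply: lagrangian_measurable => //; apply/measurable_fun_cVP => // j.
  rewrite (_ : (fun t => _) = (fun t => x t j 0 + (n.+1%:R^-1 *: Defs.basis i : 'cV[R]_d) j 0)).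
    by apply: measurable_funD; [have /measurable_fun_cVP := mx; apply|exact: measurable_cst].
  by apply/funext => t; rewrite coordD.
move=> t Dt; have := @lag_dir R d k C0 C (l t) (lag Dt) (x t) (u t) (Defs.basis i) 0.
under eq_fun do rewrite scaler0 addr0.
rewrite edot0r addr0 (_ : edot _ _ = gradx (l t) (x t) (u t) i 0)//.
rewrite /edot (bigD1 i)//= big1 ?addr0; first by rewrite [Defs.basis i _ _]mxE !eqxx mulr1.
by move=> j ji; rewrite [Defs.basis i _ _]mxE (negbTE ji) mulr0.
Qed.

Definition norm2 (u : R -> U) : R := \int[mu]_(s in D) (enorm (u s) ^+ 2).
Definition run (l : R -> X -> U -> R) (x : R -> X) (u : R -> U) : R :=
  \int[mu]_(s in D) l s (x s) (u s).

Lemma norm2_ge0 u : 0 <= norm2 u.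
Proof. by apply: Rintegral_ge0 => s _; exact: sqr_ge0. Qed.

Lemma ibl_enorm2 (u : R -> U) : vsqi D u -> ibl mu D (fun s => enorm (u s) ^+ 2).
Proof. by move=> Su; exact: (vsqi_enorm mD Su).2. Qed.

Lemma ibl_weight c (u : R -> U) : vsqi D u -> ibl mu D (fun s => c * (1 + enorm (u s) ^+ 2)).
Proof.
move=> Su; apply: (iblZ mD); apply: (iblD mD); [exact: ibl_cst_itv|exact: ibl_enorm2].
Qed.

Lemma Rint_weight c (u : R -> U) : vsqi D u ->
  \int[mu]_(s in D) (c * (1 + enorm (u s) ^+ 2)) = c * (T + norm2 u).
Proof.
move=> Su; rewrite RintegralZl//; last first.
  by apply: (iblD mD); [exact: ibl_cst_itv|exact: ibl_enorm2].
rewrite RintegralD//; [|exact: ibl_cst_itv|exact: ibl_enorm2].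
rewrite Rintegral_cst// mul1r; congr (_ * (_ + _)).
by rewrite muT.
Qed.

Lemma run_ibl (x : R -> X) (u : R -> U) : measurable_fun D x -> vsqi D u ->
  ibl mu D (fun s => l s (x s) (u s)).
Proof.
move=> mx Su; apply: (ibl_le mD) (ibl_weight C Su).
  by apply: lagrangian_measurable => //; exact: vsqi_mfun.
by move=> s Ds; exact: (lag_growth (lag Ds)).
Qed.

Lemma gradu_vsqi (x : R -> X) (u : R -> U) : measurable_fun D x -> vsqi D u ->
  vsqi D (fun s => gradu (l s) (x s) (u s)).
Proof.
move=> mx Su; apply: (vsqi_le mD (g := fun s => C * (1 + enorm (u s)))).
- by apply: gradu_measurable => //; exact: vsqi_mfun.
- by move=> s Ds; exact: (lag_gradu (lag Ds)).
- apply: (sqiZ mD); apply: (sqiD mD); [exact: sqi_cst_itv|exact: vsqi_enorm].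
Qed.

Lemma gradx_vibl (x : R -> X) (u : R -> U) : measurable_fun D x -> vsqi D u ->
  vibl D (fun s => gradx (l s) (x s) (u s)).
Proof.
move=> mx Su; apply: (vibl_le mD (g := fun s => C * (1 + enorm (u s) ^+ 2))).
- by apply: gradx_measurable => //; exact: vsqi_mfun.
- by move=> s Ds; exact: (lag_gradx (lag Ds)).
- exact: ibl_weight.
Qed.

Lemma run_coercive (x : R -> X) (u : R -> U) : measurable_fun D x -> vsqi D u ->
  C0^-1 / 4 * norm2 u - C * T <= run l x u.
Proof.
move=> mx Su; apply: (@le_trans _ _ (\int[mu]_(s in D) (C0^-1 / 4 * enorm (u s) ^+ 2 - C))).
  rewrite RintegralB//; [|by apply: (iblZ mD); exact: ibl_enorm2|exact: ibl_cst_itv].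
  rewrite RintegralZl//; last exact: ibl_enorm2.
  by rewrite Rintegral_cst// muT.
apply: Rint_le => //.
- by apply: (iblB mD); [apply: (iblZ mD); exact: ibl_enorm2|exact: ibl_cst_itv].
- exact: run_ibl.
- by move=> s Ds; exact: (lag_coercive (lag Ds)).
Qed.

Lemma run_zero (x : R -> X) : measurable_fun D x -> run l x (fun=> 0) <= C * T.
Proof.
move=> mx; have S0 : vsqi D (fun=> 0 : U).
  by move=> i; apply: (eq_sqi mD (f := cst 0)); [move=> s _; rewrite /= mxE|exact: sqi_cst_itv].
have n0 : norm2 (fun=> 0) = 0.
  rewrite /norm2 /Rintegral (eq_integral (fun=> 0%E)) ?integral0// => s _.
  by rewrite enorm0 expr0n.
rewrite -[T]addr0 -n0 -Rint_weight//; apply: Rint_le => //.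
- exact: run_ibl.
- exact: ibl_weight.
- by move=> s Ds; apply: le_trans (lag_growth (lag Ds) _ _); exact: ler_norm.
Qed.

(** The correction is linear in [u], so weak convergence of the controls to [w] makes it disappear;
    this provides the lower semicontinuity. *)
Lemma run_convex (x : R -> X) (u w : R -> U) : measurable_fun D x -> vsqi D u -> vsqi D w ->
  run l x w + \sum_i \int[mu]_(s in D) (gradu (l s) (x s) (w s) i 0 * (u s i 0 - w s i 0)) <= run l x u.
Proof.
move=> mx Su Sw; have Sg := gradu_vsqi mx Sw.
have Ii i : ibl mu D (fun s => gradu (l s) (x s) (w s) i 0 * (u s i 0 - w s i 0)).
  by apply: (sqiM mD) => //; exact: (sqiB mD).
rewrite -(Rint_sum mD)// -RintegralD//; [|exact: run_ibl|exact: (ibl_sum mD)].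
apply: Rint_le => //.
- by apply: (iblD mD); [exact: run_ibl|exact: (ibl_sum mD)].
- exact: run_ibl.
move=> s Ds; apply: le_trans (lag_convex (lag Ds) (x s) (w s) (u s)).
have -> : \sum_i gradu (l s) (x s) (w s) i 0 * (u s i 0 - w s i 0) =
    edot (gradu (l s) (x s) (w s)) (u s - w s).
  by apply: eq_bigr => i _; rewrite coordB.
by rewrite lerDl divr_ge0// mulr_ge0 ?sqr_ge0// invr_ge0 ltW.
Qed.

Lemma run_close (l' : R -> X -> U -> R) (x x' : R -> X) (u : R -> U) (e del : R) :
  (forall s, D s -> forall y v, `|l' s y v - l s y v| <= e) ->
  (forall s, D s -> enorm (x' s - x s) <= del) ->
  ibl mu D (fun s => l' s (x' s) (u s)) -> measurable_fun D x -> vsqi D u ->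
  `|run l' x' u - run l x u| <= e * T + C * del * (T + norm2 u).
Proof.
move=> le xd Il' mx Su; have Il := run_ibl mx Su.
rewrite -RintegralB//; apply: le_trans (le_normr_Rintegral mD (iblB mD Il' Il)) _.
have -> : e * T + C * del * (T + norm2 u) =
    \int[mu]_(s in D) (e + C * del * (1 + enorm (u s) ^+ 2)).
  rewrite RintegralD//; [|exact: ibl_cst_itv|exact: ibl_weight].
  rewrite Rint_weight// Rintegral_cst//; congr (_ * _ + _).
  by rewrite muT.
apply: Rint_le => //.
- exact/(ibl_norm)/(iblB mD).
- by apply: (iblD mD); [exact: ibl_cst_itv|exact: ibl_weight].
move=> s Ds; have -> : l' s (x' s) (u s) - l s (x s) (u s) =
  (l' s (x' s) (u s) - l s (x' s) (u s)) + (l s (x' s) (u s) - l s (x s) (u s)) by ring.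
apply: le_trans (ler_normD _ _) _; apply: lerD; first exact: le.
apply: le_trans (lag_lip (lag Ds) _ _ _) _; rewrite mulrAC ler_wpM2r//.
  by rewrite addr_ge0// sqr_ge0.
by rewrite ler_wpM2l//; exact: xd.
Qed.

End TimeLagrangian.

(** * Closed graph of the optimality relation *)

Lemma small_factor {R : realType} (c e : R) : 0 <= c -> 0 < e -> exists2 del, 0 < del & c * del <= e.
Proof.
move=> c0 e0; exists (e / (c + 1)); first by rewrite divr_gt0// ltr_wpDl.
by rewrite mulrA ler_pdivrMr ?ltr_wpDl// mulrC ler_wpM2l ?(ltW e0)// lerDl.
Qed.

Lemma coercive_arith {R : realFieldType} (p q g h c n N : R) :
  p + g <= q + h -> n - c <= p -> q <= c -> - N <= g -> h <= N -> n <= 2 * (c + N).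
Proof. lra. Qed.

Lemma limit_arith {R : realFieldType} (w p q b c g1 g2 h1 h2 z e : R) : 0 < e ->
  p + g1 <= b + h1 -> - (e / 8 + e / 8) <= p - q -> w + z <= q -> b - c <= e / 8 + e / 8 ->
  - (e / 8) <= g1 - g2 -> h1 - h2 <= e / 8 -> - (e / 8) <= z -> w + g2 <= c + h2 + e.
Proof. lra. Qed.

Section KineticLimit.
Context {R : realType} {n : nat}.
Variables (T : R) (Y : Type) (F : set_system Y) (FU : UltraFilter F).
Hypothesis T0 : 0 < T.
Local Notation V := 'cV[R]_n.
Local Notation mu := (@lebesgue_measure R).
Local Notation D := (`[0, T]%classic).
Let FF : ProperFilter F := @ultra_proper _ _ FU.

(** Applied to the primitives of bounded controls, this produces their weak limit [w]. *)
Lemma kinetic_ultra_limit (c : Y -> R -> V) (M M0 : R) : 0 <= M ->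
  F [set y | enorm (c y 0) <= M0] ->
  F [set y | forall s t i, D s -> D t -> (c y t i 0 - c y s i 0) ^+ 2 <= M * `|t - s|] ->
  (forall m, F [set y | venergy T (c y) (2 ^ m) <= M]) ->
  exists h w, [/\ forall t i, D t -> c y t i 0 @[y --> F] --> (h t : V) i 0, vsqi D w,
    forall t, D t -> h t = h 0 + vint `[0, t] w
    & (\int[mu]_(t in D) (enorm (w t) ^+ 2)%:E <= M%:E)%E].
Proof.
move=> M_0 F0 Fmod Fen.
have lim (q : R * 'I_n) : exists l : R, c y (clamp T q.1) q.2 0 @[y --> F] --> l.
  apply: (@ultra_lim _ _ F FU _ (M0 + Num.sqrt (M * T))).
  apply: filterS2 F0 Fmod => y y0 ymod /=.
  apply: le_trans (modulus_bound (f := fun t => c y t q.2 0) T0 M_0 (clamp_in T0 q.1) _) _.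
    apply: ymod; last exact: clamp_in.
    by rewrite /= in_itv/= lexx ltW.
  rewrite lerD2r; exact: le_trans (coord_enorm _ _) y0.
have [l lP] := choice lim.
pose h t : V := \col_i l (t, i).
have hlim t i : D t -> c y t i 0 @[y --> F] --> h t i 0.
  by move=> Dt; rewrite mxE; have := lP (t, i); rewrite /= clampE.
have hmod s t i : D s -> D t -> (h t i 0 - h s i 0) ^+ 2 <= M * `|t - s|.
  move=> Ds Dt; have c1 : c y t i 0 - c y s i 0 @[y --> F] --> h t i 0 - h s i 0 by apply: cvgB; exact: hlim.
  have c2 : (c y t i 0 - c y s i 0) * (c y t i 0 - c y s i 0) @[y --> F] -->
      (h t i 0 - h s i 0) * (h t i 0 - h s i 0) by apply: cvgM; exact: c1.
  rewrite expr2; refine (ultra_lim_le FU c2 _).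
  by apply: filterS Fmod => y H /=; rewrite -expr2; exact: H.
have hen m : venergy T h (2 ^ m) <= M.
  have N0 : (0 < 2 ^ m)%N by rewrite expn_gt0.
  suff cv : venergy T (c y) (2 ^ m) @[y --> F] --> venergy T h (2 ^ m).
    exact: (ultra_lim_le FU cv (Fen m)).
  apply: cvg_bigsum => // i; apply: cvg_bigsum => // j.
  have Dj1 : D (node T (2 ^ m) j.+1) by exact: (node_in T0 N0 (ltn_ord j)).
  have Dj : D (node T (2 ^ m) j) by exact: (node_in T0 N0 (ltnW (ltn_ord j))).
  have c1 : c y (node T (2 ^ m) j.+1) i 0 - c y (node T (2 ^ m) j) i 0 @[y --> F] -->
    h (node T (2 ^ m) j.+1) i 0 - h (node T (2 ^ m) j) i 0 by apply: cvgB; exact: hlim.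
  rewrite expr2; under eq_fun do rewrite expr2.
  by apply: cvgM; [apply: cvgM; exact: c1|exact: cvg_cst].
have [w [Sw wE wM]] := kinetic_of_energy T0 M_0 hmod hen.
by exists h, w.
Qed.

End KineticLimit.

Section Game.
Context {R : realType} {d k : nat}.
Variables (A : 'M[R]_d) (B : 'M[R]_(d, k)) (T : R).
Hypothesis T0 : 0 < T.
Local Notation X := 'cV[R]_d.
Local Notation U := 'cV[R]_k.
Local Notation mu := (@lebesgue_measure R).
Local Notation D := (`[0, T]%classic).
Local Notation Gam := (Gamma A B T).
Local Notation Pr := (probability Gam R).
Variables (L : X -> U -> probability X R -> R) (G : X -> probability X R -> R).
Hypotheses (HL : running_cost_assumptions L) (HG : terminal_cost_assumptions G).
Variables (a r : R) (m0 : probability X R).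
Hypothesis a1 : 1 < a.
Hypothesis m0a : finite_moment a m0.
Let mD : measurable (D : set (measurableTypeR R)). Proof. exact: measurable_itv. Qed.
Let D0 : D 0. Proof. by rewrite /= in_itv/= lexx ltW. Qed.
Let DT : D T. Proof. by rewrite /= in_itv/= lexx ltW. Qed.

Definition flow_cost (eta : Pr) (t : R) (x : X) (u : U) : R := L x u (marginal eta t).

Lemma flow_costP : exists C0 C K : R, [/\ 0 < C0, 0 <= C, 0 <= K & forall eta : Pr, PGamma a m0 r eta ->
  (forall t, D t -> lagrangian C0 C (flow_cost eta t)) /\
  (forall s t x u, D s -> D t -> `|flow_cost eta s x u - flow_cost eta t x u| <= K * Num.sqrt `|s - t|)].
Proof.
have [C0 [C [C00 C_0 H]]] := lagrangianP HL; have [K K0 LK] := L_Lipschitz HL.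
have [c c0 Hc] := @marginal_modulus R d k A B T T0 a r m0 a1.
exists C0, C, (K * c); split=> //; first exact: mulr_ge0.
have fm (eta : Pr) t : PGamma a m0 r eta -> D t -> finite_moment 1 (marginal eta t).
  by move=> eP Dt; exact: (marginal_moment_fin T0 a1 m0a eP Dt).2.
move=> eta eP; split=> [t Dt|s t x u Ds Dt]; first exact/H/fm.
rewrite -lee_fin; apply: le_trans (LK _ _ _ _ (fm _ _ eP Ds) (fm _ _ eP Dt)) _.
by rewrite -mulrA EFinM lee_wpmul2l ?lee_fin//; exact: Hc.
Qed.

Lemma curve_measurable (g : Gam) : measurable_fun D (fun t => ev t g).
Proof.
have [u _ /solutionP[cg _ _]] := Gamma_sol T0 g.
exact: within_measurable_cV.
Qed.

Lemma costE (eta : Pr) x u : cost L G eta x u =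
  run T (flow_cost eta) (fun t => ev t (traj A B T x u)) u + G (ev T (traj A B T x u)) (marginal eta T).
Proof. by []. Qed.

Lemma traj0 x (u : R -> U) : vibl D u -> ev 0 (traj A B T x u) = x.
Proof. by move=> Iu; exact: sol0 (traj_sol A B T0 x Iu). Qed.

Lemma optimal_control (eta : Pr) x g : optimal_curves L G eta x g -> exists u, [/\ vsqi D u,
  g = traj A B T (ev 0 g) u & forall v, vsqi D v -> cost L G eta (ev 0 g) u <= cost L G eta (ev 0 g) v].
Proof.
move=> [u [/control_L2P Su opt gE]]; have Iu := vsqi_vibl Su.
have xE : ev 0 g = x by rewrite gE traj0.
exists u; split; [exact: Su|by rewrite xE|].
by move=> v Sv; rewrite xE; apply: opt; exact/control_L2P.
Qed.

Lemma vsqi0 : vsqi D (fun=> 0 : U).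
Proof. by move=> i; apply: (eq_sqi mD (f := cst 0)); [move=> s _; rewrite /= mxE|exact: sqi_cst_itv]. Qed.

Lemma G_boundP : exists2 N, 0 <= N & forall x m, finite_moment 1 m -> `|G x m| <= N.
Proof.
have [N NP] := G_bounded HG; exists (`|N|); first exact: normr_ge0.
by move=> x m m1; apply: le_trans (NP x m m1) _; exact: ler_norm.
Qed.

(** Comparison with the zero control, whose cost is bounded independently of the starting point;
    coercivity bounds the norm from the other side. *)
Lemma optimal_norm : exists2 M, 0 <= M & forall (eta : Pr) x u, PGamma a m0 r eta -> vsqi D u ->
  (forall v, vsqi D v -> cost L G eta x u <= cost L G eta x v) -> norm2 T u <= M.
Proof.
have [C0 [C [K [C00 C_0 K0 HF]]]] := flow_costP; have [N N0 GN] := G_boundP.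
exists (4 * C0 * (2 * (C * T + N))).
  by rewrite !mulr_ge0 ?(ltW C00)// addr_ge0// mulr_ge0// ltW.
move=> eta x u eP Su opt; have [lag lmod] := HF eta eP.
have fm : finite_moment 1 (marginal eta T) by exact: (marginal_moment_fin T0 a1 m0a eP DT).2.
have := opt _ vsqi0; rewrite !costE => h.
have h1 := run_coercive T0 K0 lag lmod (curve_measurable (traj A B T x u)) Su.
have h2 := run_zero T0 K0 lag lmod (curve_measurable (traj A B T x (fun=> 0))).
have g1 := GN (ev T (traj A B T x u)) _ fm; have g2 := GN (ev T (traj A B T x (fun=> 0))) _ fm.
rewrite ler_norml in g1; case/andP: g1 => g1 _; rewrite ler_norml in g2; case/andP: g2 => _ g2.
have : C0^-1 / 4 * norm2 T u <= 2 * (C * T + N).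
  exact: coercive_arith h h1 h2 g1 g2.
have -> : C0^-1 / 4 * norm2 T u = norm2 T u / (4 * C0) by field; rewrite gt_eqF.
by rewrite ler_pdivrMr ?mulr_gt0// mulrC.
Qed.

Section ClosedGraph.
Variables (Y : Type) (F : set_system Y) (FU : UltraFilter F) (nu : Y -> Pr).
Variables (h : set Gam -> R) (eta : Pr).
Hypothesis Fnu : F [set y | PGamma a m0 r (nu y)].
Hypothesis nuh : forall E, measurable E -> fine (nu y E) @[y --> F] --> h E.
Hypothesis etaP : PGamma a m0 r eta.
Hypothesis etah : forall O, open O -> (eta O <= (h O)%:E)%E.
Let FF : ProperFilter F := @ultra_proper _ _ FU.

Lemma flow_cost_cvg e : 0 < e ->
  F [set y | forall t, D t -> forall x u, `|flow_cost (nu y) t x u - flow_cost eta t x u| <= e].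
Proof.
move=> e0; have [K K0 LK] := L_Lipschitz HL.
have [e1 e10 Ke] := @small_factor R (3 * K) e (mulr_ge0 (ler0n _ _) K0) e0.
have FC := flow_convergence T0 a1 m0a FU Fnu nuh etaP etah e10.
apply: filterS2 Fnu FC => y yP H t Dt x u.
have [m1 [m2 [f1 f2 h1 h2 h3]]] := H t Dt.
have fn : finite_moment 1 (marginal (nu y) t) by exact: (marginal_moment_fin T0 a1 m0a yP Dt).2.
have fe : finite_moment 1 (marginal eta t) by exact: (marginal_moment_fin T0 a1 m0a etaP Dt).2.
have bd m m' : finite_moment 1 m -> finite_moment 1 m' -> (d1 m m' <= e1%:E)%E -> `|L x u m - L x u m'| <= K * e1.
  move=> f f' dm; rewrite -lee_fin; apply: le_trans (LK _ _ _ _ f f') _.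
  by rewrite EFinM lee_wpmul2l ?lee_fin.
have b1 := bd _ _ fn f1 h1; have b2 := bd _ _ f1 f2 h2; have b3 := bd _ _ fe f2 h3.
apply: le_trans Ke; rewrite /flow_cost.
have -> : L x u (marginal (nu y) t) - L x u (marginal eta t) =
  (L x u (marginal (nu y) t) - L x u m1) + (L x u m1 - L x u m2) - (L x u (marginal eta t) - L x u m2) by ring.
have -> : 3 * K * e1 = K * e1 + K * e1 + K * e1 by ring.
apply: le_trans (ler_normB _ _) _; apply: lerD b3.
by apply: le_trans (ler_normD _ _) _; exact: lerD.
Qed.

Lemma terminal_cost_cvg e : 0 < e -> exists2 del, 0 < del & F [set y | forall x z, enorm (x - z) < del ->
  `|G x (marginal (nu y) T) - G z (marginal eta T)| <= e].
Proof.
move=> e0; have e3 : 0 < e / 3 by rewrite divr_gt0.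
have [del del0 Hd] := G_unif_continuous HG e3; exists del => //.
have d2 : 0 < del / 2 by rewrite divr_gt0.
have FC := flow_convergence T0 a1 m0a FU Fnu nuh etaP etah d2.
apply: filterS2 Fnu FC => y yP H x z xz.
have [m1 [m2 [f1 f2 h1 h2 h3]]] := H T DT.
have fn : finite_moment 1 (marginal (nu y) T) by exact: (marginal_moment_fin T0 a1 m0a yP DT).2.
have fe : finite_moment 1 (marginal eta T) by exact: (marginal_moment_fin T0 a1 m0a etaP DT).2.
have lt (m m' : probability X R) : (d1 m m' <= (del / 2)%:E)%E -> (d1 m m' < del%:E)%E.
  by move=> h'; apply: (le_lt_trans h'); rewrite lte_fin; lra.
have xx : enorm (x - x) < del by rewrite subrr enorm0.
have b1 := Hd x x _ _ fn f1 xx (lt _ _ h1); have b2 := Hd x x _ _ f1 f2 xx (lt _ _ h2).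
have b3 : `|G z (marginal eta T) - G x m2| < e / 3.
  by apply: Hd => //; [rewrite enorm_distC|exact: lt].
have -> : G x (marginal (nu y) T) - G z (marginal eta T) =
  (G x (marginal (nu y) T) - G x m1) + (G x m1 - G x m2) - (G z (marginal eta T) - G x m2) by ring.
have -> : e = e / 3 + e / 3 + e / 3 by field.
apply: le_trans (ler_normB _ _) _; apply: lerD (ltW b3).
by apply: le_trans (ler_normD _ _) _; apply: lerD; exact: ltW.
Qed.

Variables (gy : Y -> Gam) (g : Gam).
Hypothesis Fopt : F [set y | exists x, optimal_curves L G (nu y) x (gy y)].
Hypothesis Fg : forall e, 0 < e -> F [set y | near_curve g (gy y) e].

(** Weak limits are taken through primitives: those of the controls converge pointwise to the
    primitive of some [w]. The integrated equation is linear in the curve and in that primitive, so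
    [w] drives the limit curve. *)
Lemma limit_control : exists M (u : Y -> R -> U) (w : R -> U), [/\ 0 <= M, vsqi D w, g = traj A B T (ev 0 g) w,
  F [set y | [/\ vsqi D (u y), norm2 T (u y) <= M, gy y = traj A B T (ev 0 (gy y)) (u y) &
     forall v, vsqi D v -> cost L G (nu y) (ev 0 (gy y)) (u y) <= cost L G (nu y) (ev 0 (gy y)) v]]
  & forall q : R -> U, vsqi D q -> forall e, 0 < e ->
     F [set y | `|\sum_i \int[mu]_(s in D) (q s i 0 * (u y s i 0 - w s i 0))| <= e]].
Proof.
have [M M0 HM] := optimal_norm.
have /choice[u uP] : forall y, exists u : R -> U, (exists x, optimal_curves L G (nu y) x (gy y)) ->
   [/\ vsqi D u, gy y = traj A B T (ev 0 (gy y)) u &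
     forall v, vsqi D v -> cost L G (nu y) (ev 0 (gy y)) u <= cost L G (nu y) (ev 0 (gy y)) v].
  move=> y; have [[x o]|n] := pselect (exists x, optimal_curves L G (nu y) x (gy y)); last by exists (fun=> 0).
  by have [u up] := optimal_control o; exists u.
have Fgood : F [set y | [/\ vsqi D (u y), norm2 T (u y) <= M, gy y = traj A B T (ev 0 (gy y)) (u y) &
     forall v, vsqi D v -> cost L G (nu y) (ev 0 (gy y)) (u y) <= cost L G (nu y) (ev 0 (gy y)) v]].
  apply: filterS2 Fnu Fopt => y yP /uP[Su gE opt]; split=> //.
  exact: HM yP Su opt.
pose c y t : U := vint `[0, t] (u y).
have kin y : vsqi D (u y) -> norm2 T (u y) <= M ->
    (forall N, (0 < N)%N -> venergy T (c y) N <= M) /\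
    (forall s t i, D s -> D t -> (c y t i 0 - c y s i 0) ^+ 2 <= M * `|t - s|).
  move=> Su uM; have [||_ h1 h2] := @energy_of_kinetic R T T0 k (c y) (u y) 0 M (vsqi_vibl Su) _ _.
  - by move=> t Dt; rewrite add0r.
  - by rewrite (integralE_fin mD (ibl_enorm2 Su)) lee_fin.
  by split.
have c00 y : c y 0 = 0.
  by apply/colP => i; rewrite /c /vint mxE set_itv1 Rintegral_set1 mxE.
have [|||cw [w [cwl Sw cwE wM]]] := @kinetic_ultra_limit R k T Y F FU T0 c M 0 M0.
- by apply: filterE => y; rewrite /= c00 enorm0.
- by apply: filterS Fgood => y [Su uM _ _]; exact: (kin y Su uM).2.
- by move=> m; apply: filterS Fgood => y [Su uM _ _]; apply: (kin y Su uM).1; rewrite expn_gt0.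
have cw0 : cw 0 = 0.
  apply/colP => i; rewrite [RHS]mxE; apply: (cvg_unique _ (cwl 0 i D0)) => //.
  have -> : (fun y => c y 0 i 0) = (fun=> 0) by apply/funext => y; rewrite c00 mxE.
  exact: cvg_cst.
have Iw := vsqi_vibl Sw.
have cwv t : D t -> cw t = vint `[0, t] w by move=> Dt; rewrite cwE// cw0 add0r.
have wM' : norm2 T w <= M by rewrite -lee_fin -(integralE_fin mD (ibl_enorm2 Sw)).
have sub t n (f : R -> 'cV[R]_n) : D t -> vibl D f -> vibl `[0, t] f.
  by rewrite /= in_itv/= => /andP[_ tT] If i; exact: ibl_itv (If i).
have gvibl (g' : Gam) : vibl D (fun t => ev t g').
  by have [v _ sg'] := Gamma_sol T0 g'; exact: sol_vibl sg'.
(* The left side of the integrated equation converges by uniform closeness of the curves, the right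
   side by pointwise convergence of the primitives. *)
have gw t : D t -> ev t g = (ev 0 g + B *m vint `[0, t] w) + vint `[0, t] (fun s => A *m ev s g).
  move=> Dt; have := Dt; rewrite /= in_itv/= => /andP[t0 tT].
  suff : ev t g - ev 0 g - vint `[0, t] (fun s => A *m ev s g) = B *m vint `[0, t] w.
    by move=> <-; rewrite [ev 0 g + _]addrC [ev t g - _ - _]addrAC subrK subrK.
  apply/colP => i; rewrite -cwv//.
  have c1 : (B *m c y t) i 0 @[y --> F] --> (B *m cw t) i 0.
    rewrite mxE; under eq_fun do rewrite mxE; apply: cvg_bigsum => // j.
    by apply: cvgM; [exact: cvg_cst|exact: cwl].
  apply: (cvg_unique _ _ c1) => //; apply/cvgrPdist_le => e e0.
  have [e1 e10 He] := @small_factor R (2 + mx_sum A * T) e (addr_ge0 (ler0n _ _) (mulr_ge0 (mx_sum_ge0 _) (ltW T0))) e0.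
  apply: filterS2 Fgood (Fg e10) => y [Su _ gyE _] gyn.
  have sg := traj_sol A B T0 (ev 0 (gy y)) (vsqi_vibl Su); rewrite -gyE in sg.
  have -> : B *m c y t = ev t (gy y) - ev 0 (gy y) - vint `[0, t] (fun s => A *m ev s (gy y)).
    rewrite (sol_split (vsqi_vibl Su) sg Dt) /c.
    by rewrite addrAC addrK addrC addKr.
  apply: le_trans He; rewrite -coordB; apply: le_trans (coord_enorm _ _) _.
  have IA (g' : Gam) : vibl `[0, t] (fun s => A *m ev s g') by apply: sub => //; exact: vibl_mulmx.
  have -> : ev t g - ev 0 g - vint `[0, t] (fun s => A *m ev s g) -
     (ev t (gy y) - ev 0 (gy y) - vint `[0, t] (fun s => A *m ev s (gy y))) =
     (ev t g - ev t (gy y)) - (ev 0 g - ev 0 (gy y)) - vint `[0, t] (fun s => A *m (ev s g - ev s (gy y))).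
    have -> : vint `[0, t] (fun s => A *m (ev s g - ev s (gy y))) =
        vint `[0, t] (fun s => A *m ev s g) - vint `[0, t] (fun s => A *m ev s (gy y)).
      by rewrite -vintB//; apply: eq_vint => s _; rewrite mulmxBr.
    by apply/colP => j; rewrite !(coordB, coordD); ring.
  apply: le_trans (ler_enormB _ _) _; rewrite mulrDl; apply: lerD.
    apply: le_trans (ler_enormB _ _) _; rewrite mulr_natl mulr2n.
    by apply: lerD; exact: gyn.
  have Id : vibl `[0, t] (fun s => ev s g - ev s (gy y)) by apply: viblB => //; exact: sub.
  apply: le_trans (enorm_vint _ _) _ => //; first exact: vibl_mulmx.
  apply: (@le_trans _ _ (\int[mu]_(s in `[0, t]) (mx_sum A * e1))).
    apply: Rint_le => //.
    - by apply: vibl_enorm => //; exact: vibl_mulmx.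
    - exact: ibl_cst_itv.
    - move=> s /(sub_itvcc (lexx 0) tT) Ds; apply: le_trans (enorm_mulmx _ _) _.
      by rewrite ler_wpM2l ?mx_sum_ge0//; exact: gyn.
  rewrite Rintegral_cst//.
  have -> : fine (mu `[0, t]) = t by rewrite mu_itv// subr0.
  by rewrite mulrAC ler_wpM2r ?(ltW e10)// ler_wpM2l ?mx_sum_ge0.
have gsol : solution A B T (ev 0 g) w (fun t => ev t g).
  have [v _ /solutionP[cg _ cl]] := Gamma_sol T0 g.
  apply/solutionP; split=> // t Dt; rewrite {1}gw// vintD//; last 2 first.
  - by apply: sub => //; exact: vibl_mulmx.
  - by apply: sub => //; exact: vibl_mulmx.
  rewrite [vint `[0, t] (fun s => B *m w s)]vint_mulmx; [|exact: measurable_itv|exact: sub Dt Iw].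
  by rewrite -addrA; congr (_ + _); rewrite addrC.
exists M, u, w; split=> //; first by rewrite (trajE T0 Iw gsol).
move=> q Sq e e0; have [e1 e10 He] := @small_factor R k%:R e (ler0n _ _) e0.
have M4 : 0 <= 4 * M by rewrite mulr_ge0.
have : F [set y | forall i : 'I_k, `|\int[mu]_(s in D) (q s i 0 * (u y s i 0 - w s i 0))| <= e1].
  apply: filter_forall => i.
  (* [4 * M] since the square of a difference is at most twice the sum of the squares. *)
  apply: (@weak_convergence R T T0 Y F FU (fun y s => u y s i 0 - w s i 0) (4 * M)) => //.
    apply: filterS Fgood => y [Su uM _ _].
    have Sd : sqi mu D (fun s => u y s i 0 - w s i 0) by exact: (sqiB mD).
    split=> //; apply: (@le_trans _ _ (\int[mu]_(s in D) (2 * enorm (u y s) ^+ 2 + 2 * enorm (w s) ^+ 2))).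
      apply: Rint_le => //; first exact: Sd.2.
        by apply: (iblD mD); apply: (iblZ mD); exact: ibl_enorm2.
      move=> s _; have h1 : u y s i 0 ^+ 2 <= enorm (u y s) ^+ 2.
        by rewrite sqr_enormE (bigD1 i)//= lerDl; apply: sumr_ge0 => j _; exact: sqr_ge0.
      have h2 : w s i 0 ^+ 2 <= enorm (w s) ^+ 2.
        by rewrite sqr_enormE (bigD1 i)//= lerDl; apply: sumr_ge0 => j _; exact: sqr_ge0.
      have := sqr_ge0 (u y s i 0 + w s i 0); rewrite sqrrD sqrrB.
      move: (u y s i 0 ^+ 2) (w s i 0 ^+ 2) (u y s i 0 * w s i 0) (enorm (u y s) ^+ 2) (enorm (w s) ^+ 2) h1 h2.
      by move=> p1 p2 p3 p4 p5 h1 h2; rewrite !mulr2n; lra.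
    rewrite RintegralD//; [|by apply: (iblZ mD); exact: ibl_enorm2|by apply: (iblZ mD); exact: ibl_enorm2].
    rewrite !RintegralZl//; [|exact: ibl_enorm2|exact: ibl_enorm2].
    by move: uM wM'; rewrite /norm2; lra.
  move=> t Dt; have Dt' := Dt; have := cwl t i Dt; rewrite cwv// => cv.
  have c1 : c y t i 0 - (vint `[0, t] w) i 0 @[y --> F] --> (0 : R).
    have E : (vint `[0, t] w) i 0 - (vint `[0, t] w) i 0 = 0 by exact: subrr.
    by rewrite -[X in _ --> X]E; apply: cvgB; [exact: cv|exact: cvg_cst].
  apply: cvg_trans c1; apply: near_eq_cvg; apply: filterS Fgood => y [Su _ _ _] /=.
  have Iu' := sub t _ _ Dt (vsqi_vibl Su); have Iw' := sub t _ _ Dt Iw.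
  by rewrite /c /vint !mxE RintegralB//; [exact: Iu' i|exact: Iw' i].
apply: filterS => y H; apply: le_trans He; apply: le_trans (ler_norm_sum _ _ _) _.
apply: (@le_trans _ _ (\sum_(i < k) e1)); first by apply: ler_sum => i _; exact: H.
by rewrite sumr_const card_ord mulr_natl.
Qed.

(** A competitor [v] is run from the starting point of [gy y], where the inequality is known, and
    its curve is compared with that from [ev 0 g]. On the optimal side the curve is first moved to
    [g] with [u y] kept, and [u y] is then replaced by [w] by convexity. *)
Theorem closed_graph : optimal_curves L G eta (ev 0 g) g.
Proof.
have [M [u [w [M0 Sw gE Fu Fw]]]] := limit_control.
have [C0 [C [K [C00 C_0 K0 HF]]]] := flow_costP.
have [lag lmod] := HF eta etaP.
exists w; split; [exact/control_L2P| |exact: gE].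
move=> v /control_L2P Sv; apply/ler_addgt0Pr => e e0.
have e8 : 0 < e / 8 by rewrite divr_gt0.
have [f f0 fT] := @small_factor R T _ (ltW T0) e8; rewrite mulrC in fT.
have [delG delG0 FG] := terminal_cost_cvg e8.
pose E := 2 * expR (2 * mx_sum A * T).
have E0 : 0 < E by rewrite mulr_gt0// expR_gt0.
have [del1 del10 d1P] := @small_factor R (C * (T + M)) _ (mulr_ge0 C_0 (addr_ge0 (ltW T0) M0)) e8.
have nv0 := norm2_ge0 T v.
have [del2 del20 d2P] := @small_factor R (C * E * (T + norm2 T v)) _
  (mulr_ge0 (mulr_ge0 C_0 (ltW E0)) (addr_ge0 (ltW T0) nv0)) e8.
have [del3 del30 d3P] := @small_factor R (2 * (1 + E)) delG (mulr_ge0 (ler0n _ _) (addr_ge0 ler01 (ltW E0))) delG0.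
pose del := Num.min del1 (Num.min del2 del3).
have del0 : 0 < del by rewrite !lt_min del10 del20.
have dl1 : del <= del1 by rewrite ge_min lexx.
have dl2 : del <= del2 by rewrite !ge_min lexx orbT.
have dl3 : del <= del3 by rewrite !ge_min lexx !orbT.
have Sq := gradu_vsqi T0 K0 lag lmod (curve_measurable g) Sw.
(* The estimates for [v] and [e] hold together for a single index [y], from which the inequality for
   [w] is read off. *)
have Fall := @filterI _ F FF _ _ (@filterI _ F FF _ _ (@filterI _ F FF _ _ Fnu Fu)
  (@filterI _ F FF _ _ (Fg del0) (flow_cost_cvg f0))) (@filterI _ F FF _ _ (Fw _ Sq _ e8) FG).
have [y [[[yP [Su uM gyE opt]] [yn yf]] [yw yG]]] := @filter_ex _ F FF _ Fall.
have [lagy lmody] := HF _ yP.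
have xn : enorm (ev 0 (gy y) - ev 0 g) <= del by rewrite enorm_distC; exact: yn.
have h1 := opt v Sv; rewrite !costE -gyE in h1.
have k1 : `|run T (flow_cost (nu y)) (fun t => ev t (gy y)) (u y) - run T (flow_cost eta) (fun t => ev t g) (u y)|
    <= e / 8 + e / 8.
  apply: le_trans (run_close T0 C_0 K0 lag lmod yf _ _ (curve_measurable g) Su) _.
  - by move=> s Ds; rewrite enorm_distC; exact: yn.
  - exact: (run_ibl T0 K0 lagy lmody (curve_measurable (gy y)) Su).
  apply: lerD => //; apply: le_trans d1P.
  have -> : C * del * (T + norm2 T (u y)) = C * (T + norm2 T (u y)) * del by ring.
  have n0 := norm2_ge0 T (u y).
  apply: ler_pM => //; [by rewrite mulr_ge0// addr_ge0// ltW|exact: ltW|by rewrite ler_wpM2l// lerD2l].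
have k2 := run_convex T0 C00 K0 lag lmod (curve_measurable g) Su Sw.
have gyv := traj_sol A B T0 (ev 0 (gy y)) (vsqi_vibl Sv); have gv := traj_sol A B T0 (ev 0 g) (vsqi_vibl Sv).
have dist s : enorm (ev s (traj A B T (ev 0 (gy y)) v) - ev s (traj A B T (ev 0 g) v)) <= E * del.
  apply: le_trans (sol_dist T0 (vsqi_vibl Sv) gyv gv s) _.
  by rewrite /E mulrAC ler_wpM2l// mulr_ge0// expR_ge0.
have k3 : `|run T (flow_cost (nu y)) (fun t => ev t (traj A B T (ev 0 (gy y)) v)) v -
    run T (flow_cost eta) (fun t => ev t (traj A B T (ev 0 g) v)) v| <= e / 8 + e / 8.
  apply: le_trans (run_close T0 C_0 K0 lag lmod yf (fun s _ => dist s) _ (curve_measurable _) Sv) _.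
    exact: (run_ibl T0 K0 lagy lmody (curve_measurable _) Sv).
  apply: lerD => //; apply: le_trans d2P.
  have -> : C * (E * del) * (T + norm2 T v) = C * E * (T + norm2 T v) * del by ring.
  by rewrite ler_wpM2l// mulr_ge0 ?mulr_ge0 ?(ltW E0)// addr_ge0 ?(ltW T0).
have small (z : R) : z <= (1 + E) * del -> z < delG.
  move=> zl; apply: (le_lt_trans zl); apply: (@lt_le_trans _ _ (2 * (1 + E) * del3)) => //.
  apply: (@le_lt_trans _ _ ((1 + E) * del3)); first by rewrite ler_wpM2l// addr_ge0 ?(ltW E0).
  rewrite -mulrA mulr_natl mulr2n ltrDl mulr_gt0// addr_gt0//.
have k4 : `|G (ev T (gy y)) (marginal (nu y) T) - G (ev T g) (marginal eta T)| <= e / 8.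
  apply: yG; apply: small; rewrite enorm_distC; apply: le_trans (yn T DT) _.
  by rewrite ler_peMl ?(ltW del0)// lerDl ltW.
have k5 : `|G (ev T (traj A B T (ev 0 (gy y)) v)) (marginal (nu y) T) -
    G (ev T (traj A B T (ev 0 g) v)) (marginal eta T)| <= e / 8.
  apply: yG; apply: small; apply: le_trans (dist T) _.
  by rewrite ler_wpM2r ?(ltW del0)// lerDr.
rewrite !costE -gE; move: k1 k3 k4 k5 yw.
rewrite /= !ler_norml => /andP[k1 _] /andP[_ k3] /andP[k4 _] /andP[_ k5] /andP[yw _].
exact: limit_arith e0 h1 k1 k2 k3 k4 k5 yw.
Qed.

End ClosedGraph.
End Game.

(** * Existence of an equilibrium *)

(* [q] normalizes the weights [2 e - dist], which single out the [c j] close to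
   the current value; [approx_brouwer] makes [q] close to the weights [l] that
   it was computed from. *)
Lemma almost_fixed {R : realType} (n N : nat) (v c : 'I_n.+1 -> 'I_N -> R) (e : R) : 0 < e ->
  (forall j i, 0 <= v j i <= 1) ->
  (forall l, simplex l -> exists j, \sum_i `|\sum_m l m * v m i - c j i| <= e) ->
  exists2 q, simplex q & forall j, 0 < q j -> forall i, `|\sum_m q m * v m i - c j i| <= 3 * e.
Proof.
move=> e0 v01 net.
pose val l i : R := \sum_m l m * v m i; pose dist l j : R := \sum_i `|val l i - c j i|.
pose p l j : R := Num.max 0 (2 * e - dist l j); pose s l : R := \sum_j p l j.
(* The zeros of [g] in the simplex are the fixed points of the normalization [p / s]. Multiplying by
   [s] avoids a quotient and keeps [g] Lipschitz with zero sum. *)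
pose g j l : R := p l j - s l * l j.
pose n1 (l l' : 'I_n.+1 -> R) : R := \sum_i `|l i - l' i|.
have n1_0 l l' : 0 <= n1 l l' by apply: sumr_ge0.
have n1_le l l' j : `|l j - l' j| <= n1 l l'.
  by rewrite /n1 (bigD1 j)//= lerDl; apply: sumr_ge0.
have valB l l' i : `|val l i - val l' i| <= n1 l l'.
  rewrite /val -sumrB; apply: le_trans (ler_norm_sum _ _ _) _; apply: ler_sum => m _.
  have /andP[v0 v1] := v01 m i.
  by rewrite -mulrBl normrM (ger0_norm v0) ler_piMr.
have maxB (x y : R) : `|Num.max 0 x - Num.max 0 y| <= `|x - y|.
  by rewrite /Num.max; case: ltP => h1; case: ltP => h2; rewrite !ler_norml; apply/andP; split;
   have := ler_norm (x - y); have := ler_norm (- (x - y)); rewrite normrN; lra.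
have distB l l' j : `|dist l j - dist l' j| <= N%:R * n1 l l'.
  rewrite /dist -sumrB; apply: le_trans (ler_norm_sum _ _ _) _.
  apply: (@le_trans _ _ (\sum_(i < N) n1 l l')); last by rewrite sumr_const card_ord mulr_natl.
  apply: ler_sum => i _; apply: le_trans (ler_dist_dist _ _) _.
  by rewrite opprB addrA subrK; exact: valB.
have p0 l j : 0 <= p l j by rewrite /p le_max lexx.
have dist0 l j : 0 <= dist l j by apply: sumr_ge0.
have p2 l j : p l j <= 2 * e by rewrite /p ge_max mulr_ge0 ?(ltW e0)//= lerBlDr lerDl.
have pB l l' j : `|p l j - p l' j| <= N%:R * n1 l l'.
  apply: le_trans (maxB _ _) _.
  have -> : 2 * e - dist l j - (2 * e - dist l' j) = - (dist l j - dist l' j) by ring.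
  by rewrite normrN; exact: distB.
have s0 l : 0 <= s l by apply: sumr_ge0.
have s2 l : s l <= n.+1%:R * (2 * e).
  apply: (@le_trans _ _ (\sum_(j < n.+1) 2 * e)); first exact: ler_sum.
  by rewrite sumr_const card_ord [leRHS]mulr_natl.
have sB l l' : `|s l - s l'| <= n.+1%:R * (N%:R * n1 l l').
  rewrite /s -sumrB; apply: le_trans (ler_norm_sum _ _ _) _.
  apply: (@le_trans _ _ (\sum_(i < n.+1) N%:R * n1 l l')); last by rewrite sumr_const card_ord [leRHS]mulr_natl.
  by apply: ler_sum => j _.
(* The net puts some [c j] within [e] of the current value, and the weight [2 e - dist] is then at
   least [e]. *)
have se l : simplex l -> e <= s l.
  move=> /net[j hj]; rewrite /s (bigD1 j)//=.
  apply: (@le_trans _ _ (p l j)); last by rewrite lerDl; apply: sumr_ge0.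
  by rewrite /p le_max; apply/orP; right; move: hj; rewrite -/(dist l j); lra.
pose K : R := N%:R + n.+1%:R * N%:R + n.+1%:R * (2 * e).
have K0 : 0 <= K by rewrite !addr_ge0// mulr_ge0// mulr_ge0// ltW.
have l1 (l : 'I_n.+1 -> R) j : simplex l -> 0 <= l j <= 1.
  move=> [l0 <-]; rewrite l0/= (bigD1 j)//= lerDl; exact: sumr_ge0.
have gB j l l' : simplex l -> simplex l' -> `|g j l - g j l'| <= K * n1 l l'.
  move=> Sl Sl'; have /andP[lj0 lj1] := l1 l j Sl.
  have -> : g j l - g j l' = (p l j - p l' j) - (s l - s l') * l j - s l' * (l j - l' j) by rewrite /g; ring.
  have -> : K * n1 l l' = N%:R * n1 l l' + n.+1%:R * N%:R * n1 l l' + n.+1%:R * (2 * e) * n1 l l' by rewrite /K; ring.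
  apply: le_trans (ler_normB _ _) _; apply: lerD; last first.
    by rewrite normrM (ger0_norm (s0 _)); apply: ler_pM.
  apply: le_trans (ler_normB _ _) _; apply: lerD => //.
  rewrite normrM (ger0_norm lj0) -mulrA; apply: le_trans (sB l l').
  by rewrite ler_piMr.
have g0 l : simplex l -> \sum_j g j l = 0.
  by move=> [_ h]; rewrite /g sumrB -mulr_sumr h mulr1 subrr.
have gl j l : simplex l -> - (K * l j) <= g j l.
  move=> Sl; have /andP[lj0 _] := l1 l j Sl.
  have : s l * l j <= K * l j.
    rewrite ler_wpM2r//; apply: le_trans (s2 l) _; rewrite /K lerDr.
    by rewrite addr_ge0// mulr_ge0.
  by have := p0 l j; rewrite /g; lra.
(* Makes [2 (n+1) e1 / s] at most [e], given that [s] is at least [e]. *)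
pose e1 := e * e / (2 * n.+1%:R).
have e10 : 0 < e1 by rewrite divr_gt0 ?mulr_gt0.
have [l Sl ge] := approx_brouwer K0 gB g0 gl e10.
have sl0 : 0 < s l := lt_le_trans e0 (se _ Sl).
pose q j := p l j / s l.
have Sq : simplex q.
  split; first by move=> j; rewrite divr_ge0// ltW.
  by rewrite /q -mulr_suml divff// gt_eqF.
exists q => // j qj i.
have pj : 0 < p l j by move: qj; rewrite /q pmulr_lgt0// invr_gt0.
have dj : `|val l i - c j i| <= 2 * e.
  apply: (@le_trans _ _ (dist l j)); first by rewrite /dist (bigD1 i)//= lerDl; apply: sumr_ge0.
  by move: pj; rewrite /p lt_max ltxx/=; lra.
have qd : `|\sum_m q m * v m i - val l i| <= e.
  rewrite /val -sumrB; apply: le_trans (ler_norm_sum _ _ _) _.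
  (* From [g >= - e1] each absolute value is at most [g + 2 e1], and the [g] sum to zero: a lower
     bound alone controls the whole l^1 distance. *)
  apply: (@le_trans _ _ (\sum_m (g m l + 2 * e1) / s l)).
    apply: ler_sum => m _; have /andP[v0 v1] := v01 m i.
    rewrite -mulrBl normrM (ger0_norm v0); apply: (@le_trans _ _ `|q m - l m|); first by rewrite ler_piMr.
    have -> : q m - l m = g m l / s l by rewrite /q /g; field; rewrite gt_eqF.
    rewrite normrM (@ger0_norm _ (s l)^-1) ?invr_ge0//.
    rewrite ler_wpM2r ?invr_ge0//.
    by have := ge m; rewrite ler_norml; move: (g m l) => z; move: e10; clear; move=> *; apply/andP; split; lra.
  rewrite -mulr_suml big_split/= g0// add0r sumr_const card_ord ler_pdivrMr//.
  apply: (@le_trans _ _ (e * e)); last by rewrite ler_pM2l//; exact: se.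
  rewrite le_eqVlt; apply/orP; left; apply/eqP.
  have n0 : (n.+1%:R : R) != 0 by rewrite pnatr_eq0.
  by rewrite -[LHS]mulr_natr /e1; move: (n.+1%:R : R) n0 => z z0; field.
have -> : \sum_m q m * v m i - c j i = (\sum_m q m * v m i - val l i) + (val l i - c j i) by ring.
apply: le_trans (ler_normD _ _) _.
have -> : 3 * e = e + 2 * e by ring.
exact: lerD.
Qed.

(** * Supports of measures on curves *)

Section Support.
Context {R : realType} {d k : nat}.
Variables (A : 'M[R]_d) (B : 'M[R]_(d, k)) (T : R).
Hypothesis T0 : 0 < T.
Local Notation X := 'cV[R]_d.
Local Notation Gam := (Gamma A B T).
Local Notation Pr := (probability Gam R).

Lemma level_le (M N : R) : M <= N -> level M `<=` (level N : set Gam).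
Proof.
move=> MN g [h1 h2]; split; first exact: le_trans h1 MN.
by apply: le_trans h2 _; rewrite lee_fin.
Qed.

Lemma near_curve_sym (g g' : Gam) e : near_curve g g' e -> near_curve g' g e.
Proof. by move=> h t Dt; rewrite enorm_distC; exact: h. Qed.

(** If no point of [O] were in the support, each would have a null neighbourhood, and compactness
    would make the parts of [O] in the levels null. The countable family of levels replaces a
    countable base of the topology. *)
Lemma support_meets (P : {measure set Gam -> \bar R}) (O : set Gam) : P.-negligible (~` \bigcup_n (level n%:R : set Gam)) ->
  open O -> (0 < P O)%E -> exists2 g, O g & Defs.support P g.
Proof.
move=> PZ oO PO; apply: contrapT => no.
have null g : O g -> exists V : set Gam, [/\ open V, V g & P V = 0%E].
  move=> Og; apply: contrapT => nV; apply: no; exists g => // V oV Vg.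
  rewrite lt_neqAle measure_ge0 andbT eq_sym; apply/eqP => V0.
  by apply: nV; exists V.
(* Points well inside [O], so that a cluster point of such points still lies in [O]. *)
pose C m : set Gam := [set g | forall g', near_curve g g' m.+1%:R^-1 -> O g'].
have KC n m : P.-negligible (level n%:R `&` C m).
  apply: contrapT => nn.
  (* Sets of full measure in the piece form a proper filter if the piece is not negligible. It has a
     cluster point in the level, and the null neighbourhood of that point contradicts clustering. *)
  pose F : set_system Gam := [set E | P.-negligible (level n%:R `&` C m `\` E)].
  have FF : ProperFilter F.
    split; first by rewrite /F/= setD0.
    split; rewrite /F/=.
    - by rewrite setDT; exact: negligible_set0.
    - by move=> E E' h1 h2 /=; rewrite setDIr; exact: negligibleU.
    - by move=> E E' EE'; apply: negligibleS; exact: setDS.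
  have FK : F (level n%:R) by rewrite /F/=; apply: (negligibleS _ (negligible_set0 P)) => g [[h _] /(_ h)].
  have FC : F (C m) by rewrite /F/=; apply: (negligibleS _ (negligible_set0 P)) => g [[_ h] /(_ h)].
  have [x [Kx clx]] := level_compact T0 (ler0n R n) FF FK.
  have Ox : O x.
    have m0 : 0 < (m.+1%:R^-1 : R) by rewrite invr_gt0.
    have nx : nbhs x [set g' | near_curve x g' m.+1%:R^-1] by apply/(Gamma_nbhsP T0); exists m.+1%:R^-1.
    have [g [Cg ng]] := clx _ _ FC nx.
    by apply: Cg; exact: near_curve_sym.
  have [V [oV Vx V0]] := null x Ox.
  have FV : F (~` V).
    rewrite /F/=; apply: (@negligibleS _ _ _ P V); first by move=> g [_ /contrapT].
    by apply/negligibleP => //; exact: open_measurable_Gamma.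
  have nV : nbhs x V by exact: open_nbhs_nbhs.
  by have [g [nVg Vg]] := clx _ _ FV nV; exact: nVg.
have : P.-negligible O.
  apply: (@negligibleS _ _ _ P (~` (\bigcup_n (level n%:R : set Gam)) `|`
     \bigcup_n \bigcup_m (level n%:R `&` C m))).
    move=> g Og; have [[n _ ng]|] := pselect ((\bigcup_n (level n%:R : set Gam)) g); last by left.
    right; exists n => //.
    have /(Gamma_nbhsP T0)[e e0 He] : nbhs g O by exact: open_nbhs_nbhs.
    exists (Num.truncn e^-1) => //; split=> // g' gg'; apply: He => t Dt; apply: le_trans (gg' t Dt) _.
    rewrite invf_ple ?posrE//; apply: ltW; exact: truncnS_gt.
  by apply: negligibleU => //; apply: negligible_bigcup => n; exact: negligible_bigcup.
move=> /negligibleP -/(_ (open_measurable_Gamma oO)) O0.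
by rewrite O0 ltxx in PO.
Qed.

Lemma support_open (P : Pr) : open (~` Defs.support P : set Gam).
Proof.
have -> : ~` Defs.support P = \bigcup_(V in [set V : set Gam | open V /\ ~ (0 < P V)%E]) V.
  apply/seteqP; split=> [g /existsNP[V /not_implyP[oV /not_implyP[Vg nV]]]|g [V [oV nV] Vg] sg].
    by exists V.
  by apply: nV; exact: sg.
by apply: bigcup_open => V [].
Qed.

Variables (a r : R) (m0 : probability X R).
Hypothesis a1 : 1 < a.
Hypothesis m0a : finite_moment a m0.

Lemma level_measurable (M : R) : 0 <= M -> measurable (level M : set Gam).
Proof. by move=> M0; apply: closed_measurable_Gamma; exact: level_closed. Qed.

Lemma levels_measurable : measurable (~` \bigcup_n (level n%:R : set Gam)).
Proof. by apply: measurableC; apply: bigcupT_measurable => n; exact: level_measurable. Qed.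

Lemma levels_null (eta : Pr) : PGamma a m0 r eta -> eta (~` \bigcup_n (level n%:R : set Gam)) = 0%E.
Proof.
move=> eP; apply/eqP; rewrite -measure_le0; apply/lee_addgt0Pr => e e0; rewrite add0e.
have [M M0 H] := @level_tight R d k A B T T0 a r m0 a1 m0a _ e0.
apply: le_trans (H _ eP); apply: le_measure; rewrite ?inE.
- exact: levels_measurable.
- by apply: measurableC; exact: level_measurable.
- apply: subsetC => g gM; exists (Num.truncn M).+1 => //; apply: level_le gM; apply: ltW; exact: truncnS_gt.
Qed.

Lemma concentrated (eta : Pr) : PGamma a m0 r eta -> eta (~` Defs.support eta) = 0%E.
Proof.
move=> eP; have oS := support_open eta.
apply/eqP; rewrite eq_le measure_ge0 andbT leNgt; apply/negP => h.
have nZ : eta.-negligible (~` \bigcup_n (level n%:R : set Gam)).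
  by apply/negligibleP; [exact: levels_measurable|exact: levels_null].
by have [g ng sg] := support_meets nZ oS h; exact: ng.
Qed.

Variables (L : X -> 'cV[R]_k -> probability X R -> R) (G : X -> probability X R -> R).

(** Converts a condition on almost every fibre into one on [nu] itself, the form that mixtures and
    limits preserve. Almost every [kappa x] is carried by the levels because [nu] is, so
    [support_meets] applies fibrewise. *)
Lemma disintegration_meets (eta nu : Pr) (kappa : R.-pker X ~> Gam) : PGamma a m0 r nu ->
  disintegration m0 nu kappa -> {ae m0, forall x, Defs.support (kappa x) `<=` optimal_curves L G eta x} ->
  forall O, open O -> (0 < nu O)%E -> exists g, O g /\ exists x, optimal_curves L G eta x g.
Proof.
move=> nP [nuE _] opt O oO nO; apply: contrapT => no.
have mO := open_measurable_Gamma oO.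
pose Z : set Gam := ~` \bigcup_n (level n%:R : set Gam).
have mZ : measurable Z := levels_measurable.
have Z0 : {ae m0, forall x, setT x -> kappa x Z = cst 0%E x}.
  apply/ae_eq_integral_abs => //; first exact: measurable_kernel.
  under eq_integral do rewrite gee0_abs//.
  by rewrite -nuE//; exact: levels_null.
suff : nu O = 0%E by move=> n0; rewrite n0 ltxx in nO.
rewrite nuE// (@ge0_ae_eq_integral _ _ _ m0 setT (fun x => kappa x O) (cst 0%E)) ?integral0//.
- exact: measurable_kernel.
- apply: filterS2 Z0 opt => x /(_ I) Zx sx _ /=.
  apply/eqP; rewrite eq_le measure_ge0 andbT leNgt; apply/negP => h.
  have nZ : (kappa x : {measure set Gam -> \bar R}).-negligible Z by apply/negligibleP.
  have [g Og sg] := support_meets nZ oO h.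
  by apply: no; exists g; split=> //; exists x; exact: sx.
Qed.

End Support.

(** * From approximate to exact equilibria *)

Section Equilibrium.
Context {R : realType} {d k : nat}.
Variables (A : 'M[R]_d) (B : 'M[R]_(d, k)) (T : R).
Hypothesis T0 : 0 < T.
Local Notation X := 'cV[R]_d.
Local Notation U := 'cV[R]_k.
Local Notation Gam := (Gamma A B T).
Local Notation Pr := (probability Gam R).
Variables (L : X -> U -> probability X R -> R) (G : X -> probability X R -> R).
Variables (a r : R) (m0 : probability X R).
Hypothesis a1 : 1 < a.
Hypothesis m0a : finite_moment a m0.
Hypothesis PG0 : exists eta : Pr, PGamma a m0 r eta.
Hypothesis response : forall eta : Pr, PGamma a m0 r eta -> exists2 nu : Pr, PGamma a m0 r nu &
  forall O : set Gam, open O -> (0 < nu O)%E -> exists g, O g /\ exists x, optimal_curves L G eta x g.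

Lemma mixture_PGamma n (q : 'I_n.+1 -> R) (nu : 'I_n.+1 -> Pr) : simplex q ->
  (forall j, PGamma a m0 r (nu j)) -> exists2 eta : Pr, PGamma a m0 r eta &
  forall E, eta E = (\sum_j ((q j)%:E * nu j E))%E.
Proof.
move=> [q0 q1] nuP; have [eta [etaE etaI]] := mixture nu q0 q1; exists eta => //.
have qE : (\sum_j (q j)%:E = 1)%E by rewrite sumEFin q1.
split; last first.
  move=> E mE; rewrite [LHS]etaE.
  transitivity (\sum_j ((q j)%:E * m0 E))%E.
    by apply: eq_bigr => j _; congr (_ * _)%E; exact: (nuP j).2.
  by rewrite -ge0_sume_distrl ?qE ?mul1e// => j _; rewrite lee_fin.
have a0 : 0 < a := lt_trans ltr01 a1.
rewrite etaI; [|by apply: measurable_velocity_powR|by move=> g; exact: poweR_ge0].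
apply: (@le_trans _ _ (\sum_j ((q j)%:E * r%:E))%E).
  by apply: lee_sum => j _; apply: lee_wpmul2l; [rewrite lee_fin|exact: (nuP j).1].
rewrite -ge0_sume_distrl ?qE ?mul1e// => j _; by rewrite lee_fin.
Qed.


Lemma fine_prob (eta : Pr) E : measurable E -> 0 <= fine (eta E) <= 1.
Proof.
move=> mE; rewrite fine_ge0//= -lee_fin fineK ?fin_num_measure//; exact: probability_le1.
Qed.

Lemma finite_net (N : nat) (E : 'I_N -> set Gam) (e : R) : 0 < e -> (forall i, measurable (E i)) ->
  exists n (c : 'I_n.+1 -> Pr), (forall j, PGamma a m0 r (c j)) /\
  forall eta, PGamma a m0 r eta -> exists j, \sum_i `|fine (eta (E i)) - fine (c j (E i))| <= e.
Proof.
move=> e0 mE; have [q q0 qe] : exists2 q : nat, 0 < (q%:R : R) & N%:R * q%:R^-1 <= e.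
  exists (Num.truncn (N%:R / e)).+1; first by rewrite ltr0n.
  rewrite ler_pdivrMr ?ltr0n// mulrC -ler_pdivrMr// ltW//; exact: truncnS_gt.
(* Rounding the [N] masses to multiples of [1 / q] leaves finitely many classes; one member of
   [PGamma] from each nonempty class forms the net. *)
pose code (eta : Pr) : {ffun 'I_N -> 'I_q.+1} := [ffun i => inord (Num.truncn (q%:R * fine (eta (E i))))].
have codeP (eta eta' : Pr) : code eta = code eta' -> \sum_i `|fine (eta (E i)) - fine (eta' (E i))| <= e.
  move=> ce; apply: le_trans qe; apply: (@le_trans _ _ (\sum_(i < N) q%:R^-1)); last first.
    by rewrite sumr_const card_ord mulr_natl.
  apply: ler_sum => i _; have /ffunP/(_ i)/(congr1 val) := ce; rewrite !ffunE /=.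
  have /andP[x0 x1] := fine_prob eta (mE i); have /andP[y0 y1] := fine_prob eta' (mE i).
  move: (fine (eta (E i))) (fine (eta' (E i))) x0 x1 y0 y1 => x y x0 x1 y0 y1.
  have bd (z : R) : 0 <= z -> z <= 1 -> (Num.truncn (q%:R * z) < q.+1)%N.
    move=> z0 z1; have tq : Num.truncn (q%:R : R) = q by exact: natrK.
    rewrite ltnS -[leqRHS]tq; apply: le_truncn.
    by rewrite ler_piMr// ltW.
  rewrite !inordK ?bd// => tE.
  have /andP[] := truncn_itv (mulr_ge0 (ltW q0) x0); have /andP[] := truncn_itv (mulr_ge0 (ltW q0) y0).
  rewrite tE; move: (Num.truncn _) => t; rewrite -!natr1 => h1 h2 h3 h4.
  rewrite -(ler_pM2l q0) divff ?gt_eqF// -[X in X * _](gtr0_norm q0) -normrM mulrBr ler_norml.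
  by move: (q%:R * x) (q%:R * y) h1 h2 h3 h4 => x' y' h1 h2 h3 h4; apply/andP; split; lra.
have [eta0 P0] := PG0.
have /choice[rep repP] : forall c, exists eta : Pr, PGamma a m0 r eta /\
   ((exists eta', PGamma a m0 r eta' /\ code eta' = c) -> code eta = c).
  move=> c; have [[eta' [h1 h2]]|n] := pselect (exists eta', PGamma a m0 r eta' /\ code eta' = c).
    by exists eta'.
  by exists eta0; split=> // /n.
pose en := enum {ffun 'I_N -> 'I_q.+1}; pose dflt := code eta0.
exists (size en), (fun j => rep (nth dflt en j)); split; first by move=> j; exact: (repP _).1.
move=> eta eP; exists (inord (index (code eta) en)).
have ic : (index (code eta) en < size en)%N by rewrite index_mem mem_enum.
rewrite inordK ?ltnS ?(ltnW ic)// nth_index ?mem_enum//; apply: codeP.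
by apply/esym; apply: (repP (code eta)).2; exists eta.
Qed.

(** [almost_fixed] weights responses [nu j] to the net points [c j] so that the mixture is close to
    every [c j] whose weight is positive. An open set charged by the mixture is charged by one of
    these [nu j], and so meets the curves optimal against [c j]. *)
Lemma approx_equilibrium (s : seq (set Gam)) (e : R) : 0 < e -> exists2 eta : Pr, PGamma a m0 r eta &
  forall O : set Gam, open O -> (0 < eta O)%E -> exists eta' : Pr, [/\ PGamma a m0 r eta',
    forall E, E \in s -> measurable E -> `|fine (eta E) - fine (eta' E)| <= e
    & exists g, O g /\ exists x, optimal_curves L G eta' x g].
Proof.
move=> e0; have e3 : 0 < e / 3 by rewrite divr_gt0.
(* The family [s] is arbitrary; its nonmeasurable members are replaced by the empty set. *)
pose E (i : 'I_(size s)) : set Gam := if `[< measurable (nth set0 s i) >] then nth set0 s i else set0.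
have mE i : measurable (E i).
  rewrite /E; case: asboolP => // _; exact: measurable0.
have [n [c [cP net]]] := finite_net e3 mE.
have /choice[nu nuP] : forall j, exists nu : Pr, PGamma a m0 r nu /\ forall O : set Gam, open O -> (0 < nu O)%E ->
    exists g, O g /\ exists x, optimal_curves L G (c j) x g.
  by move=> j; have [nu h1 h2] := response (cP j); exists nu.
have nuK j : PGamma a m0 r (nu j) by case: (nuP j).
have fineS (q : 'I_n.+1 -> R) (eta : Pr) F : measurable F -> eta F = (\sum_j ((q j)%:E * nu j F))%E ->
    fine (eta F) = \sum_j q j * fine (nu j F).
  move=> mF ->; rewrite -[RHS]/(fine (\sum_j q j * fine (nu j F))%:E) -sumEFin; congr fine.
  by apply: eq_bigr => j _; rewrite EFinM fineK// fin_num_measure.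
have [||q Sq qP] := @almost_fixed R n (size s) (fun j i => fine (nu j (E i))) (fun j i => fine (c j (E i))) _ e3.
- by move=> j i; exact: fine_prob.
- move=> l Sl; have [eta eP etaE] := mixture_PGamma Sl nuK.
  have [j hj] := net eta eP; exists j; apply: le_trans hj; apply: ler_sum => i _.
  by rewrite (fineS _ _ _ (mE i) (etaE _)).
have [eta eP etaE] := mixture_PGamma Sq nuK; exists eta => // O oO etaO.
have [j qj nj] : exists2 j, 0 < q j & (0 < nu j O)%E.
  apply: contrapT => no; move: etaO; rewrite etaE big1 ?ltxx// => j _.
  have := Sq.1 j; rewrite le_eqVlt => /orP[/eqP<-|qj]; first by rewrite mul0e.
  suff -> : nu j O = 0%E by rewrite mule0.
  apply/eqP; rewrite eq_le measure_ge0 andbT leNgt; apply/negP => h; apply: no; exists j => //.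
exists (c j); split; [exact: cP| |exact: (nuP j).2 oO nj].
move=> F Fs mF.
have [i FE] : exists i, F = E i.
  have iF : (index F s < size s)%N by rewrite index_mem.
  exists (Ordinal iF); rewrite /E/= nth_index//; case: asboolP => //.
rewrite FE (fineS _ _ _ (mE i) (etaE _)); apply: le_trans (qP j qj i) _.
by rewrite mulrC divfK.
Qed.

Hypotheses (HL : running_cost_assumptions L) (HG : terminal_cost_assumptions G).

(** Two ultrafilters in succession: the first refines the families of events and the tolerances and
    defines [eta]; the second, for a given [g] in the support, also shrinks neighbourhoods of [g],
    so that optimal curves against nearby measures converge to [g]. *)
Lemma exists_equilibrium : exists2 eta : Pr, PGamma a m0 r eta &
  forall g, Defs.support eta g -> optimal_curves L G eta (ev 0 g) g.
Proof.
pose Y := (seq (set Gam) * nat)%type.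
(* Properties that hold eventually as the finite family grows and the tolerance [1 / (n + 1)]
   decreases. *)
pose F0 : set_system Y := fun P => exists (s0 : seq (set Gam)) (n0 : nat), forall (s : seq (set Gam)) (n : nat),
  {subset s0 <= s} -> (n0 <= n)%N -> P (s, n).
have FF0 : ProperFilter F0.
  split; first by move=> [s0 [n0]] /(_ s0 n0); apply.
  split.
  - by exists [::], 0%N.
  - move=> P Q [s1 [n1 h1]] [s2 [n2 h2]]; exists (s1 ++ s2), (maxn n1 n2) => s n ss nn; split.
    + by apply: h1; [move=> E Es; apply: ss; rewrite mem_cat Es|exact: leq_trans (leq_maxl _ _) nn].
    + by apply: h2; [move=> E Es; apply: ss; rewrite mem_cat Es orbT|exact: leq_trans (leq_maxr _ _) nn].
  - by move=> P Q PQ [s0 [n0 h]]; exists s0, n0 => s n ss nn; apply: PQ; exact: h.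
have [F [FU F0F]] := ultraFilterLemma FF0.
have FF : ProperFilter F := @ultra_proper _ _ FU.
have /choice[nu nuP] : forall y : Y, exists eta : Pr, PGamma a m0 r eta /\ forall O : set Gam, open O -> (0 < eta O)%E ->
    exists eta' : Pr, [/\ PGamma a m0 r eta', forall E, E \in y.1 -> measurable E -> `|fine (eta E) - fine (eta' E)| <= y.2.+1%:R^-1
    & exists g, O g /\ exists x, optimal_curves L G eta' x g].
  move=> y; have y0 : 0 < (y.2.+1%:R^-1 : R) by rewrite invr_gt0.
  by have [eta h1 h2] := approx_equilibrium y.1 y0; exists eta.
have nuK y : PGamma a m0 r (nu y) by case: (nuP y).
have FnuK : F [set y | PGamma a m0 r (nu y)] by apply: (@filterE _ F).
have [h [eta [nuh etaP etah]]] := limit_measure T0 a1 m0a FU FnuK.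
exists eta => // g sg.
pose V q : set Gam := interior [set g' | near_curve g g' q.+1%:R^-1].
have Vg q : V q g.
  rewrite /V /interior/=; apply/(Gamma_nbhsP T0); exists q.+1%:R^-1; last by [].
  by rewrite invr_gt0.
have oV q : open (V q) by exact: open_interior.
(* A neighbourhood of a support point has positive [eta]-mass, hence positive limit mass [h], and is
   eventually charged by the approximations. *)
have Fpos q : F [set y | (0 < nu y (V q))%E].
  have hV : 0 < h (V q) by rewrite -lte_fin; apply: lt_le_trans (etah _ (oV q)); exact: sg.
  have := nuh _ (open_measurable_Gamma (oV q)); move/cvgrPdist_lt/(_ _ hV).
  apply: filterS => y /= hy; rewrite lt_neqAle measure_ge0 andbT eq_sym; apply/eqP => n0.
  by move: hy; rewrite n0 subr0 gtr0_norm// ltxx.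
have /choice[w wP] : forall z : Y * nat, exists w : Pr * Gam, (0 < nu z.1 (V z.2))%E ->
   [/\ PGamma a m0 r w.1, forall E, E \in z.1.1 -> measurable E -> `|fine (nu z.1 E) - fine (w.1 E)| <= z.1.2.+1%:R^-1,
    V z.2 w.2 & exists x, optimal_curves L G w.1 x w.2].
  move=> z; have [pz|n] := pselect (0 < nu z.1 (V z.2))%E; last by exists (eta, g).
  have [eta' [h1 h2 [g' [h3 h4]]]] := (nuP z.1).2 _ (oV z.2) pz.
  by exists (eta', g').
(* The iterated limit: for all large [q], for [F]-most [y]. *)
pose H0 : set_system (Y * nat) := [set P | exists q0, forall q, (q0 <= q)%N -> F [set y | P (y, q)]].
have HF0 : ProperFilter H0.
  split; first by move=> [q0 /(_ _ (leqnn _))]; exact: (@filter_not_empty _ F FF).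
  split.
  - by exists 0%N => q _; exact: (@filterT _ F FF).
  - move=> P Q [q1 h1] [q2 h2]; exists (maxn q1 q2) => q qq.
    by apply: (@filterI _ F FF); [apply: h1; exact: leq_trans (leq_maxl _ _) qq|
      apply: h2; exact: leq_trans (leq_maxr _ _) qq].
  - move=> P Q PQ [q0 h0]; exists q0 => q /h0; apply: (@filterS _ F FF) => y; exact: PQ.
have [H [HU H0H]] := ultraFilterLemma HF0.
have HF : ProperFilter H := @ultra_proper _ _ HU.
have Hpos : H [set z | (0 < nu z.1 (V z.2))%E] by apply: H0H; exists 0%N => q _; exact: Fpos.
have c1 : H [set z | PGamma a m0 r (w z).1] by apply: filterS Hpos => z /wP[].
(* Each event eventually belongs to the family, after which the nearby measure and [nu y] differ on
   it by at most the tolerance; they share the limit [h]. *)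
have c2 E : measurable E -> fine ((w z).1 E) @[z --> H] --> h E.
  move=> mE; apply/cvgrPdist_le => e e0; have e2 : 0 < e / 2 by rewrite divr_gt0.
  have HE : H [set z | `|h E - fine (nu z.1 E)| <= e / 2].
    by apply: H0H; exists 0%N => q _; have /cvgrPdist_le/(_ _ e2) := nuh _ mE.
  have Hs : H [set z : Y * nat | E \in z.1.1 /\ (z.1.2.+1%:R^-1 <= e / 2 :> R)].
    apply: H0H; exists 0%N => q _; apply: F0F; exists [:: E], (Num.truncn (e / 2)^-1) => s n ss nn /=; split.
      by apply: ss; rewrite mem_head.
    rewrite invf_ple ?posrE//; apply: (@le_trans _ _ (Num.truncn (e / 2)^-1).+1%:R); first exact/ltW/truncnS_gt.
    by rewrite ler_nat.
  apply: filterS2 Hpos (@filterI _ H HF _ _ HE Hs) => z /wP[_ wE _ _] [h1 [Es h2]].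
  have h3 := le_trans (wE _ Es mE) h2.
  have -> : h E - fine ((w z).1 E) = (h E - fine (nu z.1 E)) + (fine (nu z.1 E) - fine ((w z).1 E)) by ring.
  by rewrite [e]splitr; apply: le_trans (ler_normD _ _) _; exact: lerD.
have c3 : H [set z | exists x, optimal_curves L G (w z).1 x (w z).2] by apply: filterS Hpos => z /wP[].
have c4 e : 0 < e -> H [set z | near_curve g (w z).2 e].
  move=> e0; have Hq : H [set z | (z.2.+1%:R^-1 <= e :> R)].
    apply: H0H; exists (Num.truncn e^-1) => q qq; apply: (@filterE _ F) => y /=.
    rewrite invf_ple ?posrE//; apply: (@le_trans _ _ (Num.truncn e^-1).+1%:R); first exact/ltW/truncnS_gt.
    by rewrite ler_nat.
  apply: filterS2 Hpos Hq => z /wP[_ _ Vz _] ze t Dt.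
  by apply: le_trans ze; exact: (interior_subset Vz).
exact: (closed_graph T0 HL HG a1 m0a HU c1 c2 etaP etah c3 c4).
Qed.

End Equilibrium.

(** * Stationarity and Lipschitz regularity *)

Section Product.
Context {R : realType}.
Local Notation mu := (@lebesgue_measure R).
Variable T : R.
Hypothesis T0 : 0 < T.
Local Notation D := (`[0, T]%classic).
Let mD : measurable (D : set (measurableTypeR R)). Proof. exact: measurable_itv. Qed.

(* Cutting at the mid-value of [W] halves the bound on the increment of [N]. *)
Lemma halving_const (W N : R -> R) : {within D, continuous W} ->
  (forall s t, 0 <= s -> s <= t -> t <= T -> W s <= W t) ->
  (forall s t, 0 <= s -> s <= t -> t <= T -> `|N t - N s| <= (W t - W s) ^+ 2) ->
  forall s t, 0 <= s -> s <= t -> t <= T -> N t = N s.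
Proof.
move=> cW mW H.
have key n : forall s t, 0 <= s -> s <= t -> t <= T -> `|N t - N s| <= (W t - W s) ^+ 2 * 2^-1 ^+ n.
  elim: n => [|n IH] s t s0 st tT; first by rewrite expr0 mulr1; exact: H.
  have cst : {within `[s, t], continuous W} by apply: continuous_subspaceW cW; exact: sub_itvcc.
  have Wst := mW s t s0 st tT.
  have [|c] := @IVT R W s t ((W s + W t) / 2) st cst.
    by rewrite (min_idPl Wst) (max_idPr Wst); apply/andP; split; lra.
  rewrite in_itv/= => /andP[sc ct] Wc.
  have h1 := IH s c s0 sc (le_trans ct tT); have h2 := IH c t (le_trans s0 sc) ct tT.
  have -> : N t - N s = (N t - N c) + (N c - N s) by ring.
  apply: le_trans (ler_normD _ _) _; apply: le_trans (lerD h2 h1) _.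
  rewrite Wc (exprS _ n); move: (2^-1 ^+ n) => z.
  by rewrite le_eqVlt; apply/orP; left; apply/eqP; field.
move=> s t s0 st tT; apply/eqP; rewrite -subr_eq0 -normr_le0; apply/ler_addgt0Pr => e e0; rewrite add0r.
have [del del0 He] := small_factor (sqr_ge0 (W t - W s)) e0.
apply: le_trans He; pose n := (Num.truncn del^-1).+1.
apply: le_trans (key n s t s0 st tT) _; rewrite ler_wpM2l ?sqr_ge0//.
rewrite exprVn invf_ple ?posrE ?exprn_gt0//; apply: (@le_trans _ _ n%:R); first exact/ltW/truncnS_gt.
by rewrite -natrX ler_nat ltnW// ltn_expl.
Qed.

Definition primitive (f a : R -> R) : Prop :=
  forall s t, 0 <= s -> s <= t -> t <= T -> f t - f s = \int[mu]_(r in `[s, t]) a r.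

Lemma ibl_mul_cont (a g : R -> R) : ibl mu D a -> {within D, continuous g} -> ibl mu D (fun s => a s * g s).
Proof.
move=> Ia cg; have [M M0 gM] := within_bounded cg.
apply: (ibl_le mD (g := fun s => `|a s| * M)).
- by apply: measurable_funM; [exact: ibl_mfun Ia|exact: ibl_mfun (within_ibl cg)].
- by move=> s Ds; rewrite normrM ler_wpM2l//; exact: gM.
- by apply: (iblZr mD); exact: ibl_norm.
Qed.

(** Integration by parts for absolutely continuous functions. The defect [N] has increments bounded
    by the square of those of the continuous primitive [W] of [|a| + |b|], so [halving_const] makes
    it constant. *)
Lemma product_rule (f g a b : R -> R) : {within D, continuous f} -> {within D, continuous g} ->
  ibl mu D a -> ibl mu D b -> primitive f a -> primitive g b ->
  ibl mu D (fun s => a s * g s + b s * f s) /\ primitive (fun s => f s * g s) (fun s => a s * g s + b s * f s).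
Proof.
move=> cf cg Ia Ib fa gb.
have Iag := ibl_mul_cont Ia cg; have Ibf := ibl_mul_cont Ib cf.
have Iab := iblD mD Iag Ibf; split; first exact: Iab.
pose w s := `|a s| + `|b s|; have Iw : ibl mu D w by apply: (iblD mD); exact: ibl_norm.
have w0 s : 0 <= w s by rewrite addr_ge0.
pose W t := \int[mu]_(s in `[0, t]) w s.
pose N t := f t * g t - \int[mu]_(s in `[0, t]) (a s * g s + b s * f s).
have cat (h : R -> R) s t : ibl mu D h -> 0 <= s -> s <= t -> t <= T ->
    \int[mu]_(r in `[0, t]) h r - \int[mu]_(r in `[0, s]) h r = \int[mu]_(r in `[s, t]) h r.
  by move=> Ih s0 st tT; rewrite (@Rint_cat R 0 s t)//; [rewrite addrC addKr|exact: ibl_itv Ih].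
have sub (h : R -> R) s t : ibl mu D h -> 0 <= s -> t <= T -> ibl mu `[s, t] h.
  by move=> Ih s0 tT; exact: ibl_itv Ih.
have WE s t : 0 <= s -> s <= t -> t <= T -> W t - W s = \int[mu]_(r in `[s, t]) w r by exact: cat.
have mW s t : 0 <= s -> s <= t -> t <= T -> W s <= W t.
  by move=> s0 st tT; rewrite -subr_ge0 WE//; apply: Rintegral_ge0.
have osc (h c : R -> R) s t r r' : ibl mu D c -> primitive h c -> (forall x, `|c x| <= w x) -> 0 <= s -> s <= r ->
    r <= r' -> r' <= t -> t <= T -> `|h r' - h r| <= W t - W s.
  move=> Ic hc cw s0 sr rr' r't tT; have r0 := le_trans s0 sr; have r'T := le_trans r't tT.
  rewrite hc//; apply: le_trans (le_normr_Rintegral _ _) _ => //; first exact: sub.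
  rewrite WE// ?(le_trans sr)// ?(le_trans rr')//.
  apply: (@le_trans _ _ (\int[mu]_(x in `[r, r']) w x)).
    by apply: Rint_le => //; [apply: ibl_norm => //; exact: sub|exact: sub].
  by apply: Rint_le_itv => //; exact: sub.
have NE s t : 0 <= s -> s <= t -> t <= T -> `|N t - N s| <= (W t - W s) ^+ 2.
  move=> s0 st tT.
  have E : N t - N s = \int[mu]_(r in `[s, t]) (a r * (g t - g r) + b r * (f s - f r)).
    have -> : N t - N s = (f t - f s) * g t + (g t - g s) * f s -
       (\int[mu]_(r in `[0, t]) (a r * g r + b r * f r) - \int[mu]_(r in `[0, s]) (a r * g r + b r * f r)).
      by rewrite /N; ring.
    rewrite cat// fa// gb// -!RintegralZr//; [|exact: sub|exact: sub].
    rewrite -RintegralD//; [|by apply: iblZr => //; exact: sub|by apply: iblZr => //; exact: sub].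
    rewrite -RintegralB//; [|by apply: iblD => //; apply: iblZr => //; exact: sub|exact: sub].
    by apply: eq_Rintegral => r _; ring.
  have Iint : ibl mu `[s, t] (fun r => a r * (g t - g r) + b r * (f s - f r)).
    have I1 : ibl mu `[s, t] (fun r => (a r * g t + b r * f s) - (a r * g r + b r * f r)).
      by apply: iblB => //; [apply: iblD => //; apply: iblZr => //; exact: sub|exact: sub].
    by apply: (eq_ibl _ _ I1) => // r _; ring.
  rewrite E; apply: le_trans (le_normr_Rintegral _ _) _ => //.
  apply: (@le_trans _ _ (\int[mu]_(r in `[s, t]) (w r * (W t - W s)))).
    apply: Rint_le => //; [exact: ibl_norm|by apply: iblZr => //; exact: sub|].
    move=> r; rewrite /= in_itv/= => /andP[sr rt]; apply: le_trans (ler_normD _ _) _.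
    rewrite /w mulrDl !normrM; apply: lerD; rewrite ler_wpM2l//.
      by apply: (osc g b s t r t) => // x; rewrite /w lerDr.
    by rewrite distrC; apply: (osc f a s t s r) => // x; rewrite /w lerDl.
  by rewrite RintegralZr//; [rewrite -WE// expr2|exact: sub].
have cW : {within D, continuous W} by exact: within_prim.
move=> s t s0 st tT; have := halving_const cW mW NE s0 st tT.
by rewrite /N -cat// => /eqP; rewrite subr_eq => /eqP ->; ring.
Qed.

Lemma prim_of_forward n (y v : R -> 'cV[R]_n) c : vibl D v -> (forall t, D t -> y t = c + vint `[0, t] v) ->
  forall i, primitive (fun t => y t i 0) (fun s => v s i 0).
Proof.
move=> Iv yE i s t s0 st tT; have Ds : D s by rewrite /= in_itv/= s0 (le_trans st).
have Dt : D t by rewrite /= in_itv/= (le_trans s0).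
rewrite !yE// !coordD /vint !mxE (@Rint_cat R 0 s t)//; last by apply: ibl_itv (Iv i).
by ring.
Qed.

Lemma prim_of_backward n (y v : R -> 'cV[R]_n) c : vibl D v -> (forall t, D t -> y t = c + vint `[t, T] v) ->
  forall i, primitive (fun t => y t i 0) (fun s => - v s i 0).
Proof.
move=> Iv yE i s t s0 st tT; have Ds : D s by rewrite /= in_itv/= s0 (le_trans st).
have Dt : D t by rewrite /= in_itv/= (le_trans s0).
have Ist : ibl mu `[s, t] (fun s => v s i 0) by apply: ibl_itv (Iv i).
rewrite !yE// !coordD /vint !mxE [in LHS](@Rint_cat R s t T)//; last by apply: ibl_itv (Iv i).
transitivity (- \int[mu]_(r in `[s, t]) v r i 0); first by ring.
by rewrite -mulN1r -RintegralZl//; apply: eq_Rintegral => r _; rewrite mulN1r.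
Qed.

Lemma edot_rule n (f g a b : R -> 'cV[R]_n) :
  (forall i, {within D, continuous (fun t => f t i 0)}) -> (forall i, {within D, continuous (fun t => g t i 0)}) ->
  vibl D a -> vibl D b -> (forall i, primitive (fun t => f t i 0) (fun t => a t i 0)) ->
  (forall i, primitive (fun t => g t i 0) (fun t => b t i 0)) ->
  ibl mu D (fun s => edot (a s) (g s) + edot (b s) (f s)) /\
  primitive (fun s => edot (f s) (g s)) (fun s => edot (a s) (g s) + edot (b s) (f s)).
Proof.
move=> cf cg Ia Ib fa gb; have H i := product_rule (cf i) (cg i) (Ia i) (Ib i) (fa i) (gb i).
have E : (fun s => edot (a s) (g s) + edot (b s) (f s)) =
   (fun s => \sum_i (a s i 0 * g s i 0 + b s i 0 * f s i 0)).
  by apply/funext => s; rewrite /edot -big_split.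
rewrite E; split; first by apply: ibl_sum => // i _; case: (H i).
move=> s t s0 st tT; rewrite Rint_sum//; last first.
  by move=> i _; have [h _] := H i; exact: ibl_itv h.
rewrite /edot -sumrB; apply: eq_bigr => i _; have [_ ->//] := H i.
Qed.

End Product.

Lemma diff_quotient {R : realType} n (g : 'cV[R]_n -> R) x y : differentiable g x ->
  n0.+1%:R * (g (x + n0.+1%:R^-1 *: y) - g x) @[n0 --> \oo] --> edot (grad g x) y.
Proof.
move=> dg; have dd : derivable g x y by exact: diff_derivable.
have E : 'D_y g x = edot (grad g x) y.
  rewrite deriveE// [y in LHS]basis_sum linear_sum; apply: eq_bigr => j _.
  by rewrite linearZ/= [grad _ _ _ _]mxE deriveE// mulrC.
have H := @cvg_comp _ _ _ (fun m : nat => m.+1%:R^-1 : R) _ _ _ _ (@harmonic_dnbhs R) dd.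
rewrite -/(derive g x y) E in H.
apply: cvg_trans H; apply: near_eq_cvg; near=> m.
by rewrite /= invrK; congr (_ * (g _ - _)); exact: addrC.
Unshelve. all: by end_near. Qed.

(** Provides the integrable bound for the difference quotients in [first_variation]. The increment
    in [u] is squeezed between the tangent slopes at its two ends, by convexity. *)
Lemma lag_increment {R : realType} d k (C0 C h : R) (f : 'cV[R]_d -> 'cV[R]_k -> R) x y u w :
  lagrangian C0 C f -> 0 < C0 -> 0 <= C -> 0 <= h <= 1 ->
  `|f (x + h *: y) (u + h *: w) - f x u| <=
    h * (C * (1 + 2 * enorm u ^+ 2 + 2 * enorm w ^+ 2) * (enorm y + 1)).
Proof.
move=> lag C00 C_0 /andP[h0 h1].
set a := enorm u; set b := enorm w; have a0 : 0 <= a := enorm_ge0 u; have b0 : 0 <= b := enorm_ge0 w.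
have hb : h * b <= b by rewrite ler_piMl.
have ub : enorm (u + h *: w) <= a + b.
  by apply: le_trans (ler_enormD _ _) _; rewrite enormZ ger0_norm// lerD2l.
pose S := 1 + 2 * a ^+ 2 + 2 * b ^+ 2.
have S1 : (a + b) ^+ 2 <= 2 * a ^+ 2 + 2 * b ^+ 2.
  have -> : 2 * a ^+ 2 + 2 * b ^+ 2 = (a + b) ^+ 2 + (a - b) ^+ 2 by ring.
  by rewrite lerDl sqr_ge0.
have S2 : (1 + (a + b)) * b <= S.
  rewrite /S; have := sqr_ge0 (1 - b); have := sqr_ge0 (a - b).
  have -> : (1 + (a + b)) * b = b + a * b + b ^+ 2 by ring.
  by rewrite !sqrrB expr1n mul1r !mulr2n; have := sqr_ge0 a; lra.
have g1 : `|f (x + h *: y) (u + h *: w) - f x (u + h *: w)| <= h * (C * S * enorm y).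
  apply: le_trans (lag_lip lag _ _ _) _.
  rewrite [x + h *: y - x]addrAC subrr add0r enormZ (ger0_norm h0).
  have -> : h * (C * S * enorm y) = C * S * (h * enorm y) by ring.
  rewrite ler_wpM2r ?mulr_ge0 ?enorm_ge0// ler_wpM2l// /S -addrA lerD2l.
  apply: le_trans S1; rewrite ler_pXn2r// ?nnegrE ?enorm_ge0// addr_ge0//.
have g2 : `|f x (u + h *: w) - f x u| <= h * (C * S).
  have c1 := lag_convex lag x u (u + h *: w); have c2 := lag_convex lag x (u + h *: w) u.
  have q (v : 'cV[R]_k) : 0 <= C0^-1 * enorm v ^+ 2 / 2.
    by rewrite divr_ge0// mulr_ge0 ?invr_ge0 ?(ltW C00)// sqr_ge0.
  have qa := q (u + h *: w - u); have qb := q (u - (u + h *: w)).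
  rewrite [u + h *: w - u]addrAC subrr add0r in c1 qa.
  have uE : u - (u + h *: w) = - (h *: w) by rewrite opprD addrA subrr sub0r.
  rewrite uE in c2 qb.
  rewrite edotNr edotZr in c2; rewrite edotZr in c1.
  have bd v : enorm v <= a + b -> h * `|edot (gradu f x v) w| <= h * (C * S).
    move=> vb; rewrite ler_wpM2l//; apply: le_trans (normr_edot _ _) _.
    apply: le_trans (_ : C * (1 + (a + b)) * b <= _); last by rewrite -mulrA ler_wpM2l.
    rewrite ler_wpM2r//; apply: le_trans (lag_gradu lag _ _) _.
    by rewrite ler_wpM2l// lerD2l.
  have d1 : h * `|edot (gradu f x u) w| <= h * (C * S) by apply: bd; rewrite lerDl.
  have d2 := bd _ ub.
  have e1 : - (h * `|edot (gradu f x u) w|) <= h * edot (gradu f x u) w.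
    by rewrite -mulrN ler_wpM2l// lerNl; have := ler_norm (- edot (gradu f x u) w); rewrite normrN.
  have e2 : h * edot (gradu f x (u + h *: w)) w <= h * `|edot (gradu f x (u + h *: w)) w|.
    by rewrite ler_wpM2l// ler_norm.
  rewrite ler_norml; apply/andP; split; lra.
have -> : f (x + h *: y) (u + h *: w) - f x u =
  (f (x + h *: y) (u + h *: w) - f x (u + h *: w)) + (f x (u + h *: w) - f x u) by ring.
apply: le_trans (ler_normD _ _) _.
have -> : h * (C * (1 + 2 * a ^+ 2 + 2 * b ^+ 2) * (enorm y + 1)) = h * (C * S * enorm y) + h * (C * S) by rewrite /S; ring.
exact: lerD.
Qed.

Lemma envelope_arith {R : realFieldType} (a b fv fu g t k S : R) :
  fu + g + t <= fv -> - k <= g + b -> k <= S + t -> - (a + b) - fv <= - a - fu + S.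
Proof. lra. Qed.

(** * The gradient of the Hamiltonian at a stationary control *)

Section GradHamiltonian.
Context {R : realType} {d k : nat}.
Variables (A : 'M[R]_d) (B : 'M[R]_(d, k)) (C0 C : R) (f : 'cV[R]_d -> 'cV[R]_k -> R).
Hypotheses (lag : lagrangian C0 C f) (C00 : 0 < C0) (C_0 : 0 <= C).
Variables (x p : 'cV[R]_d) (u : 'cV[R]_k).
Hypothesis stat : gradu f x u = - (B^T *m p).
Let Phi y v := - edot p (A *m y + B *m v) - f y v.
Let H y := sup (range (Phi y)).

(* Since [Phi x] is maximal at [u], [H - Phi^~ u] vanishes to second order at
   [x]; this envelope argument makes [H] differentiable there. *)
Lemma sup_sandwich y : Phi y u <= H y <= Phi y u + C0 * (C * (1 + enorm u) * enorm (y - x)) ^+ 2 / 2.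
Proof.
pose K1 := C * (1 + enorm u) * enorm (y - x).
have up v : Phi y v <= Phi y u + C0 * K1 ^+ 2 / 2.
  have c := lag_convex lag y u v; set w := v - u.
  have ev : edot p (A *m y + B *m v) = edot p (A *m y + B *m u) + edot (B^T *m p) w.
    by rewrite -edot_mulmx -edotDr /w mulmxBr; congr edot; rewrite -addrA [B *m u + _]addrC subrK.
  have gw : - (K1 * enorm w) <= edot (gradu f y u) w + edot (B^T *m p) w.
    have -> : edot (gradu f y u) w + edot (B^T *m p) w = edot (gradu f y u - gradu f x u) w.
      by rewrite edotBl stat edotNl opprK.
    have := normr_edot (gradu f y u - gradu f x u) w; rewrite ler_norml => /andP[h _].
    apply: le_trans h; rewrite lerN2 ler_wpM2r ?enorm_ge0//.
    exact: lag_gradu_lip lag _ _ _.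
  have sq : K1 * enorm w <= C0 * K1 ^+ 2 / 2 + C0^-1 * enorm w ^+ 2 / 2.
    have : 0 <= C0^-1 / 2 * (enorm w - C0 * K1) ^+ 2 by rewrite mulr_ge0 ?sqr_ge0// divr_ge0 ?invr_ge0 ?(ltW C00).
    have -> : C0^-1 / 2 * (enorm w - C0 * K1) ^+ 2 =
      C0^-1 * enorm w ^+ 2 / 2 + C0 * K1 ^+ 2 / 2 - K1 * enorm w by field; rewrite gt_eqF.
    by rewrite subr_ge0 addrC.
  rewrite /Phi ev; exact: envelope_arith c gw sq.
have ne : range (Phi y) !=set0 by exists (Phi y u), u.
apply/andP; split; last by apply: ge_sup => // _ [v _ <-]; exact: up.
by apply: ub_le_sup; [exists (Phi y u + C0 * K1 ^+ 2 / 2) => _ [v _ <-]; exact: up|exists u].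
Qed.

Lemma grad_sup : grad H x = - (A^T *m p) - gradx f x u.
Proof.
apply/colP => i; rewrite [LHS]mxE; set e := Defs.basis i.
pose K := C * (1 + enorm u) * enorm e; pose K2 := C0 * K ^+ 2 / 2.
have K20 : 0 <= K2 by rewrite divr_ge0// mulr_ge0 ?sqr_ge0 ?(ltW C00).
have Hx : H x = Phi x u.
  have /andP[h1 h2] := sup_sandwich x; apply/eqP; rewrite eq_le h1 andbT.
  by move: h2; rewrite subrr enorm0 mulr0 expr0n mulr0 mul0r addr0.
have sw (h : R) : `|(H (h *: e + x) - H x) - (Phi (h *: e + x) u - Phi x u)| <= K2 * h ^+ 2.
  have /andP[h1 h2] := sup_sandwich (h *: e + x).
  have E : C0 * (C * (1 + enorm u) * enorm (h *: e + x - x)) ^+ 2 / 2 = K2 * h ^+ 2.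
    by rewrite addrK enormZ /K2 /K -[in RHS](real_normK (num_real h)); ring.
  rewrite E in h2; rewrite Hx ler_norml; move: (K2 * h ^+ 2) h1 h2 (mulr_ge0 K20 (sqr_ge0 h)) => q h1 h2 q0.
  by apply/andP; split; lra.
have dPhi : h^-1 *: (Phi (h *: e + x) u - Phi x u) @[h --> (0 : R)^'] --> (- (A^T *m p) - gradx f x u) i 0.
  have df : derivable (fun y => f y u) x e by apply: diff_derivable; exact: lag_diffx lag _ _.
  have E : 'D_e (fun y => f y u) x = gradx f x u i 0 by rewrite /gradx /grad mxE.
  have cf : h^-1 *: (f (h *: e + x) u - f x u) @[h --> (0 : R)^'] --> gradx f x u i 0 by rewrite -E; exact: df.
  have c2 : - (A^T *m p) i 0 - h^-1 *: (f (h *: e + x) u - f x u) @[h --> (0 : R)^'] --> - (A^T *m p) i 0 - gradx f x u i 0.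
    by apply: cvgB; [exact: cvg_cst|exact: cf].
  have -> : (- (A^T *m p) - gradx f x u) i 0 = - (A^T *m p) i 0 - gradx f x u i 0.
    by rewrite coordB; congr (_ - _); rewrite mxE.
  apply: cvg_trans c2; apply: near_eq_cvg; near=> h.
  have h0 : h != 0 by near: h; exact: nbhs_dnbhs_neq.
  have -> : (A^T *m p) i 0 = edot p (A *m e).
    rewrite edot_mulmx /edot (bigD1 i)//= big1 ?addr0; first by rewrite [e _ _]mxE !eqxx mulr1.
    by move=> j ji; rewrite [e _ _]mxE (negbTE ji) mulr0.
  have sE (z : R) : h^-1 *: z = h^-1 * z by [].
  have EA : edot p (A *m (h *: e + x) + B *m u) = h * edot p (A *m e) + edot p (A *m x + B *m u).
    by rewrite mulmxDr -scalemxAr -addrA edotDr edotZr.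
  rewrite !sE /Phi EA.
  by move: (edot p _) (edot p _) (f _ u) (f x u) => a b c c'; field.
apply: cvg_lim => //; apply/cvgrPdist_le => eps eps0.
have e2 : 0 < eps / 2 by rewrite divr_gt0.
have [del del0 Hd] := small_factor K20 e2.
have /cvgrPdist_le/(_ _ e2) c1 := dPhi.
have Hn : \forall h \near (0 : R)^', `|h| < del.
  by apply: nbhs_dnbhs; have := @nbhsx_ballx _ R 0 del del0; apply: filterS => z; rewrite /ball/= sub0r normrN.
near=> h.
have h0 : h != 0 by near: h; exact: nbhs_dnbhs_neq.
have hd : `|h| <= del by apply: ltW; near: h; exact: Hn.
have hc : `|(- (A^T *m p) - gradx f x u) i 0 - h^-1 *: (Phi (h *: e + x) u - Phi x u)| <= eps / 2.
  by near: h; exact: c1.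
have E : (- (A^T *m p) - gradx f x u) i 0 - h^-1 *: (H (h *: e + x) - H x) =
   ((- (A^T *m p) - gradx f x u) i 0 - h^-1 *: (Phi (h *: e + x) u - Phi x u)) -
   h^-1 * ((H (h *: e + x) - H x) - (Phi (h *: e + x) u - Phi x u)) by rewrite /GRing.scale/=; ring.
rewrite /= E [eps]splitr; apply: le_trans (ler_normB _ _) _; apply: lerD => //.
rewrite normrM normfV; apply: le_trans (_ : `|h|^-1 * (K2 * h ^+ 2) <= _).
  by rewrite ler_wpM2l ?invr_ge0.
have -> : `|h|^-1 * (K2 * h ^+ 2) = K2 * `|h|.
  by rewrite -(real_normK (num_real h)); field; rewrite normr_eq0.
by apply: le_trans Hd; rewrite ler_wpM2l.
Unshelve. all: by end_near. Qed.

End GradHamiltonian.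

Lemma strong_convexity_arith {R : realFieldType} (a1 a2 a3 a4 a5 : R) :
  a1 - a3 + a5 / 2 <= a2 -> a2 + a4 + a5 / 2 <= a1 -> a5 <= a3 - a4.
Proof. lra. Qed.

(** * Stationarity and bounds for optimal controls *)

Section Stationarity.
Context {R : realType} {d k : nat}.
Variables (A : 'M[R]_d) (B : 'M[R]_(d, k)) (T : R).
Hypothesis T0 : 0 < T.
Local Notation mu := (@lebesgue_measure R).
Local Notation X := 'cV[R]_d.
Local Notation U := 'cV[R]_k.
Local Notation D := (`[0, T]%classic).
Let mD : measurable (D : set (measurableTypeR R)). Proof. exact: measurable_itv. Qed.
Let D0 : D 0. Proof. by rewrite /= in_itv/= lexx ltW. Qed.
Let DT : D T. Proof. by rewrite /= in_itv/= lexx ltW. Qed.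
Variables (l : R -> X -> U -> R) (C0 C K : R).
Hypotheses (C00 : 0 < C0) (C_0 : 0 <= C) (K0 : 0 <= K).
Hypothesis lag : forall t, D t -> lagrangian C0 C (l t).
Hypothesis lmod : forall s t x u, D s -> D t -> `|l s x u - l t x u| <= K * Num.sqrt `|s - t|.
Variables (g : X -> R) (x0 : X) (u : R -> U).
Hypothesis dg : forall x, differentiable g x.
Hypothesis Su : vsqi D u.
Local Notation curve v := (fun t => ev t (traj A B T x0 v)).
Let c := curve u.
Hypothesis opt : forall v, vsqi D v -> run T l c u + g (c T) <= run T l (curve v) v + g (curve v T).

Let Iu := vsqi_vibl Su.
Let cc i : {within D, continuous (fun t => c t i 0)}.
Proof. by have /solutionP[h _ _] := traj_sol A B T0 x0 Iu; exact: h. Qed.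
Let mc : measurable_fun D c. Proof. exact: within_measurable_cV. Qed.
Let q s := gradx (l s) (c s) (u s).
Let gu s := gradu (l s) (c s) (u s).
Let Iq : vibl D q. Proof. exact: (gradx_vibl T0 K0 lag lmod mc Su). Qed.
Let Sgu : vsqi D gu. Proof. exact: (gradu_vsqi T0 K0 lag lmod mc Su). Qed.

Lemma curve_shift (w : R -> U) y (h : R) : vibl D w -> solution A B T 0 w y ->
  forall t, curve (fun s => u s + h *: w s) t = c t + h *: y t.
Proof.
move=> Iw sy; have Ihw : vibl D (fun s => h *: w s).
  move=> i; rewrite (_ : (fun s => _) = (fun s => h * w s i 0)); last by apply/funext => s; rewrite mxE.
  by apply: (iblZ mD); exact: Iw.
have Iv := viblD mD Iu Ihw.
have sc := traj_sol A B T0 x0 Iu; have sv := traj_sol A B T0 x0 Iv.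
suff E : (fun t => curve (fun s => u s + h *: w s) t) = (fun t => c t + h *: y t).
  by move=> t; exact: (congr1 (@^~ t) E).
apply: (sol_unique T0 Iv sv).
have /solutionP[c1 c2 c3] := sc; have /solutionP[y1 y2 y3] := sy.
have Ic : vibl D c := sol_vibl sc; have Iy : vibl D y := sol_vibl sy.
apply/solutionP; split.
- move=> i; rewrite (_ : (fun t => _) = (fun t => c t i 0) \+ (fun t => h * y t i 0)).
    apply: within_continuousD; first exact: c1.
    by move=> t; apply: cvgM; [exact: cvg_cst|exact: y1].
  by apply/funext => t; rewrite coordD [(h *: y t) i 0]mxE.
- move=> t Dt; have := Dt; rewrite /= in_itv/= => /andP[_ tT].
  have sub n (f : R -> 'cV[R]_n) : vibl D f -> vibl `[0, t] f by move=> If i; exact: ibl_itv (If i).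
  have c2' : c t = x0 + vint `[0, t] (fun s => A *m c s + B *m u s) := c2 t Dt.
  rewrite c2' y2// add0r.
  have -> : vint `[0, t] (fun s => A *m (c s + h *: y s) + B *m (u s + h *: w s)) =
      vint `[0, t] (fun s => (A *m c s + B *m u s) + (h%:M *m (A *m y s + B *m w s))).
    apply: eq_vint => s _; rewrite mul_scalar_mx !mulmxDr scalerDr -!scalemxAr.
    by rewrite -!addrA; congr (_ + _); rewrite addrCA.
  have m' : measurable (`[0, t] : set (measurableTypeR R)) by exact: measurable_itv.
  have Iv1 : vibl `[0, t] (fun s => A *m c s + B *m u s) := sub _ _ (sol_velocity_vibl Iu sc).
  have Iv2 : vibl `[0, t] (fun s => A *m y s + B *m w s) := sub _ _ (sol_velocity_vibl Iw sy).
  by rewrite (vintD m' Iv1 (vibl_mulmx h%:M m' Iv2)) (vint_mulmx _ m' Iv2) mul_scalar_mx addrA.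
- by move=> t; have c3' : c t = c (clamp T t) := c3 t; rewrite -c3' -y3.
Qed.

(** Perturbing the control by [h *: w] moves the curve by [h *: y]. The optimality inequality is
    divided by [h = 1 / (n + 1)], and dominated convergence gives the limit. *)
Lemma first_variation w y : vsqi D w -> solution A B T 0 w y ->
  0 <= \int[mu]_(s in D) (edot (q s) (y s) + edot (gu s) (w s)) + edot (grad g (c T)) (y T).
Proof.
move=> Sw sy; have Iw := vsqi_vibl Sw.
have /solutionP[y1 y2 y3] := sy.
have my : measurable_fun D y by exact: within_measurable_cV.
have [Y Y0 yY] : exists2 Y, 0 <= Y & forall s, D s -> enorm (y s) <= Y.
  have /choice[M HM] : forall i, exists M, 0 <= M /\ forall t, D t -> `|y t i 0| <= M.
    by move=> i; have [M M0 HM] := within_bounded (y1 i); exists M.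
  exists (\sum_i M i); first by apply: sumr_ge0 => i _; exact: (HM i).1.
  move=> t Dt; apply: le_trans (enorm_le_sum _) _; apply: ler_sum => i _; exact: (HM i).2.
pose h n : R := n.+1%:R^-1.
have h01 n : 0 <= h n <= 1 by rewrite invr_ge0 ler0n/= invf_le1// ler1n.
pose v n s := u s + h n *: w s.
have Sv n : vsqi D (v n).
  apply: vsqiD => //; move=> i; apply: (eq_sqi mD (f := fun s => h n * w s i 0)).
    by move=> s _; rewrite mxE.
  by apply: (sqiZ mD); exact: Sw.
pose F n s := n.+1%:R * (l s (c s + h n *: y s) (u s + h n *: w s) - l s (c s) (u s)).
pose bd s := C * (1 + 2 * enorm (u s) ^+ 2 + 2 * enorm (w s) ^+ 2) * (Y + 1).
have mcy n : measurable_fun D (fun s => c s + h n *: y s).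
  apply/measurable_fun_cVP => // j.
  rewrite (_ : (fun t => _) = (fun t => c t j 0 + h n * y t j 0)).
    apply: measurable_funD; first by have /measurable_fun_cVP := mc; apply.
    by apply: measurable_funM; [exact: measurable_cst|have /measurable_fun_cVP := my; apply].
  by apply/funext => t; rewrite coordD [(h n *: y t) j 0]mxE.
have I1 n : ibl mu D (fun s => l s (c s + h n *: y s) (v n s)) := run_ibl T0 K0 lag lmod (mcy n) (Sv n).
have I0 : ibl mu D (fun s => l s (c s) (u s)) := run_ibl T0 K0 lag lmod mc Su.
have [|||||Ilim cvI] := @Rdct _ _ _ mu D mD F (fun s => edot (q s) (y s) + edot (gu s) (w s)) bd.
- by move=> n; apply: measurable_funM; [exact: measurable_cst|exact: ibl_mfun (iblB mD (I1 n) I0)].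
- apply: measurable_funD; apply: ibl_mfun; last exact: vsqi_edot.
  by apply: ibl_sum => // i _; exact: ibl_mul_cont.
- by apply: aeW => s Ds; exact: (lag_dir (lag Ds)).
- have -> : bd = (fun s => ((1 + 2 * enorm (u s) ^+ 2) + 2 * enorm (w s) ^+ 2) * (C * (Y + 1))).
    by apply/funext => s; rewrite /bd; ring.
  apply: (iblZr mD); apply: (iblD mD); [apply: (iblD mD); first exact: ibl_cst_itv|];
   by apply: (iblZ mD); exact: ibl_enorm2.
- apply: aeW => s n Ds; rewrite normrM ger0_norm//.
  rewrite -ler_pdivlMl// ; apply: le_trans (lag_increment _ _ _ _ (lag Ds) C00 C_0 (h01 n)) _.
  rewrite ler_wpM2l ?invr_ge0// ler_wpM2l//; last by rewrite lerD2r yY.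
  by rewrite mulr_ge0// !addr_ge0// mulr_ge0// sqr_ge0.
have cg := @diff_quotient R d g (c T) (y T) (dg (c T)).
have cs : \int[mu]_(s in D) F n s + n.+1%:R * (g (c T + h n *: y T) - g (c T)) @[n --> \oo] -->
   \int[mu]_(s in D) (edot (q s) (y s) + edot (gu s) (w s)) + edot (grad g (c T)) (y T).
  by apply: cvgD; [exact: cvI|exact: cg].
apply: (cvgr_to_ge cs); apply: nearW => n.
rewrite RintegralZl//; last exact: (iblB mD).
rewrite RintegralB//; [|exact: I1].
rewrite -mulrDr mulr_ge0//.
have := opt (Sv n); rewrite /run.
have E t : curve (v n) t = c t + h n *: y t := curve_shift _ Iw sy t.
have -> : \int[mu]_(s in D) l s (curve (v n) s) (v n s) = \int[mu]_(s in D) l s (c s + h n *: y s) (v n s).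
  by apply: eq_Rintegral => s _; rewrite E.
rewrite E; move: (\int[mu]_(s in D) _) (\int[mu]_(s in D) _) (g _) (g _) => a1 a2 a3 a4; lra.
Qed.


(** Integrating [<p, y>] by parts rewrites the first variation as the integral of [<gu + B^T p, w>].
    Testing with [w = - (gu + B^T p)] leaves minus a square, which must then vanish almost
    everywhere. *)
Lemma stationary : exists p : R -> X, [/\ forall i, {within D, continuous (fun t => p t i 0)}, p T = grad g (c T),
  forall i, primitive T (fun t => p t i 0) (fun t => (- (A^T *m p t + q t)) i 0)
  & {ae mu, forall t, D t -> gu t = - (B^T *m p t)}].
Proof.
pose F t := grad g (c T) + vint `[t, T] q.
have cF i : {within D, continuous (fun t => F t i 0)}.
  rewrite (_ : (fun t => _) = (fun=> grad g (c T) i 0) \+ (fun t => \int[mu]_(s in `[t, T]) q s i 0)).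
    apply: within_continuousD; first by apply: continuous_subspaceT => t; exact: cvg_cst.
    exact: within_prim_back.
  by apply/funext => t; rewrite /F coordD [vint _ _ _ _]mxE.
have [p [cp pE]] := @picard_backward R d T A^T T0 F cF; exists p.
have Ip : vibl D p by move=> i; exact: within_ibl.
have IA : vibl D (fun s => A^T *m p s + q s) by apply: viblD => //; exact: vibl_mulmx.
have pE' t : D t -> p t = grad g (c T) + vint `[t, T] (fun s => A^T *m p s + q s).
  move=> Dt; have := Dt; rewrite /= in_itv/= => /andP[t0 _].
  have sub (f : R -> X) : vibl D f -> vibl `[t, T] f by move=> If i; exact: ibl_itv (If i).
  rewrite pE// /F vintD; [|exact: measurable_itv|by apply: sub; exact: vibl_mulmx|exact: sub].
  by rewrite -addrA [vint _ q + _]addrC.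
have pT : p T = grad g (c T).
  rewrite pE'//; have -> : vint `[T, T] (fun s => A^T *m p s + q s) = 0; last by rewrite addr0.
  by apply/colP => i; rewrite !mxE set_itv1 Rintegral_set1.
have pp i : primitive T (fun t => p t i 0) (fun t => (- (A^T *m p t + q t)) i 0).
  have := prim_of_backward IA pE' i; rewrite (_ : (fun s => - _) = (fun t => (- (A^T *m p t + q t)) i 0))//.
  by apply/funext => s; rewrite [in RHS]mxE.
split=> //.
have Sp : vsqi D p.
  move=> i; have [M M0 HM] := within_bounded (cp i).
  apply: (sqi_le mD (g := fun=> M)) => //; [exact: ibl_mfun (Ip i)|exact: sqi_cst_itv].
pose z s := gu s + B^T *m p s.
have Sz : vsqi D z by apply: vsqiD => //; exact: vsqi_mulmx.
pose w s := - z s.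
have Sw : vsqi D w by move=> i; apply: (eq_sqi mD (f := fun s => - z s i 0)) => [s _|]; [rewrite /w [RHS]mxE|apply: (sqiN mD); exact: Sz].
have Iw := vsqi_vibl Sw.
have [y sy] := @sol_exists R d k A B T T0 0 w Iw.
have /solutionP[y1 y2 y3] := sy.
have y0 : y 0 = 0 := sol0 T0 sy.
have Iv := sol_velocity_vibl Iw sy.
have INA : vibl D (fun t => - (A^T *m p t + q t)) by exact: viblN.
have [Ie Ep] := edot_rule T0 cp y1 INA Iv pp (prim_of_forward Iv y2).
have := first_variation Sw sy; rewrite -pT.
have -> : edot (p T) (y T) = edot (p T) (y T) - edot (p 0) (y 0) by rewrite y0 edot0r subr0.
rewrite (Ep 0 T (lexx 0) (ltW T0) (lexx T)) -RintegralD//; last first.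
  apply: (iblD mD); last exact: vsqi_edot.
  by apply: ibl_sum => // i _; exact: ibl_mul_cont.
rewrite [X in 0 <= X](_ : _ = \int[mu]_(s in D) (- edot (z s) (z s))); last first.
  apply: eq_Rintegral => s _; rewrite edotDl !edotNl edotDl /w mulmxN edotDl edotNl.
  rewrite ![edot (_ *m _) (p s)]edotC !edot_mulmx edotNr.
  move: (edot _ _) (edot _ _) (edot _ _) (edot _ _) => *; ring.
have Izz : ibl mu D (fun s => edot (z s) (z s)) by exact: vsqi_edot.
have zz0 s : 0 <= edot (z s) (z s) by exact: edot_ge0.
rewrite (_ : (fun s => - _) = (fun s => -1 * edot (z s) (z s))); last by apply/funext => s; rewrite mulN1r.
rewrite RintegralZl// mulN1r oppr_ge0 => Z0.
have : {ae mu, forall t, D t -> edot (z t) (z t) = 0}.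
  apply: ibl_prim_eq0 => // t; rewrite in_itv/= => /andP[t0 tT]; apply/eqP; rewrite eq_le; apply/andP; split.
    by apply: le_trans Z0; apply: Rint_le_itv.
  by apply: Rintegral_ge0.
apply: ae_imp => t H Dt; have h := H Dt; have z0 : z t = 0.
  by apply: enorm_eq0; apply/eqP; rewrite -sqrf_eq0 sqr_enorm h.
by apply/eqP; rewrite -subr_eq0 opprK; apply/eqP.
Qed.

Lemma Rint_cst_itv (e s t : R) : s <= t -> \int[mu]_(r in `[s, t]) e = e * (t - s).
Proof.
move=> st; have E : fine (mu `[s, t]) = t - s by rewrite mu_itv.
by rewrite Rintegral_cst// E.
Qed.

Lemma Rint_ae_ge (f : R -> R) e s t : ibl mu D f -> {ae mu, forall x, D x -> e <= f x} ->
  0 <= s -> s <= t -> t <= T -> e * (t - s) <= \int[mu]_(r in `[s, t]) f r.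
Proof.
move=> If ef s0 st tT; have sub : `[s, t] `<=` D by exact: sub_itvcc.
have Ist : ibl mu `[s, t] f by exact: ibl_itv If.
have m' : measurable (`[s, t] : set (measurableTypeR R)) by exact: measurable_itv.
(* [max e f] agrees with [f] almost everywhere and is at least [e] everywhere, so pointwise
   monotonicity of the integral suffices. *)
have Im : ibl mu `[s, t] (fun r => Num.max e (f r)).
  apply: (ibl_le m' (g := fun r => `|e| + `|f r|)).
  - by apply: measurable_maxr; [exact: measurable_cst|exact: ibl_mfun Ist].
  - move=> r _; rewrite /Num.max; case: ifP => _; [by rewrite lerDr|by rewrite lerDl].
  - by apply: (iblD m'); [exact: ibl_cst_itv|exact: ibl_norm].
have -> : \int[mu]_(r in `[s, t]) f r = \int[mu]_(r in `[s, t]) Num.max e (f r).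
  congr fine; apply: ae_eq_integral => //.
  - by apply/measurable_EFinP; exact: ibl_mfun Ist.
  - by apply/measurable_EFinP; exact: ibl_mfun Im.
  by apply: ae_imp ef => r h /sub/h er; rewrite (max_idPr er).
apply: le_trans (_ : \int[mu]_(r in `[s, t]) e <= _); last first.
  apply: Rint_le => //; [exact: ibl_cst_itv|by move=> r _; rewrite le_max lexx].
by rewrite Rint_cst_itv.
Qed.

Variables (c4 Mg : R).
Hypothesis gradg : enorm (grad g (c T)) <= Mg.
Hypothesis ham : forall t x p, D t ->
  - c4 <= edot (grad (fun y => sup (range (fun v : U => - edot p (A *m y + B *m v) - l t y v))) x) p.

(** The square root bounds the costate, and [mx_sum B^T] times it bounds [D_u L] along the optimum,
    while [C] bounds [D_u L] at [u = 0]; strong convexity converts the sum into a bound on [u] at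
    the price of [C0]. *)
Definition control_bound := C0 * (mx_sum B^T * Num.sqrt (Mg ^+ 2 + 2 * T * `|c4|) + C).

Lemma control_bounded : {ae mu, forall t, D t -> enorm (u t) <= control_bound}.
Proof.
have [p [cp pT pp st]] := stationary.
have Ip : vibl D p by move=> i; exact: within_ibl.
have IN : vibl D (fun t => - (A^T *m p t + q t)) by apply: viblN => //; apply: viblD => //; exact: vibl_mulmx.
have [Ie Ep] := edot_rule T0 cp cp IN IN pp pp.
have pN t : D t -> enorm (p t) <= Num.sqrt (Mg ^+ 2 + 2 * T * `|c4|).
  move=> Dt; have := Dt; rewrite /= in_itv/= => /andP[t0 tT].
  rewrite -[leLHS]ger0_norm ?enorm_ge0// -sqrtr_sqr ler_wsqrtr// sqr_enorm.
  have low : {ae mu, forall s, D s -> - (2 * c4) <= edot (- (A^T *m p s + q s)) (p s) + edot (- (A^T *m p s + q s)) (p s)}.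
    apply: ae_imp st => s h Ds; have := ham (c s) (p s) Ds.
    (* Stationarity makes [u s] the maximizer at [c s], which identifies the gradient with the
       velocity of the costate. *)
    have gs : grad (fun y => sup (range (fun v : U => - edot (p s) (A *m y + B *m v) - l s y v))) (c s) =
      - (A^T *m p s) - q s := grad_sup A (lag Ds) C00 (h Ds).
    rewrite gs -opprD => h1; move: (edot _ _) h1 => e1 h1; lra.
  have := Rint_ae_ge Ie low t0 tT (lexx T); rewrite -Ep// pT => h1.
  have h2 : edot (grad g (c T)) (grad g (c T)) <= Mg ^+ 2.
    rewrite -sqr_enorm ler_pXn2r// ?nnegrE ?enorm_ge0//; apply: le_trans gradg; exact: enorm_ge0.
  have h3 : c4 * (T - t) <= `|c4| * T.
    apply: le_trans (_ : `|c4| * (T - t) <= _); first by rewrite ler_wpM2r ?subr_ge0// ler_norm.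
    by rewrite ler_wpM2l// gerBl.
  move: h1 h2 h3; have -> : - (2 * c4) * (T - t) = - (2 * (c4 * (T - t))) by ring.
  have -> : 2 * T * `|c4| = 2 * (`|c4| * T) by ring.
  move: (edot _ _) (edot _ _) (c4 * _) (`|c4| * T) (Mg ^+ 2) => a1 a2 a3 a4 a5; lra.
apply: ae_imp st => t h Dt.
have uE : enorm (gu t) <= mx_sum B^T * Num.sqrt (Mg ^+ 2 + 2 * T * `|c4|).
  rewrite (h Dt) enormN; apply: le_trans (enorm_mulmx _ _) _; rewrite ler_wpM2l ?mx_sum_ge0//; exact: pN.
have c1 := lag_convex (lag Dt) (c t) (u t) 0; have c2 := lag_convex (lag Dt) (c t) 0 (u t).
have c3 := lag_gradu (lag Dt) (c t) 0; rewrite enorm0 addr0 mulr1 in c3.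
rewrite sub0r enormN edotNr in c1; rewrite subr0 in c2.
have e1 := edot_le (gu t) (u t); have e2 := edot_le (- gradu (l t) (c t) 0) (u t).
rewrite edotNl enormN in e2.
have u0 := enorm_ge0 (u t); set n := enorm (u t) in c1 c2 e1 e2 u0 *.
have key : C0^-1 * n ^+ 2 <= (mx_sum B^T * Num.sqrt (Mg ^+ 2 + 2 * T * `|c4|) + C) * n.
  rewrite mulrDl; apply: le_trans (lerD (ler_wpM2r u0 uE) (ler_wpM2r u0 c3)).
  apply: le_trans (_ : edot (gu t) (u t) - edot (gradu (l t) (c t) 0) (u t) <= _); last exact: lerD.
  exact: strong_convexity_arith c1 c2.
rewrite /control_bound; have [->|n0] := eqVneq n 0.
  by rewrite mulr_ge0 ?(ltW C00)// addr_ge0// mulr_ge0 ?mx_sum_ge0 ?sqrtr_ge0.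
have np : 0 < n by rewrite lt_neqAle eq_sym n0.
move: key; rewrite expr2 mulrA ler_pM2r// mulrC ler_pdivrMr// => key.
by rewrite mulrC.
Qed.

(** Bounds the velocity [A *m c + B *m u] divided by [1 + |x0|]: the first term comes from
    [sol_bound], the second from the bound on the control. *)
Definition speed := mx_sum A * (2 * (1 + mx_sum B * (control_bound * T)) * expR (2 * mx_sum A * T)) +
  mx_sum B * control_bound.

Lemma curve_lipschitz s t : 0 <= s -> s <= t -> t <= T ->
  enorm (c t - c s) <= speed * (1 + enorm x0) * (t - s).
Proof.
move=> s0 st tT; have ub := control_bounded.
have cb0 : 0 <= control_bound.
  by rewrite mulr_ge0 ?(ltW C00)// addr_ge0// mulr_ge0 ?mx_sum_ge0 ?sqrtr_ge0.
have IuE : ibl mu D (fun r => enorm (u r)) by exact: vibl_enorm.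
have intu a b : 0 <= a -> a <= b -> b <= T -> \int[mu]_(r in `[a, b]) enorm (u r) <= control_bound * (b - a).
  move=> a0 ab bT; have low : {ae mu, forall r, D r -> - control_bound <= -1 * enorm (u r)}.
    by apply: ae_imp ub => r h /h; rewrite mulN1r lerN2.
  have := Rint_ae_ge (iblZ mD (-1) IuE) low a0 ab bT.
  by rewrite RintegralZl//; [rewrite mulN1r mulNr lerN2|exact: ibl_itv IuE].
have sc := traj_sol A B T0 x0 Iu.
have Ic : vibl D c := sol_vibl sc.
have cM r : enorm (c r) <= 2 * (enorm x0 + mx_sum B * (control_bound * T)) * expR (2 * mx_sum A * T).
  apply: le_trans (sol_bound T0 Iu sc r) _; rewrite ler_wpM2r ?expR_ge0// ler_wpM2l// lerD2l ler_wpM2l ?mx_sum_ge0//.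
  by have := intu 0 T (lexx 0) (ltW T0) (lexx T); rewrite subr0.
have Iv := sol_velocity_vibl Iu sc.
have sub n (f : R -> 'cV[R]_n) : vibl D f -> vibl `[s, t] f by move=> If i; exact: ibl_itv (If i).
have /solutionP[_ cE _] := sc.
have -> : c t - c s = vint `[s, t] (fun r => A *m c r + B *m u r).
  by apply/colP => i; rewrite coordB (prim_of_forward Iv cE i s0 st tT) [RHS]mxE.
rewrite vintD; [|exact: measurable_itv|by apply: sub; exact: vibl_mulmx|by apply: sub; exact: vibl_mulmx].
rewrite !vint_mulmx; [|exact: measurable_itv|exact: sub|exact: measurable_itv|exact: sub].
apply: le_trans (ler_enormD _ _) _; rewrite /speed.
set E := expR _ in cM *; have E0 : 0 <= E by exact: expR_ge0.
have x00 := enorm_ge0 x0.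
have ts : 0 <= t - s by rewrite subr_ge0.
set S := 2 * _ * E.
have -> : (mx_sum A * S + mx_sum B * control_bound) * (1 + enorm x0) * (t - s) =
  mx_sum A * (S * (1 + enorm x0) * (t - s)) + mx_sum B * (control_bound * (1 + enorm x0) * (t - s)) by ring.
apply: lerD.
  apply: le_trans (enorm_mulmx _ _) _; rewrite ler_wpM2l ?mx_sum_ge0//.
  apply: le_trans (enorm_vint _ _) _; [exact: measurable_itv|exact: sub|].
  apply: (@le_trans _ _ (\int[mu]_(r in `[s, t]) (2 * (enorm x0 + mx_sum B * (control_bound * T)) * E))).
    apply: Rint_le => //; [by apply: vibl_enorm => //; exact: sub|exact: ibl_cst_itv].
  rewrite Rint_cst_itv// ler_wpM2r// /S.
  have : 0 <= mx_sum B * (control_bound * T) by rewrite mulr_ge0 ?mx_sum_ge0// mulr_ge0// ltW.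
  move: (mx_sum B * _) => z z0.
  have -> : 2 * (1 + z) * E * (1 + enorm x0) = 2 * (1 + z + enorm x0 + z * enorm x0) * E by ring.
  rewrite ler_wpM2r// ler_wpM2l//; have := mulr_ge0 z0 x00; lra.
apply: le_trans (enorm_mulmx _ _) _; rewrite ler_wpM2l ?mx_sum_ge0//.
apply: le_trans (enorm_vint _ _) _; [exact: measurable_itv|exact: sub|].
apply: le_trans (intu s t s0 st tT) _; rewrite ler_wpM2r//.
by rewrite ler_peMr// lerDl.
Qed.

End Stationarity.

(** * Lipschitz flow of the equilibrium *)

Section LipschitzFlow.
Context {R : realType} {d k : nat}.
Variables (A : 'M[R]_d) (B : 'M[R]_(d, k)) (T : R).
Hypothesis T0 : 0 < T.
Local Notation X := 'cV[R]_d.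
Local Notation U := 'cV[R]_k.
Local Notation Gam := (Gamma A B T).
Local Notation Pr := (probability Gam R).
Local Notation D := (`[0, T]%classic).
Variables (L : X -> U -> probability X R -> R) (G : X -> probability X R -> R).
Hypotheses (HL : running_cost_assumptions L) (HG : terminal_cost_assumptions G).
Variables (a r c3 c4 : R) (m0 : probability X R).
Hypothesis a1 : 1 < a.
Hypothesis m0a : finite_moment a m0.
Hypothesis c30 : 0 < c3.
Hypothesis ham : forall (x p : X) (m : probability X R), finite_moment a m ->
  c3 * enorm p ^+ 2 - c4 <= edot (grad (fun y => hamiltonian A B L y p m) x) p.
Let D0 : D 0. Proof. by rewrite /= in_itv/= lexx ltW. Qed.
Let DT : D T. Proof. by rewrite /= in_itv/= lexx ltW. Qed.

Lemma optimal_lipschitz (eta : Pr) : PGamma a m0 r eta -> exists2 K, 0 <= K & forall g,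
  optimal_curves L G eta (ev 0 g) g -> forall s t, D s -> D t ->
  enorm (ev t g - ev s g) <= K * (1 + enorm (ev 0 g)) * `|t - s|.
Proof.
move=> eP; have [C0 [C [K [C00 C_0 K0 HF]]]] := flow_costP A B T0 HL r a1 m0a.
have [lag lmod] := HF eta eP.
have fT := (marginal_moment_fin T0 a1 m0a eP DT).2.
have [[dG _] _ [Mg HMg] _] := G_C1b HG fT.
pose S := speed A B T C0 C c4 Mg; exists (Num.max 0 S); first by rewrite le_max lexx.
move=> g og s t Ds Dt; have [u [Su gE opt]] := optimal_control T0 og.
have opt' v : vsqi D v -> run T (flow_cost L eta) (fun t => ev t (traj A B T (ev 0 g) u)) u +
    G (ev T (traj A B T (ev 0 g) u)) (marginal eta T) <=
    run T (flow_cost L eta) (fun t => ev t (traj A B T (ev 0 g) v)) v +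
    G (ev T (traj A B T (ev 0 g) v)) (marginal eta T) by move=> Sv; have := opt v Sv; rewrite !costE.
have hm t' x p : D t' -> - c4 <= edot (grad (fun y => sup (range (fun v : U =>
    - edot p (A *m y + B *m v) - flow_cost L eta t' y v))) x) p.
  move=> Dt'; have fm := (marginal_moment_fin T0 a1 m0a eP Dt').1.
  apply: le_trans (ham x p fm); rewrite -subr_ge0 opprK subrK mulr_ge0 ?sqr_ge0// ltW//.
have H s' t' : 0 <= s' -> s' <= t' -> t' <= T -> enorm (ev t' g - ev s' g) <= Num.max 0 S * (1 + enorm (ev 0 g)) * (t' - s').
  move=> s0 st tT; have := @curve_lipschitz R d k A B T T0 (flow_cost L eta) C0 C K C00 C_0 K0 lag lmod
    (fun x => G x (marginal eta T)) (ev 0 g) u dG Su opt' c4 Mg (HMg _) hm s' t' s0 st tT.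
  rewrite -gE => h; apply: le_trans h _; rewrite ler_wpM2r ?subr_ge0// ler_wpM2r ?addr_ge0 ?enorm_ge0//.
  by rewrite le_max lexx orbT.
move: Ds Dt; rewrite /= !in_itv/= => /andP[s0 sT] /andP[t0 tT].
have [st|ts] := leP s t; first by rewrite ger0_norm ?subr_ge0//; exact: H.
by rewrite enorm_distC distrC ger0_norm ?subr_ge0 ?(ltW ts)//; apply: H => //; exact: ltW.
Qed.

(** [eta] is carried by its support, hence by curves that are Lipschitz with constant
    [K (1 + |g 0|)]. The joint law of the two evaluations is a coupling, and the mean of [|g 0|] is
    finite. *)
Lemma equilibrium_lipschitz (eta : Pr) : PGamma a m0 r eta ->
  (forall g, Defs.support eta g -> optimal_curves L G eta (ev 0 g) g) -> Lip_curve T a (marginal eta).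
Proof.
move=> eP opt; have [K K0 HK] := optimal_lipschitz eP; split.
  by move=> t Dt; exact: (marginal_moment_fin T0 a1 m0a eP Dt).1.
have m1 : (\int[eta]_g (enorm (ev 0 g))%:E < +oo)%E.
  have := (marginal_moment_fin T0 a1 m0a eP D0).2; rewrite /finite_moment /moment.
  rewrite (ge0_integral_distribution (ev 0 : {RV eta >-> X})); last 2 first.
  - apply/measurable_EFinP; apply: (measurableT_comp (measurable_powR 1)); exact: measurable_enorm.
  - by move=> x; rewrite lee_fin powR_ge0.
  congr (_ < _)%E; apply: eq_integral => g _; by rewrite /= powRr1 ?enorm_ge0.
have mev t : measurable_fun setT (fun g : Gam => enorm (ev t g)).
  by apply: measurableT_comp; [exact: measurable_enorm|exact: measurable_ev].
have m0' : (0 <= \int[eta]_g (enorm (ev 0 g))%:E)%E by apply: integral_ge0 => g _; rewrite lee_fin enorm_ge0.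
pose N := fine (\int[eta]_g (enorm (ev 0 g))%:E)%E.
have NE : (\int[eta]_g (enorm (ev 0 g))%:E = N%:E)%E by rewrite fineK// ge0_fin_numE.
apply: (@le_lt_trans _ _ (K * (1 + N))%:E); last by rewrite ltry.
apply: ge_ereal_sup => _ [[s t] [/= Ds Dt st] <-].
have st0 : 0 < `|s - t| by rewrite normr_gt0 subr_eq0.
suff h : (d1 (marginal eta s) (marginal eta t) <= (K * (1 + N) * `|s - t|)%:E)%E.
  apply: le_trans (lee_wpmul2r _ h) _; first by rewrite lee_fin invr_ge0.
  by rewrite -EFinM lee_fin mulfK// gt_eqF.
apply: le_trans (d1_image (P := eta) (f := ev s) (g := ev t) _ _ _ _) _ => //.
have mi : measurable_fun setT (fun g : Gam => (K * (1 + enorm (ev 0 g)) * `|s - t|)%:E).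
  apply/measurable_EFinP; apply: measurable_funM; last exact: measurable_cst.
  by apply: measurable_funM; [exact: measurable_cst|apply: measurable_funD; [exact: measurable_cst|exact: mev]].
apply: (@le_trans _ _ (\int[eta]_g (K * (1 + enorm (ev 0 g)) * `|s - t|)%:E)%E).
  apply: ae_ge0_le_integral => //.
  - by move=> g _; rewrite lee_fin enorm_ge0.
  - apply/measurable_EFinP; apply: measurableT_comp; first exact: measurable_enorm.
    apply/measurable_fun_cVP => // i; rewrite (_ : (fun t => _) = (fun g => ev s g i 0 - ev t g i 0)).
      by apply: measurable_funB; apply: (measurableT_comp (measurable_coord i)); exact: measurable_ev.
    by apply/funext => g; rewrite coordB.
  - by move=> g _; rewrite lee_fin mulr_ge0// mulr_ge0// addr_ge0// enorm_ge0.
  - have nS : eta.-negligible (~` Defs.support eta).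
      apply/negligibleP; last exact: (concentrated T0 a1 m0a eP).
      by apply: open_measurable_Gamma; exact: support_open.
    apply: (negligibleS _ nS) => g /= h sg; apply: h => _; rewrite lee_fin; exact: HK (opt g sg) _ _ Dt Ds.
rewrite (_ : (fun g => _) = (fun g => (K * `|s - t|)%:E * (1%:E + (enorm (ev 0 g))%:E))%E); last first.
  by apply/funext => g; rewrite -EFinD -EFinM; congr EFin; ring.
rewrite ge0_integralZl ?lee_fin ?mulr_ge0//; last 2 first.
- by apply: emeasurable_funD; [exact: measurable_cst|exact/measurable_EFinP].
- by move=> g _; rewrite -EFinD lee_fin addr_ge0// enorm_ge0.
rewrite ge0_integralD//; [|by move=> g _; rewrite lee_fin enorm_ge0|exact/measurable_EFinP].
rewrite integral_cst// mul1e (_ : eta setT = 1%E); last exact: probability_setT.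
rewrite NE -EFinD -EFinM lee_fin.
by have -> : K * (1 + N) * `|s - t| = K * `|s - t| * (1 + N) by ring.
Qed.

End LipschitzFlow.

Theorem theorem5p9 (R : realType) (d k : nat) (T : R)
    (A : 'M[R]_d) (B : 'M[R]_(d, k))
    (L : 'cV[R]_d -> 'cV[R]_k -> probability 'cV[R]_d R -> R)
    (G : 'cV[R]_d -> probability 'cV[R]_d R -> R)
    (alpha r0 r : R) (m0 : probability 'cV[R]_d R) :
  0 < T ->
  running_cost_assumptions L ->
  terminal_cost_assumptions G ->
  1 < alpha ->
  finite_moment alpha m0 ->
  admissible_bound A B T L G alpha m0 r0 ->
  r0 <= r ->
  (exists c3 c4 : R, 0 < c3 /\
    forall (x p : 'cV[R]_d) (m : probability 'cV[R]_d R),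
      finite_moment alpha m ->
      c3 * enorm p ^+ 2 - c4
        <= edot (grad (fun y => hamiltonian A B L y p m) x) p) ->
  exists eta : probability (Gamma A B T) R,
    MFG_equilibrium L G alpha m0 r eta /\
    Lip_curve T alpha (marginal eta).
Proof.
move=> T0 HL HG a1 m0a [_ _ adm] r0r [c3 [c4 [c30 ham]]].
have [PG0 resp] := adm r r0r.
have response eta : PGamma alpha m0 r eta -> exists2 nu : probability (Gamma A B T) R, PGamma alpha m0 r nu &
    forall O : set (Gamma A B T), open O -> (0 < nu O)%E -> exists g, O g /\ exists x, optimal_curves L G eta x g.
  move=> /resp[nu nuP [kappa dis opt]]; exists nu => //.
  exact: (disintegration_meets T0 a1 m0a nuP dis opt).
have [eta etaP opt] := exists_equilibrium T0 a1 m0a PG0 response HL HG.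
exists eta; split; last exact: (equilibrium_lipschitz T0 HL HG a1 m0a c30 ham etaP opt).
by split=> // g /opt og; exists (ev 0 g).
Qed.
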